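(* Let $\{P^{(i)}\}_{i=1,\ldots,N}$ be a measurable partition of the unit cell $Q=(0,1)^n$ and define $\chi=(\chi^{(1)},\ldots,\chi^{(N)})$ by letting $\chi^{(i)}:=\chi_{P^{(i)}}$ be the characteristic function of $P^{(i)}$ for $i\in\{1,\ldots,N\}$. Assume that the functions $W^{(1)},\ldots,W^{(N)}\in\mathcal{F}(\alpha,p)$ are quasiconvex and that the compact sets $\mathfrak{A}^{(i)}:=\{\xi\in\mathbb{R}^{m\times n}:W^{(i)}(\xi)=0\}$, $i=1,\ldots,N$, are not empty. Then $$\mathfrak{A}_{\mathrm{cell}}=\big\{\xi\in\mathbb{R}^{m\times n}:(W_\chi)_{\mathrm{cell}}(\xi)=0\big\},$$ i.e. the zero level set of the cell integrand $(W_\chi)_{\mathrm{cell}}$ associated to $W_\chi$ coincides with the cell set $\mathfrak{A}_{\mathrm{cell}}$ associated to $\{(\mathfrak{A}^{(i)},P^{(i)})\}_{i=1,\ldots,N}$.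
   Context: Standing setting: $m,n,N\ge 1$ are integers, $p\in(1,+\infty)$, and $\alpha=(\alpha_1,\alpha_2,\alpha_3)\in\mathbb{R}^3$ with $\alpha_1,\alpha_2,\alpha_3>0$. $\mathcal{F}(\alpha,p)$ is the set of continuous functions $f:\mathbb{R}^{m\times n}\to[0,+\infty)$ with $\alpha_1|\xi|^p-\alpha_2\le f(\xi)\le\alpha_3(1+|\xi|^p)$ for all $\xi\in\mathbb{R}^{m\times n}$. For $1<q\le\infty$, $W^{1,q}_{\mathrm{per}}(Q;\mathbb{R}^m)$ is the space of $Q$-periodic functions in $W^{1,q}_{\mathrm{loc}}(\mathbb{R}^n;\mathbb{R}^m)$. Quasiconvexity is in the sense of Morrey. Define $W_\chi(y,\xi):=\sum_{i=1}^N\chi^{(i)}(y)W^{(i)}(\xi)$ for $y\in Q$, $\xi\in\mathbb{R}^{m\times n}$. The cell integrand associated to $W_\chi$ is $$(W_\chi)_{\mathrm{cell}}(\xi):=\inf\Big\{\int_Q W_\chi(y,\xi+\nabla\phi(y))\,dy:\ \phi\in W^{1,p}_{\mathrm{per}}(Q;\mathbb{R}^m)\Big\}.$$ Given a measurable partition $\{P^{(i)}\}_{i=1,\ldots,N}$ of $Q$ and compact sets $\mathfrak{A}^{(1)},\ldots,\mathfrak{A}^{(N)}\subseteq\mathbb{R}^{m\times n}$, the cell set $\mathfrak{A}_{\mathrm{cell}}$ associated to $\{(\mathfrak{A}^{(i)},P^{(i)})\}_{i=1,\ldots,N}$ is the set of all $\xi\in\mathbb{R}^{m\times n}$ for which there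 exists $\phi\in W^{1,\infty}_{\mathrm{per}}(Q;\mathbb{R}^m)$ such that $\xi+\nabla\phi(y)\in\mathfrak{A}^{(i)}$ for a.e. $y\in P^{(i)}$ and all $i\in\{1,\ldots,N\}$. *)

(* Defs.v *)
From HB Require Import structures.
From mathcomp Require Import all_boot all_order all_algebra.
From mathcomp Require Import all_classical all_reals all_analysis.

Set Implicit Arguments.
Unset Strict Implicit.
Unset Printing Implicit Defensive.

Import Order.TTheory GRing.Theory Num.Theory.
Import numFieldNormedType.Exports.

Local Open Scope classical_set_scope.
Local Open Scope ring_scope.

(* Lebesgue measure on R^n = 'rV[R]_n: the outer measure defined by countable
   covers by open boxes, restricted to its Caratheodory-measurable sets. *)

Definition open_box (R : realType) (n : nat) (I : 'rV[R]_n * 'rV[R]_n) :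
  set 'rV[R]_n := [set x | forall i, I.1 0 i < x 0 i < I.2 0 i].

Definition box_volume (R : realType) (n : nat) (I : 'rV[R]_n * 'rV[R]_n) : R :=
  \prod_(i < n) Num.max 0 (I.2 0 i - I.1 0 i).

Definition lebesgue_outer (R : realType) (n : nat) (A : set 'rV[R]_n) : \bar R :=
  ereal_inf [set \esum_(I in D) (box_volume I)%:E | D in
    [set D : set ('rV[R]_n * 'rV[R]_n) |
      countable D /\ A `<=` \bigcup_(I in D) open_box I]].

Section lebesgue_outer_measure.
Variables (R : realType) (n : nat).
Local Open Scope ereal_scope.
Implicit Types (A B : set 'rV[R]_n) (D : set ('rV[R]_n * 'rV[R]_n)).

Let vol_ge0 (I : 'rV[R]_n * 'rV[R]_n) : 0 <= (box_volume I)%:E.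
Proof. by rewrite lee_fin; apply: prodr_ge0 => i _; rewrite le_max lexx. Qed.

Lemma lebesgue_outer_ge0 A : 0 <= lebesgue_outer A.
Proof.
by apply: le_ereal_inf_tmp => _ [D _ <-]; apply: esum_ge0 => I _; exact: vol_ge0.
Qed.

Lemma lebesgue_outer0 : lebesgue_outer (set0 : set 'rV[R]_n) = 0.
Proof.
apply/eqP; rewrite eq_le lebesgue_outer_ge0 andbT; apply: ereal_inf_lbound.
by exists set0; [split; [exact: countable0|exact: sub0set]|rewrite esum_set0].
Qed.

Lemma le_lebesgue_outer :
  {homo @lebesgue_outer R n : A B / A `<=` B >-> A <= B}.
Proof.
move=> A B AB; apply/ereal_inf_le_tmp => x [D [cD BD] <-].
by exists D => //; split => //; exact: subset_trans BD.
Qed.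

Lemma lebesgue_outer_sigma_subadditive :
  sigma_subadditive (@lebesgue_outer R n).
Proof.
move=> A; have [[i ioo]|] := pselect (exists i, lebesgue_outer (A i) = +oo).
  rewrite (eseries_pinfty _ _ ioo) ?leey// => k _.
  by rewrite -ltNye (lt_le_trans _ (lebesgue_outer_ge0 _)).
rewrite -forallNE => Aoo.
suff add2e (e : {posnum R}) : lebesgue_outer (\bigcup_n A n) <=
    \sum_(i <oo) lebesgue_outer (A i) + e%:num%:E.
  by apply/lee_addgt0Pr => _/posnumP[].
rewrite (le_trans _ (epsilon_trick _ _ _))//; last first.
  by move=> k; exact: lebesgue_outer_ge0.
pose P k D := (countable D /\ A k `<=` \bigcup_(I in D) open_box I) /\
  \esum_(I in D) (box_volume I)%:E <=
    lebesgue_outer (A k) + (e%:num / (2 ^ k.+1)%:R)%:E.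
have [G PG] : {G : nat -> set ('rV[R]_n * 'rV[R]_n) & forall k, P k (G k)}.
  apply: (@choice _ _ P) => k; rewrite /P.
  have en1 : (0 < e%:num / (2 ^ k.+1)%:R :> R)%R by [].
  have fk : lebesgue_outer (A k) \is a fin_num.
    by rewrite ge0_fin_numE ?lebesgue_outer_ge0// ltey; exact/eqP/Aoo.
  have [_ [D cD <-] Dlt] := lb_ereal_inf_adherent en1 fk.
  by exists D; split => //; exact: ltW.
apply: (@le_trans _ _ (\esum_(I in \bigcup_k G k) (box_volume I)%:E)).
  apply: ereal_inf_lbound; exists (\bigcup_k G k) => //; split.
    by apply: bigcup_countable => // k _; exact: (PG k).1.1.
  move=> x [k _ /(PG k).1.2 [I GI xI]]; exists I => //; exists k => //.
have tG : trivIset setT (seqDU G) by exact: trivIset_seqDU.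
rewrite seqDU_bigcup_eq (esum_bigcupT _ _ tG)//.
have sum_ge0 k : 0 <= \esum_(I in seqDU G k) (box_volume I)%:E.
  by apply: esum_ge0 => I _; exact: vol_ge0.
rewrite -(nneseries_esumT sum_ge0).
apply: lee_nneseries => [k _ _|k _]; first exact: sum_ge0.
apply: le_trans (PG k).2.
rewrite /esum; apply: ereal_sup_le => _ [X [fX XS] <-]; exists X => //.
by split => //; exact: subset_trans XS (@subset_seqDU _ _ _).
Qed.

End lebesgue_outer_measure.

HB.instance Definition _ (R : realType) (n : nat) :=
  isOuterMeasure.Build R 'rV[R]_n (@lebesgue_outer R n)
    (@lebesgue_outer0 R n) (@lebesgue_outer_ge0 R n)
    (@le_lebesgue_outer R n) (@lebesgue_outer_sigma_subadditive R n).

(* Convertible to 'rV[R]_n, equipped with the Lebesgue sigma-algebra. *)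
Definition Rn (R : realType) (n : nat) := caratheodory_type (@lebesgue_outer R n).

HB.instance Definition _ (R : realType) (n : nat) := Measurable.on (Rn R n).

Definition lebesgue_Rn (R : realType) (n : nat) : set (Rn R n) -> \bar R :=
  @lebesgue_outer R n.

HB.instance Definition _ (R : realType) (n : nat) :=
  isMeasure.Build _ (Rn R n) R (@lebesgue_Rn R n)
    (@caratheodory_measure0 R _ (@lebesgue_outer R n))
    (@caratheodory_measure_ge0 R _ (@lebesgue_outer R n))
    (@caratheodory_measure_sigma_additive R _ (@lebesgue_outer R n)).

Definition unit_cell (R : realType) (n : nat) : set 'rV[R]_n :=
  [set x | forall i, 0 < x 0 i < 1].

(* The Euclidean norm of R^{m x n}; the norm `|xi| provided by the library on
   matrices is the maximum norm. *)
Definition frobenius (R : realType) (m n : nat) (xi : 'M[R]_(m, n)) : R :=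
  Num.sqrt (\sum_(i < m) \sum_(j < n) xi i j ^+ 2).

Definition pgrowth_class (R : realType) (m n : nat) (a1 a2 a3 p : R) :
  set ('M[R]_(m, n) -> R) :=
  [set f : 'M[R]_(m, n) -> R | [/\ continuous f, forall xi, 0 <= f xi &
    forall xi, a1 * frobenius xi `^ p - a2 <= f xi
               <= a3 * (1 + frobenius xi `^ p)]].

Definition partial (R : realType) (n : nat) (j : 'I_n) (f : 'rV[R]_n -> R) :
  'rV[R]_n -> R := fun x => 'D_(delta_mx 0 j) f x.

Definition smooth (R : realType) (n : nat) (f : 'rV[R]_n -> R) : Prop :=
  forall s : seq 'I_n, let g := foldr (@partial R n) f s in
    continuous g /\ forall j x, derivable g x (delta_mx 0 j).

Definition test_function (R : realType) (n : nat) (psi : 'rV[R]_n -> R) : Prop :=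
  smooth psi /\ compact (closure [set x | psi x != 0]).

Definition Lq_loc (R : realType) (n : nat) (q : \bar R) (f : 'rV[R]_n -> R) :
  Prop :=
  measurable_fun [set: Rn R n] f /\
  forall K : set 'rV[R]_n, compact K ->
    (Lnorm (@lebesgue_Rn R n) q (fun x => (f x * \1_K x)%:E) < +oo)%E.

(* G is a representative of the distributional gradient of u, with rows
   indexed by the components of u: G i j = d_j u_i. *)
Definition is_weak_gradient (R : realType) (m n : nat)
    (u : 'rV[R]_n -> 'cV[R]_m) (G : 'rV[R]_n -> 'M[R]_(m, n)) : Prop :=
  [/\ forall i, Lq_loc 1%E (fun x => u x i 0),
      forall i j, Lq_loc 1%E (fun x => G x i j) &
      forall (psi : 'rV[R]_n -> R), test_function psi -> forall i j,
        Rintegral (@lebesgue_Rn R n) setT (fun x => u x i 0 * partial j psi x) =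
        - Rintegral (@lebesgue_Rn R n) setT (fun x => G x i j * psi x)].

Definition W1q_loc (R : realType) (m n : nat) (q : \bar R) :
  set ('rV[R]_n -> 'cV[R]_m) :=
  [set u : 'rV[R]_n -> 'cV[R]_m | (forall i, Lq_loc q (fun x => u x i 0)) /\
    exists2 G : 'rV[R]_n -> 'M[R]_(m, n), is_weak_gradient u G &
      forall i j, Lq_loc q (fun x => G x i j)].

(* Sobolev functions being classes modulo null sets, periodicity is required
   almost everywhere. *)
Definition W1q_per (R : realType) (m n : nat) (q : \bar R) :
  set ('rV[R]_n -> 'cV[R]_m) :=
  [set u : 'rV[R]_n -> 'cV[R]_m | W1q_loc q u /\ forall z : 'rV[int]_n,
    {ae @lebesgue_Rn R n, forall x, u (x + map_mx intr z) = u x}].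

(* Morrey's definition: Lipschitz perturbations vanishing outside an arbitrary
   bounded open set. *)
Definition quasiconvex (R : realType) (m n : nat) (f : 'M[R]_(m, n) -> R) :
  Prop :=
  forall (D : set 'rV[R]_n) (phi : 'rV[R]_n -> 'cV[R]_m)
         (G : 'rV[R]_n -> 'M[R]_(m, n)) (xi : 'M[R]_(m, n)),
    open D -> bounded_set D ->
    lipschitz phi -> (forall x, ~ D x -> phi x = 0) -> is_weak_gradient phi G ->
    ((f xi)%:E * @lebesgue_Rn R n D <=
     \int[@lebesgue_Rn R n]_(y in D) (f (xi + G y))%:E)%E.

Definition measurable_partition (R : realType) (n N : nat)
    (P : 'I_N -> set 'rV[R]_n) (Q : set 'rV[R]_n) : Prop :=
  [/\ forall i, measurable (P i : set (Rn R n)),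
      trivIset setT P & \bigcup_i P i = Q].

Definition mixture (R : realType) (m n N : nat) (P : 'I_N -> set 'rV[R]_n)
    (W : 'I_N -> 'M[R]_(m, n) -> R) (y : 'rV[R]_n) (xi : 'M[R]_(m, n)) : R :=
  \sum_(i < N) \1_(P i) y * W i xi.

Definition cell_integrand (R : realType) (m n : nat) (p : R)
    (W : 'rV[R]_n -> 'M[R]_(m, n) -> R) (xi : 'M[R]_(m, n)) : \bar R :=
  ereal_inf [set J | exists (phi : 'rV[R]_n -> 'cV[R]_m)
                            (G : 'rV[R]_n -> 'M[R]_(m, n)),
    [/\ W1q_per p%:E phi, is_weak_gradient phi G &
        J = (\int[@lebesgue_Rn R n]_(y in @unit_cell R n)
               (W y (xi + G y))%:E)%E]].

Definition cell_set (R : realType) (m n N : nat) (A : 'I_N -> set 'M[R]_(m, n))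
    (P : 'I_N -> set 'rV[R]_n) : set 'M[R]_(m, n) :=
  [set xi | exists (phi : 'rV[R]_n -> 'cV[R]_m) (G : 'rV[R]_n -> 'M[R]_(m, n)),
    [/\ W1q_per +oo%E phi, is_weak_gradient phi G &
        forall i, {ae @lebesgue_Rn R n, forall y, P i y -> A i (xi + G y)}]].

(* Main.v *)
(**
If xi is in the cell set, the corrector has energy zero, and the energy is nonnegative. Conversely, let
(W_chi)_cell(xi) = 0. Mollifying almost minimizers gives smooth periodic u_k with
int_Q W_chi(y, xi + grad u_k) -> 0. By the growth condition |xi + grad u_k|^p is at most a constant T
plus an excess of integral delta_k, so if delta_k is small compared with s_k^n then the mollifications of
u_k at scale s_k -> 0 are equi-Lipschitz; by a Poincare inequality they stay close to u_k in L^p. Along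
an ultrafilter they converge locally uniformly to a periodic Lipschitz function phi, up to constants, with
bounded weak gradient G. Let y be a point of P^(i) which is a Lebesgue point of G and of the
characteristic function of P^(i). In a small cube around y the function phi is close to the affine map of
slope G(y), so cutting off u_k minus this map at the boundary of the cube gives a test function for the
quasiconvexity of W^(i) at xi + G(y). The energy of xi + grad u_k in the cube tends to 0 on P^(i), and
the rest of the cube as well as the cutoff layer contribute an arbitrarily small fraction of its volume.
Hence W^(i)(xi + G(y)) = 0.
*)
From HB Require Import structures.
Require Import Defs.
From mathcomp Require Import all_boot all_order all_algebra.
From mathcomp Require Import all_classical all_reals all_analysis.
From mathcomp Require Import measurable_realfun ring lra.
Set Implicit Arguments.
Unset Strict Implicit.
Unset Printing Implicit Defensive.
Import Order.TTheory GRing.Theory Num.Theory.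
Import numFieldNormedType.Exports.
Local Open Scope classical_set_scope.
Local Open Scope ring_scope.

(** * Lebesgue measure of boxes and cubes *)

Section LebesgueOuter.
Variables (R : realType) (n : nat).
Implicit Types (A B X : set 'rV[R]_n) (I : 'rV[R]_n * 'rV[R]_n).
Local Notation mu := (@lebesgue_outer R n).

(** Two obstacles shape the proof. Quasiconvexity is tested with Lipschitz fields, and the corrector
    must have a bounded gradient, whereas almost minimizers are only in [W^{1,p}]. Hence there are
    two mollifications. The one at a scale depending on the single almost minimizer nearly preserves
    its energy and makes it [C1], so that its cutoffs are admissible test fields. The one at the
    prescribed scale [s_k] bounds gradients but gives no control of the energy; it serves only to
    construct the limit. The blow-up therefore has to work with [u_k] itself, and it is for this
    that [u_k] must be close to its own mollification in [L^p]. Analysis on R^n starts from covers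
    by boxes: translations and dilations act on covers, so a cube of radius [r] has measure [r^n]
    times a constant. One estimate, that the averaged oscillation of an integrable function over
    small cubes vanishes, yields both the [L^1] convergence of mollifications and the Lebesgue
    points. Integration by parts and the Poincare inequality come from finite differences and the
    translation invariance of the integral. *)

Definition cube (c : 'rV[R]_n) (r : R) : set 'rV[R]_n :=
  [set x | forall j, `|x 0 j - c 0 j| < r].

Lemma box_volume_ge0 I : 0 <= box_volume I.
Proof. by apply: prodr_ge0 => i _; rewrite le_max lexx. Qed.

Lemma lebesgue_outer_le_box A I : A `<=` open_box I -> (mu A <= (box_volume I)%:E)%E.
Proof.
move=> AI; apply: ereal_inf_lbound; exists [set I]; last first.
  by rewrite esum_set1// lee_fin box_volume_ge0.
by split; [exact: countable1|move=> x /AI xI; exists I].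
Qed.

(** A map of covers may merge boxes, so only an inequality can hold. A section [s] of [f] reindexes
    the sum over the image by a subset of [D]. *)
Lemma esum_image_le (T T' : choiceType) (t0 : T) (D : set T) (f : T -> T') (g : T' -> \bar R) :
  (forall j, 0 <= g j)%E ->
  (\esum_(j in f @` D) g j <= \esum_(i in D) g (f i))%E.
Proof.
move=> g0.
have /choice[s hs] : forall j, exists i, (f @` D) j -> D i /\ f i = j.
  move=> j; have [[i Di <-]|nj] := pselect ((f @` D) j); first by exists i.
  by exists t0.
rewrite (_ : (\esum_(j in f @` D) g j = \esum_(j in f @` D) g (f (s j)))%E); last first.
  by apply: eq_esum => j /hs[_ ->].
rewrite -(@esum_image _ _ _ (f @` D) s (g \o f)); last first.
  by move=> x y /set_mem/hs[_ {2}<-] /set_mem/hs[_ {2}<-] ->.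
rewrite /esum; apply: ereal_sup_le => _ [X [fX XS] <-]; exists X => //; split => //.
by apply: (subset_trans XS) => _ [j /hs[Dj _] <-].
Qed.

Lemma lebesgue_outer_le_boxes A (D : set ('rV[R]_n * 'rV[R]_n))
    (f : 'rV[R]_n * 'rV[R]_n -> 'rV[R]_n * 'rV[R]_n) :
  countable D -> A `<=` \bigcup_(I in D) open_box (f I) ->
  (mu A <= \esum_(I in D) (box_volume (f I))%:E)%E.
Proof.
move=> cD AD; apply: (le_trans _ (esum_image_le (0, 0) D f
  (fun J => _ : 0%E <= (box_volume J)%:E)%E)); last first.
  by move=> *; rewrite lee_fin box_volume_ge0.
apply: ereal_inf_lbound; exists (f @` D) => //; split.
  exact: sub_countable (card_image_le _ _) cD.
by move=> x /AD[I DI xI]; exists (f I) => //; exists I.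
Qed.

Definition cut_below (j : 'I_n) (a : R) I :=
  (I.1, \row_k (if k == j then Num.min (I.2 0 k) a else I.2 0 k)).

Definition cut_above (j : 'I_n) (a : R) I :=
  (\row_k (if k == j then Num.max (I.1 0 k) a else I.1 0 k), I.2).

(** Only side [j] changes; the truncation at [0] in [box_volume] also covers planes that miss the
    box and boxes that are empty. *)
Lemma box_volume_cut j a I :
  box_volume (cut_below j a I) + box_volume (cut_above j a I) <= box_volume I.
Proof.
rewrite /box_volume (bigD1 j)//= [X in _ + X](bigD1 j)//= [leRHS](bigD1 j)//=.
rewrite !mxE eqxx.
have -> : \prod_(i < n | i != j) Num.max 0 ((cut_below j a I).2 0 i - I.1 0 i) =
    \prod_(i < n | i != j) Num.max 0 (I.2 0 i - I.1 0 i).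
  by apply: eq_bigr => i /negbTE ij; rewrite mxE ij.
have -> : \prod_(i < n | i != j) Num.max 0 (I.2 0 i - (cut_above j a I).1 0 i) =
    \prod_(i < n | i != j) Num.max 0 (I.2 0 i - I.1 0 i).
  by apply: eq_bigr => i /negbTE ij; rewrite mxE ij.
rewrite -mulrDl ler_wpM2r//; first by apply: prodr_ge0 => i _; rewrite le_max lexx.
rewrite /Num.max /Num.min.
repeat case: ifPn; rewrite -?leNgt; move=> *; lra.
Qed.

(** Every box of a cover is cut along the plane. Open boxes lose the plane itself, which is why both
    inequalities are strict. *)
Lemma lebesgue_outer_split j a A :
  (mu (A `&` [set x : 'rV[R]_n | (x 0 j < a)%R]) + mu (A `&` [set x : 'rV[R]_n | (a < x 0 j)%R]) <= mu A)%E.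
Proof.
apply: le_ereal_inf_tmp => _ [D [cD AD] <-].
apply: (@le_trans _ _ (\esum_(I in D) (box_volume (cut_below j a I))%:E +
    \esum_(I in D) (box_volume (cut_above j a I))%:E)%E).
  apply: leeD; apply: lebesgue_outer_le_boxes => // x [/AD[I DI xI] /= xa]; exists I => // i /=.
    rewrite mxE; case: eqP => [->|_]; last exact: xI.
    by have /andP[-> ?] := xI j; rewrite lt_min xa andbT.
  rewrite mxE; case: eqP => [->|_]; last exact: xI.
  by have /andP[? ->] := xI j; rewrite gt_max xa !andbT.
rewrite -esumD; try by move=> *; rewrite lee_fin box_volume_ge0.
by apply: le_esum => I _; rewrite -EFinD lee_fin box_volume_cut.
Qed.

Lemma lebesgue_outer_hyperplane j a : mu [set x | x 0 j = a] = 0%E.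
Proof.
apply/eqP; rewrite eq_le lebesgue_outer_ge0 andbT.
pose H k := [set x : 'rV[R]_n | x 0 j = a] `&` cube 0 k%:R.
have H0 k : mu (H k) = 0%E.
  apply/eqP; rewrite eq_le lebesgue_outer_ge0 andbT; apply/lee_addgt0Pr => e e0.
  rewrite add0e.
  pose C : R := \prod_(i < n | i != j) (2 * k%:R).
  have C0 : 0 <= C by apply: prodr_ge0 => i _; rewrite mulr_ge0.
  (* Half the thickness of a slab around the plane, whose volume [2 d C] is then at most [e]. The
     [+ 1] guards against [C = 0]. *)
  pose d := e / (2 * (C + 1)).
  have d0 : 0 < d by rewrite divr_gt0// mulr_gt0// ltr_wpDl.
  pose I : 'rV[R]_n * 'rV[R]_n := (\row_i (if i == j then a - d else - k%:R),
    \row_i (if i == j then a + d else k%:R)).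
  apply: (@le_trans _ _ (box_volume I)%:E).
    apply: lebesgue_outer_le_box => x [/= xa xk] i; rewrite !mxE; case: eqP => [->|_].
      by rewrite xa; apply/andP; split; lra.
    by have := xk i; rewrite mxE subr0 ltr_norml.
  rewrite lee_fin /box_volume (bigD1 j)//= !mxE eqxx.
  have -> : \prod_(i < n | i != j) Num.max 0 (I.2 0 i - I.1 0 i) = C.
    apply: eq_bigr => i /negbTE ij; rewrite !mxE ij opprK -mulr2n mulr_natl.
    by rewrite max_r// mulrn_wge0.
  rewrite max_r; last lra.
  rewrite (_ : a + d - (a - d) = 2 * d); last lra.
  rewrite /d (_ : 2 * (e / (2 * (C + 1))) = e / (C + 1)); last by field; rewrite lt0r_neq0// ltr_wpDl.
  by rewrite mulrAC ler_pdivrMr ?ltr_wpDl// ler_wpM2l// ?(ltW e0)//; lra.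
apply: (@le_trans _ _ (mu (\bigcup_k H k))).
  apply: le_lebesgue_outer => x xa.
  pose M := \sum_i `|x 0 i|.
  have [k Mk] : exists k : nat, M < k%:R by exists (Num.Def.archi_bound M); rewrite archi_boundP// sumr_ge0.
  exists k => //; split => // i; rewrite mxE subr0 (le_lt_trans _ Mk)//.
  by rewrite /M (bigD1 i)//= lerDl sumr_ge0.
apply: le_trans (lebesgue_outer_sigma_subadditive H) _.
by rewrite eseries0// => k _ _; rewrite H0.
Qed.

(** Caratheodory's criterion is [lebesgue_outer_split], once the null boundary plane is moved to one
    side. *)
Lemma measurable_halfspace j a : measurable ([set x | x 0 j < a] : set (Rn R n)).
Proof.
apply: le_caratheodory_measurable => X.
apply: le_trans (lebesgue_outer_split j a X); rewrite leeD2l//.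
have -> : X `&` ~` [set x : 'rV[R]_n | x 0 j < a] =
    (X `&` [set x | a < x 0 j]) `|` (X `&` [set x | x 0 j = a]).
  apply/seteqP; split => x /=.
    by move=> [Xx /negP]; rewrite -leNgt le_eqVlt => /orP[/eqP <-|]; [right|left].
  by move=> [[Xx ax]|[Xx ->]]; split => //; rewrite ?ltxx// ltNge (ltW ax).
apply: le_trans (outer_measureU2 _ _ _) _.
rewrite [X in (_ + X)%E](_ : _ = 0%E) ?adde0//.
apply/eqP; rewrite eq_le lebesgue_outer_ge0 andbT -(lebesgue_outer_hyperplane j a).
by apply: le_lebesgue_outer => x [].
Qed.

Lemma measurable_coord i j : measurable_fun [set: Rn R n] (fun x : 'rV[R]_n => x i j).
Proof.
rewrite (_ : (fun x : 'rV[R]_n => x i j) = (fun x : 'rV[R]_n => x 0 j)); last first.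
  by apply/funext => x; rewrite ord1.
apply: (measurability _ (RGenInftyO.measurableE R)) => _ [_ [a ->] <-].
rewrite setTI (_ : _ @^-1` _ = [set x : 'rV[R]_n | x 0 j < a]).
  exact: measurable_halfspace.
by apply/seteqP; split => x /=; rewrite in_itv.
Qed.

Lemma esumZ_le (T : choiceType) (D : set T) (c : R) (a : T -> \bar R) :
  0 <= c -> (forall i, 0 <= a i)%E ->
  (\esum_(i in D) (c%:E * a i) <= c%:E * \esum_(i in D) a i)%E.
Proof.
move=> c0 a0; apply: ge_ereal_sup => _ [X XD <-].
rewrite -ge0_mule_fsumr; last by move=> *; exact: a0.
by rewrite lee_wpmul2l ?lee_fin//; apply: ereal_sup_ubound; exists X.
Qed.

Lemma lebesgue_outer_affine_le (z : 'rV[R]_n) (s : R) A : 0 < s ->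
  (mu ((fun x => z + s *: x)%R @` A) <= (s ^+ n)%:E * mu A)%E.
Proof.
move=> s0; have sn0 : 0 < s ^+ n by rewrite exprn_gt0.
rewrite -lee_pdivrMl//; apply: le_ereal_inf_tmp => _ [D [cD AD] <-].
rewrite lee_pdivrMl// muleC.
pose f I : 'rV[R]_n * 'rV[R]_n := (z + s *: I.1, z + s *: I.2).
have vf I : box_volume (f I) = s ^+ n * box_volume I.
  rewrite /box_volume /=.
  have -> : s ^+ n = \prod_(i < n) s by rewrite prodr_const card_ord.
  rewrite -big_split/=; apply: eq_bigr => i _; rewrite !mxE maxr_pMr ?mulr0 ?(ltW s0)//.
  by congr (Num.max _ _); ring.
apply: (@le_trans _ _ (\esum_(I in D) (box_volume (f I))%:E)).
  apply: lebesgue_outer_le_boxes => // _ [x /AD[I DI xI] <-]; exists I => // i.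
  by rewrite !mxE !ltrD2l !ltr_pM2l.
under eq_esum => I _ do rewrite vf EFinM.
by rewrite muleC; apply: esumZ_le => //; [exact: ltW|move=> I; rewrite lee_fin box_volume_ge0].
Qed.

(** The reverse inequality is [lebesgue_outer_affine_le] for the inverse dilation. *)
Lemma lebesgue_outer_affine (z : 'rV[R]_n) (s : R) A : 0 < s ->
  mu ((fun x => z + s *: x)%R @` A) = ((s ^+ n)%:E * mu A)%E.
Proof.
move=> s0; apply/eqP; rewrite eq_le lebesgue_outer_affine_le//=.
rewrite -lee_pdivlMl ?exprn_gt0//.
have s'0 : 0 < s^-1 by rewrite invr_gt0.
have := lebesgue_outer_affine_le (- (s^-1 *: z)) ((fun x => z + s *: x)%R @` A) s'0.
rewrite exprVn; apply: le_trans; apply: le_lebesgue_outer => x Ax.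
exists (z + s *: x); first by exists x.
by rewrite scalerDr addKr scalerA mulVf ?scale1r// lt0r_neq0.
Qed.

Lemma lebesgue_outer_translate (z : 'rV[R]_n) A : mu ((fun x => z + x)%R @` A) = mu A.
Proof.
have := lebesgue_outer_affine z A ltr01; rewrite expr1n mul1e => <-.
by congr (mu (_ @` A)); apply/funext => x; rewrite scale1r.
Qed.

Lemma image_translate (z : 'rV[R]_n) A : (fun x => z + x) @` A = (fun x => x - z) @^-1` A.
Proof.
apply/seteqP; split => [_ [y Ay <-]|x Ax] /=; first by rewrite addrC addKr.
by exists (x - z) => //; rewrite addrC subrK.
Qed.

(** Caratheodory's criterion for the preimage, tested on [X], is the criterion for [A] tested on the
    translate of [X]. *)
Lemma measurable_translate (z : 'rV[R]_n) : measurable_fun [set: Rn R n] (fun x : 'rV[R]_n => x + z : Rn R n).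
Proof.
move=> _ A mA; rewrite setTI; apply: le_caratheodory_measurable => X.
change (mu (X `&` +%R^~ z @^-1` A) + mu (X `&` ~` (+%R^~ z @^-1` A)) <= mu X)%E.
have -> : mu X = (mu (((fun x => z + x)%R @` X) `&` A) + mu (((fun x => z + x)%R @` X) `&` ~` A))%E.
  by rewrite -[LHS](lebesgue_outer_translate z); exact: (mA ((fun x => z + x) @` X)).
rewrite -(lebesgue_outer_translate z (X `&` _)) -(lebesgue_outer_translate z (X `&` ~` _)).
by apply: leeD; apply: le_lebesgue_outer => _ [x [Xx /= Ax] <-]; (split; [exists x|rewrite [z + x]addrC]).
Qed.

Lemma lebesgue_outer_lty_bounded A : (exists c r, A `<=` cube c r) -> (mu A < +oo)%E.
Proof.
move=> [c [r Acr]]; apply: le_lt_trans (ltry (box_volume (c - const_mx r, c + const_mx r))).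
apply: lebesgue_outer_le_box => x /Acr xc i; rewrite !mxE.
by have := xc i; rewrite ltr_distl.
Qed.

Lemma cube_affine (c : 'rV[R]_n) (r : R) : 0 < r ->
  cube c r = (fun x => c + r *: x) @` cube 0 1.
Proof.
move=> r0; apply/seteqP; split => [x xr|_ [x xr <-] j]; last first.
  rewrite !mxE addrAC subrr add0r normrM gtr0_norm// -ltr_pdivlMl// mulVf ?lt0r_neq0//.
  by have := xr j; rewrite mxE subr0.
exists (r^-1 *: (x - c)); last by rewrite scalerA mulfV ?lt0r_neq0// scale1r addrC subrK.
by move=> j; rewrite !mxE subr0 normrM gtr0_norm ?invr_gt0// mulrC ltr_pdivrMr// mul1r.
Qed.

Lemma lebesgue_cube (c : 'rV[R]_n) (r : R) : 0 < r ->
  mu (cube c r) = ((r ^+ n)%:E * mu (cube 0 1))%E.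
Proof. by move=> r0; rewrite cube_affine// lebesgue_outer_affine. Qed.

Lemma open_box_cover (D : set ('rV[R]_n * 'rV[R]_n)) : open (\bigcup_(I in D) open_box I).
Proof.
apply: bigcup_open => I _; rewrite openE => x xI.
exists (fun _ j => `]I.1 0 j, I.2 0 j[%classic).
  by move=> i j; rewrite ord1; apply: open_nbhs_nbhs; split; [exact: itv_open|rewrite /= in_itv; exact: xI].
by move=> y yI j; have := yI 0 j; rewrite /= in_itv.
Qed.

(** Covers consist of open boxes, so the union of an almost optimal cover is already the open
    set. *)
Lemma lebesgue_outer_regular A (e : R) : 0 < e -> (mu A < +oo)%E ->
  exists O, [/\ open O, A `<=` O & (mu O <= mu A + e%:E)%E].
Proof.
move=> e0 Aoo.
have fA : mu A \is a fin_num by rewrite ge0_fin_numE ?lebesgue_outer_ge0.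
have [_ [D [cD AD] <-] Dlt] := lb_ereal_inf_adherent e0 fA.
exists (\bigcup_(I in D) open_box I); split => //; first exact: open_box_cover.
by apply: le_trans (ltW Dlt); apply: ereal_inf_lbound; exists D => //; split.
Qed.

End LebesgueOuter.

(** * Measurability of matrix-valued maps *)

Section MeasurableMatrix.
Context d (T : measurableType d) (R : realType) (m n : nat).

(** Measurability into matrices is expressed entry by entry; an open set is the union of the
    countably many rational cubes that it contains. The domain [T] is left arbitrary because the
    lemma also serves on products [Rn R n * Rn R n]. *)
Lemma measurable_open_mx (G : T -> 'M[R]_(m, n)) (O : set 'M[R]_(m, n)) :
  (forall i j, measurable_fun setT (fun x => G x i j)) -> open O ->
  measurable (G @^-1` O).
Proof.
move=> mG oO.
pose Q := ('M[rat]_(m, n) * rat)%type.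
pose B (q : Q) := [set x : 'M[R]_(m, n) | forall i j, `|x i j - ratr (q.1 i j)| < ratr q.2].
have -> : G @^-1` O = \bigcup_(q in [set q | B q `<=` O]) (G @^-1` B q).
  apply/seteqP; split => [t Ot|t [q /= qO /qO]//].
  have /nbhs_ballP[e /= e0 eO] : nbhs (G t) O by exact: open_nbhs_nbhs.
  have [r /[!in_itv]/= /andP[r0 re]] : exists r : rat, ratr r \in `]0, (e / 2)[.
    by apply: rat_in_itvoo; rewrite divr_gt0.
  have /choice[q hq] : forall ij : 'I_m * 'I_n, exists q : rat, `|G t ij.1 ij.2 - ratr q| < ratr r.
    move=> [i j] /=; have [q /[!in_itv]/= /andP[q1 q2]] : exists q : rat,
        ratr q \in `](G t i j - ratr r), (G t i j + ratr r)[.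
      by apply: rat_in_itvoo; lra.
    by exists q; rewrite ltr_norml; apply/andP; split; lra.
  exists (\matrix_(i, j) q (i, j), r); last by move=> i j /=; rewrite mxE; exact: hq (i, j).
  move=> x /= xq; apply: eO; split => // i j; rewrite /ball/=.
  have := xq i j; have := hq (i, j); rewrite /= mxE !ltr_norml => /andP[? ?] /andP[? ?].
  by apply/andP; split; lra.
rewrite bigcup_mkcond; apply: countable_bigcupT_measurable => [|q]; first exact: countableP.
case: ifPn => _ //.
rewrite (_ : _ @^-1` _ = \bigcap_(ij in [set: 'I_m * 'I_n])
    [set x | `|G x ij.1 ij.2 - ratr (q.1 ij.1 ij.2)| < ratr q.2]).
  apply: fin_bigcap_measurable => // -[i j] _ /=.
  have mf : measurable_fun setT (fun x => `|G x i j - ratr (q.1 i j)|).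
    by apply: measurableT_comp => //; exact: measurable_funB.
  have := mf measurableT _ (measurable_itv `]-oo, (ratr q.2)[); rewrite setTI.
  by congr measurable; apply/seteqP; split => x /=; rewrite in_itv.
by apply/seteqP; split => x /= xq; [move=> [i j] _; exact: xq|move=> i j; exact: (xq (i, j))].
Qed.

End MeasurableMatrix.

Section Lebesgue.
Variables (R : realType) (n : nat).
Local Notation mu := (@lebesgue_Rn R n).

(** The value is never computed; the proof only distinguishes whether it is positive. *)
Definition cube_vol : R := fine (mu (cube 0 1)).

Lemma cubeP (c x : 'rV[R]_n) r : 0 < r -> cube c r x <-> `|x - c| < r.
Proof.
move=> r0; split => [xr|xr j].
  have -> : `|x - c| = mx_norm (x - c) by [].
  by rewrite mx_normrE; apply/bigmax_ltP; split => // -[i j] _; rewrite ord1 !mxE; exact: xr.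
apply: le_lt_trans xr; have -> : `|x - c| = mx_norm (x - c) by [].
rewrite mx_normrE; apply/bigmax_geP; right; exists (0, j) => //=.
by rewrite !mxE.
Qed.

Lemma coord_le_norm m' (x : 'M[R]_(m', n)) i j : `|x i j| <= `|x|.
Proof.
have -> : `|x| = mx_norm x by [].
by rewrite mx_normrE; apply/bigmax_geP; right; exists (i, j).
Qed.

Lemma norm_le_coord m' (x : 'M[R]_(m', n)) r : 0 <= r -> (forall i j, `|x i j| <= r) -> `|x| <= r.
Proof.
move=> r0 xr; have -> : `|x| = mx_norm x by [].
by rewrite mx_normrE; apply/bigmax_leP; split.
Qed.

Lemma open_measurable_Rn (O : set 'rV[R]_n) : open O -> measurable (O : set (Rn R n)).
Proof.
move=> oO; exact: (@measurable_open_mx _ (Rn R n) R 1 n id O (@measurable_coord R n) oO).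
Qed.

Lemma closed_measurable_Rn (C : set 'rV[R]_n) : closed C -> measurable (C : set (Rn R n)).
Proof.
move=> cC; rewrite -(setCK C); apply: measurableC; apply: open_measurable_Rn.
exact: closed_openC.
Qed.

Lemma measurable_comp_mx d (T : measurableType d) m' n' (G : T -> 'M[R]_(m', n')) (h : 'M[R]_(m', n') -> R) :
  (forall i j, measurable_fun setT (fun x => G x i j)) -> continuous h ->
  measurable_fun setT (fun x => h (G x)).
Proof.
move=> mG ch; apply: (measurability _ (RGenOpens.measurableE R)) => A [_ [a [b ->]] <-].
rewrite setTI -[X in measurable X]/(G @^-1` (h @^-1` `]a, b[)).
by apply: measurable_open_mx => //; move/continuousP: ch; apply; exact: itv_open.
Qed.

Lemma continuous_measurable_Rn (f : 'rV[R]_n -> R) : continuous f -> measurable_fun [set: Rn R n] f.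
Proof.
by move=> cf; apply: (@measurable_comp_mx _ (Rn R n) 1 n id f) cf; exact: (@measurable_coord R n).
Qed.

Lemma cube_open (c : 'rV[R]_n) r : open (cube c r).
Proof.
rewrite openE => x xI.
exists (fun _ j => ball (c 0 j) r); last first.
  by move=> y yI j; have := yI 0 j; rewrite /ball/= distrC.
move=> i j; rewrite ord1; apply: open_nbhs_nbhs; split; first exact: ball_open.
by have := xI j; rewrite /ball/= distrC.
Qed.

Lemma measurable_cube (c : 'rV[R]_n) r : measurable (cube c r : set (Rn R n)).
Proof. by apply: open_measurable_Rn; exact: cube_open. Qed.

Lemma lebesgue_cube_lty (c : 'rV[R]_n) r : (mu (cube c r) < +oo)%E.
Proof. by apply: lebesgue_outer_lty_bounded; exists c, r. Qed.

Lemma lebesgue_cubeE (c : 'rV[R]_n) r : 0 < r -> mu (cube c r) = (r ^+ n * cube_vol)%:E.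
Proof.
move=> r0; rewrite /lebesgue_Rn lebesgue_cube// EFinM /cube_vol fineK//.
by rewrite ge0_fin_numE ?lebesgue_cube_lty.
Qed.

Lemma cube_vol_ge0 : 0 <= cube_vol.
Proof. by rewrite fine_ge0. Qed.

Lemma cube_subset (c c' : 'rV[R]_n) r r' : (forall j, `|c 0 j - c' 0 j| + r <= r') -> cube c r `<=` cube c' r'.
Proof.
move=> cr x xr j; have := xr j; have := cr j.
by have := ler_distD (c 0 j) (x 0 j) (c' 0 j); lra.
Qed.

Lemma cube_le (c : 'rV[R]_n) r r' : r <= r' -> cube c r `<=` cube c r'.
Proof. by move=> rr; apply: cube_subset => j; rewrite subrr normr0 add0r. Qed.

Lemma bigcup_cube : \bigcup_k cube 0 k.+1%:R = [set: 'rV[R]_n].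
Proof.
apply/seteqP; split => // x _.
exists (Num.truncn `|x|) => //.
by apply/cubeP => //; rewrite subr0; exact: truncnS_gt.
Qed.

Lemma lebesgue_sigma_finite : sigma_finite [set: Rn R n] mu.
Proof.
exists (fun k => cube 0 k.+1%:R); first by rewrite bigcup_cube.
by move=> k; split; [exact: measurable_cube|exact: lebesgue_cube_lty].
Qed.

HB.instance Definition _ := @Measure_isSigmaFinite.Build _ (Rn R n) R mu lebesgue_sigma_finite.

Lemma bounded_subset_cube (K : set 'rV[R]_n) : bounded_set K -> exists2 r, 0 < r & K `<=` cube 0 r.
Proof.
move=> [M [_ /(_ (`|M| + 1)) KM]]; exists (`|M| + 2); first by rewrite ltr_wpDl.
have r0 : 0 < `|M| + 2 by rewrite ltr_wpDl.
move=> x /KM xM; apply/(cubeP _ _ r0); rewrite subr0.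
apply: (@le_lt_trans _ _ (`|M| + 1)); last by lra.
by apply: xM; have := ler_norm M; lra.
Qed.

Lemma compact_subset_cube (K : set 'rV[R]_n) : compact K -> exists2 r, 0 < r & K `<=` cube 0 r.
Proof. by move=> cK; apply: bounded_subset_cube; exact: compact_bounded. Qed.

Lemma cube_subset0 (c : 'rV[R]_n) r : exists2 r', 0 < r' & cube c r `<=` cube 0 r'.
Proof.
exists (`|c| + `|r| + 1); first by rewrite ltr_wpDl// addr_ge0.
apply: cube_subset => j; rewrite mxE subr0.
by have := coord_le_norm c 0 j; have := ler_norm r; lra.
Qed.

Lemma closed_cube_compact (r : R) : compact [set x : 'rV[R]_n | forall j, x 0 j \in `[- r, r]].
Proof. by apply: (@rV_compact R n (fun=> `[- r, r]%classic)) => i; exact: segment_compact. Qed.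

Lemma lebesgue_translate (z : 'rV[R]_n) (A : set 'rV[R]_n) : mu ((fun x => x + z) @^-1` A) = mu A.
Proof.
rewrite -[RHS](lebesgue_outer_translate (- z)); congr lebesgue_outer.
by rewrite image_translate; apply/seteqP; split => x /=; rewrite opprK.
Qed.

Lemma ge0_integral_translate (z : 'rV[R]_n) (D : set (Rn R n)) (f : Rn R n -> \bar R) :
  measurable D -> measurable_fun D f -> (forall x, 0 <= f x)%E ->
  (\int[mu]_(x in (fun x : 'rV[R]_n => (x + z)%R) @^-1` D) f ((x : 'rV[R]_n) + z)%R = \int[mu]_(x in D) f x)%E.
Proof.
move=> mD mf f0.
rewrite -(@ge0_integral_pushforward _ _ _ _ _ _ (@measurable_translate R n z) mu D f)//.
have mt := @measurable_translate R n z.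
apply: eq_measure_integral => A mA _.
exact: (@lebesgue_translate z A).
Qed.

Lemma ge0_integral_translateT (z : 'rV[R]_n) (f : Rn R n -> \bar R) :
  measurable_fun setT f -> (forall x, 0 <= f x)%E ->
  (\int[mu]_x f ((x : 'rV[R]_n) + z)%R = \int[mu]_x f x)%E.
Proof.
move=> mf f0; have := ge0_integral_translate z measurableT mf f0.
by apply: etrans; rewrite preimage_setT.
Qed.

Lemma integrable_translate (z : 'rV[R]_n) (f : Rn R n -> \bar R) :
  mu.-integrable setT f -> mu.-integrable setT (fun x : Rn R n => f ((x : 'rV[R]_n) + z)).
Proof.
move=> /integrableP[mf fi]; apply/integrableP; split.
  exact: measurableT_comp mf (@measurable_translate R n z).
have mf' : measurable_fun setT (fun x => `|f x|%E) by exact: measurableT_comp.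
by rewrite (ge0_integral_translateT z mf').
Qed.

Lemma integral_translate (z : 'rV[R]_n) (f : Rn R n -> \bar R) :
  measurable_fun setT f ->
  (\int[mu]_x f ((x : 'rV[R]_n) + z)%R = \int[mu]_x f x)%E.
Proof.
move=> mf; rewrite integralE [RHS]integralE; congr (_ - _)%E.
  have H := @ge0_integral_translateT z (f^\+)%E (measurable_funepos mf) (fun x => funepos_ge0 f x).
  by apply: etrans H; apply: eq_integral => x _; rewrite !funeposE.
have H := @ge0_integral_translateT z (f^\-)%E (measurable_funeneg mf) (fun x => funeneg_ge0 f x).
by apply: etrans H; apply: eq_integral => x _; rewrite !funenegE.
Qed.

End Lebesgue.

(** * Vanishing mean oscillation *)

Import HBSimple.

(* [K], [V] and [Op] stand for the cubes, their volumes and the open sets of R^n. *)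
Section Oscillation.
Context d (T : measurableType d) (R : realType).
Variable mu : {sigma_finite_measure set T -> \bar R}.
Variables (K : T -> R -> set T) (V : R -> R).
Hypothesis K_sym : forall x y r, K x r y -> K y r x.
Hypothesis measurable_K2 : forall r, measurable [set z : T * T | K z.1 r z.2].
Hypothesis measurable_K : forall x r, measurable (K x r).
Hypothesis muK : forall x r, 0 < r -> mu (K x r) = (V r)%:E.
Hypothesis V_ge0 : forall r, 0 <= V r.
Hypothesis K_le : forall x r r', r <= r' -> K x r `<=` K x r'.
Implicit Types (f g : T -> R).

Lemma indic_cube_sym x y r : \1_(K x r) y = \1_(K y r) x :> R.
Proof. by rewrite !indicE; congr (_ %:R); congr nat_of_bool; apply/idP/idP; rewrite !inE; exact: K_sym. Qed.

Lemma measurable_pair_fst f : measurable_fun setT f -> measurable_fun setT (fun z : T * T => f z.1).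
Proof. by move=> mf; exact: (measurableT_comp mf measurable_fst). Qed.

Lemma measurable_pair_snd f : measurable_fun setT f -> measurable_fun setT (fun z : T * T => f z.2).
Proof. by move=> mf; exact: (measurableT_comp mf measurable_snd). Qed.

Lemma measurable_indic_cube r : measurable_fun setT (fun z : T * T => \1_(K z.1 r) z.2 : R).
Proof.
rewrite (_ : (fun _ => _) = \1_[set z : T * T | K z.1 r z.2] :> (T * T -> R)); first exact: measurable_indic.
by apply/funext => z; rewrite !indicE; congr (_ %:R); congr nat_of_bool; apply/idP/idP; rewrite !inE.
Qed.

(** The [L^1] mean oscillation at scale [r], left unnormalised: the volume [V r] appears on the
    other side of the estimates. *)
Definition osc f r : \bar R :=
  (\int[mu]_y \int[mu]_w (`|f w - f y| * \1_(K y r) w)%:E)%E.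

Lemma measurable_osc_integrand f g r : measurable_fun setT f -> measurable_fun setT g ->
  measurable_fun [set: T * T] (fun z => (`|f z.2 - g z.1| * \1_(K z.1 r) z.2)%:E).
Proof.
move=> mf mg; apply/measurable_EFinP; apply: measurable_funM; last exact: measurable_indic_cube.
apply: measurableT_comp => //; apply: measurable_funB; first exact: measurable_pair_snd.
exact: measurable_pair_fst.
Qed.

Lemma integral_cube_fst g r : 0 < r -> measurable_fun setT g -> (forall x, 0 <= g x) ->
  (\int[mu]_y \int[mu]_w (g y * \1_(K y r) w)%:E = (V r)%:E * \int[mu]_y (g y)%:E)%E.
Proof.
move=> r0 mg g0; rewrite -ge0_integralZl//.
- apply: eq_integral => y _.
  under eq_integral do rewrite EFinM.
  have mK : measurable_fun setT (fun w => (\1_(K y r) w)%:E : \bar R).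
    by apply/measurable_EFinP; exact: measurable_indic.
  rewrite ge0_integralZl ?lee_fin//.
  by rewrite integral_indic// setIT [X in (_ * X)%E = _](muK y r0) muleC.
- exact/measurable_EFinP.
- by move=> y _; rewrite lee_fin.
- by rewrite lee_fin.
Qed.

(** Tonelli exchanges the variables, and the symmetry of [K] turns the result into
    [integral_cube_fst]. *)
Lemma integral_cube_snd g r : 0 < r -> measurable_fun setT g -> (forall x, 0 <= g x) ->
  (\int[mu]_y \int[mu]_w (g w * \1_(K y r) w)%:E = (V r)%:E * \int[mu]_y (g y)%:E)%E.
Proof.
move=> r0 mg g0; rewrite -(integral_cube_fst r0 mg g0).
pose F (z : T * T) := (g z.2 * \1_(K z.1 r) z.2)%:E.
have mF : measurable_fun setT F.
  apply/measurable_EFinP; apply: measurable_funM; last exact: measurable_indic_cube.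
  exact: measurable_pair_snd.
have F0 z : (0 <= F z)%E by rewrite lee_fin mulr_ge0.
rewrite (fubini_tonelli F mF F0).
by apply: eq_integral => y _; apply: eq_integral => w _; rewrite /F/= indic_cube_sym.
Qed.

Lemma measurable_inner_osc f g r : measurable_fun setT f -> measurable_fun setT g ->
  measurable_fun setT (fun y : T => (\int[mu]_w (`|f w - g y| * \1_(K y r) w)%:E)%E).
Proof.
move=> mf mg.
have F0 z : (0 <= (fun z : T * T => (`|f z.2 - g z.1| * \1_(K z.1 r) z.2)%:E) z)%E by rewrite lee_fin mulr_ge0.
exact: (@measurable_fun_fubini_tonelli_F _ _ _ _ _ mu _ (measurable_osc_integrand r mf mg) F0).
Qed.

(** Only a pointwise bound on nearby pairs is asked for, so that the lemma serves both for a sum and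
    for the splitting of [f] into [g] and [f - g]. *)
Lemma osc_le2 f g1 g2 r : measurable_fun setT f -> measurable_fun setT g1 -> measurable_fun setT g2 ->
  (forall y w, K y r w -> `|f w - f y| <= `|g1 w - g1 y| + `|g2 w - g2 y|) ->
  (osc f r <= osc g1 r + osc g2 r)%E.
Proof.
move=> mf mg1 mg2 fg.
rewrite /osc -ge0_integralD//; last 4 first.
- by move=> y _; apply: integral_ge0 => w _; rewrite lee_fin mulr_ge0.
- exact: measurable_inner_osc.
- by move=> y _; apply: integral_ge0 => w _; rewrite lee_fin mulr_ge0.
- exact: measurable_inner_osc.
have m (h : T -> R) y : measurable_fun setT h -> measurable_fun setT (fun w : T => (`|h w - h y| * \1_(K y r) w)%:E).
  move=> mh; apply/measurable_EFinP; apply: measurable_funM.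
    by apply: measurableT_comp => //; exact: measurable_funB.
  exact: measurable_indic.
apply: ge0_le_integral => //.
- by move=> y _; apply: integral_ge0 => w _; rewrite lee_fin mulr_ge0.
- exact: measurable_inner_osc.
- by apply: emeasurable_funD; exact: measurable_inner_osc.
move=> y _; rewrite -ge0_integralD//; try exact: m; try by move=> w _; rewrite lee_fin mulr_ge0.
apply: ge0_le_integral => //; try exact: m; try by move=> w _; rewrite lee_fin mulr_ge0.
  by apply: emeasurable_funD; exact: m.
move=> w _; rewrite -EFinD lee_fin -mulrDl indicE.
case: (boolP (w \in K y r)); last by rewrite !mulr0.
by rewrite inE !mulr1 => /fg.
Qed.

(* Both terms of the bound integrate to [(V r)%:E * \int g], by Tonelli. *)
Lemma osc_le_dom f g r : 0 < r -> measurable_fun setT f -> measurable_fun setT g ->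
  (forall x, 0 <= g x) -> (forall y w, K y r w -> `|f w - f y| <= g y + g w) ->
  (osc f r <= 2%:E * (V r)%:E * \int[mu]_y (g y)%:E)%E.
Proof.
move=> r0 mf mg g0 fg.
have m y : measurable_fun setT (fun w : T => (g y * \1_(K y r) w)%:E).
  by apply/measurable_EFinP; apply: measurable_funM => //; exact: measurable_indic.
have m' y : measurable_fun setT (fun w : T => (g w * \1_(K y r) w)%:E).
  by apply/measurable_EFinP; apply: measurable_funM => //; exact: measurable_indic.
have mF1 : measurable_fun setT (fun y : T => \int[mu]_w (g y * \1_(K y r) w)%:E)%E.
  have F0 z : (0 <= (fun z : T * T => (g z.1 * \1_(K z.1 r) z.2)%:E) z)%E by rewrite lee_fin mulr_ge0.
  apply: (@measurable_fun_fubini_tonelli_F _ _ _ _ _ mu _ _ F0).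
  apply/measurable_EFinP; apply: measurable_funM; last exact: measurable_indic_cube.
  exact: measurable_pair_fst.
have mF2 : measurable_fun setT (fun y : T => \int[mu]_w (g w * \1_(K y r) w)%:E)%E.
  have F0 z : (0 <= (fun z : T * T => (g z.2 * \1_(K z.1 r) z.2)%:E) z)%E by rewrite lee_fin mulr_ge0.
  apply: (@measurable_fun_fubini_tonelli_F _ _ _ _ _ mu _ _ F0).
  apply/measurable_EFinP; apply: measurable_funM; last exact: measurable_indic_cube.
  exact: measurable_pair_snd.
rewrite -muleA (_ : 2%:E = 1 + 1)%E// ge0_muleDl ?lee_fin// !mul1e.
rewrite -{1}integral_cube_fst// -integral_cube_snd//.
rewrite -ge0_integralD//; try by move=> y _; apply: integral_ge0 => w _; rewrite lee_fin mulr_ge0.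
apply: ge0_le_integral => //; try by move=> y _; apply: integral_ge0 => w _; rewrite lee_fin mulr_ge0.
- exact: measurable_inner_osc.
- exact: emeasurable_funD.
move=> y _; rewrite -ge0_integralD//; try by move=> w _; rewrite lee_fin mulr_ge0.
apply: ge0_le_integral => //; try by move=> w _; rewrite lee_fin mulr_ge0.
- apply/measurable_EFinP; apply: measurable_funM.
    by apply: measurableT_comp => //; exact: measurable_funB.
  exact: measurable_indic.
- exact: emeasurable_funD.
move=> w _; rewrite -EFinD lee_fin -mulrDl indicE.
case: (boolP (w \in K y r)); last by rewrite !mulr0.
by rewrite inE !mulr1 => /fg.
Qed.

(** An averaged form of the [L^1] continuity of translations. It is proved for indicators of open
    sets, then of sets of finite measure, then for simple and for integrable functions. *)
Definition vanishing_osc f := forall e, 0 < e -> exists2 d, 0 < d &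
  forall r, 0 < r <= d -> (osc f r <= e%:E * (V r)%:E)%E.

Lemma vanishing_oscD f g : measurable_fun setT f -> measurable_fun setT g ->
  vanishing_osc f -> vanishing_osc g -> vanishing_osc (f \+ g).
Proof.
move=> mf mg vf vg e e0; have e20 : 0 < e / 2 by rewrite divr_gt0.
have [d1 d10 h1] := vf _ e20; have [d2 d20 h2] := vg _ e20.
exists (Num.min d1 d2); first by rewrite lt_min d10.
move=> r /andP[r0]; rewrite le_min => /andP[rd1 rd2].
apply: (@le_trans _ _ (osc f r + osc g r)%E).
  apply: osc_le2 => //; first exact: measurable_funD.
  by move=> y w _ /=; apply: le_trans (ler_normD _ _); rewrite le_eqVlt; apply/orP; left; apply/eqP; congr `|_|; ring.
have e2 : (0 <= (e / 2)%:E)%E by rewrite lee_fin ltW.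
rewrite [e]splitr EFinD ge0_muleDl//.
by apply: leeD; [apply: h1; rewrite r0|apply: h2; rewrite r0].
Qed.

Lemma vanishing_oscZ f c : measurable_fun setT f -> vanishing_osc f -> vanishing_osc (fun x => c * f x).
Proof.
move=> mf vf e e0; have e20 : 0 < e / (`|c| + 1) by rewrite divr_gt0// ltr_wpDl.
have [t t0 h] := vf _ e20; exists t => // r rd.
have /le_trans := h r rd => h'.
apply: (@le_trans _ _ (`|c|%:E * osc f r)%E).
  rewrite /osc -ge0_integralZl//; last 2 first.
  - exact: measurable_inner_osc.
  - by move=> y _; apply: integral_ge0 => w _; rewrite lee_fin mulr_ge0.
  rewrite le_eqVlt; apply/orP; left; apply/eqP; apply: eq_integral => y _.
  have mh : measurable_fun setT (fun w => (`|f w - f y| * \1_(K y r) w)%:E).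
    apply/measurable_EFinP; apply: measurable_funM; last exact: measurable_indic.
    by apply: measurableT_comp => //; exact: measurable_funB.
  rewrite -ge0_integralZl//; try by move=> w _; rewrite lee_fin mulr_ge0.
  by apply: eq_integral => w _; rewrite -mulrBr normrM -EFinM mulrA.
apply: (@le_trans _ _ (`|c|%:E * ((e / (`|c| + 1))%:E * (V r)%:E))%E).
  by rewrite lee_wpmul2l ?lee_fin// h.
rewrite -!EFinM lee_fin mulrA ler_wpM2r//.
by rewrite mulrCA ger_pMr// ler_pdivrMr ?ltr_wpDl// mul1r; lra.
Qed.

(** Closedness in [L^1]: by [osc_le_dom] the oscillation of [f - g] is at most [2 V(r)] times its
    [L^1] norm, at every scale at once. Hence the [e / 4]. *)
Lemma vanishing_osc_approx f : measurable_fun setT f ->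
  (forall e, 0 < e -> exists g, [/\ measurable_fun setT g, vanishing_osc g &
     (\int[mu]_x (`|f x - g x|)%:E <= e%:E)%E]) ->
  vanishing_osc f.
Proof.
move=> mf H e e0; have e40 : 0 < e / 4 by rewrite divr_gt0.
have [g [mg vg fg]] := H _ e40; have e20 : 0 < e / 2 by rewrite divr_gt0.
have [t t0 h] := vg _ e20; exists t => // r rd; have /andP[r0 _] := rd.
apply: (@le_trans _ _ (osc g r + osc (f \- g)%R r)%E).
  apply: osc_le2 => //; first exact: measurable_funB.
  by move=> y w _ /=; apply: le_trans (ler_normD _ _); rewrite le_eqVlt; apply/orP; left; apply/eqP; congr `|_|; ring.
have mfg : measurable_fun setT (f \- g) by exact: measurable_funB.
have e2 : (0 <= (e / 2)%:E)%E by rewrite lee_fin ltW.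
rewrite [e]splitr EFinD ge0_muleDl//.
apply: leeD; first exact: h.
apply: (@le_trans _ _ (2%:E * (V r)%:E * \int[mu]_y (`|(f \- g)%R y|)%:E)%E).
  apply: osc_le_dom => //; first exact: measurableT_comp.
  by move=> y w _; rewrite [leRHS]addrC; exact: ler_normB.
rewrite muleAC lee_wpmul2r ?lee_fin//.
apply: (@le_trans _ _ (2%:E * (e / 4)%:E)%E); first by rewrite lee_wpmul2l// lee_fin.
by rewrite -EFinM lee_fin; lra.
Qed.

Variable Op : set T -> Prop.
Hypothesis Op_measurable : forall O, Op O -> measurable O.
Hypothesis Op_bdry : forall O r, Op O -> measurable (O `&` \bigcup_(w in ~` O) K w r).
Hypothesis Op_open : forall O x, Op O -> O x -> exists k, K x k.+1%:R^-1 `<=` O.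
Hypothesis Op_regular : forall A e, 0 < e -> measurable A -> (mu A < +oo)%E ->
  exists O, [/\ Op O, A `<=` O & (mu O <= mu A + e%:E)%E].

(** The indicator oscillates only across the boundary, so the oscillation is controlled by the
    measure of a boundary layer. The layers decrease to the empty set since [O] is open, and
    [mu O < +oo] makes their measures tend to 0. *)
Lemma vanishing_osc_open (O : set T) : Op O -> (mu O < +oo)%E -> vanishing_osc \1_O.
Proof.
move=> oO Ooo e e0.
(* The inner layer suffices: of two nearby points on different sides of the boundary, the one in [O]
   belongs to [U r]. *)
pose U r := O `&` \bigcup_(w in ~` O) K w r.
have mO : measurable O by exact: Op_measurable.
have mU r : measurable (U r) by exact: Op_bdry.
have : (mu \o (fun k => U k.+1%:R^-1)) k @[k --> \oo] --> mu (\bigcap_k U k.+1%:R^-1).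
  apply: nonincreasing_cvg_mu => //.
  - by apply: le_lt_trans Ooo; apply: le_measure; rewrite ?inE//; move=> x [].
  - by apply: bigcapT_measurable => k.
  - move=> a b ab; apply/subsetPset => x [Ox [w Ow wx]]; split => //; exists w => //.
    by apply: K_le wx; rewrite lef_pV2 ?posrE// ler_nat ltnS.
rewrite (_ : \bigcap_k _ = set0); last first.
  rewrite -subset0 => x xU.
  have [Ox _] := xU 0%N I.
  have [k kO] := Op_open oO Ox.
  by have [_ [w Ow wx]] := xU k I; apply: Ow; apply: kO; exact: K_sym.
rewrite measure0 => /fine_cvgP[Ufin /cvgrPdist_lt/(_ (e / 2))].
rewrite divr_gt0// => /(_ isT) Ue.
have [k [kfin ke]] := filter_ex (filterI Ufin Ue).
exists k.+1%:R^-1; first by rewrite invr_gt0.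
move=> r /andP[r0 rk].
have UU : U r `<=` U k.+1%:R^-1.
  by move=> x [Ox [w Ow wx]]; split => //; exists w => //; exact: K_le wx.
apply: (@le_trans _ _ (2%:E * (V r)%:E * \int[mu]_y (\1_(U r) y)%:E)%E).
  apply: osc_le_dom => //.
  move=> y w yw; rewrite !indicE.
  have [yO|yO] := pselect (O y); have [wO|wO] := pselect (O w).
  - by rewrite (mem_set yO) (mem_set wO) subrr normr0 addr_ge0.
  - rewrite (mem_set yO) (memNset wO) sub0r normrN normr1.
    rewrite (_ : y \in U r); first by rewrite lerDl.
    by rewrite inE; split => //; exists w => //; exact: K_sym.
  - rewrite (memNset yO) (mem_set wO) subr0 normr1.
    rewrite (_ : w \in U r); first by rewrite lerDr.
    by rewrite inE; split => //; exists y.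
  - by rewrite (memNset yO) (memNset wO) subrr normr0 addr_ge0.
rewrite integral_indic// setIT muleAC lee_wpmul2r ?lee_fin//.
apply: (@le_trans _ _ (2%:E * (e / 2)%:E)%E); last by rewrite -EFinM lee_fin; lra.
rewrite lee_wpmul2l ?lee_fin//.
apply: (@le_trans _ _ (mu (U k.+1%:R^-1))); first by apply: le_measure; rewrite ?inE.
rewrite -[leLHS]fineK// lee_fin ltW//.
by move: ke; rewrite /= sub0r normrN ger0_norm// fine_ge0.
Qed.

Lemma vanishing_osc_indic (A : set T) : measurable A -> (mu A < +oo)%E -> vanishing_osc \1_A.
Proof.
move=> mA Aoo; apply: vanishing_osc_approx; first exact: measurable_indic.
move=> e e0; have [B [oB AB Be]] := Op_regular e0 mA Aoo.
have finA : mu A \is a fin_num by rewrite ge0_fin_numE.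
have Boo : (mu B < +oo)%E by apply: le_lt_trans Be _; rewrite lte_add_pinfty// ltry.
have mB : measurable B by exact: Op_measurable.
exists \1_B; split; [exact: measurable_indic|exact: vanishing_osc_open|].
rewrite (_ : (\int[mu]_x _)%E = (\int[mu]_x (\1_(B `\` A) x)%:E)%E); last first.
  apply: eq_integral => x _; rewrite !indicE; congr EFin.
  have [xA|xA] := pselect (A x).
    by rewrite (mem_set xA) (mem_set (AB _ xA)) subrr normr0 memNset//; case.
  rewrite (memNset xA) sub0r normrN.
  have [xB|xB] := pselect (B x); first by rewrite !mem_set// normr1.
  by rewrite !memNset ?normr0//; case.
rewrite integral_indic//; last exact: measurableD.
rewrite setIT measureD//= (_ : B `&` A = A); last by apply/setIidPr.
by rewrite leeBlDr// addeC.
Qed.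

Lemma vanishing_osc_integrable f : mu.-integrable setT (EFin \o f) -> vanishing_osc f.
Proof.
move=> fi; have mf : measurable_fun setT f by apply/measurable_EFinP; exact: measurable_int fi.
apply: vanishing_osc_approx => // e e0.
have [g_ [gi _ /fine_cvgP[gfin /cvgrPdist_lt/(_ e e0) ge]]] := approximation_sfun_integrable measurableT fi.
have [k [kfin ke]] := filter_ex (filterI gfin ge).
exists (g_ k : T -> R); split => //; last first.
  apply: (@le_trans _ _ (\int[mu]_z `|(EFin \o f) z - (g_ k z)%:E|)%E) => //.
  rewrite -[leLHS]fineK// lee_fin; move: ke; rewrite /= sub0r normrN => /ltW.
  exact: le_trans (ler_norm _).
have := gi k; move: (g_ k) => g {}gi.
have [s Es] : exists s : seq R, forall F : R -> R, \sum_(y \in range g) F y = \sum_(y <- s) F y.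
  by exists (finmap.enum_fset (fset_set (range g))) => F; rewrite fsbig_finite.
have -> : (g : T -> R) = fun x => \sum_(y <- s) (y * \1_(g @^-1` [set y]) x).
  by apply/funext => x; rewrite {1}(fimfunE g) Es.
have mg y : measurable (g @^-1` [set y]) by exact: measurable_sfunP.
have ms (s' : seq R) : measurable_fun setT (fun x : T => \sum_(y <- s') (y * \1_(g @^-1` [set y]) x)).
  by apply: measurable_sum => y; apply: measurable_funM => //; exact: measurable_indic.
elim: s {Es} => [|y s IH].
  move=> e' e'0; exists 1 => // r /andP[r0 _]; rewrite /osc.
  rewrite integral0_eq ?mule_ge0 ?lee_fin ?(ltW e'0)// => x _.
  by rewrite integral0_eq// => w _; rewrite !big_nil subrr normr0 mul0r.
rewrite (_ : (fun x => _) = (fun x => y * \1_(g @^-1` [set y]) x) \+ (fun x : T => \sum_(y <- s) (y * \1_(g @^-1` [set y]) x))); last first.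
  by apply/funext => x; rewrite big_cons.
apply: vanishing_oscD; [|exact: ms| |exact: IH].
  by apply: measurable_funM => //; exact: measurable_indic.
(* The level set of [0] may have infinite measure, but its term vanishes. The other level sets have
   finite measure because [|y|] times the measure is at most the integral of [|g|]. *)
have [->|y0] := eqVneq y 0.
  move=> e' e'0; exists 1 => // r /andP[r0 _]; rewrite /osc.
  rewrite integral0_eq ?mule_ge0 ?lee_fin ?(ltW e'0)// => x _.
  by rewrite integral0_eq// => w _; rewrite !mul0r subrr normr0 mul0r.
apply: vanishing_oscZ; first exact: measurable_indic.
apply: vanishing_osc_indic => //.
have /integrableP[mgE giy] := gi.
have : (`|y|%:E * mu (g @^-1` [set y]) < +oo)%E.
  apply: le_lt_trans giy.
  have mA : measurable_fun setT (fun x => (\1_(g @^-1` [set y]) x)%:E : \bar R).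
    by apply/measurable_EFinP; exact: measurable_indic.
  rewrite -[X in (_ * mu X)%E]setIT -integral_indic// -ge0_integralZl//.
  apply: ge0_le_integral => //.
  - by apply: measurable_funeM.
  - exact: measurableT_comp.
  move=> x _ /=; rewrite lee_fin indicE.
  have [gx|gx] := pselect (g x = y); last by rewrite memNset// mulr0.
  by rewrite mem_set// mulr1 gx.
rewrite ltNge leye_eq => /negP h; rewrite ltNge leye_eq; apply/negP => /eqP E.
by apply: h; rewrite E gt0_muley// lte_fin normr_gt0.
Qed.

End Oscillation.

(** * Integral inequalities *)

Lemma near_le_cvg (R : realType) (u : nat -> \bar R) (l : \bar R) (e : R) :
  l \is a fin_num -> u j @[j --> \oo] --> l -> 0 < e -> \forall j \near \oo, (u j <= l + e%:E)%E.
Proof.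
move=> fl; rewrite -(fineK fl) => /fine_cvgP[uf /cvgrPdist_le ue] e0.
apply: filterS2 uf (ue _ e0) => j ufj uej.
rewrite -(fineK ufj) -EFinD lee_fin; move: uej; rewrite /= ler_distl; lra.
Qed.

Section AlmostEverywhere.
Context d (T : measurableType d) (R : realType) (mu : {measure set T -> \bar R}).
Variable D : set T.
Hypothesis mD : measurable D.

(** The sum of all [f k] has a finite integral, hence is finite almost everywhere, and the terms of
    a convergent series tend to 0. Choosing scales with summable errors thus gives almost everywhere
    convergence of a whole sequence. *)
Lemma ae_cvg0_summable_integral (f : nat -> T -> R) :
  (forall k, measurable_fun D (f k)) -> (forall k x, 0 <= f k x) ->
  (forall k, (\int[mu]_(x in D) (f k x)%:E <= ((2 ^ k.+1)%:R^-1)%:E)%E) ->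
  {ae mu, forall x, D x -> f k x @[k --> \oo] --> 0}.
Proof.
move=> mf f0 fle.
have mfE k : measurable_fun D (fun x => (f k x)%:E) by exact/measurable_EFinP.
have f0E k x : D x -> (0 <= (f k x)%:E)%E by rewrite lee_fin.
pose S x : \bar R := (\sum_(0 <= k <oo) (f k x)%:E)%E.
have S0 x : (0 <= S x)%E by apply: nneseries_ge0 => k _ _; rewrite lee_fin.
have iS : mu.-integrable D S.
  apply/integrableP; split; first by apply: ge0_emeasurable_sum => // k x Dx _; exact: f0E.
  under eq_integral do rewrite gee0_abs//.
  rewrite integral_nneseries//.
  apply: (@le_lt_trans _ _ 1%E); last exact: ltry.
  (* The summand is padded with [0] so that [epsilon_trick], applied to the zero sequence, evaluates
     the geometric series. *)
  apply: (@le_trans _ _ (\sum_(0 <= k <oo) (0 + (1 / (2 ^ k.+1)%:R)%:E))%E).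
    apply: lee_nneseries => [k _ _|k _]; first by apply: integral_ge0 => x _; rewrite lee_fin.
    by rewrite add0e div1r; exact: fle.
  apply: le_trans (epsilon_trick xpredT (A := fun=> 0%E) _ ler01) _ => //.
  by rewrite eseries0// add0e.
apply: filterS (integrable_ae mD iS) => x /[apply] Sx.
apply: cvg_series_cvg_0; apply: nondecreasing_is_cvgn.
  by apply/nondecreasing_seqP => k; rewrite /series/= big_nat_recr//= lerDl.
exists (fine (S x)) => _ [k _ <-].
rewrite -lee_fin fineK// /series/= -sumEFin.
by apply: nneseries_lim_ge => i _ _; rewrite lee_fin.
Qed.

(* [W_j <= min(W_j, c(1+g)) + c|g_j - g|], where dominated convergence applies to the minimum. *)
Lemma limsup_integral_le_dom (c : R) (h : nat -> T -> R) (h_ : T -> R) (g : nat -> T -> R) (g_ : T -> R) :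
  0 <= c -> (mu D < +oo)%E ->
  (forall j, measurable_fun D (h j)) -> measurable_fun D h_ ->
  (forall j, measurable_fun D (g j)) -> mu.-integrable D (EFin \o g_) ->
  (forall j x, D x -> 0 <= h j x <= c * (1 + g j x)) ->
  (forall x, D x -> 0 <= h_ x <= c * (1 + g_ x)) ->
  {ae mu, forall x, D x -> h j x @[j --> \oo] --> h_ x} ->
  (\int[mu]_(x in D) (`|g j x - g_ x|)%:E @[j --> \oo] --> 0)%E ->
  forall e, 0 < e -> \forall j \near \oo,
   (\int[mu]_(x in D) (h j x)%:E <= \int[mu]_(x in D) (h_ x)%:E + e%:E)%E.
Proof.
move=> c0 Doo mh mh_ mg ig hj h_b hcv gcv e e0.
have mg_ : measurable_fun D g_ by apply/measurable_EFinP; exact: measurable_int ig.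
pose G x := c * (1 + g_ x).
have iG : mu.-integrable D (EFin \o G).
  rewrite /G (_ : _ \o _ = fun x => c%:E * (cst 1%:E x + (EFin \o g_) x))%E; last first.
    by apply/funext => x /=; rewrite EFinM EFinD.
  apply: integrableZl => //; apply: integrableD => //.
  apply/integrableP; split; first exact: measurable_cst.
  by under eq_integral do rewrite /cst abse1; rewrite integral_cst// mul1e.
have G0 x : D x -> 0 <= G x by move=> /h_b /andP[]; exact: le_trans.
pose mi j x := Num.min (h j x) (G x).
have mmi j : measurable_fun D (fun x => (mi j x)%:E).
  apply/measurable_EFinP; apply: measurable_minr => //.
  by apply/measurable_EFinP; exact: measurable_int iG.
have mi_cvg : {ae mu, forall x, D x -> (mi j x)%:E @[j --> \oo] --> (h_ x)%:E}.
  apply: filterS hcv => x hx Dx; apply: cvg_EFin; first exact: nearW.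
  have /cvgrPdist_le hx' := hx Dx.
  apply/cvgrPdist_le => t t0; apply: filterS (hx' t t0) => j /=.
  have /andP[_ hG] := h_b _ Dx; rewrite /mi /Num.min; case: ifPn => //; rewrite -leNgt => Ghj.
  by rewrite !ler_distl /G in Ghj *; move=> /andP[? ?]; apply/andP; split; lra.
have mi_dom : {ae mu, forall x j, D x -> (`|(mi j x)%:E| <= (EFin \o G) x)%E}.
  apply: aeW => x j Dx; rewrite /= lee_fin ger0_norm; first by rewrite /mi ge_min lexx orbT.
  by rewrite le_min G0// andbT; have /andP[] := hj j _ Dx.
have ih : mu.-integrable D (EFin \o h_).
  apply: le_integrable iG => //; first exact/measurable_EFinP.
  move=> x Dx /=; have /andP[h0 hG] := h_b _ Dx.
  by rewrite lee_fin !ger0_norm// G0.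
have [_ _ cv] := @dominated_convergence _ _ _ mu D mD (fun j x => (mi j x)%:E) (EFin \o h_) (EFin \o G)
  mmi (proj2 (measurable_EFinP _ _) mh_) mi_cvg iG mi_dom.
have e20 : 0 < e / 2 by rewrite divr_gt0.
have ec0 : 0 < e / (2 * (c + 1)) by rewrite divr_gt0// mulr_gt0//; lra.
have N1 := near_le_cvg (integrable_fin_num mD ih) cv e20.
have N2 := near_le_cvg (isT : 0%E \is a fin_num) gcv ec0.
apply: filterS2 N1 N2 => j H1 H2.
have mgj : measurable_fun D (fun x => (`|g j x - g_ x|)%:E).
  by apply/measurable_EFinP; apply: measurableT_comp => //; exact: measurable_funB.
apply: (@le_trans _ _ (\int[mu]_(x in D) ((mi j x)%:E + c%:E * (`|g j x - g_ x|)%:E))%E).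
  apply: ge0_le_integral => //.
  - by move=> x Dx; rewrite lee_fin; have /andP[] := hj j _ Dx.
  - exact/measurable_EFinP.
  - by apply: emeasurable_funD => //; exact: measurable_funeM.
  move=> x Dx; rewrite -EFinM -EFinD lee_fin.
  have /andP[_ hjx] := hj j _ Dx; rewrite /mi /Num.min /G; case: ifPn => _.
    by rewrite lerDl mulr_ge0.
  have := ler_wpM2l c0 (ler_norm (g j x - g_ x)); lra.
rewrite ge0_integralD//; last 3 first.
- move=> x Dx; rewrite lee_fin le_min G0// andbT; by have /andP[] := hj j _ Dx.
- by move=> x Dx; rewrite mule_ge0// lee_fin.
- exact: measurable_funeM.
rewrite ge0_integralZl//.
rewrite [e]splitr EFinD addeA; apply: leeD; first exact: H1.
move: H2; rewrite add0e => H2.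
apply: (@le_trans _ _ (c%:E * (e / (2 * (c + 1)))%:E)%E); first by rewrite lee_wpmul2l.
rewrite -EFinM lee_fin mulrA ler_pdivrMr ?mulr_gt0//; last lra.
by rewrite (_ : e / 2 * (2 * (c + 1)) = c * e + e); [lra|field].
Qed.

End AlmostEverywhere.

Section KernelAverage.
Context d (T : measurableType d) (R : realType) (mu : {measure set T -> \bar R}).

(** The tangent line of the convex function [t^p] at [a], obtained from Young's inequality for [g]
    and [a^(p-1)] with the conjugate exponent [q = p / (p - 1)]. *)
Lemma powR_tangent (p a g : R) : 1 < p -> 0 <= a -> 0 <= g ->
  a `^ p + p * (a `^ (p - 1)) * (g - a) <= g `^ p.
Proof.
move=> p1 a0 g0; have p0 : 0 < p by lra.
have [->|an0] := eqVneq a 0.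
  rewrite powR0 ?gt_eqF// powR0; last by rewrite gt_eqF//; lra.
  by rewrite mulr0 mul0r addr0 powR_ge0.
have a_gt0 : 0 < a by rewrite lt0r an0.
pose q := p / (p - 1).
have pm1 : 0 < p - 1 by lra.
have q0 : 0 < q by rewrite divr_gt0.
have pq : p^-1 + q^-1 = 1 by rewrite /q invf_div; field; rewrite gt_eqF.
have := @conjugate_powR R g (a `^ (p - 1)) p q g0 (powR_ge0 _ _) p0 q0 pq.
rewrite -powRrM (_ : (p - 1) * q = p); last by rewrite /q; field; rewrite gt_eqF.
have -> : a `^ p = a * a `^ (p - 1).
  by rewrite -{2}(powRr1 a0) -powRD; [congr (_ `^ _); lra|rewrite an0 implybT].
set X := a `^ (p - 1) => h.
have h2 : p * (g * X) <= g `^ p + (p - 1) * (a * X).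
  rewrite -(ler_pM2l p0) in h; apply: le_trans h _.
  rewrite le_eqVlt; apply/orP; left; apply/eqP; rewrite /q.
  by field; rewrite !gt_eqF.
by lra.
Qed.

(** The tangent inequality at the mean [a] is integrated against [k]; the linear term cancels
    because [k] has mass 1. *)
Lemma jensen_powR (p : R) (k g : T -> R) : 1 < p ->
  (forall x, 0 <= k x) -> (forall x, 0 <= g x) ->
  mu.-integrable setT (EFin \o k) -> \int[mu]_x k x = 1 ->
  mu.-integrable setT (EFin \o (fun x => g x * k x)) ->
  mu.-integrable setT (EFin \o (fun x => g x `^ p * k x)) ->
  (\int[mu]_x (g x * k x)) `^ p <= \int[mu]_x (g x `^ p * k x).
Proof.
move=> p1 k0 g0 ik k1 igk igpk.
set a := \int[mu]_x (g x * k x).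
have a0 : 0 <= a by apply: Rintegral_ge0 => x _; rewrite mulr_ge0.
set b := p * a `^ (p - 1).
have i1 : mu.-integrable setT (EFin \o (fun x => (a `^ p - b * a) * k x)).
  by rewrite (_ : _ \o _ = fun x => (a `^ p - b * a)%:E * (EFin \o k) x)%E//; exact: integrableZl.
have i2 : mu.-integrable setT (EFin \o (fun x => b * (g x * k x))).
  by rewrite (_ : _ \o _ = fun x => b%:E * (EFin \o (fun x => (g x * k x)%R)) x)%E//; exact: integrableZl.
have : \int[mu]_x ((a `^ p - b * a) * k x + b * (g x * k x)) <= \int[mu]_x (g x `^ p * k x).
  apply: le_Rintegral => //; first exact: (integrableD measurableT i1 i2).
  move=> x _; have := powR_tangent p1 a0 (g0 x); rewrite -/b => h.
  rewrite mulrA -mulrDl ler_wpM2r//; apply: le_trans h; rewrite mulrBr; lra.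
rewrite RintegralD// !RintegralZl// k1 -/a; lra.
Qed.

End KernelAverage.

Section KernelL1.
Context d (T : measurableType d) (R : realType).
Variable mu : {sigma_finite_measure set T -> \bar R}.
Variables (K : T -> R -> set T).
Hypothesis measurable_K2 : forall r, measurable [set z : T * T | K z.1 r z.2].
Hypothesis measurable_K : forall x r, measurable (K x r).

(** Since each [k x] has mass 1, [g x - f x] is the average of [f z - f x], and [k x] is at most [B]
    times the indicator of [K x r]. This is how vanishing oscillation becomes [L^1] convergence of
    averages. *)
Lemma kernel_average_osc (r B : R) (k : T -> T -> R) (f g : T -> R) : 0 <= B ->
  (forall x, measurable_fun setT (k x)) ->
  (forall x z, 0 <= k x z <= B * \1_(K x r) z) ->
  (forall x, mu.-integrable setT (EFin \o k x)) -> (forall x, \int[mu]_z k x z = 1) ->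
  mu.-integrable setT (EFin \o f) -> measurable_fun setT g ->
  (forall x, g x = \int[mu]_z (f z * k x z)) ->
  (\int[mu]_x (`|g x - f x|)%:E <= B%:E * osc mu K f r)%E.
Proof.
move=> B0 mk kB ik k1 fi mg gE.
have mf : measurable_fun setT f by apply/measurable_EFinP; exact: measurable_int fi.
have kb x z : 0 <= k x z by have /andP[] := kB x z.
have ifk x : mu.-integrable setT (EFin \o (fun z => f z * k x z)).
  apply: (@le_integrable _ _ _ mu setT measurableT _ (fun z => B%:E * (EFin \o f) z)%E).
  - by apply/measurable_EFinP; exact: measurable_funM.
  - move=> z _ /=; rewrite lee_fin !normrM mulrC ler_wpM2r//.
    have /andP[k0 kB'] := kB x z; rewrite ger0_norm// (le_trans kB')// (ger0_norm B0).
    by rewrite ler_piMr// indicE; case: (_ \in _).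
  - exact: integrableZl.
have mo : measurable_fun setT (fun x => \int[mu]_w (`|f w - f x| * \1_(K x r) w)%:E)%E.
  exact: measurable_inner_osc.
rewrite /osc -ge0_integralZl ?lee_fin//; last first.
  by move=> x _; apply: integral_ge0 => z _; rewrite lee_fin mulr_ge0.
apply: ge0_le_integral => //.
- by apply/measurable_EFinP; apply: measurableT_comp => //; exact: measurable_funB.
- exact: measurable_funeM.
move=> x _.
have mfx : measurable_fun setT (fun z => (`|f z - f x| * \1_(K x r) z)%:E).
  apply/measurable_EFinP; apply: measurable_funM; last exact: measurable_indic.
  by apply: measurableT_comp => //; exact: measurable_funB.
rewrite -ge0_integralZl ?lee_fin//; try by move=> z _; rewrite lee_fin mulr_ge0.
have i2 : mu.-integrable setT (EFin \o (fun z => f x * k x z)).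
  by rewrite (_ : _ \o _ = fun z => (f x)%:E * (EFin \o k x) z)%E//; exact: integrableZl.
have -> : g x - f x = \int[mu]_z ((f z - f x) * k x z).
  rewrite gE -[X in _ - X]mulr1 -(k1 x) -RintegralZl// -RintegralB//.
  by apply: eq_Rintegral => z _; rewrite mulrBl.
have i3 : mu.-integrable setT (EFin \o (fun z => (f z - f x) * k x z)).
  rewrite (_ : _ \o _ = (fun z => (EFin \o (fun z => (f z * k x z)%R)) z - (EFin \o (fun z => (f x * k x z)%R)) z)%E).
    exact: integrableB.
  by apply/funext => z /=; rewrite mulrBl EFinB.
rewrite EFin_normr_Rintegral//.
apply: le_trans (le_abse_integral mu measurableT (measurable_int _ i3)) _.
apply: ge0_le_integral => //.
- by apply: measurableT_comp => //; exact: (measurable_int _ i3).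
- exact: measurable_funeM.
move=> z _; rewrite -EFinM lee_fin normrM [`|k x z|]ger0_norm// mulrCA ler_wpM2l//.
by have /andP[] := kB x z.
Qed.

End KernelL1.

Section UltraLimit.
Context {R : realType} {U : set_system nat} {UU : UltraFilter U}.

(** A cluster point of an ultrafilter is a limit, so compactness of the segment applies to the whole
    sequence. Uniform and weak limits can then be taken along the same filter. *)
Lemma ultra_limit (x : nat -> R) (a b : R) : (\forall k \near U, a <= x k <= b) ->
  exists2 l, a <= l <= b & x k @[k --> U] --> l.
Proof.
move=> xab.
have PU : ProperFilter U by exact: ultra_proper.
have [l [lab cl]] := @segment_compact R a b (x k @[k --> U]) _ (filterS (fun k => id) xab).
exists l => // V /= Vl; have [//|UV] := in_ultra_setVsetC (x @^-1` V) UU.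
have UV' : (x k @[k --> U]) (~` V) by [].
by have [y [Vy]] := cl _ _ UV' Vl.
Qed.

End UltraLimit.

Section IntegralBound.
Context d (T : measurableType d) (R : realType) (mu : {measure set T -> \bar R}).

(** On the set where [f] exceeds [M], the positive function [f - M] has integral at most 0, so this
    set is null. *)
Lemma ae_le_of_integral_le (D : set T) (M : R) (f : T -> R) :
  measurable D -> (mu D < +oo)%E -> mu.-integrable D (EFin \o f) ->
  (forall A, measurable A -> A `<=` D -> (\int[mu]_(x in A) (f x)%:E <= M%:E * mu A)%E) ->
  {ae mu, forall x, D x -> f x <= M}.
Proof.
move=> mD Doo fi fM.
have mf : measurable_fun D f by apply/measurable_EFinP; exact: measurable_int fi.
pose B := D `&` [set x | M < f x].
have mB : measurable B.
  have := mf mD _ (measurable_itv `]M, +oo[); congr measurable.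
  by rewrite /B; congr setI; apply/seteqP; split => x /=; rewrite in_itv/= andbT.
have BD : B `<=` D by move=> x [].
have fiB : mu.-integrable B (EFin \o f) by exact: integrableS BD fi.
have mBoo : (mu B < +oo)%E by apply: le_lt_trans Doo; apply: le_measure; rewrite ?inE.
have ic : mu.-integrable B (cst M%:E).
  apply/integrableP; split; first exact: measurable_cst.
  under eq_integral do rewrite /cst.
  by rewrite integral_cst// lte_mul_pinfty.
have iB : mu.-integrable B (fun x => (f x - M)%:E).
  by rewrite (_ : (fun _ => _) = ((EFin \o f) \- cst M%:E)%E)//; exact: integrableB.
have H : (\int[mu]_(x in B) `|(f x - M)%:E| = 0)%E.
  apply/eqP; rewrite eq_le integral_ge0// andbT.
  rewrite (eq_integral (fun x => (EFin \o f) x - cst M%:E x)%E); last first.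
    by move=> x /[!inE] -[_ /= Mf]; rewrite gtr0_norm// subr_gt0.
  rewrite integralB// integral_cst//= leeBlDr ?add0e; last first.
    by rewrite fin_numM// ge0_fin_numE.
  exact: fM.
have mh : measurable_fun B (fun x => (f x - M)%:E) by exact: measurable_int iB.
have := (ae_eq_integral_abs mu mB mh).1 H.
apply: filterS => x fx Dx; rewrite leNgt; apply/negP => Mf.
have := fx (conj Dx Mf) => /= -[] /eqP.
by rewrite subr_eq0 gt_eqF.
Qed.

End IntegralBound.

Section AdditiveDensity.
Context d (T : measurableType d) (R : realType).
Variable mu : {sigma_finite_measure set T -> \bar R}.
Variables (D : set T) (M : R) (lam : set T -> R).
Hypothesis mD : measurable D.
Hypothesis Doo : (mu D < +oo)%E.
Hypothesis M0 : 0 <= M.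
Hypothesis lamU : forall A B, measurable A -> measurable B -> A `&` B = set0 ->
  lam (A `|` B) = lam A + lam B.
Hypothesis lam_le : forall A, measurable A -> (`|lam A|%:E <= M%:E * mu (A `&` D))%E.

Let nu (A : set T) : \bar R := (lam A)%:E.

Let nu0 : nu set0 = 0%E.
Proof.
rewrite /nu; have := lam_le measurable0; rewrite set0I measure0 mule0 lee_fin normr_le0 => /eqP ->.
by [].
Qed.

Let nu_fin A : measurable A -> nu A \is a fin_num. Proof. by []. Qed.

(** Countable additivity follows from the finite one and the bound by [M] times the measure: the
    remainders [E k] decrease to the empty set inside the set [D] of finite measure, so [lam (E k)]
    tends to 0. *)
Let nu_sigma : semi_sigma_additive nu.
Proof.
move=> F mF tF mUF.
pose G k := \big[setU/set0]_(i < k) F i.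
have mG k : measurable (G k) by exact: bigsetU_measurable.
have lamG k : lam (G k) = \sum_(0 <= i < k) lam (F i).
  elim: k => [|k IH]; first by rewrite /G big_ord0 big_nil; have [] := nu0.
  rewrite /G big_ord_recr/= -/(G k) big_nat_recr//= -IH lamU//.
  rewrite /G -bigcup_mkord -subset0 => x [[i /= ik Fi] Fk].
  have ik' : i = k by apply: tF => //; exists x.
  by rewrite ik' ltnn in ik.
have Gs k : G k `<=` \bigcup_i F i by rewrite /G; exact: bigsetU_bigcup.
pose E k := (\bigcup_i F i) `\` G k.
have mE k : measurable (E k) by exact: measurableD.
have lamE k : lam (\bigcup_i F i) = lam (G k) + lam (E k).
  by rewrite -lamU ?setDIK// setDUK.
have : (mu \o (fun k => E k `&` D)) k @[k --> \oo] --> mu (\bigcap_k (E k `&` D)).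
  apply: nonincreasing_cvg_mu => //.
  - by apply: le_lt_trans Doo; apply: le_measure; rewrite ?inE//; exact: measurableI.
  - by move=> k; exact: measurableI.
  - by apply: bigcapT_measurable => k; exact: measurableI.
  - move=> a b ab; apply/subsetPset; apply: setSI; apply: setDS.
    by rewrite /G; exact: subset_bigsetU.
rewrite (_ : \bigcap_k _ = set0); last first.
  rewrite -subset0 => x Ex; have [[[i _ Fi] _] _] := Ex 0%N I.
  have [[_ nG] _] := Ex i.+1 I; apply: nG; rewrite /G big_ord_recr/=; by right.
rewrite measure0 => cv.
rewrite (_ : (fun k => _) = EFin \o (fun k => lam (G k))); last first.
  by apply/funext => k /=; rewrite lamG sumEFin.
apply: cvg_EFin; first exact: nearW.
apply/cvgrPdist_le => e e0 /=.
have eM : 0 < e / (M + 1) by rewrite divr_gt0// ltr_wpDl.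
have := near_le_cvg (isT : 0%E \is a fin_num) cv eM.
apply: filterS => k /=; rewrite add0e => H.
rewrite (lamE k) addrAC subrr add0r -lee_fin.
apply: le_trans (lam_le (mE k)) _.
apply: (@le_trans _ _ (M%:E * (e / (M + 1))%:E)%E); first by rewrite lee_wpmul2l.
by rewrite -EFinM lee_fin mulrCA ger_pMr// ler_pdivrMr ?ltr_wpDl// mul1r lerDl.
Qed.

HB.instance Definition _ := isCharge.Build _ _ _ nu nu0 nu_fin nu_sigma.

Let nu_mu : nu `<< mu.
Proof.
move=> N N0 A mA AN; rewrite /nu; congr EFin; apply/eqP; rewrite -normr_le0 -lee_fin.
have A0 : mu A = 0%E by exact: N0.
apply: le_trans (lam_le mA) _.
rewrite (_ : mu (A `&` D) = 0%E) ?mule0//.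
apply/eqP; rewrite -measure_le0 -A0; apply: le_measure; rewrite ?inE//.
exact: measurableI.
Qed.

(** The Radon-Nikodym density of the charge [nu]. The two-sided domination of [lam] bounds it by [M]
    almost everywhere on [D]. *)
Lemma additive_density : exists g : T -> R, [/\ measurable_fun setT g,
  (forall x, `|g x| <= M) &
  forall A, measurable A -> (lam A)%:E = (\int[mu]_(x in A `&` D) (g x)%:E)%E].
Proof.
pose f := fun x => fine (Radon_Nikodym nu mu x).
have fE : EFin \o f = Radon_Nikodym nu mu.
  by apply/funext => x; rewrite /f/= fineK//; exact: Radon_Nikodym_fin_num nu_mu.
have fi : mu.-integrable setT (EFin \o f) by rewrite fE; exact: Radon_Nikodym_integrable nu_mu.
have lamE A : measurable A -> (lam A)%:E = (\int[mu]_(x in A) (f x)%:E)%E.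
  move=> mA; have := Radon_Nikodym_integral nu_mu mA; rewrite -fE; exact.
have mf : measurable_fun setT f by apply/measurable_EFinP; exact: measurable_int fi.
have fiD A : measurable A -> mu.-integrable A (EFin \o f).
  by move=> mA; exact: integrableS (@subsetT _ _) fi.
have lamAD A : measurable A -> A `<=` D -> (`|lam A|%:E <= M%:E * mu A)%E.
  by move=> mA AD; have := lam_le mA; rewrite (_ : A `&` D = A)//; apply/setIidPl.
have ae1 : {ae mu, forall x, D x -> f x <= M}.
  apply: ae_le_of_integral_le => //; first exact: fiD.
  move=> A mA AD; rewrite -lamE//; apply: le_trans (lamAD _ mA AD).
  by rewrite lee_fin ler_norm.
have ae2 : {ae mu, forall x, D x -> - f x <= M}.
  apply: ae_le_of_integral_le => //.
    by rewrite (_ : _ \o _ = (\- (EFin \o f))%E)//; exact/integrableN/fiD.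
  move=> A mA AD; rewrite (_ : \int[mu]_(x in A) _ = - \int[mu]_(x in A) (f x)%:E)%E; last first.
    by rewrite -integralN//; exact: integrable_add_def (fiD _ mA).
  rewrite -lamE//; apply: le_trans (lamAD _ mA AD).
  by rewrite -EFinN lee_fin -normrN ler_norm.
(* Clamping makes the bound hold at every point; on [D] the density changes only on a null set. *)
pose g x := Num.max (- M) (Num.min M (f x)).
have mg : measurable_fun setT g.
  by apply: measurable_maxr => //; exact: measurable_minr.
exists g; split => // [x|A mA].
  rewrite ler_norml /g; apply/andP; split; first by rewrite le_max lexx.
  by rewrite ge_max ge_min lexx/= andbT; have := M0; lra.
have mAD : measurable (A `&` D) by exact: measurableI.
have -> : lam A = lam (A `&` D).
  rewrite -{1}(setUIDK A D) [LHS]lamU//; last 2 first.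
  - exact: measurableD.
  - by rewrite -subset0 => x [[_ Dx] [_ nDx]].
  have := lam_le (measurableD mA mD); rewrite (_ : (A `\` D) `&` D = set0); last by rewrite setDE -setIA setICl setI0.
  by rewrite measure0 mule0 lee_fin normr_le0 => /eqP ->; rewrite addr0.
rewrite lamE//; apply: ae_eq_integral => //.
- by apply/measurable_EFinP; exact: measurable_funTS.
- by apply/measurable_EFinP; exact: measurable_funTS.
apply: filterS2 ae1 ae2 => x h1 h2 [Ax Dx] /=; congr EFin.
rewrite /g min_r ?h1// max_r//; have := h2 Dx; lra.
Qed.

End AdditiveDensity.

(** * Weak limits of bounded sequences *)

Import HBSimple.

Lemma cvg_norm_le_near (R : realType) (I : Type) (F : set_system I) (f : I -> R) (l a : R) :
  ProperFilter F -> f x @[x --> F] --> l -> (\forall x \near F, `|f x| <= a) -> `|l| <= a.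
Proof.
move=> PF /cvgrPdist_le fl fa; apply/ler_addgt0Pr => e e0.
have [x [fx ax]] := filter_ex (filterI (fl _ e0) fa).
have := ler_distD (f x) l 0; rewrite !subr0; move: fx ax; lra.
Qed.

Lemma cvg_sum_ord (R : realType) (I : Type) (F : set_system I) (N : nat) (f : 'I_N -> I -> R) (l : 'I_N -> R) :
  Filter F -> (forall i, f i x @[x --> F] --> l i) ->
  \sum_(i < N) f i x @[x --> F] --> \sum_(i < N) l i.
Proof.
move=> FF; elim: N f l => [|N IH] f l fl.
  rewrite big_ord0 (_ : (fun x => _) = cst 0); first exact: cvg_cst.
  by apply/funext => x; rewrite big_ord0.
rewrite big_ord_recr/= (_ : (fun x => _) = fun x => \sum_(i < N) f (widen_ord (leqnSn N) i) x + f ord_max x).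
  by apply: cvgD => //; apply: IH.
by apply/funext => x; rewrite big_ord_recr.
Qed.

Section WeakLimit.
Context d (T : measurableType d) (R : realType).
Variable mu : {sigma_finite_measure set T -> \bar R}.
Context {U : set_system nat} {UU : UltraFilter U}.
Variables (M : R) (h : nat -> T -> R).
Hypothesis M0 : 0 <= M.
Hypothesis mh : forall k, measurable_fun setT (h k).
Hypothesis hM : forall k x, `|h k x| <= M.

Lemma integrable_mul_bounded (D : set T) (C : R) (f g : T -> R) : measurable D ->
  measurable_fun setT g -> (forall x, `|g x| <= C) -> mu.-integrable D (EFin \o f) ->
  mu.-integrable D (EFin \o (fun x => g x * f x)).
Proof.
move=> mD mg gC fi; have mf : measurable_fun D f by apply/measurable_EFinP; exact: measurable_int fi.
apply: (@le_integrable _ _ _ mu D mD _ (fun z => C%:E * (EFin \o f) z)%E).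
- by apply/measurable_EFinP; apply: measurable_funM => //; exact: measurable_funTS.
- move=> x _ /=; rewrite lee_fin !normrM ler_wpM2r//.
  exact: le_trans (gC x) (ler_norm _).
- exact: integrableZl.
Qed.

Lemma Rintegral_mul_bounded_le (D : set T) (C : R) (f g : T -> R) : measurable D ->
  measurable_fun setT g -> (forall x, `|g x| <= C) -> mu.-integrable D (EFin \o f) ->
  `|\int[mu]_(x in D) (g x * f x)| <= C * \int[mu]_(x in D) `|f x|.
Proof.
move=> mD mg gC fi; have mf : measurable_fun D f by apply/measurable_EFinP; exact: measurable_int fi.
have igf := integrable_mul_bounded mD mg gC fi.
apply: le_trans (le_normr_Rintegral mD igf) _.
rewrite -RintegralZl//; last exact: integrable_norm.
apply: le_Rintegral => //.
- exact: integrable_norm.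
- rewrite (_ : _ \o _ = fun x => C%:E * (EFin \o (fun x => `|f x|%R)) x)%E//.
  by apply: integrableZl => //; exact: integrable_norm.
by move=> x _; rewrite normrM ler_wpM2r.
Qed.

Let PU : ProperFilter U. Proof. exact: ultra_proper. Qed.

Section OnFiniteMeasure.
Variable D : set T.
Hypothesis mD : measurable D.
Hypothesis Doo : (mu D < +oo)%E.

Let finD A : measurable A -> (mu (A `&` D) < +oo)%E.
Proof. by move=> mA; apply: le_lt_trans Doo; apply: le_measure; rewrite ?inE//; exact: measurableI. Qed.

Let hi k A : measurable A -> mu.-integrable (A `&` D) (EFin \o h k).
Proof.
move=> mA; apply: measurable_bounded_integrable => //; [exact: measurableI|exact: finD|exact: measurable_funTS|].
by exists M; split; [exact: num_real|move=> x Mx y _; apply: le_trans (hM _ _) (ltW Mx)].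
Qed.

Let hle k A : measurable A -> `|\int[mu]_(x in A `&` D) h k x| <= M * fine (mu (A `&` D)).
Proof.
move=> mA; have mAD : measurable (A `&` D) by exact: measurableI.
apply: le_trans (le_normr_Rintegral mAD (hi k mA)) _.
rewrite -Rintegral_cst//; apply: le_Rintegral => //.
- exact: integrable_norm (hi k mA).
- apply: measurable_bounded_integrable => //; first exact: finD.
  by exists M; split; [exact: num_real|move=> x Mx y _; rewrite /= ger0_norm// ltW].
Qed.

Let lam_ex : exists lam : set T -> R, forall A, measurable A ->
  \int[mu]_(x in A `&` D) h k x @[k --> U] --> lam A.
Proof.
suff /choice[lam hlam] : forall A, exists l : R, measurable A -> \int[mu]_(x in A `&` D) h k x @[k --> U] --> l.
  by exists lam.
move=> A; have [mA|nA] := pselect (measurable A); last by exists 0.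
have [|l _ hl] := @ultra_limit R U _ (fun k => \int[mu]_(x in A `&` D) h k x)
   (- (M * fine (mu (A `&` D)))) (M * fine (mu (A `&` D))).
  by apply: nearW => k; rewrite -ler_norml; exact: hle.
by exists l.
Qed.

(* The ultralimit of [\int_A h_k] is additive and bounded by [M mu(A)] in [A]: take its Radon-Nikodym density. *)
Lemma weak_limit_finite_measure : exists g : T -> R, [/\ measurable_fun setT g,
  (forall x, `|g x| <= M) &
  forall psi, mu.-integrable D (EFin \o psi) ->
    \int[mu]_(x in D) (h k x * psi x) @[k --> U] --> \int[mu]_(x in D) (g x * psi x)].
Proof.
have [lam hlam] := lam_ex.
have PU' : ProperFilter U by exact: ultra_proper.
have lamU A B : measurable A -> measurable B -> A `&` B = set0 -> lam (A `|` B) = lam A + lam B.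
  move=> mA mB AB0.
  have h1 := hlam _ (measurableU _ _ mA mB).
  have h2 : (\int[mu]_(x in A `&` D) h k x + \int[mu]_(x in B `&` D) h k x) @[k --> U] --> lam A + lam B.
    by apply: cvgD; exact: hlam.
  have E : (fun k => \int[mu]_(x in A `&` D) h k x + \int[mu]_(x in B `&` D) h k x) =
      fun k => \int[mu]_(x in (A `|` B) `&` D) h k x.
    apply/funext => k; rewrite setIUl Rintegral_setU//; [exact: measurableI|exact: measurableI| |].
      by rewrite -setIUl; apply: hi; exact: measurableU.
    by apply/disj_setPS => x [[Ax _] [Bx _]]; rewrite -AB0.
  rewrite E in h2; exact: (@cvg_unique _ (@Rhausdorff R) _ _ _ _ h1 h2).
have lam_le A : measurable A -> (`|lam A|%:E <= M%:E * mu (A `&` D))%E.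
  move=> mA; rewrite -(@fineK _ (mu (A `&` D))); last by rewrite ge0_fin_numE//; exact: finD.
  rewrite -EFinM lee_fin.
  by apply: cvg_norm_le_near (hlam _ mA) _; apply: nearW => k; exact: hle.
have [g [mg gM gE]] := additive_density mD Doo M0 lamU lam_le.
exists g; split => // psi psii.
pose P (f : T -> R) := \int[mu]_(x in D) (h k x * f x) @[k --> U] --> \int[mu]_(x in D) (g x * f x).
have P_indic A : measurable A -> P (\1_A).
  move=> mA; rewrite /P.
  have E (f : T -> R) : \int[mu]_(x in D) (f x * \1_A x) = \int[mu]_(x in A `&` D) f x.
    rewrite setIC Rintegral_mkcondr; apply: eq_Rintegral => x _.
    by rewrite patchE indicE; case: ifPn => _; rewrite ?mulr1 ?mulr0.
  rewrite E (_ : (fun k => _) = fun k => \int[mu]_(x in A `&` D) h k x); last by apply/funext => k; rewrite E.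
  rewrite (_ : \int[mu]_(x in _) g x = lam A); first exact: hlam.
  by rewrite /Rintegral -gE.
have PD f1 f2 : mu.-integrable D (EFin \o f1) -> mu.-integrable D (EFin \o f2) -> P f1 -> P f2 -> P (f1 \+ f2).
  move=> i1 i2 P1 P2; rewrite /P.
  have E (f : T -> R) : measurable_fun setT f -> (forall x, `|f x| <= M) ->
     \int[mu]_(x in D) (f x * (f1 \+ f2) x) = \int[mu]_(x in D) (f x * f1 x) + \int[mu]_(x in D) (f x * f2 x).
    move=> mf fM; rewrite -RintegralD//; try exact: integrable_mul_bounded mf fM _.
    by apply: eq_Rintegral => x _; rewrite mulrDr.
  rewrite E// (_ : (fun k => _) = fun k => \int[mu]_(x in D) (h k x * f1 x) + \int[mu]_(x in D) (h k x * f2 x)).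
    exact: cvgD.
  by apply/funext => k; rewrite E.
have PZ c f : mu.-integrable D (EFin \o f) -> P f -> P (fun x => c * f x).
  move=> i1 P1; rewrite /P.
  have E (f0 : T -> R) : measurable_fun setT f0 -> (forall x, `|f0 x| <= M) ->
     \int[mu]_(x in D) (f0 x * (c * f x)) = c * \int[mu]_(x in D) (f0 x * f x).
    move=> mf fM; rewrite -RintegralZl//; last exact: integrable_mul_bounded mf fM _.
    by apply: eq_Rintegral => x _; rewrite mulrCA.
  rewrite E// (_ : (fun k => _) = fun k => c * \int[mu]_(x in D) (h k x * f x)).
    by apply: cvgM => //; exact: cvg_cst.
  by apply/funext => k; rewrite E.
suff Psfun (s : {sfun T >-> R}) : mu.-integrable D (EFin \o s) -> P s.
  have [s_ [si _ /fine_cvgP[sfin /cvgrPdist_lt sc]]] := approximation_sfun_integrable mD psii.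
  apply/cvgrPdist_le => e e0.
  have e3 : 0 < e / (3 * (M + 1)) by rewrite divr_gt0// mulr_gt0// ltr_wpDl.
  have [k [_ sk]] := filter_ex (filterI sfin (sc _ e3)).
  have e30 : 0 < e / 3 by rewrite divr_gt0.
  have /cvgrPdist_le/(_ _ e30) := Psfun _ (si k).
  have ips : mu.-integrable D (EFin \o (fun x => psi x - s_ k x)).
    rewrite (_ : _ \o _ = (fun x => (EFin \o psi) x - (EFin \o s_ k) x)%E)//.
    exact: integrableB.
  have sk' : M * \int[mu]_(x in D) `|psi x - s_ k x| <= e / 3.
    have : \int[mu]_(x in D) `|psi x - s_ k x| <= e / (3 * (M + 1)).
      by move: sk; rewrite /= sub0r normrN => /ltW; apply: le_trans (ler_norm _).
    move=> /(ler_wpM2l M0) => H; apply: le_trans H _.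
    rewrite mulrCA ler_wpM2l ?(ltW e0)// invfM mulrCA ger_pMr// ler_pdivrMr ?ltr_wpDl//; lra.
  have E (f : T -> R) : measurable_fun setT f -> (forall x, `|f x| <= M) ->
     `|\int[mu]_(x in D) (f x * psi x) - \int[mu]_(x in D) (f x * s_ k x)| <= e / 3.
    move=> mf fM; rewrite -RintegralB//; try exact: integrable_mul_bounded mf fM _.
    apply: le_trans sk'; have := Rintegral_mul_bounded_le mD mf fM ips.
    by apply: le_trans; rewrite le_eqVlt; apply/orP; left; apply/eqP; congr `|_|; apply: eq_Rintegral => x _; rewrite mulrBr.
  apply: filterS => k'.
  have := E _ mg gM; have := E _ (mh k') (hM k').
  rewrite !ler_distl; lra.
move=> si.
have [l El] : exists l : seq R, forall F : R -> R, \sum_(y \in range s) F y = \sum_(y <- l) F y.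
  by exists (finmap.enum_fset (fset_set (range s))) => F; rewrite fsbig_finite.
have -> : (s : T -> R) = fun x => \sum_(y <- l) (y * \1_(s @^-1` [set y]) x).
  by apply/funext => x; rewrite {1}(fimfunE s) El.
have ms y : measurable (s @^-1` [set y]) by exact: measurable_sfunP.
have ii y : mu.-integrable D (EFin \o \1_(s @^-1` [set y])).
  apply: measurable_bounded_integrable => //.
  exists 1; split; [exact: num_real|move=> x x1 z _ /=].
  by rewrite ger0_norm// (le_trans _ (ltW x1))// indicE; case: (_ \in _).
have iy y : mu.-integrable D (EFin \o (fun x => y * \1_(s @^-1` [set y]) x)).
  by rewrite (_ : _ \o _ = fun x => y%:E * (EFin \o \1_(s @^-1` [set y])) x)%E//; exact: integrableZl.
have isum (l' : seq R) : mu.-integrable D (EFin \o (fun x => \sum_(y <- l') (y * \1_(s @^-1` [set y]) x))).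
  elim: l' => [|y l' IH].
    rewrite (_ : _ \o _ = cst 0%E); first exact: integrable0.
    by apply/funext => x /=; rewrite big_nil.
  rewrite (_ : _ \o _ = (fun x => (EFin \o (fun x => (y * \1_(s @^-1` [set y]) x)%R)) x +
     (EFin \o (fun x => (\sum_(y <- l') (y * \1_(s @^-1` [set y]) x))%R)) x)%E).
    exact: integrableD.
  by apply/funext => x /=; rewrite big_cons EFinD.
elim: l {El} => [|y l' IH].
  rewrite /P; apply: cvg_near_cst; apply: nearW => k.
  by apply: eq_Rintegral => x _; rewrite !big_nil !mulr0.
rewrite (_ : (fun x => _) = (fun x => y * \1_(s @^-1` [set y]) x) \+ (fun x => \sum_(y <- l') (y * \1_(s @^-1` [set y]) x))).
  by apply: PD => //; apply: PZ => //; exact: P_indic.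
by apply/funext => x; rewrite big_cons.
Qed.

End OnFiniteMeasure.

(** The densities obtained on the pieces of finite measure are glued. A function [psi] living on the
    first [N] pieces involves only a finite sum of limits. *)
Lemma weak_limit (S : nat -> set T) :
  (forall L, measurable (S L)) -> (forall L, (mu (S L) < +oo)%E) ->
  trivIset setT S -> \bigcup_L S L = setT ->
  exists g : T -> R, [/\ measurable_fun setT g, (forall x, `|g x| <= M) &
    forall psi N, mu.-integrable setT (EFin \o psi) ->
      (forall x L, S L x -> (N <= L)%N -> psi x = 0) ->
      \int[mu]_x (h k x * psi x) @[k --> U] --> \int[mu]_x (g x * psi x)].
Proof.
move=> mS Soo tS Sc.
have /choice[gL hgL] := fun L => weak_limit_finite_measure (mS L) (Soo L).
have /choice[Lx hLx] : forall x, exists L, S L x.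
  by move=> x; have : setT x by []; rewrite -Sc => -[L _ SL]; exists L.
pose g x := gL (Lx x) x.
have gS L x : S L x -> g x = gL L x.
  by move=> SL; rewrite /g; congr (gL _ x); apply: tS => //; exists x; split => //; exact: hLx.
have mg : measurable_fun setT g.
  rewrite -Sc; apply/measurable_fun_bigcup => // L.
  have [mgL _ _] := hgL L; apply: (eq_measurable_fun (gL L)); last exact: measurable_funTS.
  by move=> x; rewrite inE => /gS.
have gM x : `|g x| <= M by have [_ + _] := hgL (Lx x); exact.
exists g; split => // psi N psii psi0.
pose G k := \big[setU/set0]_(i < k) S i.
have E (f : T -> R) : measurable_fun setT f -> (forall x, `|f x| <= M) ->
    \int[mu]_x (f x * psi x) = \sum_(L < N) \int[mu]_(x in S L) (f x * psi x).
  move=> mf fM.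
  have ifp : mu.-integrable setT (EFin \o (fun x => f x * psi x)).
    exact: integrable_mul_bounded mf fM psii.
  transitivity (\int[mu]_(x in G N) (f x * psi x)).
    rewrite [RHS]Rintegral_mkcond; apply: eq_Rintegral => x _.
    rewrite patchE; case: ifPn => // xG.
    have : setT x by []; rewrite -Sc => -[L _ SL].
    rewrite (psi0 _ L SL) ?mulr0// leqNgt; apply/negP => LN.
    by move/negP: xG; apply; rewrite inE /G -bigcup_mkord; exists L.
  rewrite {}/G; elim: N {psi0} => [|N IH]; first by rewrite !big_ord0 Rintegral_set0.
  rewrite !big_ord_recr/= -IH Rintegral_setU//.
  - exact: bigsetU_measurable.
  - by apply: integrableS ifp => //; apply: measurableU => //; exact: bigsetU_measurable.
  - apply/disj_setPS => x [+ SN]; rewrite -bigcup_mkord => -[L /= LN SL].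
    by have e : L = N by [apply: tS => //; exists x]; rewrite e ltnn in LN.
rewrite E// (_ : (fun k => _) = fun k => \sum_(L < N) \int[mu]_(x in S L) (h k x * psi x)).
  apply: cvg_sum_ord => L.
  rewrite (_ : \int[mu]_(x in S L) (g x * psi x) = \int[mu]_(x in S L) (gL L x * psi x)).
    have [_ _ + ] := hgL L; apply.
    exact: integrableS psii.
  by apply: eq_Rintegral => x; rewrite inE => /gS ->.
by apply/funext => k; rewrite E.
Qed.

End WeakLimit.

(** * Bump functions *)

Section Calculus.
Variable R : realType.

Lemma is_derive_quotient (V : normedModType R) (f : V -> R) (x v : V) (l : R) :
  (forall e, 0 < e -> exists2 d, 0 < d &
    forall h, h != 0 -> `|h| < d -> `|(f (h *: v + x) - f x) / h - l| <= e) ->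
  is_derive x v f l.
Proof.
move=> H.
have cv : h^-1 *: (f (h *: v + x) - f x) @[h --> 0^'] --> l.
  apply/cvgrPdist_le => e e0; have [d d0 Hd] := H e e0.
  exists d => //= h; rewrite /= sub0r normrN => hd h0.
  by rewrite distrC [_ *: _]mulrC; exact: Hd.
have d : derivable f x v by apply/cvg_ex; exists l.
by apply: DeriveDef => //; exact: cvg_lim cv.
Qed.

Lemma is_derive_quotientE (V : normedModType R) (f : V -> R) (x v : V) (l : R) :
  is_derive x v f l -> forall e, 0 < e -> exists2 d, 0 < d &
    forall h, h != 0 -> `|h| < d -> `|(f (h *: v + x) - f x) / h - l| <= e.
Proof.
move=> [d dl] e e0; have : h^-1 *: (f (h *: v + x) - f x) @[h --> 0^'] --> l by rewrite -dl; exact: d.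
move=> /cvgrPdist_le/(_ e e0) [a /= a0 Ha]; exists a => // h h0 ha.
have := Ha h; rewrite /= sub0r normrN => /(_ ha h0).
by rewrite distrC [_ *: _]mulrC.
Qed.

Lemma is_derive_continuous (f : R -> R) (t l : R) : is_derive t (1 : R) f l -> {for t, continuous f}.
Proof. by move=> [d _]; apply: differentiable_continuous; exact/derivable1_diffP. Qed.

(** Serves for the bumps at the ends of their support and beyond, where no formula for the
    derivative is available. *)
Lemma is_derive_flat (f : R -> R) (t C : R) : f t = 0 ->
  (forall h, `|h| <= 1 -> `|f (t + h)| <= C * `|h| * `|h|) -> is_derive t (1 : R) f 0.
Proof.
move=> f0 fC; apply: is_derive_quotient => e e0.
have C1 : 0 < `|C| + 1 by rewrite ltr_wpDl.
exists (Num.min 1 (e / (`|C| + 1))); first by rewrite lt_min ltr01 divr_gt0.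
move=> h h0; rewrite lt_min => /andP[h1 he].
rewrite f0 !subr0 normrM normfV ler_pdivrMr ?normr_gt0//.
have -> : h *: (1 : R) + t = t + h by rewrite /GRing.scale/= mulr1 addrC.
apply: le_trans (fC h (ltW h1)) _; rewrite ler_wpM2r//.
rewrite ltr_pdivlMr// in he; apply: le_trans (ltW he).
rewrite mulrC ler_wpM2l//; have := ler_norm C; lra.
Qed.

(* [P(t) (1 - t^2)^-k exp (- 1 / (1 - t^2))]: a family closed under derivatives. *)
Definition bumpf (P : {poly R}) (k : nat) (t : R) : R :=
  if `|t| < 1 then P.[t] * (1 - t ^+ 2)^-1 ^+ k * expR (- (1 - t ^+ 2)^-1) else 0.

(** The numerator of the derivative over the common denominator [(1 - t^2)^(k+2)]: the three terms
    come from differentiating [P], the power and the exponential. *)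
Definition dbump (P : {poly R}) (k : nat) : {poly R} :=
  P^`() * (1 - 'X^2) ^+ 2 + (2 * k%:R) *: ('X * (1 - 'X^2) * P) - 2 *: ('X * P).

Lemma bump_out P k t : 1 <= `|t| -> bumpf P k t = 0.
Proof. by rewrite /bumpf ltNge => ->. Qed.

Lemma one_sub_sqr_gt0 (t : R) : `|t| < 1 -> 0 < 1 - t ^+ 2.
Proof. by move=> t1; rewrite subr_gt0 -[t ^+ 2]ger0_norm ?sqr_ge0// normrX exprn_ilt1. Qed.

Lemma exp_pow_le (k : nat) (x : R) : 0 <= x -> x ^+ k.+1 * expR (- x) <= k.+1`!%:R.
Proof.
move=> x0; rewrite expRN ler_pdivrMr ?expR_gt0//.
have := expR_ge1Dxn k x0 => h.
have f0 : 0 < k.+1`!%:R :> R by rewrite ltr0n fact_gt0.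
rewrite mulrC -ler_pdivrMr//; apply: le_trans h; lra.
Qed.

Lemma horner_bounded (P : {poly R}) : exists2 C, 0 <= C & forall t, `|t| <= 1 -> `|P.[t]| <= C.
Proof.
elim/poly_ind: P => [|P c [C C0 H]]; first by exists 0 => // t _; rewrite horner0 normr0.
exists (C + `|c|); first by rewrite addr_ge0.
move=> t t1; rewrite hornerMXaddC (le_trans (ler_normD _ _))// lerD2r normrM.
by rewrite -[C]mulr1 ler_pM// H.
Qed.

(** The exponential absorbs two more powers of [1 / (1 - t^2)] than the bump contains. The resulting
    quadratic decay at the ends of the support is what [is_derive_flat] asks for. *)
Lemma bump_sqr_le P k : exists2 C, 0 <= C & forall t, `|bumpf P k t| <= C * (1 - t ^+ 2) ^+ 2.
Proof.
have [C C0 H] := horner_bounded P; exists (C * k.+2`!%:R); first by rewrite mulr_ge0.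
move=> t; rewrite /bumpf; case: ifPn => [t1|_]; last first.
  by rewrite normr0; apply: mulr_ge0; [apply: mulr_ge0|exact: sqr_ge0].
have s0 := one_sub_sqr_gt0 t1; set s := 1 - t ^+ 2 in s0 *.
rewrite -mulrA normrM -mulrA; apply: ler_pM => //; first exact: H (ltW t1).
rewrite ger0_norm ?mulr_ge0 ?expR_ge0 ?exprn_ge0 ?invr_ge0 ?(ltW s0)//.
have := exp_pow_le k.+1 (_ : 0 <= s^-1); rewrite invr_ge0 (ltW s0) => /(_ isT).
rewrite -ler_pdivrMr ?exprn_gt0//; apply: le_trans.
rewrite -[s ^- 2]exprVn !exprS !expr0; rewrite le_eqVlt; apply/orP; left; apply/eqP; ring.
Qed.

Lemma bump_bounded P k : exists2 C, 0 <= C & forall t, `|bumpf P k t| <= C.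
Proof.
have [C C0 H] := bump_sqr_le P k; exists C => // t.
have [t1|t1] := ltP `|t| 1; last by rewrite bump_out// normr0.
apply: le_trans (H t) _; have := one_sub_sqr_gt0 t1 => s0.
rewrite -[leRHS]mulr1 ler_wpM2l// exprn_ile1 ?(ltW s0)//.
by rewrite gerBl sqr_ge0.
Qed.

Lemma is_derive_bumpf P k t : is_derive t (1 : R) (bumpf P k) (bumpf (dbump P k) k.+2 t).
Proof.
have [t1|t1] := ltP `|t| 1.
  have s0 := one_sub_sqr_gt0 t1.
  pose s (u : R) := 1 - u ^+ 2.
  have s'0 : s t != 0 by rewrite gt_eqF.
  pose f (u : R) := P.[u] * (s u)^-1 ^+ k * expR (- (s u)^-1).
  have ds : is_derive t (1 : R) s (- 2 * t).
    rewrite /s; apply: is_derive_eq; rewrite /GRing.scale/=; ring.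
  have dw : is_derive t (1 : R) (fun u => (s u)^-1) (2 * t * ((s t)^-1) ^+ 2).
    have dv := @is_deriveV R s t (- 2 * t) 1 s'0 ds; apply: is_derive_eq dv _.
    by rewrite /GRing.scale/= exprVn; ring.
  have de : is_derive t (1 : R) (fun u => expR (- (s u)^-1)) (expR (- (s t)^-1) * - (2 * t * ((s t)^-1) ^+ 2)).
    have dNw : is_derive t (1 : R) (fun u => - (s u)^-1) (- (2 * t * ((s t)^-1) ^+ 2)) by exact: is_deriveN.
    exact: (@is_derive1_comp _ expR (fun u => - (s u)^-1)).
  have dp := is_derive_poly P t.
  have dwk : is_derive t (1 : R) (fun u => (s u)^-1 ^+ k) (k%:R * (s t)^-1 ^+ k.-1 * (2 * t * ((s t)^-1) ^+ 2)).
    have -> : (fun u => (s u)^-1 ^+ k) = (fun u => (s u)^-1) ^+ k.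
      by apply/funext => u; rewrite exprfctE.
    by apply: is_derive_eq; rewrite /GRing.scale/= mulrA.
  have df : is_derive t (1 : R) f (bumpf (dbump P k) k.+2 t).
    have dm := is_deriveM (is_deriveM dp dwk) de.
    have fE : f = (horner P * (fun u => (s u)^-1 ^+ k) * (fun u => expR (- (s u)^-1)))%R by [].
    rewrite fE; apply: is_derive_eq dm _.
    have dE : (dbump P k).[t] = P^`().[t] * (s t) ^+ 2 + (2 * k%:R) * (t * s t * P.[t]) - 2 * (t * P.[t]).
      by rewrite /dbump !(hornerD, hornerN, hornerM, hornerZ, hornerX, hornerXn, hornerC, horner_exp).
    rewrite /GRing.scale/= !fctE /bumpf t1 dE -/(s t).
    (* For [k = 0] the truncated exponent [k.-1] is wrong but multiplied by [0]. *)
    have -> : k%:R * (s t)^-1 ^+ k.-1 = k%:R * (s t)^-1 ^+ k * s t.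
      by case: (k) => [|j]; [rewrite !mul0r|rewrite /= exprS; field].
    rewrite [_ ^+ k.+2]exprS [_ ^+ k.+1]exprS.
    move: ((s t)^-1 ^+ k) (expR (- (s t)^-1)) s'0 => w e S0; field.
    exact: S0.
  apply: near_eq_is_derive df; exists (1 - `|t|) => /=; first by rewrite subr_gt0.
  move=> u /= tu; rewrite /bumpf (_ : `|u| < 1)//.
  by have := ler_distD t u 0; rewrite !subr0 distrC; lra.
have b0 : bumpf (dbump P k) k.+2 t = 0 by rewrite bump_out.
rewrite b0.
have [C C0 H] := bump_sqr_le P k.
(* The [4] is the square of the [2] in [1 - (t + h)^2 <= 2 |h|], which holds because [|t| >= 1]. *)
apply: (@is_derive_flat _ _ (C * 4)); first by rewrite bump_out.
move=> h h1; have [th|th] := ltP `|t + h| 1; last by rewrite bump_out// normr0 !mulr_ge0.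
apply: le_trans (H _) _; rewrite -!mulrA ler_wpM2l//.
have s0 := one_sub_sqr_gt0 th.
have : 1 - (t + h) ^+ 2 <= 2 * `|h|.
  rewrite -[_ ^+ 2]ger0_norm ?sqr_ge0// normrX.
  have : 1 - `|t + h| <= `|h| by have := lerB_normD t h; lra.
  have := normr_ge0 (t + h); nra.
rewrite expr2; move: (normr_ge0 h); nra.
Qed.

End Calculus.

(** * Continuously differentiable functions *)

Section C1Functions.
Variables (R : realType) (n : nat).
Implicit Types (f : 'rV[R]_n -> R) (g : 'I_n -> 'rV[R]_n -> R) (x h : 'rV[R]_n).

Lemma continuous_eps f x : (forall e, 0 < e -> exists2 d, 0 < d &
  forall y, `|y - x| < d -> `|f y - f x| <= e) -> {for x, continuous f}.
Proof.
move=> H; apply/(@cvgrPdist_le _ _ _ _ (nbhs_filter x)) => e e0.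
have [d d0 dH] := H e e0; apply/nbhs_ballP; exists d => //= y.
by rewrite -ball_normE/= distrC => yd; rewrite distrC; exact: dH.
Qed.

(** The partial derivatives are carried as data and only derivatives along the axes are required.
    Continuity of [f] and derivatives in other directions follow from the telescoping identity
    [C1_increment]. *)
Definition C1 f g := (forall j x, is_derive x (delta_mx 0 j) f (g j x)) /\
  (forall j, continuous (g j)).

Lemma is_derive_line f g x j t : C1 f g ->
  is_derive (t : R) (1 : R) (fun u : R => f (u *: delta_mx 0 j + x)) (g j (t *: delta_mx 0 j + x)).
Proof.
move=> [df _]; apply: is_derive_quotient => e e0.
have [d d0 H] := is_derive_quotientE (df j (t *: delta_mx 0 j + x)) e0.
exists d => // k k0 kd; have := H k k0 kd.
by rewrite addrA -scalerDl [k *: (1 : R)]mulr1.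
Qed.

Lemma C1_mvt f g x j s : C1 f g -> exists2 t, `|t| <= `|s| &
  f (s *: delta_mx 0 j + x) - f x = s * g j (t *: delta_mx 0 j + x).
Proof.
move=> fg.
pose F (u : R) := f (u *: delta_mx 0 j + x).
have dF u : is_derive (u : R) (1 : R) F (g j (u *: delta_mx 0 j + x)) by exact: is_derive_line.
have cF : continuous F by move=> u; exact: is_derive_continuous (dF u).
have F0 : F 0 = f x by rewrite /F scale0r add0r.
have [s0|s0] := leP 0 s.
  have [|t + E] := @MVT_segment R F _ 0 s s0 (fun u _ => dF u).
    exact: continuous_subspaceT.
  rewrite in_itv/= => /andP[t0 ts]; exists t; first by rewrite !ger0_norm.
  by rewrite -F0 E subr0 mulrC.
have [|t + E] := @MVT_segment R F _ s 0 (ltW s0) (fun u _ => dF u).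
  exact: continuous_subspaceT.
rewrite in_itv/= => /andP[t0 ts]; exists t.
  by rewrite !ler0_norm ?lerN2 // ltW.
by rewrite -F0 -opprB E sub0r mulrN opprK mulrC.
Qed.

(* Telescoping along the coordinates. *)
Lemma C1_increment f g x h : C1 f g -> exists xi : 'I_n -> 'rV[R]_n,
  (forall j, `|xi j - x| <= `|h|) /\ f (x + h) - f x = \sum_j h 0 j * g j (xi j).
Proof.
move=> fg.
pose p k : 'rV[R]_n := x + \row_j (if (j < k)%N then h 0 j else 0).
have pS (j : 'I_n) : p j.+1 = h 0 j *: delta_mx 0 j + p j.
  apply/rowP => i; rewrite !mxE eqxx/= ltnS leq_eqVlt eq_sym.
  rewrite eq_sym; have [->|ij] /= := eqVneq i j; first by rewrite eqxx ltnn mulr1 addr0 addrC.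
  have ijn : ((i : nat) == j) = false by exact/negbTE.
  by rewrite ijn mulr0 add0r.
have /choice[t ht] : forall j : 'I_n, exists t, `|t| <= `|h 0 j| /\
   f (p j.+1) - f (p j) = h 0 j * g j (t *: delta_mx 0 j + p j).
  by move=> j; have [t t1 E] := C1_mvt (p j) j (h 0 j) fg; exists t; rewrite pS.
exists (fun j => t j *: delta_mx 0 j + p j); split.
  move=> j; apply: norm_le_coord => // i k; rewrite !mxE ord1 eqxx/=.
  have hk : `|h 0 k| <= `|h| by exact: coord_le_norm.
  have [->|kj] := eqVneq k j.
    rewrite ltnn addr0 mulr1 addrK; have [+ _] := ht j.
    by move=> /le_trans; apply; exact: coord_le_norm.
  rewrite mulr0 add0r addrAC subrr add0r; case: ifP => _ //.
  by rewrite normr0.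
have -> : f (x + h) - f x = f (p n) - f (p 0%N).
  congr (f _ - f _); apply/rowP => i; rewrite !mxE ?ltn_ord//.
  by rewrite addr0.
rewrite -(telescope_sumr (fun k => f (p k)) (leq0n n)) big_mkord.
by apply: eq_bigr => j _; have [_ ->] := ht j.
Qed.

Lemma norm_sum_mul_le (a b : 'I_n -> R) (A B : R) : 0 <= A -> 0 <= B ->
  (forall j, `|a j| <= A) -> (forall j, `|b j| <= B) -> `|\sum_j a j * b j| <= n%:R * (A * B).
Proof.
move=> A0 B0 aA bB; apply: le_trans (ler_norm_sum _ _ _) _.
have -> : n%:R * (A * B) = \sum_(j < n) (A * B) by rewrite sumr_const card_ord mulr_natl.
apply: ler_sum => j _.
by rewrite normrM ler_pM.
Qed.

Lemma C1_lipschitz_on f g x h L : C1 f g ->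
  (forall j y, `|y - x| <= `|h| -> `|g j y| <= L) -> 0 <= L -> `|f (x + h) - f x| <= n%:R * L * `|h|.
Proof.
move=> fg gL L0; have [xi [xih ->]] := C1_increment x h fg.
rewrite -mulrA [L * _]mulrC; apply: norm_sum_mul_le => // j; first exact: coord_le_norm.
by apply: gL.
Qed.

Lemma C1_continuous f g : C1 f g -> continuous f.
Proof.
move=> fg x.
have [d d0 gd] : exists2 d, 0 < d & forall j y, `|y - x| < d -> `|g j y| <= `|g j x| + 1.
  have H : \forall y \near x, forall j, `|g j y| <= `|g j x| + 1.
    apply: (@filter_forall _ _ (fun j y => `|g j y| <= `|g j x| + 1) _ (nbhs_filter x)) => j.
    have /cvgrPdist_le/(_ _ ltr01) := fg.2 j x; apply: filterS => y.
    by have := ler_distD (g j x) (g j y) 0; rewrite !subr0 distrC; lra.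
  have /nbhs_ballP[d d0 dH] := H; exists d => // j y yd; apply: dH.
  by rewrite -ball_normE/= distrC.
pose L := \sum_j (`|g j x| + 1).
have L0 : 0 <= L by apply: sumr_ge0 => j _; rewrite addr_ge0.
apply: continuous_eps => e e0.
pose d' := Num.min d (e / (n%:R * L + 1)).
have C0 : 0 < n%:R * L + 1 by rewrite ltr_wpDl// mulr_ge0.
have d'0 : 0 < d' by rewrite lt_min d0 divr_gt0.
exists d' => // y; rewrite lt_min => /andP[yd ye].
have : `|f (x + (y - x)) - f x| <= n%:R * L * `|y - x|.
  apply: C1_lipschitz_on fg _ L0 => j z zy; apply: (@le_trans _ _ (`|g j x| + 1)).
    by apply: gd; exact: le_lt_trans zy _.
  by rewrite /L (bigD1 j)//= lerDl sumr_ge0// => i _; rewrite addr_ge0.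
rewrite [x + _]addrC subrK => /le_trans; apply.
rewrite ltr_pdivlMr// in ye; apply: le_trans (ltW ye).
by rewrite mulrC ler_wpM2l// lerDl.
Qed.

(** The limit is taken along the steps [1 / (k + 1)], in the sequential form that dominated
    convergence needs. *)
Lemma C1_direction f g x h : C1 f g ->
  k.+1%:R * (f (x + k.+1%:R^-1 *: h) - f x) @[k --> \oo] --> \sum_j h 0 j * g j x.
Proof.
move=> fg; apply/cvgrPdist_le => e e0.
have e'0 : 0 < e / (n%:R * `|h| + 1) by rewrite divr_gt0// ltr_wpDl// mulr_ge0.
have [d d0 gd] : exists2 d, 0 < d & forall j y, `|y - x| < d -> `|g j x - g j y| <= e / (n%:R * `|h| + 1).
  have H : \forall y \near x, forall j, `|g j x - g j y| <= e / (n%:R * `|h| + 1).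
    apply: (@filter_forall _ _ (fun j y => `|g j x - g j y| <= e / (n%:R * `|h| + 1)) _ (nbhs_filter x)) => j.
    by have /cvgrPdist_le/(_ _ e'0) := fg.2 j x.
  have /nbhs_ballP[d d0 dH] := H; exists d => // j y yd; apply: dH.
  by rewrite -ball_normE/= distrC.
exists (Num.truncn (`|h| / d)) => // k /= hk.
have [xi [xih ->]] := C1_increment x (k.+1%:R^-1 *: h) fg.
have k0 : (0 : R) < k.+1%:R by [].
have -> : k.+1%:R * (\sum_j (k.+1%:R^-1 *: h) 0 j * g j (xi j)) = \sum_j h 0 j * g j (xi j).
  by rewrite mulr_sumr; apply: eq_bigr => j _; rewrite !mxE; field.
have -> : (\sum_j h 0 j * g j x) - (\sum_j h 0 j * g j (xi j)) = \sum_j h 0 j * (g j x - g j (xi j)).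
  by rewrite -sumrB; apply: eq_bigr => j _; rewrite mulrBr.
apply: (@le_trans _ _ (n%:R * (`|h| * (e / (n%:R * `|h| + 1))))).
  apply: norm_sum_mul_le => //; first exact: ltW.
    by move=> j; exact: coord_le_norm.
  move=> j; apply: gd; apply: le_lt_trans (xih j) _.
  rewrite normrZ normfV ger0_norm// mulrC ltr_pdivrMr// mulrC -ltr_pdivrMr//.
  by apply: lt_le_trans (truncnS_gt _) _; rewrite ler_nat ltnS.
by rewrite mulrA mulrCA ger_pMr// ler_pdivrMr ?mul1r ?lerDl// ltr_wpDl// mulr_ge0.
Qed.

Lemma continuous_comp_coord (b : R -> R) i : continuous b -> continuous (fun x : 'rV[R]_n => b (x 0 i)).
Proof.
move=> cb x; have := @continuous_comp _ _ _ (fun x : 'rV[R]_n => x 0 i) b x.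
by apply; [exact: coord_continuous|exact: cb].
Qed.

Lemma C1_prod_coord (b b' : 'I_n -> R -> R) :
  (forall j t, is_derive (t : R) (1 : R) (b j) (b' j t)) -> (forall j, continuous (b' j)) ->
  C1 (fun x => \prod_j b j (x 0 j)) (fun i x => b' i (x 0 i) * \prod_(j | j != i) b j (x 0 j)).
Proof.
move=> db cb'; have cb j : continuous (b j) by move=> t; exact: is_derive_continuous (db j t).
split=> [i x|i]; last first.
  have cs (s : seq 'I_n) : continuous (fun x : 'rV[R]_n => \prod_(j <- s | j != i) b j (x 0 j)).
    elim: s => [|j s IH].
      by rewrite (_ : (fun x => _) = cst 1); [exact: cst_continuous|apply/funext => x; rewrite big_nil].
    have [ji|ji] := boolP (j != i); last first.
      by rewrite (_ : (fun x => _) = (fun x : 'rV[R]_n => \prod_(j <- s | j != i) b j (x 0 j)))//; apply/funext => x; rewrite big_cons (negbTE ji).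
    rewrite (_ : (fun x => _) = (fun x : 'rV[R]_n => b j (x 0 j) * \prod_(j <- s | j != i) b j (x 0 j))).
      by move=> x; apply: continuousM; [exact: continuous_comp_coord|exact: IH].
    by apply/funext => x; rewrite big_cons ji.
  by move=> x; apply: continuousM; [exact: continuous_comp_coord|exact: cs].
apply: is_derive_quotient => e e0.
pose q := \prod_(j | j != i) b j (x 0 j).
have e'0 : 0 < e / (`|q| + 1) by rewrite divr_gt0// ltr_wpDl.
have [d d0 H] := is_derive_quotientE (db i (x 0 i)) e'0; exists d => // h h0 hd.
rewrite !(bigD1 i (P := xpredT))//= -/q.
have -> : \prod_(j < n | j != i) b j ((h *: delta_mx 0 i + x) 0 j) = q.
  by apply: eq_bigr => j ji; rewrite !mxE (negbTE ji) andbF mulr0 add0r.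
have := H h h0 hd; rewrite !mxE !eqxx mulr1 [h *: (1 : R)]mulr1 => H'.
have -> : (b i (h + x 0 i) * q - b i (x 0 i) * q) / h - b' i (x 0 i) * q =
   ((b i (h + x 0 i) - b i (x 0 i)) / h - b' i (x 0 i)) * q by field.
rewrite normrM; apply: le_trans (ler_wpM2r (normr_ge0 _) H') _.
by rewrite mulrAC ler_pdivrMr ?ltr_wpDl// ler_wpM2l ?(ltW e0)// lerDl.
Qed.

End C1Functions.

Section BoundedMultiplier.
Context d (T : measurableType d) (R : realType).
Variable mu : {sigma_finite_measure set T -> \bar R}.
Variables (D : set T) (C : R) (f k : T -> R).
Hypothesis mD : measurable D.
Hypothesis fi : mu.-integrable D (EFin \o f).
Hypothesis mk : measurable_fun setT k.
Hypothesis kC : forall x, `|k x| <= C.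
Hypothesis k0 : forall x, ~ D x -> k x = 0.

Let restrE : (fun x => f x * k x) = (fun x => k x * f x) \_ D.
Proof.
apply/funext => x; rewrite patchE; case: ifPn => [_|]; first by rewrite mulrC.
by rewrite notin_setE => /k0 ->; rewrite mulr0.
Qed.

Lemma integrable_mul_supp : mu.-integrable setT (EFin \o (fun x => f x * k x)).
Proof.
rewrite restrE (_ : _ \o _ = (EFin \o (fun x => k x * f x)) \_ D); last first.
  by apply/funext => x; rewrite /= !patchE; case: ifPn.
by rewrite -integrable_mkcond//; exact: integrable_mul_bounded mD mk kC fi.
Qed.

Lemma Rintegral_mul_supp_le : `|\int[mu]_x (f x * k x)| <= C * \int[mu]_(x in D) `|f x|.
Proof.
have -> : \int[mu]_x (f x * k x) = \int[mu]_(x in D) (k x * f x).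
  by rewrite [RHS]Rintegral_mkcond -restrE.
exact: Rintegral_mul_bounded_le.
Qed.

End BoundedMultiplier.

(** * Smooth kernels with compact support *)

Section Kernels.
Variables (R : realType) (n : nat).
Local Notation ker_data := ('I_n -> {poly R} * nat)%type.
Implicit Types (c x z : 'rV[R]_n) (pk : ker_data) (s : R).

(** A tensor product of one-dimensional bumps rescaled to [cube c s], not normalised. The data [pk]
    record the polynomial and the exponent of each factor, so that all partial derivatives stay in
    the family. *)
Definition kern c s pk x : R := \prod_j bumpf (pk j).1 (pk j).2 ((x 0 j - c 0 j) / s).

(** The factor [1 / s] of the chain rule is stored in the polynomial of the differentiated
    coordinate. *)
Definition dker s (i : 'I_n) pk : ker_data := fun j =>
  if j == i then (s^-1 *: dbump (pk j).1 (pk j).2, (pk j).2.+2) else pk j.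

Lemma bumpZ a (P : {poly R}) k t : bumpf (a *: P) k t = a * bumpf P k t.
Proof. by rewrite /bumpf; case: ifP; rewrite ?mulr0// hornerZ !mulrA. Qed.

Lemma C1_kern c s pk : C1 (kern c s pk) (fun i => kern c s (dker s i pk)).
Proof.
have e i : kern c s (dker s i pk) =
   fun x => (s^-1 * bumpf (dbump (pk i).1 (pk i).2) (pk i).2.+2 ((x 0 i - c 0 i) / s)) *
     \prod_(j | j != i) bumpf (pk j).1 (pk j).2 ((x 0 j - c 0 j) / s).
  apply/funext => x; rewrite /kern (bigD1 i)//= /dker eqxx/= bumpZ; congr (_ * _).
  by apply: eq_bigr => j /negbTE ->.
have := @C1_prod_coord R n (fun j t => bumpf (pk j).1 (pk j).2 ((t - c 0 j) / s))
  (fun j t => s^-1 * bumpf (dbump (pk j).1 (pk j).2) (pk j).2.+2 ((t - c 0 j) / s)).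
have -> : (fun i => kern c s (dker s i pk)) = (fun i x => (s^-1 * bumpf (dbump (pk i).1 (pk i).2) (pk i).2.+2 ((x 0 i - c 0 i) / s)) *
     \prod_(j | j != i) bumpf (pk j).1 (pk j).2 ((x 0 j - c 0 j) / s)).
  by apply/funext => i; exact: e.
have da a t : is_derive (t : R) (1 : R) (fun u : R => (u - a) / s) s^-1.
  by apply: is_derive_eq; rewrite /GRing.scale/= !mulr0 subr0 mulr1 add0r.
have ca a : continuous (fun t : R => (t - a) / s) by move=> t; exact: is_derive_continuous (da a t).
apply.
  by move=> j t; rewrite mulrC; apply: is_derive1_comp (is_derive_bumpf _ _ _) (da _ _).
move=> j t.
have dj := @is_derive1_comp R _ (fun u => (u - c 0 j) / s) t _ _ (is_derive_bumpf (s^-1 *: dbump (pk j).1 (pk j).2) (pk j).2.+2 ((t - c 0 j) / s)) (da (c 0 j) t).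
have := is_derive_continuous dj.
by under [X in _ -> {for _, continuous X}]eq_fun do rewrite -bumpZ.
Qed.

Lemma partial_kern c s pk i : partial i (kern c s pk) = kern c s (dker s i pk).
Proof. by apply/funext => x; have [+ _] := C1_kern c s pk => /(_ i x) -[_ <-]. Qed.

Lemma continuous_kern c s pk : continuous (kern c s pk).
Proof. exact: C1_continuous (C1_kern c s pk). Qed.

Lemma smooth_kern c s pk : smooth (kern c s pk).
Proof.
move=> l; have [pk' ->] : exists pk', foldr (@partial R n) (kern c s pk) l = kern c s pk'.
  elim: l => [|i l [pk' IH]]; first by exists pk.
  by exists (dker s i pk'); rewrite /= IH partial_kern.
split; first exact: continuous_kern.
by move=> j x; have [+ _] := C1_kern c s pk' => /(_ j x) -[].
Qed.

Lemma kern_out c s pk x : 0 < s -> ~ cube c s x -> kern c s pk x = 0.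
Proof.
move=> s0 nx; have [j xj] : exists j, s <= `|x 0 j - c 0 j|.
  by apply: contrapT => /forallNP h; apply: nx => j; rewrite ltNge; apply/negP.
rewrite /kern (bigD1 j)//= bump_out ?mul0r//.
by rewrite normrM normfV (gtr0_norm s0) ler_pdivlMr// mul1r.
Qed.

Lemma test_function_kern c s pk : 0 < s -> test_function (kern c s pk).
Proof.
move=> s0; split; first exact: smooth_kern.
have cK : compact [set x : 'rV[R]_n | forall j, `[c 0 j - s, c 0 j + s]%classic (x 0 j)].
  by apply: (@rV_compact R n (fun j => `[c 0 j - s, c 0 j + s]%classic)) => i; exact: segment_compact.
apply: (subclosed_compact _ cK); first exact: closed_closure.
have clK : closed [set x : 'rV[R]_n | forall j, `[c 0 j - s, c 0 j + s]%classic (x 0 j)].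
  by apply: compact_closed => //; exact: norm_hausdorff.
set K := [set x : 'rV[R]_n | _] in cK clK *.
apply: (@subset_trans _ (closure K)); last by rewrite -((closure_id K).1 clK).
apply: closure_subset => x /= /eqP k0 j.
have [xc|xc] := pselect (cube c s x); last by case: k0; exact: kern_out.
by have := xc j; rewrite /= in_itv/= ltr_distl => /andP[/ltW -> /ltW ->].
Qed.

Lemma kern_bounded pk : exists2 C, 0 <= C & forall c s x, `|kern c s pk x| <= C.
Proof.
have /choice[C hC] : forall j, exists C, 0 <= C /\ forall t, `|bumpf (pk j).1 (pk j).2 t| <= C.
  by move=> j; have [C C0 H] := bump_bounded (pk j).1 (pk j).2; exists C.
exists (\prod_j C j); first by apply: prodr_ge0 => j _; have [] := hC j.
move=> c s x; rewrite /kern normr_prod; apply: ler_prod => j _.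
by rewrite normr_ge0/=; have [_] := hC j; exact.
Qed.

Lemma kern_shift c s pk x : kern c s pk x = kern 0 s pk (x - c).
Proof. by apply: eq_bigr => j _; rewrite !mxE subr0. Qed.

Definition ker0 : ker_data := fun=> (1, 0%N).

Lemma bump0E t : bumpf (1 : {poly R}) 0 t = if `|t| < 1 then expR (- (1 - t ^+ 2)^-1) else 0.
Proof. by rewrite /bumpf; case: ifP => // _; rewrite hornerC expr0 !mul1r. Qed.

Lemma bump0_ge0 t : 0 <= bumpf (1 : {poly R}) 0 t.
Proof. by rewrite bump0E; case: ifP => // _; exact: expR_ge0. Qed.

Lemma kern0_ge0 c s x : 0 <= kern c s ker0 x.
Proof. by apply: prodr_ge0 => j _; exact: bump0_ge0. Qed.

Lemma kern0_le1 c s x : kern c s ker0 x <= 1.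
Proof.
have -> : (1 : R) = \prod_(j < n) 1 by rewrite big1.
apply: ler_prod => j _; rewrite bump0_ge0/= bump0E; case: ifP => // t1.
by rewrite expR_le1 oppr_le0 invr_ge0 ltW// one_sub_sqr_gt0.
Qed.

Lemma kern0_lower : exists2 a, 0 < a & forall c s x, 0 < s -> cube c (s / 2) x -> a <= kern c s ker0 x.
Proof.
(* On the half cube each rescaled coordinate satisfies [1 - t^2 >= 3 / 4]. *)
exists (\prod_(j < n) expR (- (4 / 3))); first by apply: prodr_gt0 => j _; exact: expR_gt0.
move=> c s x s0 xc; apply: ler_prod => j _; rewrite expR_ge0/= bump0E.
have t2 : `|(x 0 j - c 0 j) / s| < 1 / 2.
  by rewrite normrM normfV (gtr0_norm s0) ltr_pdivrMr//; have := xc j; lra.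
rewrite (lt_trans t2); last lra.
rewrite ler_expR lerN2.
have t4 : ((x 0 j - c 0 j) / s) ^+ 2 <= 1 / 4.
  rewrite -[_ ^+ 2]ger0_norm ?sqr_ge0// normrX; have := normr_ge0 ((x 0 j - c 0 j) / s); nra.
rewrite -[4 / 3]invrK lef_pV2 ?posrE ?invr_gt0//; last lra.
by rewrite invf_div; lra.
Qed.

End Kernels.

Section LnormRestriction.
Context d (T : measurableType d) (R : realType) (mu : {measure set T -> \bar R}).
Implicit Types (f : T -> R) (K : set T).
Local Open Scope ereal_scope.

Lemma Lnorm_restrict_lty f K (p : R) : (0 < p)%R -> measurable K ->
  (Lnorm mu p%:E (fun x => (f x * \1_K x)%R%:E) < +oo) =
  (\int[mu]_(x in K) (`|f x| `^ p)%:E < +oo).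
Proof.
move=> p0 mK.
have E : Lnorm mu p%:E (fun x => (f x * \1_K x)%R%:E) `^ p = \int[mu]_(x in K) (`|f x| `^ p)%:E.
  rewrite (poweR_Lnorm mu _ (lt0r_neq0 p0)) [RHS]integral_mkcond; apply: eq_integral => x _.
  rewrite patchE indicE; case: ifPn => _; first by rewrite mulr1.
  by rewrite mulr0/= normr0 powR0 ?gt_eqF.
apply/idP/idP => H; first by rewrite -E; exact: poweR_lty.
by apply: (@lty_poweRy _ _ p); rewrite ?gt_eqF// E.
Qed.

Lemma Lnorm_restrict_bounded f K (q : \bar R) M : 0 < q -> q != -oo -> measurable K -> mu K < +oo ->
  measurable_fun setT f -> {ae mu, forall x, K x -> (`|f x| <= M)%R} ->
  Lnorm mu q (fun x => (f x * \1_K x)%R%:E) < +oo.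
Proof.
move=> q0 qNoo mK muK mf fM.
case: q q0 qNoo => // [q|] q0 _.
  rewrite Lnorm_restrict_lty//.
  apply: (@le_lt_trans _ _ (\int[mu]_(x in K) (M `^ q)%:E)).
    apply: ae_ge0_le_integral => //.
    - apply/measurable_EFinP; apply: (measurable_funS measurableT) => //.
      by apply: (measurableT_comp (measurable_powR q)); exact: measurableT_comp.
    - by move=> x _; rewrite lee_fin powR_ge0.
    - apply: filterS fM => x H Kx; rewrite lee_fin ge0_ler_powR//.
      + exact: ltW.
      + exact: le_trans (H Kx).
      + exact: H.
  by rewrite integral_cst// lte_mul_pinfty// lee_fin powR_ge0.
rewrite unlock; case: ifPn => // _.
apply: (@le_lt_trans _ _ (Num.max M 0)%:E); last exact: ltry.
apply/ess_sup_inf.ess_supP; apply: filterS fM => x H.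
rewrite /= lee_fin indicE; have [xK|] := boolP (x \in K).
  by rewrite mulr1 le_max H//; exact/set_mem.
by rewrite mulr0 normr0 le_max lexx orbT.
Qed.

(** [Lnorm] at [+oo] is the essential supremum only if the whole space has positive measure, whence
    the first hypothesis. *)
Lemma Lnorm_pinfty_restrict_bounded f K : 0 < mu setT -> measurable K ->
  Lnorm mu +oo (fun x => (f x * \1_K x)%R%:E) < +oo ->
  exists M : R, {ae mu, forall x, K x -> (`|f x| <= M)%R}.
Proof.
move=> mu0 mK; rewrite unlock mu0 => fy.
set E := ess_sup_inf.ess_sup _ _ in fy.
have HE := ess_sup_inf.ess_sup_ge mu (abse \o (fun x => (f x * \1_K x)%R%:E)).
rewrite -/E in HE; move: E fy HE => [M||] // _ HE.
  exists M; apply: filterS HE => x; rewrite /= lee_fin indicE => + Kx.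
  by rewrite mem_set// mulr1.
exists 0%R; apply: filterS HE => x; rewrite /= leeNy_eq//.
Qed.

End LnormRestriction.

(** * Mollification *)

Lemma Rintegral_lin3 d (T : measurableType d) (R : realType)
    (mu : {sigma_finite_measure set T -> \bar R}) (a : R) (F1 F2 F3 : T -> R) :
  mu.-integrable setT (EFin \o F1) -> mu.-integrable setT (EFin \o F2) -> mu.-integrable setT (EFin \o F3) ->
  \int[mu]_x (a * (F1 x - F2 x) + F3 x) = a * (\int[mu]_x F1 x - \int[mu]_x F2 x) + \int[mu]_x F3 x.
Proof.
move=> i1 i2 i3.
have i12 : mu.-integrable setT (EFin \o (fun x => F1 x - F2 x)).
  by rewrite (_ : _ \o _ = (fun x => (EFin \o F1) x - (EFin \o F2) x)%E)//; exact: integrableB.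
rewrite RintegralD//; first by rewrite RintegralZl// RintegralB.
by rewrite (_ : _ \o _ = (fun x => a%:E * (EFin \o (fun x => (F1 x - F2 x)%R)) x)%E)//; exact: integrableZl.
Qed.

Section Mollification.
Variables (R : realType) (n : nat).
Local Notation mu := (@lebesgue_Rn R n).
Let lebS : {sigma_finite_measure set (Rn R n) -> \bar R} := @lebesgue_Rn R n.
Implicit Types (f : 'rV[R]_n -> R) (x z h : 'rV[R]_n) (pk : 'I_n -> {poly R} * nat).

Definition locint f := measurable_fun [set: Rn R n] f /\
  forall c r, mu.-integrable (cube c r) (EFin \o f).

Definition conv s pk f x : R := Rintegral mu setT (fun z : 'rV[R]_n => f z * kern x s pk z).

Lemma measurable_kern x s pk : measurable_fun [set: Rn R n] (kern x s pk).
Proof.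
apply: continuous_measurable_Rn; exact: continuous_kern.
Qed.

Lemma locint_mul_integrable f (k : 'rV[R]_n -> R) C c r : locint f ->
  measurable_fun [set: Rn R n] k -> (forall x, `|k x| <= C) -> (forall x, ~ cube c r x -> k x = 0) ->
  mu.-integrable setT (EFin \o (fun x : 'rV[R]_n => f x * k x)).
Proof.
move=> [mf fi] mk kC k0.
exact (@integrable_mul_supp _ (Rn R n) R lebS (cube c r) C f k (measurable_cube c r) (fi c r) mk kC k0).
Qed.

Lemma locint_mul_le f (k : 'rV[R]_n -> R) C c r : locint f ->
  measurable_fun [set: Rn R n] k -> (forall x, `|k x| <= C) -> (forall x, ~ cube c r x -> k x = 0) ->
  `|Rintegral mu setT (fun x : 'rV[R]_n => f x * k x)| <= C * Rintegral mu (cube c r) (fun x : 'rV[R]_n => `|f x|).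
Proof.
move=> [mf fi] mk kC k0.
exact (@Rintegral_mul_supp_le _ (Rn R n) R lebS (cube c r) C f k (measurable_cube c r) (fi c r) mk kC k0).
Qed.

Lemma integrable_conv s pk f x : 0 < s -> locint f ->
  mu.-integrable setT (EFin \o (fun z : 'rV[R]_n => f z * kern x s pk z)).
Proof.
move=> s0 lf; have [C C0 HC] := kern_bounded pk.
apply: (@locint_mul_integrable f (kern x s pk) C x s lf) => //; first exact: measurable_kern.
by move=> z; exact: kern_out.
Qed.

Lemma kern_shift_lipschitz s pk : exists2 L, 0 <= L &
  forall x y z, `|kern y s pk z - kern x s pk z| <= L * `|y - x|.
Proof.
have /choice[C HC] : forall j, exists C, 0 <= C /\ forall c s' x, `|kern c s' (dker s j pk) x| <= C.
  by move=> j; have [C C0 H] := kern_bounded (dker s j pk); exists C.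
exists (n%:R * \sum_j C j); first by rewrite mulr_ge0// sumr_ge0// => j _; have [] := HC j.
move=> x y z; rewrite kern_shift [X in _ - X]kern_shift.
have -> : z - y = (z - x) + (x - y) by rewrite addrA subrK.
rewrite (distrC y x); apply: C1_lipschitz_on (C1_kern 0 s pk) _ _.
  move=> j w _; have [_ /(_ 0 s w) H] := HC j; apply: le_trans H _.
  by rewrite (bigD1 j)//= lerDl sumr_ge0// => i _; have [] := HC i.
by rewrite sumr_ge0// => j _; have [] := HC j.
Qed.

Lemma kern_out_shift s pk x y z : 0 < s -> `|y - x| <= 1 -> ~ cube x (s + 1) z -> kern y s pk z = 0.
Proof.
move=> s0 yx nz; apply: kern_out => // zy; apply: nz => j.
have := zy j; have := coord_le_norm (y - x) 0 j; rewrite !mxE.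
have := ler_distD (y 0 j) (z 0 j) (x 0 j); lra.
Qed.

Lemma conv_continuous s pk f : 0 < s -> locint f -> continuous (conv s pk f).
Proof.
move=> s0 lf x; apply: continuous_eps => e e0.
have [L L0 HL] := kern_shift_lipschitz s pk.
pose A := Rintegral mu (cube x (s + 1)) (fun x : 'rV[R]_n => `|f x|).
have A0 : 0 <= A by exact: Rintegral_ge0.
exists (Num.min 1 (e / (L * A + 1))); first by rewrite lt_min ltr01 divr_gt0// ltr_wpDl// mulr_ge0.
move=> y; rewrite lt_min => /andP[/ltW y1 ye].
rewrite /conv -(@RintegralB _ (Rn R n) R lebS)//; [|exact: integrable_conv|exact: integrable_conv].
under eq_Rintegral do rewrite -mulrBr.
apply: le_trans (locint_mul_le lf (k := fun z => kern y s pk z - kern x s pk z) (C := L * `|y - x|) (c := x) (r := s + 1) _ _ _) _.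
- by apply: measurable_funB; exact: measurable_kern.
- by move=> z; exact: HL.
- by move=> z nz; rewrite !(kern_out_shift pk s0 _ nz) ?subrr ?normr0.
rewrite -/A mulrAC; rewrite ltr_pdivlMr ?ltr_wpDl ?mulr_ge0// in ye.
by apply: le_trans (ltW ye); rewrite mulrC ler_wpM2l// lerDl.
Qed.

(** The derivative falls on the kernel; the sign appears because moving the centre [x] is moving [z]
    the other way. The kernel [k] below is the error of the difference quotient and is of order [h],
    uniformly in [z]. *)
Lemma C1_conv s pk f : 0 < s -> locint f ->
  C1 (conv s pk f) (fun i x => - conv s (dker s i pk) f x).
Proof.
move=> s0 lf; split=> [i x|i]; last first.
  by move=> x; apply: continuousN; exact: conv_continuous.
apply: is_derive_quotient => e e0.
have [C C0 HC] := kern_bounded (dker s i (dker s i pk)).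
pose A := Rintegral mu (cube x (s + 1)) (fun x : 'rV[R]_n => `|f x|).
have A0 : 0 <= A by exact: Rintegral_ge0.
exists (Num.min 1 (e / (C * A + 1))); first by rewrite lt_min ltr01 divr_gt0// ltr_wpDl// mulr_ge0.
move=> h h0; rewrite lt_min => /andP[/ltW h1 he].
pose y := h *: delta_mx 0 i + x.
have yx : `|y - x| <= 1.
  rewrite /y addrK; apply: norm_le_coord => // a b; rewrite !mxE ord1 eqxx/=.
  by case: (b == i); rewrite ?mulr1// mulr0 normr0.
pose k z := h^-1 * (kern y s pk z - kern x s pk z) + kern x s (dker s i pk) z.
have -> : (conv s pk f y - conv s pk f x) / h - - conv s (dker s i pk) f x =
    Rintegral mu setT (fun z : 'rV[R]_n => f z * k z).
  rewrite opprK mulrC /conv -(@Rintegral_lin3 _ (Rn R n) R lebS); try exact: integrable_conv.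
  by apply: eq_Rintegral => z _; rewrite /k; ring.
apply: le_trans (locint_mul_le lf (k := k) (C := `|h| * C) (c := x) (r := s + 1) _ _ _) _.
- apply: measurable_funD; last exact: measurable_kern.
  exact: (measurable_funM (measurable_cst _) (measurable_funB (measurable_kern y s pk) (measurable_kern x s pk))).
- move=> z; rewrite /k kern_shift [kern x s pk z]kern_shift [kern x s (dker s i pk) z]kern_shift.
  have -> : z - y = (- h) *: delta_mx 0 i + (z - x) by rewrite /y opprD addrCA scaleNr.
  (* Two mean value steps: the difference quotient is minus a derivative of the kernel at an
     intermediate point, and a second derivative bounds its distance from the derivative at
     [z - x]. *)
  have [t th ->] := C1_mvt (z - x) i (- h) (C1_kern 0 s pk).
  have [t' _ E] := C1_mvt (z - x) i t (C1_kern 0 s (dker s i pk)).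
  rewrite mulrA mulrN mulVf// mulN1r addrC -opprB E normrN normrM ler_pM//.
  by rewrite normrN in th.
- move=> z nz; rewrite /k !(kern_out_shift _ s0 _ nz) ?subrr ?normr0//.
  by rewrite mulr0 addr0.
rewrite -/A -mulrA; rewrite ltr_pdivlMr ?ltr_wpDl ?mulr_ge0// in he.
by apply: le_trans (ltW he); rewrite ler_wpM2l// lerDl.
Qed.

Lemma locint_Lq_loc1 f : Lq_loc 1%E f -> locint f.
Proof.
move=> [mf fK]; split=> // c r.
pose K := [set x : 'rV[R]_n | forall j, `[c 0 j - r, c 0 j + r]%classic (x 0 j)].
have cK : compact K.
  by apply: (@rV_compact R n (fun j => `[c 0 j - r, c 0 j + r]%classic)) => i; exact: segment_compact.
have cubeK : cube c r `<=` K.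
  by move=> x xc j; have := xc j; rewrite /= in_itv/= ltr_distl => /andP[/ltW -> /ltW ->].
have mK : measurable (K : set (Rn R n)) by apply: closed_measurable_Rn; exact: (compact_closed _ cK).
have := fK K cK; rewrite (@Lnorm_restrict_lty _ (Rn R n) R lebS f K 1 ltr01 mK) => H.
apply: (@integrableS _ (Rn R n) R lebS K (cube c r) _ mK (measurable_cube c r) cubeK).
apply/integrableP; split; first by apply/measurable_EFinP; exact: (measurable_funS measurableT).
apply: le_lt_trans H; apply: ge0_le_integral => //=; last by move=> x _; rewrite lee_fin powRr1.
- by apply/measurable_EFinP; apply: (measurableT_comp (@normr_measurable R setT)); exact: (measurable_funS measurableT).
- apply/measurable_EFinP; apply: (measurableT_comp (measurable_powR 1)).
  by apply: (measurableT_comp (@normr_measurable R setT)); exact: (measurable_funS measurableT).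
Qed.

(** The kernel centred at [x] is itself a test function, so this is the defining identity of the
    weak gradient. *)
Lemma conv_weak_gradient m (u : 'rV[R]_n -> 'cV[R]_m) G s pk i j x : 0 < s ->
  is_weak_gradient u G ->
  conv s (dker s j pk) (fun z => u z i 0) x = - conv s pk (fun z => G z i j) x.
Proof.
move=> s0 [_ _ /(_ _ (test_function_kern x pk s0) i j)].
by rewrite partial_kern.
Qed.

Lemma C1_conv_weak m (u : 'rV[R]_n -> 'cV[R]_m) G s pk i : 0 < s ->
  is_weak_gradient u G ->
  C1 (conv s pk (fun z => u z i 0)) (fun j => conv s pk (fun z => G z i j)).
Proof.
move=> s0 uG; have [lu _ _] := uG.
rewrite (_ : (fun j => _) = fun j x => - conv s (dker s j pk) (fun z => u z i 0) x).
  exact: (C1_conv pk s0 (locint_Lq_loc1 (lu i))).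
by apply/funext => j; apply/funext => x; rewrite (conv_weak_gradient pk i j x s0 uG) opprK.
Qed.

End Mollification.

Section LebesgueOscillation.
Variables (R : realType) (n : nat).
Local Notation mu := (@lebesgue_Rn R n).
Let lebS : {sigma_finite_measure set (Rn R n) -> \bar R} := @lebesgue_Rn R n.
Implicit Types (f : 'rV[R]_n -> R) (x y z : 'rV[R]_n).

(** [Num.max] makes the volume nonnegative for every real [r], as the section on oscillation
    requires of [V]. *)
Definition ball_vol (r : R) := Num.max 0 r ^+ n * cube_vol R n.

Definition leb_osc f r := osc lebS (fun x r => cube x r : set (Rn R n)) f r.

Lemma cube_sym x y (r : R) : cube x r y -> cube y r x.
Proof. by move=> xy j; rewrite distrC; exact: xy. Qed.

Lemma measurable_cube_pair (r : R) :
  measurable ([set z | cube z.1 r z.2] : set (Rn R n * Rn R n)).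
Proof.
have -> : [set z : Rn R n * Rn R n | cube z.1 r z.2] =
    (fun z : Rn R n * Rn R n => (z.2 : 'rV[R]_n) - z.1) @^-1` (cube 0 r).
  by apply/funext => z; apply/propext; split => H j; have := H j; rewrite !mxE subr0.
apply: measurable_open_mx; last exact: cube_open.
move=> i j.
rewrite (_ : (fun _ => _) = (fun z : Rn R n * Rn R n => (z.2 : 'rV[R]_n) i j - (z.1 : 'rV[R]_n) i j)); last first.
  by apply/funext => z; rewrite !mxE.
apply: measurable_funB.
  exact: (measurableT_comp (measurable_coord i j) measurable_snd).
exact: (measurableT_comp (measurable_coord i j) measurable_fst).
Qed.

Lemma leb_osc_vanish f : mu.-integrable setT (EFin \o f) ->
  forall e, 0 < e -> exists2 d, 0 < d & forall r, 0 < r <= d ->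
    (leb_osc f r <= e%:E * (r ^+ n * cube_vol R n)%:E)%E.
Proof.
move=> fi e e0.
have H := @vanishing_osc_integrable _ (Rn R n) R lebS (fun x r => cube x r : set (Rn R n)) ball_vol.
have [||||||||||d d0 Hd] := H _ _ _ _ _ _ (fun O : set (Rn R n) => open (O : set 'rV[R]_n)) _ _ _ _ f fi e e0.
- exact: cube_sym.
- exact: measurable_cube_pair.
- exact: measurable_cube.
- move=> x r r0; rewrite /ball_vol max_r ?ltW//; exact: lebesgue_cubeE.
- by move=> r; rewrite mulr_ge0 ?cube_vol_ge0// exprn_ge0// le_max lexx.
- by move=> x r r'; exact: cube_le.
- exact: open_measurable_Rn.
- move=> O r oO; apply: open_measurable_Rn; apply: openI => //.
  by apply: bigcup_open => w _; exact: cube_open.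
- move=> O x oO Ox.
  have /nbhs_ballP[e' /= e'0 H'] := open_nbhs_nbhs (conj oO Ox).
  have [k Hk] : exists k : nat, k.+1%:R^-1 < e' by exists (Num.truncn e'^-1); rewrite invf_plt ?posrE// truncnS_gt.
  exists k => z /cubeP; rewrite invr_gt0 ltr0n => /(_ isT) zx; apply: H'.
  by rewrite -ball_normE/= distrC (lt_trans zx).
- move=> A e' e'0 _ Aoo; exact: lebesgue_outer_regular.
exists d => // r /andP[r0 rd]; apply: le_trans (Hd r _) _; first by rewrite r0.
by rewrite /ball_vol max_r//; exact: ltW.
Qed.

End LebesgueOscillation.

Section Mollifier.
Variables (R : realType) (n : nat).
Local Notation mu := (@lebesgue_Rn R n).
Local Notation ker0 := (@ker0 R n).
Let lebS : {sigma_finite_measure set (Rn R n) -> \bar R} := @lebesgue_Rn R n.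
Implicit Types (f : 'rV[R]_n -> R) (x y z : 'rV[R]_n) (s : R).

Lemma integrable_cst_cube (c : 'rV[R]_n) (r a : R) : mu.-integrable (cube c r) (EFin \o (fun=> a)).
Proof.
apply/integrableP; split; first exact: measurable_cst.
rewrite integral_cst; last exact: measurable_cube.
by rewrite lte_mul_pinfty//; exact: lebesgue_cube_lty.
Qed.

Lemma locint_cst (a : R) : locint (fun _ : 'rV[R]_n => a).
Proof. by split=> [|c r]; [exact: measurable_cst|exact: integrable_cst_cube]. Qed.

Lemma measurable_indic_Rn (A : set 'rV[R]_n) : measurable (A : set (Rn R n)) ->
  measurable_fun [set: Rn R n] (\1_A : 'rV[R]_n -> R).
Proof. by move=> mA; exact: (@measurable_indic _ (Rn R n) R setT A mA). Qed.

Lemma integrable_kern x s pk : 0 < s -> mu.-integrable setT (EFin \o kern x s pk).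
Proof.
move=> s0; have := integrable_conv pk x s0 (locint_cst 1).
by rewrite (_ : (fun z => _) = kern x s pk)//; apply/funext => z; rewrite mul1r.
Qed.

Definition ker_mass s : R := Rintegral mu setT (kern 0 s ker0).

Lemma ker_massE x s : 0 < s -> Rintegral mu setT (kern x s ker0) = ker_mass s.
Proof.
move=> s0; have mk : measurable_fun setT (EFin \o kern 0 s ker0 : Rn R n -> \bar R).
  by apply/measurable_EFinP; exact: measurable_kern.
rewrite /ker_mass /Rintegral -(integral_translate (- x) mk).
by congr fine; apply: eq_integral => z _; rewrite kern_shift.
Qed.

Hypothesis vol0 : 0 < cube_vol R n.

Lemma ker_mass_lower : exists2 a, 0 < a & forall s, 0 < s -> a * (s ^+ n * cube_vol R n) <= ker_mass s.
Proof.
have [a a0 Ha] := kern0_lower R n.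
exists (a / 2 ^+ n); first by rewrite divr_gt0// exprn_gt0.
move=> s s0; have s20 : 0 < s / 2 by rewrite divr_gt0.
have -> : a / 2 ^+ n * (s ^+ n * cube_vol R n) = Rintegral mu setT (fun z : 'rV[R]_n => a * \1_(cube 0 (s / 2)) z).
  rewrite /Rintegral.
  under eq_integral do rewrite EFinM.
  have mi : measurable_fun setT (fun z : Rn R n => (\1_(cube 0 (s / 2)) (z : 'rV[R]_n) : R)%:E).
    by apply/measurable_EFinP; exact: (measurable_indic_Rn (measurable_cube _ _)).
  rewrite (@ge0_integralZl _ (Rn R n) R mu _ measurableT _ mi); first last.
  - by rewrite lee_fin ltW.
  - by move=> z _; rewrite lee_fin.
  rewrite (@integral_indic _ (Rn R n) R mu _ measurableT _ (measurable_cube _ _)).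
  rewrite [_ `&` _](setIT (cube 0 (s / 2) : set (Rn R n))).
  transitivity (fine (a%:E * ((s / 2) ^+ n * cube_vol R n)%:E)%E).
    by rewrite /= expr_div_n; field; rewrite expf_neq0.
  by congr (fine (_ * _)%E); exact/esym/(lebesgue_cubeE 0 s20).
apply: le_Rintegral => //.
- have := locint_mul_integrable (locint_cst a) (k := \1_(cube 0 (s/2))) (C := 1) (c := 0) (r := s / 2).
  apply.
  + exact: (measurable_indic_Rn (measurable_cube _ _)).
  + by move=> x; rewrite indicE; case: (_ \in _); rewrite ?normr1// normr0.
  + by move=> x nx; rewrite indicE memNset.
- exact: integrable_kern.
- move=> z _; have [zc|nz] := pselect (cube 0 (s / 2) z).
    by rewrite indicE mem_set// mulr1; exact: Ha.
  by rewrite indicE memNset// mulr0; exact: kern0_ge0.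
Qed.

Lemma ker_mass_gt0 s : 0 < s -> 0 < ker_mass s.
Proof.
move=> s0; have [a a0 /(_ s s0)] := ker_mass_lower; apply: lt_le_trans.
by rewrite !mulr_gt0// exprn_gt0.
Qed.

Definition mker s x z : R := kern x s ker0 z / ker_mass s.

Definition moll s f x : R := conv s ker0 f x / ker_mass s.

Lemma mker_ge0 s x z : 0 < s -> 0 <= mker s x z.
Proof. by move=> s0; rewrite divr_ge0 ?kern0_ge0// ltW// ker_mass_gt0. Qed.

Lemma mker_out s x z : 0 < s -> ~ cube x s z -> mker s x z = 0.
Proof. by move=> s0 nz; rewrite /mker kern_out ?mul0r. Qed.

(** The bump is at most 1, and its mass is at least a fixed fraction of [s^n cube_vol] by its lower
    bound on the half cube. *)
Lemma mker_le : exists2 B, 0 < B & forall s x z, 0 < s ->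
  mker s x z <= B / (s ^+ n * cube_vol R n).
Proof.
have [a a0 Ha] := ker_mass_lower; exists a^-1; first by rewrite invr_gt0.
move=> s x z s0; have sn : 0 < s ^+ n * cube_vol R n by rewrite mulr_gt0// exprn_gt0.
have H := Ha s s0; have Z0 := ker_mass_gt0 s0.
rewrite /mker ler_pdivrMr// -mulrA -ler_pdivrMl ?invr_gt0// invrK.
rewrite mulrC (mulrC _ (ker_mass s)) ler_pdivlMr// (le_trans _ H)//.
by rewrite -mulrA ler_piMl ?kern0_le1// ltW// mulr_gt0.
Qed.

Lemma measurable_mker s x : measurable_fun [set: Rn R n] (mker s x).
Proof. exact: (measurable_funM (measurable_kern x s ker0) (measurable_cst _)). Qed.

Lemma mker_mul_integrable s x f : 0 < s -> locint f ->
  mu.-integrable setT (EFin \o (fun z : 'rV[R]_n => f z * mker s x z)).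
Proof.
move=> s0 lf; have [B B0 HB] := mker_le.
apply: (@locint_mul_integrable R n f (mker s x) (B / (s ^+ n * cube_vol R n)) x s lf (measurable_mker s x)).
- by move=> z; rewrite ger0_norm ?mker_ge0//; exact: HB.
- by move=> z; exact: mker_out.
Qed.

Lemma mker_integrable s x : 0 < s -> mu.-integrable setT (EFin \o mker s x).
Proof.
move=> s0; have := mker_mul_integrable x s0 (locint_cst 1).
by rewrite (_ : (fun z => _) = mker s x)//; apply/funext => z; rewrite mul1r.
Qed.

Lemma mollE s f x : 0 < s -> locint f -> moll s f x = Rintegral mu setT (fun z : 'rV[R]_n => f z * mker s x z).
Proof.
move=> s0 lf; rewrite /moll mulrC -(@RintegralZl _ (Rn R n))//; last exact: integrable_conv.
by apply: eq_Rintegral => z _; rewrite /mker; ring.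
Qed.

Lemma mker_mass s x : 0 < s -> Rintegral mu setT (mker s x) = 1.
Proof.
move=> s0; have := mollE x s0 (locint_cst 1); rewrite /moll /conv.
rewrite (_ : (fun z => 1 * kern x s ker0 z) = kern x s ker0); last by apply/funext => z; rewrite mul1r.
rewrite (_ : (fun z => 1 * mker s x z) = mker s x); last by apply/funext => z; rewrite mul1r.
by move=> <-; rewrite ker_massE// divff// gt_eqF// ker_mass_gt0.
Qed.

Lemma moll_continuous s f : 0 < s -> locint f -> continuous (moll s f).
Proof.
move=> s0 lf x; apply: continuousM; last exact: cst_continuous.
exact: conv_continuous.
Qed.

Lemma measurable_moll s f : 0 < s -> locint f -> measurable_fun [set: Rn R n] (moll s f).
Proof. by move=> s0 lf; apply: continuous_measurable_Rn; exact: moll_continuous. Qed.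

Lemma moll_L1 f : mu.-integrable setT (EFin \o f) ->
  forall e, 0 < e -> exists2 d, 0 < d & forall s, 0 < s <= d ->
    (\int[mu]_x (`|moll s f x - f x|)%:E <= e%:E)%E.
Proof.
move=> fi e e0; have [B B0 HB] := mker_le.
have lf : locint f.
  have /integrableP[/measurable_EFinP mf _] := fi.
  split=> // c r; exact: (integrableS measurableT (measurable_cube c r) (@subsetT _ _) fi).
have [d d0 Hd] := leb_osc_vanish fi (divr_gt0 e0 B0).
exists d => // s /andP[s0 sd].
have sn : 0 < s ^+ n * cube_vol R n by rewrite mulr_gt0// exprn_gt0.
have B'0 : 0 <= B / (s ^+ n * cube_vol R n) by rewrite divr_ge0// ltW.
apply: le_trans (@kernel_average_osc _ (Rn R n) R lebS (fun x r => cube x r : set (Rn R n))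
  (@measurable_cube_pair R n) (@measurable_cube R n) s (B / (s ^+ n * cube_vol R n)) (mker s) f (moll s f)
  B'0 (measurable_mker s) _ (fun x => mker_integrable x s0) (fun x => mker_mass x s0) fi (measurable_moll s0 lf)
  (fun x => mollE x s0 lf)) _.
  move=> x z; rewrite mker_ge0//= indicE; have [|] := boolP (z \in _).
    by rewrite mulr1 HB.
  by rewrite notin_setE mulr0 => nz; rewrite mker_out.
apply: le_trans (lee_wpmul2l _ (Hd s _)) _; first by rewrite lee_fin.
  by rewrite s0.
rewrite -!EFinM lee_fin le_eqVlt; apply/orP; left; apply/eqP.
by field; rewrite !gt_eqF// exprn_gt0.
Qed.

(** For [s <= 1] the mollification on [cube c r] sees only [cube c (r + 1)], so [f] may be cut off
    there and becomes integrable. *)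
Lemma moll_L1_cube f c r : locint f ->
  forall e, 0 < e -> exists2 d, 0 < d & forall s, 0 < s <= d ->
    (\int[mu]_(x in cube c r) (`|moll s f x - f x|)%:E <= e%:E)%E.
Proof.
move=> lf e e0.
pose f1 : 'rV[R]_n -> R := f \_ (cube c (r + 1)).
have fi : mu.-integrable setT (EFin \o f1).
  rewrite (_ : EFin \o f1 = (EFin \o f) \_ (cube c (r + 1))); last first.
    by apply/funext => x; rewrite /= /f1 !patchE; case: ifPn.
  by rewrite -integrable_mkcond; [exact: lf.2|exact: measurable_cube].
have lf1 : locint f1.
  have /integrableP[/measurable_EFinP mf _] := fi.
  split=> // c' r'; exact: (integrableS measurableT (measurable_cube c' r') (@subsetT _ _) fi).
have [d d0 Hd] := moll_L1 fi e0.
exists (Num.min d 1); first by rewrite lt_min d0 ltr01.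
move=> s /andP[s0]; rewrite le_min => /andP[sd s1].
apply: le_trans (Hd s _); last by rewrite s0.
apply: (@le_trans _ _ (\int[mu]_(x in cube c r) (`|moll s f1 x - f1 x|)%:E)%E).
  rewrite le_eqVlt; apply/orP; left; apply/eqP; apply: eq_integral => x; rewrite inE => xc.
  congr (`|_ - _|%:E); last first.
    by rewrite /f1 patchE mem_set//; apply: cube_le xc; rewrite lerDl.
  rewrite !mollE//; apply: eq_Rintegral => z _.
  have [zx|nzx] := pselect (cube x s z); last by rewrite mker_out// !mulr0.
  rewrite /f1 patchE mem_set// => j; apply: le_lt_trans (ler_distD (x 0 j) _ _) _.
  by rewrite addrC; apply: ltrD; [exact: xc|exact: lt_le_trans (zx j) s1].
apply: ge0_subset_integral => //; first exact: measurable_cube.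
apply/measurable_EFinP; apply: (measurableT_comp (@normr_measurable R setT)).
by apply: measurable_funB; [exact: measurable_moll|exact: lf1.1].
Qed.

End Mollifier.

Lemma measurable_EFinS d (T : measurableType d) (R : realType) (D : set T) (f : T -> R) :
  measurable_fun setT f -> measurable_fun D (EFin \o f).
Proof. by move=> mf; apply/measurable_EFinP; exact: (measurable_funS measurableT (@subsetT _ _) mf). Qed.

Section NonnegativeIntegrals.
Context d (T : measurableType d) (R : realType) (mu : {measure set T -> \bar R}).
Implicit Types (f g h : T -> R) (D : set T).
Local Open Scope ereal_scope.

Lemma le_integral_EFin D f g : measurable D -> measurable_fun setT f -> measurable_fun setT g ->
  (forall x, D x -> (0 <= f x <= g x)%R) -> \int[mu]_(x in D) (f x)%:E <= \int[mu]_(x in D) (g x)%:E.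
Proof.
move=> mD mf mg fg; apply: ge0_le_integral => //.
- by move=> x /fg /andP[]; rewrite lee_fin.
- exact: measurable_EFinS.
- exact: measurable_EFinS.
- by move=> x /fg /andP[]; rewrite lee_fin.
Qed.

Lemma integral_EFinD D f g : measurable D -> measurable_fun setT f -> measurable_fun setT g ->
  (forall x, 0 <= f x)%R -> (forall x, 0 <= g x)%R ->
  \int[mu]_(x in D) (f x + g x)%:E = \int[mu]_(x in D) (f x)%:E + \int[mu]_(x in D) (g x)%:E.
Proof.
move=> mD mf mg f0 g0; rewrite -ge0_integralD//.
- by move=> x _; rewrite lee_fin.
- exact: measurable_EFinS.
- by move=> x _; rewrite lee_fin.
- exact: measurable_EFinS.
Qed.

Lemma integral_EFinZ D (c : R) f : measurable D -> measurable_fun setT f ->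
  (forall x, 0 <= f x)%R -> (0 <= c)%R ->
  \int[mu]_(x in D) (c * f x)%:E = c%:E * \int[mu]_(x in D) (f x)%:E.
Proof.
move=> mD mf f0 c0; rewrite -ge0_integralZl//.
- exact: measurable_EFinS.
- by move=> x _; rewrite lee_fin.
Qed.

Lemma integral_EFin_sum (I : Type) (s : seq I) D (f : I -> T -> R) : measurable D ->
  (forall i, measurable_fun setT (f i)) -> (forall i x, 0 <= f i x)%R ->
  \int[mu]_(x in D) (\sum_(i <- s) f i x)%R%:E = \sum_(i <- s) \int[mu]_(x in D) (f i x)%:E.
Proof.
move=> mD mf f0; rewrite -ge0_integral_sum//.
- by apply: eq_integral => x _; rewrite sumEFin.
- by move=> i; exact: measurable_EFinS.
- by move=> i x _; rewrite lee_fin.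
Qed.

Lemma le_integral_EFinD D f g h : measurable D -> measurable_fun setT f -> measurable_fun setT g ->
  measurable_fun setT h -> (forall x, D x -> (0 <= f x <= g x + h x)%R) ->
  (forall x, 0 <= g x)%R -> (forall x, 0 <= h x)%R ->
  \int[mu]_(x in D) (f x)%:E <= \int[mu]_(x in D) (g x)%:E + \int[mu]_(x in D) (h x)%:E.
Proof.
move=> mD mf mg mh fgh g0 h0; rewrite -integral_EFinD//.
by apply: le_integral_EFin => //; exact: measurable_funD.
Qed.

Lemma subset_integral_EFin D D' f : measurable D -> measurable D' -> measurable_fun setT f ->
  (forall x, 0 <= f x)%R -> D `<=` D' -> \int[mu]_(x in D) (f x)%:E <= \int[mu]_(x in D') (f x)%:E.
Proof.
move=> mD mD' mf f0 DD'; apply: ge0_subset_integral => //; first exact: measurable_EFinS.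
by move=> x _; rewrite lee_fin.
Qed.

Lemma integrable_EFin_lty D f : measurable D -> measurable_fun setT f -> (forall x, 0 <= f x)%R ->
  \int[mu]_(x in D) (f x)%:E < +oo -> mu.-integrable D (EFin \o f).
Proof.
move=> mD mf f0 fy; apply/integrableP; split; first exact: measurable_EFinS.
by under eq_integral do rewrite /= (ger0_norm (f0 _)).
Qed.

End NonnegativeIntegrals.

(** * Locally integrable functions and uniqueness of weak gradients *)

Section LocallyIntegrable.
Variables (R : realType) (n : nat).
Local Notation mu := (@lebesgue_Rn R n).
Implicit Types (f g : 'rV[R]_n -> R) (x y z : 'rV[R]_n) (s : R).

Lemma ae_imply (P Q : 'rV[R]_n -> Prop) : (forall x, P x -> Q x) ->
  {ae mu, forall x, P x} -> {ae mu, forall x, Q x}.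
Proof. by move=> PQ; apply: (@filterS _ _ (ae_filter_ringOfSetsType mu)). Qed.

Lemma ae_forall_fin (I : finType) (P : I -> 'rV[R]_n -> Prop) :
  (forall i, {ae mu, forall x, P i x}) -> {ae mu, forall x, forall i, P i x}.
Proof. exact: (@filter_forall _ _ P _ (ae_filter_ringOfSetsType mu)). Qed.

Lemma continuous_bounded_cube f c r : continuous f ->
  exists2 M : R, 0 <= M & forall x, cube c r x -> `|f x| <= M.
Proof.
move=> cf; have [r' r'0 H] := cube_subset0 c r.
have cK := @closed_cube_compact R n r'.
have : bounded_set (f @` [set x : 'rV[R]_n | forall j, x 0 j \in `[- r', r']]).
  by apply: compact_bounded; apply: continuous_compact cK; exact: continuous_subspaceT.
move=> [M [_ /(_ (`|M| + 1)) HM]]; exists (`|M| + 1); first by rewrite addr_ge0.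
move=> x /H xr; apply: HM; first by have := ler_norm M; lra.
exists x => // j; rewrite in_itv/=; have := xr j; rewrite mxE subr0 ltr_norml => /andP[/ltW -> /ltW ->].
by [].
Qed.

Lemma measurable_norm_Rn f : measurable_fun [set: Rn R n] f -> measurable_fun [set: Rn R n] (fun x => `|f x|).
Proof. by move=> mf; exact: (measurableT_comp (@normr_measurable R setT) mf). Qed.

Lemma continuous_locint f : continuous f -> locint f.
Proof.
move=> cf; split=> [|c r]; first exact: continuous_measurable_Rn.
have [M M0 HM] := continuous_bounded_cube c r cf.
have mf := continuous_measurable_Rn cf.
apply: (@le_integrable _ (Rn R n) R mu (cube c r) (measurable_cube c r) _ _ (@measurable_EFinS _ (Rn R n) R _ f mf) _ (integrable_cst_cube c r M)).
by move=> x xc; rewrite /= lee_fin (ger0_norm M0) HM.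
Qed.

Lemma locint_norm f : locint f -> locint (fun x => `|f x|).
Proof.
move=> [mf fi]; split=> [|c r]; first exact: measurable_norm_Rn.
exact: (@integrable_norm _ (Rn R n) R mu _ _ (fi c r)).
Qed.

Lemma locintD f g : locint f -> locint g -> locint (fun x => f x + g x).
Proof.
move=> [mf fi] [mg gi]; split=> [|c r]; first exact: measurable_funD.
exact: (@integrableD _ (Rn R n) R mu _ (measurable_cube c r) _ _ (fi c r) (gi c r)).
Qed.

Lemma locintZ a f : locint f -> locint (fun x => a * f x).
Proof.
move=> [mf fi]; split=> [|c r]; first exact: measurable_funM.
exact: (@integrableZl _ (Rn R n) R mu _ (measurable_cube c r) a _ (fi c r)).
Qed.

Lemma locintB f g : locint f -> locint g -> locint (fun x => f x - g x).
Proof.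
move=> lf lg; have := locintD lf (locintZ (-1) lg).
by rewrite (_ : (fun x => f x + _) = (fun x => f x - g x))//; apply/funext => x; rewrite mulN1r.
Qed.

Lemma locint_ae_eq0 f : locint f ->
  (forall c r e, 0 < e -> (\int[mu]_(x in cube c r) (`|f x|)%:E <= e%:E)%E) ->
  {ae mu, forall x, f x = 0}.
Proof.
move=> [mf fi] H.
have Hk (k : nat) : {ae mu, forall x, cube (0 : 'rV[R]_n) k.+1%:R x -> (EFin \o f) x = 0%E}.
  have mc := measurable_cube (0 : 'rV[R]_n) k.+1%:R.
  apply: (iffLR (@ae_eq_integral_abs _ (Rn R n) R mu _ mc (EFin \o f) _)).
    exact: (@measurable_EFinS _ (Rn R n) R _ f mf).
  apply/eqP; rewrite eq_le; apply/andP; split; last exact: integral_ge0.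
  by apply/lee_addgt0Pr => e e0; rewrite add0e; exact: H.
have := ae_foralln Hk; apply: filterS => x Hx.
have : [set: 'rV[R]_n] x by [].
by rewrite -bigcup_cube => -[k _ /(Hx k)[]].
Qed.

Hypothesis vol0 : 0 < cube_vol R n.

Lemma moll_norm_powR (p : R) f s x : 0 < s -> 1 < p -> locint f -> locint (fun x => `|f x| `^ p) ->
  `|moll s f x| `^ p <= moll s (fun x => `|f x| `^ p) x.
Proof.
move=> s0 p1 lf lfp.
apply: (@le_trans _ _ (Rintegral mu setT (fun z => `|f z| * mker s x z) `^ p)).
  apply: ge0_ler_powR; rewrite ?nnegrE//; first by lra.
    by apply: Rintegral_ge0 => z _; rewrite mulr_ge0// mker_ge0.
  rewrite mollE//; have := @le_normr_Rintegral _ (Rn R n) R mu setT (fun z => f z * mker s x z).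
  move=> /(_ measurableT (mker_mul_integrable vol0 x s0 lf)) H; apply: le_trans H _.
  by rewrite le_eqVlt; apply/orP; left; apply/eqP/eq_Rintegral => z _; rewrite normrM [X in _ * X]ger0_norm// mker_ge0.
rewrite mollE//; apply: (@jensen_powR _ (Rn R n) R mu p (mker s x) (fun z => `|f z|) p1) => //.
- by move=> z; exact: mker_ge0.
- exact: mker_integrable.
- exact: mker_mass.
- exact: (mker_mul_integrable vol0 x s0 (locint_norm lf)).
- exact: (mker_mul_integrable vol0 x s0 lfp).
Qed.

(** On every cube [f - g] is the difference of two mollification errors, both small in [L^1]. *)
Lemma moll_inj_ae f g : locint f -> locint g -> (forall s x, 0 < s -> moll s f x = moll s g x) ->
  {ae mu, forall x, f x = g x}.
Proof.
move=> lf lg fg; have := locint_ae_eq0 (locintB lf lg).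
have H : forall c r e, 0 < e -> (\int[mu]_(x in cube c r) (`|f x - g x|)%:E <= e%:E)%E.
  move=> c r e e0; have e20 : 0 < e / 2 by lra.
  have [d d0 Hd] := moll_L1_cube vol0 c r lf e20; have [d' d'0 Hd'] := moll_L1_cube vol0 c r lg e20.
  pose s := Num.min d d'; have s0 : 0 < s by rewrite lt_min d0.
  have {}Hd := Hd s; have {}Hd' := Hd' s; rewrite s0 !ge_min !lexx ?orbT/= in Hd Hd'.
  have -> : e%:E = ((e / 2)%:E + (e / 2)%:E)%E :> \bar R by rewrite -EFinD -splitr.
  apply: le_trans (leeD (Hd isT) (Hd' isT)).
  have mE h : locint h -> measurable_fun [set: Rn R n] (fun x => `|moll s h x - h x|).
    by move=> lh; exact: (measurable_norm_Rn (measurable_funB (measurable_moll s0 lh) lh.1)).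
  apply: (@le_integral_EFinD _ (Rn R n) R mu _ _ (fun x => `|moll s f x - f x|) (fun x => `|moll s g x - g x|)
    (measurable_cube c r) (measurable_norm_Rn (locintB lf lg).1) (mE f lf) (mE g lg)) => // x _.
  rewrite normr_ge0/= fg//.
  by have := ler_distD (moll s g x) (f x) (g x); rewrite (distrC (f x) (moll s g x)).
move=> /(_ H); apply: ae_imply => x /eqP; by rewrite subr_eq0 => /eqP.
Qed.

(** The gradient in the cell integral and the witness inside [W1q_per] may be different
    representatives. The mollifications of both are determined by [u]. *)
Lemma weak_gradient_unique m (u : 'rV[R]_n -> 'cV[R]_m) G G' : is_weak_gradient u G -> is_weak_gradient u G' ->
  {ae mu, forall x, G x = G' x}.
Proof.
move=> uG uG'.
have H i j : {ae mu, forall x, G x i j = G' x i j}.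
  have [_ /(_ i j)/locint_Lq_loc1 lG _] := uG; have [_ /(_ i j)/locint_Lq_loc1 lG' _] := uG'.
  apply: moll_inj_ae => // s x s0; rewrite /moll; congr (_ / _); apply: oppr_inj.
  by rewrite -(conv_weak_gradient _ _ _ _ s0 uG) -(conv_weak_gradient _ _ _ _ s0 uG').
apply: ae_imply (ae_forall_fin (fun i => ae_forall_fin (H i))) => x Hx.
by apply/matrixP => i j; exact: Hx.
Qed.

Lemma conv_periodic s pk f z x : 0 < s -> locint f -> {ae mu, forall x, f (x + z) = f x} ->
  conv s pk f (x + z) = conv s pk f x.
Proof.
move=> s0 lf fz; rewrite /conv /Rintegral.
have mF y : measurable_fun [set: Rn R n] (EFin \o (fun w => f w * kern y s pk w)).
  exact: (@measurable_EFinS _ (Rn R n) R _ _ (measurable_funM lf.1 (measurable_kern y s pk))).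
congr fine; apply: etrans (esym (integral_translate z (mF (x + z)))) _.
apply: (@ae_eq_integral _ (Rn R n) R mu setT _ _ measurableT _ (mF x)).
  exact: (measurableT_comp (mF (x + z)) (@measurable_translate R n z)).
apply: ae_imply fz => w H _; rewrite /= H kern_shift [in RHS]kern_shift.
  by rewrite opprD addrACA subrr addr0.
Qed.

Lemma moll_periodic s f z x : 0 < s -> locint f -> {ae mu, forall x, f (x + z) = f x} ->
  moll s f (x + z) = moll s f x.
Proof. by move=> s0 lf fz; rewrite /moll conv_periodic. Qed.

End LocallyIntegrable.

Lemma dominated_cvg_Rintegral d (T : measurableType d) (R : realType) (mu : {measure set T -> \bar R})
    (D : set T) (h : nat -> T -> R) (h_ g : T -> R) :
  measurable D -> (forall k, measurable_fun setT (h k)) -> measurable_fun setT h_ ->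
  (forall x, D x -> h k x @[k --> \oo] --> h_ x) -> mu.-integrable D (EFin \o g) ->
  (forall k x, D x -> `|h k x| <= g x) ->
  \int[mu]_(x in D) h k x @[k --> \oo] --> \int[mu]_(x in D) h_ x.
Proof.
move=> mD mh mh_ hh gi hg.
have [||||hi _ H] := @dominated_convergence _ T R mu D mD (fun k => EFin \o h k) (EFin \o h_) (EFin \o g) _ _ _ gi.
- by move=> k; exact: measurable_EFinS.
- exact: measurable_EFinS.
- apply: aeW => x Dx; apply: cvg_EFin; last exact: hh.
  by near=> k.
- by apply: aeW => x k Dx; rewrite lee_fin hg.
have hk k : mu.-integrable D (EFin \o h k).
  apply: le_integrable gi => //; first exact: measurable_EFinS.
  by move=> x Dx; rewrite /= lee_fin (le_trans (hg k x Dx))// ler_norm.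
apply: fine_cvg; rewrite fineK; last exact: integrable_fin_num.
exact: H.
Unshelve. all: by end_near. Qed.

(** * Integration by parts for [C1] functions *)

Section ClassicalGradient.
Variables (R : realType) (n : nat).
Local Notation mu := (@lebesgue_Rn R n).
Implicit Types (f g psi : 'rV[R]_n -> R) (df dg : 'I_n -> 'rV[R]_n -> R) (x y z : 'rV[R]_n) (s : R).

Lemma C1M f g df dg : C1 f df -> C1 g dg ->
  C1 (fun x => f x * g x) (fun j x => f x * dg j x + g x * df j x).
Proof.
move=> Cf Cg; split=> [j x|j].
  have := @is_deriveM R _ f g x (delta_mx 0 j) (df j x) (dg j x) (Cf.1 j x) (Cg.1 j x).
  by [].
have cf := C1_continuous Cf; have cg := C1_continuous Cg.
move=> x; apply: (@continuousD _ _ _ (fun y => f y * dg j y) (fun y => g y * df j y)).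
  by apply: continuousM; [exact: cf|exact: (Cg.2 j x)].
by apply: continuousM; [exact: cg|exact: (Cf.2 j x)].
Qed.

Lemma C1B f g df dg : C1 f df -> C1 g dg ->
  C1 (fun x => f x - g x) (fun j x => df j x - dg j x).
Proof.
move=> Cf Cg; split=> [j x|j].
  by have := @is_deriveB R _ _ f g x (delta_mx 0 j) (df j x) (dg j x) (Cf.1 j x) (Cg.1 j x).
by move=> x; apply: continuousB; [exact: (Cf.2 j x)|exact: (Cg.2 j x)].
Qed.

Lemma test_function_C1 psi : test_function psi -> C1 psi (fun j => partial j psi).
Proof.
move=> [sm _]; split=> [j x|j]; last by have [] := sm [:: j].
by have [_ /(_ j x)] := sm [::]; exact: derivableP.
Qed.

Lemma test_function_supp psi : test_function psi -> exists2 r, 0 < r &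
  forall x, ~ cube 0 r x -> psi x = 0.
Proof.
move=> [_ /compact_subset_cube[r r0 H]]; exists r => // x nx; apply/eqP/negPn/negP => psix.
by apply: nx; apply: H; exact: subset_closure.
Qed.

(** Outside [cube 0 (r + 1)] every difference quotient with step at most 1 vanishes; hence the
    margin. *)
Lemma C1_supp f df r : 0 < r -> C1 f df -> (forall x, ~ cube 0 r x -> f x = 0) ->
  forall j x, ~ cube 0 (r + 1) x -> df j x = 0.
Proof.
move=> r0 Cf f0 j x nx.
have := @C1_direction _ _ f df x (delta_mx 0 j) Cf.
rewrite (bigD1 j)//= big1 ?addr0; last by move=> i /negbTE ij; rewrite mxE eqxx ij mul0r.
rewrite mxE !eqxx mul1r => /cvg_lim H.
rewrite -H//; apply: lim_near_cst => //; near=> k.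
have H1 : cube 0 r (x + k.+1%:R^-1 *: delta_mx 0 j) -> cube 0 (r + 1) x.
  move=> H1 i; have := H1 i; rewrite !mxE !subr0.
  set b := k.+1%:R^-1 * _ => ar.
  have b1 : `|b| <= 1.
    rewrite /b normrM ger0_norm; last by rewrite invr_ge0.
    have : `|((0 == 0 :> 'I_1) && (i == j))%:R : R| <= 1 by case: (_ && _); rewrite ?normr1 ?normr0.
    by move=> H2; rewrite mulr_ile1// invf_le1// ler1n.
  by have := ler_normB (x 0 i + b) b; rewrite addrK; lra.
rewrite !f0 ?subrr ?mulr0//; last by move/H1.
by move=> xr; apply: nx; apply: cube_le xr; rewrite lerDl.
Unshelve. all: by end_near. Qed.

(** Each difference quotient has integral 0 by translation invariance, and these quotients converge
    dominatedly to the derivative. *)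
Lemma integral_partial_eq0 f df r j : 0 < r -> C1 f df -> (forall x, ~ cube 0 r x -> f x = 0) ->
  Rintegral mu setT (df j) = 0.
Proof.
move=> r0 Cf f0; have df0 := @C1_supp f df r r0 Cf f0 j.
have cf := C1_continuous Cf; have mf := continuous_measurable_Rn cf.
have mdf := continuous_measurable_Rn (Cf.2 j).
(* The radius [r + 2] contains the intermediate points of difference quotients with step at most 1
   based in [cube 0 (r + 1)]. *)
have [M M0 HM] := continuous_bounded_cube 0 (r + 2) (Cf.2 j).
pose D : set 'rV[R]_n := cube 0 (r + 1).
pose e : nat -> 'rV[R]_n := fun k => k.+1%:R^-1 *: delta_mx 0 j.
have ei (g : 'rV[R]_n -> R) : continuous g -> (forall x, ~ cube 0 (r + 1) x -> g x = 0) ->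
    mu.-integrable setT (EFin \o g).
  move=> cg g0; have [B B0 HB] := continuous_bounded_cube 0 (r + 1) cg.
  have gB x : `|g x| <= B.
    by have [/HB//|/g0 ->] := pselect (cube 0 (r + 1) x); rewrite normr0.
  have := locint_mul_integrable (@locint_cst R n 1) (continuous_measurable_Rn cg) gB g0.
  by rewrite (_ : (fun x => 1 * g x) = g)//; apply/funext => x; rewrite mul1r.
pose h k x := k.+1%:R * (f (x + e k) - f x).
have f01 x : ~ cube 0 (r + 1) x -> f x = 0.
  by move=> nx; apply: f0 => xr; apply: nx; apply: cube_le xr; rewrite lerDl.
have fi := ei _ cf f01.
have mfe k : measurable_fun [set: Rn R n] (fun x => f (x + e k)).
  exact: (measurableT_comp mf (@measurable_translate R n (e k))).
have cvg0 : Rintegral mu setT (h k) @[k --> \oo] --> Rintegral mu setT (df j).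
  apply: (@dominated_cvg_Rintegral _ (Rn R n) R mu setT h (df j) (fun x => M * \1_(cube 0 (r + 1)) x) measurableT) => //.
  - move=> k; exact: (measurable_funM (measurable_cst _) (measurable_funB (mfe k) mf)).
  - move=> x _; have := @C1_direction _ _ f df x (delta_mx 0 j) Cf.
    rewrite (bigD1 j)//= big1 ?addr0; last by move=> i /negbTE ij; rewrite mxE eqxx ij mul0r.
    by rewrite mxE !eqxx mul1r.
  - apply: (locint_mul_integrable (@locint_cst R n M) (measurable_indic_Rn (measurable_cube 0 (r + 1))) (C := 1) (c := 0) (r := r + 1)).
      by move=> x; rewrite indicE; case: (_ \in _); rewrite ?normr1// normr0.
    by move=> x nx; rewrite indicE memNset.
  - move=> k x _; rewrite /h /e (addrC x).
    have k0 : 0 < k.+1%:R^-1 :> R by rewrite invr_gt0.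
    have k1 : k.+1%:R^-1 <= 1 :> R by rewrite invf_le1// ler1n.
    have cub t : `|t| <= k.+1%:R^-1 -> forall i, `|(t *: delta_mx 0 j : 'rV[R]_n) 0 i| <= 1.
      move=> tk i; rewrite !mxE eqxx/=; case: (i == j); rewrite ?mulr1 ?mulr0 ?normr0//.
      exact: le_trans tk k1.
    have [xc|nx] := pselect (cube 0 (r + 1) x).
      rewrite indicE mem_set// mulr1; have [t + ->] := C1_mvt x j (k.+1%:R^-1) Cf.
      rewrite mulrA divff// mul1r (ger0_norm (ltW k0)) => tk; apply: HM => i; have := xc i.
      rewrite [X in _ -> `|X - _| < _]mxE !mxE !subr0 => H.
      have := cub t tk i; rewrite !mxE => H'; apply: le_lt_trans (ler_normD _ _) _; lra.
    rewrite indicE memNset// mulr0 (f01 x nx) f0 ?subrr ?mulr0 ?normr0// => H; apply: nx => i.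
    have := H i; rewrite !mxE !subr0 => H1.
    have H2 := cub k.+1%:R^-1 _ i; rewrite (ger0_norm (ltW k0)) !mxE in H2; have {}H2 := H2 (lexx _).
    have := ler_normB (k.+1%:R^-1 * ((0 == 0 :> 'I_1) && (i == j))%:R + x 0 i) (k.+1%:R^-1 * ((0 == 0 :> 'I_1) && (i == j))%:R).
    by rewrite addrC addKr; lra.
have h0 k : Rintegral mu setT (h k) = 0.
  have HZ := @RintegralZl _ (Rn R n) R mu setT (fun x => f (x + e k) - f x) k.+1%:R measurableT.
  rewrite /h HZ; last first.
    exact: (@integrableB _ (Rn R n) R mu _ measurableT _ _ (integrable_translate (e k) fi) fi).
  rewrite (@RintegralB _ (Rn R n) R mu _ _ _ measurableT (integrable_translate (e k) fi) fi).
  rewrite [X in X - _](_ : _ = Rintegral mu setT f) ?subrr ?mulr0//.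
  rewrite /Rintegral; congr fine; apply: (integral_translate (e k) (f := EFin \o f)).
  exact: (@measurable_EFinS _ (Rn R n) R setT f mf).
rewrite (_ : (fun k => _) = fun=> 0) in cvg0; last exact/funext.
apply: (@cvg_unique _ (@Rhausdorff R) _ _ _ _ cvg0); exact: cvg_cst.
Qed.

Lemma Lq_loc_bounded (q : \bar R) f : (0 < q)%E -> q != -oo%E -> measurable_fun [set: Rn R n] f ->
  (forall c r, exists M, forall x, cube c r x -> `|f x| <= M) -> Lq_loc q f.
Proof.
move=> q0 qNoo mf fM; split=> // K cK.
have [r r0 Kr] := compact_subset_cube cK; have [M HM] := fM 0 r.
have mK : measurable (K : set (Rn R n)) by apply: closed_measurable_Rn; exact: compact_closed.
apply: (@Lnorm_restrict_bounded _ (Rn R n) R mu f K q M q0 qNoo mK) => //.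
  exact: le_lt_trans (le_lebesgue_outer Kr) (lebesgue_cube_lty 0 r).
by apply: aeW => x /Kr; exact: HM.
Qed.

Lemma Lq_loc_continuous (q : \bar R) f : (0 < q)%E -> q != -oo%E -> continuous f -> Lq_loc q f.
Proof.
move=> q0 qNoo cf; apply: Lq_loc_bounded => //; first exact: continuous_measurable_Rn.
by move=> c r; have [M _ H] := continuous_bounded_cube c r cf; exists M.
Qed.

(** Integration by parts is [integral_partial_eq0] for the product of a component of [u] and
    [psi]. *)
Lemma C1_weak_gradient m (u : 'rV[R]_n -> 'cV[R]_m) (G : 'rV[R]_n -> 'M[R]_(m, n)) :
  (forall i, C1 (fun x => u x i 0) (fun j x => G x i j)) -> is_weak_gradient u G.
Proof.
move=> CG; split=> [i|i j|psi tpsi i j].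
- by apply: Lq_loc_continuous => //; exact: C1_continuous (CG i).
- by apply: Lq_loc_continuous => //; exact: (CG i).2 j.
have Cp := test_function_C1 tpsi; have [r r0 psi0] := test_function_supp tpsi.
have H := @integral_partial_eq0 _ _ r j r0 (C1M (CG i) Cp).
have int g h : continuous g -> continuous h -> (forall x, ~ cube 0 (r + 1) x -> h x = 0) ->
    mu.-integrable setT (EFin \o (fun x => g x * h x)).
  move=> cg ch h0; have [B B0 HB] := continuous_bounded_cube 0 (r + 1) ch.
  apply: (locint_mul_integrable (continuous_locint cg) (continuous_measurable_Rn ch) (C := B) _ h0).
  by move=> x; have [/HB//|/h0 ->] := pselect (cube 0 (r + 1) x); rewrite normr0.
have i1 := int _ _ (C1_continuous (CG i)) (Cp.2 j) (@C1_supp _ _ r r0 Cp psi0 j).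
have i2 : mu.-integrable setT (EFin \o (fun x => psi x * G x i j)).
  rewrite (_ : (fun x => _) = (fun x => G x i j * psi x)); last by apply/funext => x; rewrite mulrC.
  apply: (int _ _ ((CG i).2 j) (C1_continuous Cp)) => x nx; apply: psi0 => xr; apply: nx.
  by apply: cube_le xr; rewrite lerDl.
have E := @RintegralD _ (Rn R n) R mu setT _ _ measurableT i1 i2; rewrite E in H.
apply/eqP; rewrite -addr_eq0; apply/eqP; rewrite -[RHS]H; last by move=> x nx; rewrite psi0 ?mulr0.
by congr (_ + _); apply: eq_Rintegral => x _; rewrite mulrC.
Qed.

End ClassicalGradient.

(** * Growth conditions and smooth periodic approximants *)

Section PowerNorm.
Variables (R : realType) (m n : nat) (p : R).
Hypothesis p1 : 1 < p.
Implicit Types (A B : 'M[R]_(m, n)).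

(** Comparable to the [p]-th power of the Frobenius norm, but a sum over the entries, so that
    mollification and integration act entry by entry. *)
Definition pnorm A : R := \sum_i \sum_j `|A i j| `^ p.

Let p0 : 0 <= p. Proof. by have := p1; lra. Qed.
Let pn0 : p != 0. Proof. by rewrite gt_eqF//; have := p1; lra. Qed.

Lemma pnorm_ge0 A : 0 <= pnorm A.
Proof. by apply: sumr_ge0 => i _; apply: sumr_ge0 => j _; exact: powR_ge0. Qed.

Lemma coord_le_pnorm A i j : `|A i j| `^ p <= pnorm A.
Proof.
rewrite /pnorm (bigD1 i)//= (bigD1 j)//= -addrA lerDl addr_ge0//.
  by apply: sumr_ge0 => k _; exact: powR_ge0.
by apply: sumr_ge0 => k _; apply: sumr_ge0 => l _; exact: powR_ge0.
Qed.

Lemma powR_normD (a b : R) : `|a + b| `^ p <= 2 `^ p * (`|a| `^ p + `|b| `^ p).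
Proof.
pose c := Num.max `|a| `|b|.
have c0 : 0 <= c by rewrite le_max normr_ge0.
apply: (@le_trans _ _ ((2 * c) `^ p)).
  apply: ge0_ler_powR; rewrite ?nnegrE ?mulr_ge0//.
  apply: le_trans (ler_normD _ _) _; rewrite mulr2n mulrDl mul1r.
  by apply: lerD; rewrite le_max lexx ?orbT.
rewrite powRM//; apply: ler_wpM2l; first exact: powR_ge0.
by rewrite /c; case: (leP `|a| `|b|) => _; rewrite ?lerDl ?lerDr powR_ge0.
Qed.

Lemma pnormD A B : pnorm (A + B) <= 2 `^ p * (pnorm A + pnorm B).
Proof.
rewrite /pnorm -big_split mulr_sumr; apply: ler_sum => i _.
rewrite -big_split mulr_sumr; apply: ler_sum => j _.
by rewrite mxE powR_normD.
Qed.

Lemma frobenius_powR_le A : frobenius A `^ p <= ((m * n)%:R `^ p) * pnorm A.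
Proof.
have s0 : 0 <= \sum_i \sum_j `|A i j| by apply: sumr_ge0 => i _; exact: sumr_ge0.
have H1 : frobenius A <= \sum_i \sum_j `|A i j|.
  rewrite /frobenius -(ger0_norm s0) -sqrtr_sqr; apply: ler_wsqrtr.
  rewrite expr2 mulr_suml; apply: ler_sum => i _.
  rewrite mulr_suml; apply: ler_sum => j _.
  rewrite -[A i j ^+ 2]real_normK ?num_real// expr2 ler_wpM2l//.
  rewrite (bigD1 i)//= (bigD1 j)//= -addrA lerDl addr_ge0//; first exact: sumr_ge0.
  by apply: sumr_ge0 => k _; exact: sumr_ge0.
have H2 : \sum_i \sum_j `|A i j| <= (m * n)%:R * pnorm A `^ p^-1.
  have H i j : `|A i j| <= pnorm A `^ p^-1.
    have -> : `|A i j| = (`|A i j| `^ p) `^ p^-1 by rewrite -powRrM divff// powRr1.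
    apply: ge0_ler_powR; rewrite ?nnegrE ?invr_ge0 ?powR_ge0 ?pnorm_ge0//.
    exact: coord_le_pnorm.
  apply: (@le_trans _ _ (\sum_(i < m) \sum_(j < n) pnorm A `^ p^-1)).
    by apply: ler_sum => i _; apply: ler_sum => j _; exact: H.
  by rewrite !sumr_const !card_ord -mulrnA mulr_natl mulnC.
apply: (@le_trans _ _ (((m * n)%:R * pnorm A `^ p^-1) `^ p)).
  by apply: ge0_ler_powR; rewrite ?nnegrE ?sqrtr_ge0 ?mulr_ge0 ?powR_ge0//; exact: le_trans H2.
rewrite powRM ?powR_ge0// -powRrM mulVf// powRr1 ?pnorm_ge0//.
Qed.

Lemma coord_le_frobenius A i j : `|A i j| <= frobenius A.
Proof.
rewrite /frobenius -sqrtr_sqr; apply: ler_wsqrtr.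
rewrite (bigD1 i)//= (bigD1 j)//= -addrA lerDl addr_ge0//.
  by apply: sumr_ge0 => k _; exact: sqr_ge0.
by apply: sumr_ge0 => k _; apply: sumr_ge0 => l _; exact: sqr_ge0.
Qed.

Lemma pnorm_le_frobenius A : pnorm A <= (m * n)%:R * frobenius A `^ p.
Proof.
apply: (@le_trans _ _ (\sum_(i < m) \sum_(j < n) frobenius A `^ p)).
  apply: ler_sum => i _; apply: ler_sum => j _.
  by apply: ge0_ler_powR; rewrite ?nnegrE ?sqrtr_ge0//; exact: coord_le_frobenius.
by rewrite !sumr_const !card_ord -mulrnA mulr_natl mulnC.
Qed.

Variables (a1 a2 a3 : R).
Hypothesis a1_gt0 : 0 < a1.
Hypothesis a2_gt0 : 0 < a2.
Hypothesis a3_gt0 : 0 < a3.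

Lemma growth_upper : exists2 c, 0 <= c & forall W : 'M[R]_(m, n) -> R,
  pgrowth_class a1 a2 a3 p W -> forall A, W A <= c * (1 + pnorm A).
Proof.
have b0 : 0 <= (m * n)%:R `^ p :> R by exact: powR_ge0.
exists (a3 * (1 + (m * n)%:R `^ p)); first by rewrite mulr_ge0 ?addr_ge0// ltW.
move=> W [_ _ HW] A; have /andP[_ H] := HW A; apply: le_trans H _.
rewrite -mulrA; apply: ler_wpM2l; first exact: ltW.
have := frobenius_powR_le A; have := pnorm_ge0 A.
set x := pnorm A; set y := _ `^ p; set z := _ `^ p => x0 zyx.
by rewrite mulrDl mul1r mulrDr mulr1; have : 0 <= z by []; lra.
Qed.

Lemma growth_lower : exists T c, [/\ 0 <= T, 0 <= c & forall W : 'M[R]_(m, n) -> R,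
  pgrowth_class a1 a2 a3 p W -> forall A, pnorm A <= T + c * W A].
Proof.
exists ((m * n)%:R * (a2 / a1)), ((m * n)%:R / a1); split.
- by rewrite mulr_ge0// divr_ge0// ltW.
- by rewrite divr_ge0// ltW.
move=> W [_ _ HW] A; have /andP[H _] := HW A; apply: le_trans (pnorm_le_frobenius A) _.
rewrite -mulrA -mulrDr; apply: ler_wpM2l => //.
rewrite (mulrC a1^-1) -mulrDl ler_pdivlMr// mulrC; lra.
Qed.

End PowerNorm.

Lemma cvg_dist0 (R : realType) (F : set_system nat) (FF : Filter F) (u : nat -> R) (a : R) :
  `|u k - a| @[k --> F] --> 0 -> u k @[k --> F] --> a.
Proof.
move=> /cvgrPdist_le H; apply/cvgrPdist_le => e /H; apply: filterS => k.
by rewrite sub0r normrN normr_id distrC.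
Qed.

Section UnitCell.
Variables (R : realType) (n : nat).
Local Notation mu := (@lebesgue_Rn R n).

Lemma unit_cellE : @unit_cell R n = cube (const_mx 2^-1) 2^-1.
Proof.
apply/funext => x; apply/propext; split => H j; have := H j; rewrite ?mxE ltr_distl; lra.
Qed.

Lemma measurable_unit_cell : measurable (@unit_cell R n : set (Rn R n)).
Proof. by rewrite unit_cellE; exact: measurable_cube. Qed.

Lemma unit_cell_lty : (mu (@unit_cell R n) < +oo)%E.
Proof. by rewrite unit_cellE; exact: lebesgue_cube_lty. Qed.

Lemma near_at_right_le (P : R -> Prop) : (exists2 d, 0 < d & forall s, 0 < s <= d -> P s) ->
  \forall s \near 0^'+, P s.
Proof.
move=> [d d0 Hd]; near=> s; apply: Hd; apply/andP; split; first by near: s; exact: nbhs_right_gt.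
by near: s; exact: nbhs_right_le.
Unshelve. all: by end_near. Qed.

Lemma cube_subset_compact (c : 'rV[R]_n) r : exists2 K : set 'rV[R]_n, compact K & cube c r `<=` K.
Proof.
have [r' _ H] := cube_subset0 c r.
exists [set x : 'rV[R]_n | forall j, x 0 j \in `[- r', r']]; first exact: closed_cube_compact.
move=> x /H xr j; rewrite in_itv/=; have := xr j; rewrite mxE subr0 ltr_norml.
by move=> /andP[/ltW -> /ltW ->].
Qed.

Lemma locint_ge0 (f : 'rV[R]_n -> R) : measurable_fun [set: Rn R n] f -> (forall x, 0 <= f x) ->
  (forall c r, (\int[mu]_(x in cube c r) (f x)%:E < +oo)%E) -> locint f.
Proof.
move=> mf f0 H; split=> // c r.
exact: (@integrable_EFin_lty _ (Rn R n) R mu _ _ (measurable_cube c r) mf f0 (H c r)).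
Qed.

Lemma Lq_loc_powR_locint p (f : 'rV[R]_n -> R) : 0 < p -> Lq_loc p%:E f -> locint (fun x => `|f x| `^ p).
Proof.
move=> p0 [mf fK].
have mfp : measurable_fun [set: Rn R n] (fun x => `|f x| `^ p).
  exact: (measurableT_comp (measurable_powR p) (measurable_norm_Rn mf)).
apply: (locint_ge0 mfp) => [x|c r]; first exact: powR_ge0.
have [K cK HK] := cube_subset_compact c r.
have mK : measurable (K : set (Rn R n)) by apply: closed_measurable_Rn; exact: compact_closed.
have := fK K cK; rewrite (@Lnorm_restrict_lty _ (Rn R n) R mu f K p p0 mK); apply: le_lt_trans.
apply: (@subset_integral_EFin _ (Rn R n) R mu _ _ _ (measurable_cube c r) mK mfp) => //.
Qed.

Lemma locint_sum (I : Type) (s : seq I) (f : I -> 'rV[R]_n -> R) : (forall i, locint (f i)) ->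
  locint (fun x => \sum_(i <- s) f i x).
Proof.
move=> lf; elim: s => [|i s IH].
  by rewrite (_ : (fun x => _) = fun=> 0); [exact: locint_cst|apply/funext => x; rewrite big_nil].
rewrite (_ : (fun x => _) = (fun x => f i x + \sum_(i <- s) f i x)); first exact: locintD.
by apply/funext => x; rewrite big_cons.
Qed.

Lemma moll_sum (vol0 : 0 < cube_vol R n) (I : Type) (r : seq I) (f : I -> 'rV[R]_n -> R) s x : 0 < s ->
  (forall i, locint (f i)) -> moll s (fun x => \sum_(i <- r) f i x) x = \sum_(i <- r) moll s (f i) x.
Proof.
move=> s0 lf; elim: r => [|i r IH].
  rewrite big_nil /moll /conv (_ : Rintegral _ _ _ = 0) ?mul0r//.
  by under eq_Rintegral do rewrite big_nil mul0r; rewrite /Rintegral integral0.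
have lr := locint_sum r lf.
rewrite big_cons -IH (mollE x s0 (lf i)) (mollE x s0 lr) mollE//; last exact: locint_sum.
have E := @RintegralD _ (Rn R n) R mu _ _ _ measurableT (mker_mul_integrable vol0 x s0 (lf i)) (mker_mul_integrable vol0 x s0 lr).
rewrite -E; apply: eq_Rintegral => z _; rewrite big_cons mulrDl//.
Qed.

Lemma C1_div f (g : 'I_n -> 'rV[R]_n -> R) a : C1 f g -> C1 (fun x => f x / a) (fun j x => g j x / a).
Proof.
move=> Cf; split=> [j x|j x].
  have := @is_deriveZ R _ _ f a^-1 x (delta_mx 0 j) (g j x) (Cf.1 j x).
  by rewrite [_ *: g j x]mulrC (_ : a^-1 \*: f = fun x => f x / a)//; apply/funext => y /=; rewrite mulrC.
by apply: (@continuousM _ _ (g j) (fun=> a^-1)); [exact: Cf.2|exact: cst_continuous].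
Qed.

Lemma C1_periodic f (g : 'I_n -> 'rV[R]_n -> R) z : C1 f g -> (forall x, f (x + z) = f x) ->
  forall j x, g j (x + z) = g j x.
Proof.
move=> Cf fz j x.
have H y : k.+1%:R * (f (y + k.+1%:R^-1 *: delta_mx 0 j) - f y) @[k --> \oo] --> g j y.
  have := @C1_direction _ _ f g y (delta_mx 0 j) Cf.
  rewrite (bigD1 j)//= big1 ?addr0; last by move=> i /negbTE ij; rewrite mxE eqxx ij mul0r.
  by rewrite mxE !eqxx mul1r.
apply: (@cvg_unique _ (@Rhausdorff R) _ _ _ _ (H (x + z))).
rewrite (_ : (fun k => _) = (fun k => k.+1%:R * (f (x + k.+1%:R^-1 *: delta_mx 0 j) - f x))); first exact: H.
by apply/funext => k; rewrite addrAC !fz.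
Qed.

Lemma C1_moll (vol0 : 0 < cube_vol R n) m (u : 'rV[R]_n -> 'cV[R]_m) G s i : 0 < s -> is_weak_gradient u G ->
  C1 (moll s (fun z => u z i 0)) (fun j => moll s (fun z => G z i j)).
Proof. by move=> s0 uG; exact: (C1_div _ (C1_conv_weak _ i s0 uG)). Qed.

End UnitCell.

(** * Smooth periodic almost minimizers *)

Section Mixture.
Variables (R : realType) (m n N : nat) (p : R).
Local Notation mu := (@lebesgue_Rn R n).
Hypothesis p1 : 1 < p.
Variables (a1 a2 a3 : R).
Hypothesis a3_gt0 : 0 < a3.
Variables (P : 'I_N -> set 'rV[R]_n).
Hypothesis hP : measurable_partition P (@unit_cell R n).
Variable (W : 'I_N -> 'M[R]_(m, n) -> R).
Hypothesis hW : forall i, pgrowth_class a1 a2 a3 p (W i).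

Lemma mixtureE i y A : P i y -> mixture P W y A = W i A.
Proof.
move=> Piy; have [_ /trivIsetP tP _] := hP.
rewrite /mixture (bigD1 i)//= indicE mem_set// mul1r big1 ?addr0// => j ji.
rewrite indicE memNset ?mul0r// => Pjy.
by have := tP _ _ I I ji; rewrite -subset0 => /(_ y)[].
Qed.

Lemma mixture_cell y : unit_cell y -> exists i, mixture P W y = W i.
Proof.
have [_ _ <-] := hP; move=> [i _ Piy]; exists i; apply/funext => A; exact: mixtureE.
Qed.

Lemma mixture_ge0 y A : 0 <= mixture P W y A.
Proof.
apply: sumr_ge0 => i _; apply: mulr_ge0; last by have [_ H _] := hW i; exact: H.
by rewrite indicE.
Qed.

Lemma measurable_mixture (G : 'rV[R]_n -> 'M[R]_(m, n)) :
  (forall i j, measurable_fun [set: Rn R n] (fun x => G x i j)) ->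
  measurable_fun [set: Rn R n] (fun y => mixture P W y (G y)).
Proof.
move=> mG; rewrite /mixture; apply: measurable_sum => i.
apply: measurable_funM; first by apply: measurable_indic_Rn; have [H _ _] := hP; exact: H.
by apply: (@measurable_comp_mx R _ (Rn R n)) => //; have [] := hW i.
Qed.

Lemma measurable_addmx (xi : 'M[R]_(m, n)) (G : 'rV[R]_n -> 'M[R]_(m, n)) :
  (forall i j, measurable_fun [set: Rn R n] (fun x => G x i j)) ->
  forall i j, measurable_fun [set: Rn R n] (fun x => (xi + G x) i j).
Proof.
move=> mG i j; rewrite (_ : (fun x => _) = (fun x => xi i j + G x i j)); last by apply/funext => x; rewrite mxE.
by apply: measurable_funD.
Qed.

Lemma measurable_pnorm (G : 'rV[R]_n -> 'M[R]_(m, n)) :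
  (forall i j, measurable_fun [set: Rn R n] (fun x => G x i j)) ->
  measurable_fun [set: Rn R n] (fun y => pnorm p (G y)).
Proof.
move=> mG; apply: measurable_sum => i; apply: measurable_sum => j.
by apply: (measurableT_comp (measurable_powR p)); exact: measurable_norm_Rn.
Qed.

Lemma mixture_cvg (A : nat -> 'M[R]_(m, n)) (A0 : 'M[R]_(m, n)) y :
  (forall i j, A k i j @[k --> \oo] --> A0 i j) ->
  mixture P W y (A k) @[k --> \oo] --> mixture P W y A0.
Proof.
move=> AA0; apply: cvg_sum_ord => i; apply: cvgMr.
have [cW _ _] := hW i; apply: (@continuous_cvg _ _ _ _ _ A (W i) A0); first exact: cW.
apply/(@cvgrPdist_le _ 'M[R]_(m, n)) => e e0.
have H : \forall k \near \oo, forall a b, `|A0 a b - A k a b| <= e.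
  apply: filter_forall => a'; apply: filter_forall => b'.
  by move/cvgrPdist_le : (AA0 a' b') => /(_ e e0).
near=> k; apply: norm_le_coord; first exact: ltW.
by move=> a b; rewrite !mxE; move: a b; near: k.
Unshelve. all: by end_near. Qed.

(** An almost minimizer is mollified along scales with summable errors, so that the gradients
    converge almost everywhere on the cell. Jensen's inequality bounds the energies by the
    mollifications of [pnorm p (Gp x)]. These vary with [k] but converge in [L^1], which is the
    situation of [limsup_integral_le_dom]. *)
Lemma periodic_approx (vol0 : 0 < cube_vol R n) xi : cell_integrand p (mixture P W) xi = 0%E ->
  forall d, 0 < d -> exists (u : 'rV[R]_n -> 'cV[R]_m) (H : 'rV[R]_n -> 'M[R]_(m, n)),
  [/\ forall i, C1 (fun x => u x i 0) (fun j x => H x i j),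
      forall (z : 'rV[int]_n) x, u (x + map_mx intr z) = u x,
      forall (z : 'rV[int]_n) x, H (x + map_mx intr z) = H x &
      (\int[mu]_(y in @unit_cell R n) (mixture P W y (xi + H y))%:E <= d%:E)%E].
Proof.
move=> cell0 d d0; have d20 : 0 < d / 2 by lra.
have [_ [phi [G [Wphi phiG ->]]] Jlt] : exists2 J, [set J | exists (phi : 'rV[R]_n -> 'cV[R]_m) (G : 'rV[R]_n -> 'M[R]_(m, n)),
    [/\ W1q_per p%:E phi, is_weak_gradient phi G &
        J = (\int[mu]_(y in @unit_cell R n) (mixture P W y (xi + G y))%:E)%E]] J & (J < (d / 2)%:E)%E.
  by apply: ereal_inf_lt; rewrite -/(cell_integrand _ _ _) cell0 lte_fin.
have [[_ [Gp phiGp LGp]] phiper] := Wphi.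
have mQ := @measurable_unit_cell R n.
have [Lphi LG _] := phiG; have [_ LGp1 _] := phiGp.
have lphi i := locint_Lq_loc1 (Lphi i).
have lGp i j := locint_Lq_loc1 (LGp1 i j).
have lG i j := locint_Lq_loc1 (LG i j).
have mGp i j : measurable_fun [set: Rn R n] (fun x => Gp x i j) := (lGp i j).1.
have mmix (G' : 'rV[R]_n -> 'M[R]_(m, n)) : (forall i j, measurable_fun [set: Rn R n] (fun x => G' x i j)) ->
    measurable_fun [set: Rn R n] (fun y => mixture P W y (xi + G' y)).
  by move=> mG'; apply: measurable_mixture; exact: measurable_addmx.
(* [Gp] is the gradient with [p]-integrable entries provided by [W1q_per], while [G] is the one in
   the energy. *)
have intE : (\int[mu]_(y in @unit_cell R n) (mixture P W y (xi + G y))%:E =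
    \int[mu]_(y in @unit_cell R n) (mixture P W y (xi + Gp y))%:E)%E.
  apply: (@ae_eq_integral _ (Rn R n) R mu _ _ _ mQ).
  - exact: (@measurable_EFinS _ (Rn R n) R _ _ (mmix G (fun i j => (lG i j).1))).
  - exact: (@measurable_EFinS _ (Rn R n) R _ _ (mmix Gp mGp)).
  - by apply: ae_imply (weak_gradient_unique vol0 phiG phiGp) => x Hx _; rewrite Hx.
rewrite intE in Jlt.
have p0 : 0 < p by have := p1; lra.
have lGpp i j : locint (fun x => `|Gp x i j| `^ p) by exact: Lq_loc_powR_locint.
pose g x := pnorm p (Gp x).
have lg : locint g by apply: locint_sum => i; exact: locint_sum.
have [c c0 Hc] := growth_upper m n p1 a1 a2 a3_gt0.
have [s [s0 sG sg]] : exists s : nat -> R, [/\ forall k, 0 < s k,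
    forall k i j, (\int[mu]_(x in @unit_cell R n) (`|moll (s k) (fun x => Gp x i j) x - Gp x i j|)%:E <= ((2 ^ k.+1)%:R^-1)%:E)%E &
    forall k, (\int[mu]_(x in @unit_cell R n) (`|moll (s k) g x - g x|)%:E <= ((2 ^ k.+1)%:R^-1)%:E)%E].
  have : forall k, exists t, [/\ 0 < t,
    forall i j, (\int[mu]_(x in @unit_cell R n) (`|moll t (fun x => Gp x i j) x - Gp x i j|)%:E <= ((2 ^ k.+1)%:R^-1)%:E)%E &
    (\int[mu]_(x in @unit_cell R n) (`|moll t g x - g x|)%:E <= ((2 ^ k.+1)%:R^-1)%:E)%E].
    move=> k; have e0 : 0 < (2 ^ k.+1)%:R^-1 :> R by rewrite invr_gt0 ltr0n expn_gt0.
    have near1 f : locint f -> \forall t \near 0^'+,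
        (\int[mu]_(x in @unit_cell R n) (`|moll t f x - f x|)%:E <= ((2 ^ k.+1)%:R^-1)%:E)%E.
      by move=> lf; rewrite unit_cellE; apply: near_at_right_le; exact: moll_L1_cube.
    have near2 : \forall t \near (0 : R)^'+, forall i j,
        (\int[mu]_(x in @unit_cell R n) (`|moll t (fun x => Gp x i j) x - Gp x i j|)%:E <= ((2 ^ k.+1)%:R^-1)%:E)%E.
      by apply: filter_forall => i; apply: filter_forall => j; exact: near1.
    near (0 : R)^'+ => t; exists t; split; first by near: t; exact: nbhs_right_gt.
      by near: t.
    by near: t; exact: near1.
  by move=> /choice[s Hs]; exists s; split=> k; have [] := Hs k.
pose H k x : 'M[R]_(m, n) := \matrix_(i, j) moll (s k) (fun x => Gp x i j) x.
have mH k i j : measurable_fun [set: Rn R n] (fun x => H k x i j).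
  rewrite (_ : (fun x => _) = moll (s k) (fun x => Gp x i j)); last by apply/funext => x; rewrite mxE.
  exact: measurable_moll.
(* The constant that absorbs [xi]: the growth bound at [xi + A] becomes a multiple of [1 + b]
   whenever [b] bounds [pnorm p A]. *)
pose c' := c * (1 + 2 `^ p * (1 + pnorm p xi)).
have t0 : 0 <= 2 `^ p :> R by exact: powR_ge0.
have x0 := pnorm_ge0 p xi.
have c'0 : 0 <= c' by rewrite mulr_ge0// addr_ge0// mulr_ge0// addr_ge0.
have mix_le y A b : unit_cell y -> pnorm p A <= b -> mixture P W y (xi + A) <= c' * (1 + b).
  move=> /mixture_cell[i ->] Ab; apply: le_trans (Hc _ (hW i) _) _.
  rewrite /c' -mulrA; apply: ler_wpM2l => //.
  apply: (@le_trans _ _ (1 + 2 `^ p * (pnorm p xi + b))).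
    by rewrite lerD2l; apply: le_trans (pnormD p1 _ _) _; rewrite ler_wpM2l// lerD2l.
  have b0 : 0 <= b by exact: le_trans (pnorm_ge0 p A) Ab.
  have : 0 <= 2 `^ p * (pnorm p xi * b) by rewrite !mulr_ge0.
  by set q := 2 `^ p in t0 *; set X := pnorm p xi in x0 *; move: t0 x0 b0; nra.
have Hg k x : pnorm p (H k x) <= moll (s k) g x.
  apply: (@le_trans _ _ (\sum_i \sum_j moll (s k) (fun x => `|Gp x i j| `^ p) x)).
    apply: ler_sum => i _; apply: ler_sum => j _; rewrite mxE.
    exact: moll_norm_powR.
  rewrite /g /pnorm (moll_sum vol0 _ x (s0 k) (fun i => locint_sum _ (lGpp i))).
  by apply: ler_sum => i _; rewrite (moll_sum vol0 _ x (s0 k) (lGpp i)).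
have qmg k : measurable_fun [set: Rn R n] (moll (s k) g) by exact: measurable_moll.
have near_le := @limsup_integral_le_dom _ (Rn R n) R mu (@unit_cell R n) mQ c'
  (fun k y => mixture P W y (xi + H k y)) (fun y => mixture P W y (xi + Gp y))
  (fun k y => moll (s k) g y) g c'0 (@unit_cell_lty R n).
have [||||||||k _ Hk] := near_le _ _ _ _ _ _ _ _ _ d20.
- by move=> k; exact: (measurable_funS measurableT (@subsetT _ _) (mmix (H k) (mH k))).
- exact: (measurable_funS measurableT (@subsetT _ _) (mmix Gp mGp)).
- by move=> k; exact: (measurable_funS measurableT (@subsetT _ _) (qmg k)).
- by rewrite unit_cellE; exact: lg.2.
- by move=> k x xQ; rewrite mixture_ge0/=; exact: mix_le.
- by move=> x xQ; rewrite mixture_ge0/=; exact: mix_le.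
- have ae1 i j : {ae mu, forall x : Rn R n, unit_cell x -> `|moll (s k) (fun x => Gp x i j) x - Gp x i j| @[k --> \oo] --> 0}.
    have mF k := measurable_norm_Rn (measurable_funB (measurable_moll (s0 k) (lGp i j)) (mGp i j)).
    have F0 k x : 0 <= `|moll (s k) (fun x => Gp x i j) x - Gp x i j| by [].
    exact: (@ae_cvg0_summable_integral _ (Rn R n) R mu _ mQ _
      (fun k => measurable_funS measurableT (@subsetT _ _) (mF k)) F0 (fun k => sG k i j)).
  apply: ae_imply (ae_forall_fin (fun i => ae_forall_fin (ae1 i))) => x Hx xQ.
  apply: mixture_cvg => i j; rewrite [X in _ --> X]mxE.
  under eq_fun do rewrite !mxE.
  by apply: cvgD; [exact: cvg_cst|exact: (cvg_dist0 _ (Hx i j xQ))].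
- apply: (@squeeze_cvge _ _ _ _ (cst 0%E) _ (fun k => (harmonic k)%:E)); last 2 first.
  + exact: cvg_cst.
  + by apply: cvg_EFin; [near=> k|exact: cvg_harmonic].
  near=> k; rewrite integral_ge0//=; apply: le_trans (sg k) _.
  by rewrite lee_fin lef_pV2 ?posrE ?ltr0n ?expn_gt0// ler_nat ltnW// ltn_expl.
pose u x : 'cV[R]_m := \col_i moll (s k) (fun x => phi x i 0) x.
have Cu i : C1 (fun x => u x i 0) (fun j x => H k x i j).
  rewrite (_ : (fun x => u x i 0) = moll (s k) (fun x => phi x i 0)); last by apply/funext => x; rewrite mxE.
  rewrite (_ : (fun j x => _) = fun j => moll (s k) (fun x => Gp x i j)); last by apply/funext => j; apply/funext => x; rewrite mxE.
  exact: C1_moll.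
have uper (z : 'rV[int]_n) x : u (x + map_mx intr z) = u x.
  apply/colP => i; rewrite !mxE; apply: moll_periodic => //.
  by apply: ae_imply (phiper z) => y ->.
exists u, (H k); split=> [//|//|z x|].
  apply/matrixP => i j.
  by apply: (C1_periodic (Cu i)) => y; rewrite uper.
apply: le_trans (Hk _ (leqnn k)) _.
have -> : d%:E = ((d / 2)%:E + (d / 2)%:E)%E :> \bar R by rewrite -EFinD -splitr.
by rewrite leeD2r// ltW.
Unshelve. all: by end_near. Qed.

End Mixture.

(** * Periodic functions and the excess energy *)

Section AbstractIntegral.
Context d (T : measurableType d) (R : realType) (mu : {measure set T -> \bar R}).

Lemma le_ae_integral_EFin (f g : T -> R) : measurable_fun setT f -> measurable_fun setT g ->
  (forall x, 0 <= f x) -> (forall x, 0 <= g x) -> {ae mu, forall x, f x <= g x} ->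
  (\int[mu]_x (f x)%:E <= \int[mu]_x (g x)%:E)%E.
Proof.
move=> mf mg f0 g0 fg; apply: ae_ge0_le_integral => //.
- by move=> x _; rewrite lee_fin.
- exact: measurable_EFinS.
- by move=> x _; rewrite lee_fin.
- exact: measurable_EFinS.
- by apply: filterS fg => x fgx _; rewrite lee_fin.
Qed.

Lemma integral_indic_mul (f : T -> R) (D : set T) :
  (\int[mu]_(x in D) (f x)%:E = \int[mu]_x (f x * \1_D x)%:E)%E.
Proof.
rewrite integral_mkcond; apply: eq_integral => x _.
by rewrite patchE indicE; case: ifPn => _; rewrite ?mulr1// mulr0.
Qed.

End AbstractIntegral.

Section PeriodicIntegral.
Variables (R : realType) (n : nat).
Local Notation mu := (@lebesgue_Rn R n).

Lemma measurable_mul_indic (f : 'rV[R]_n -> R) (D : set 'rV[R]_n) : measurable_fun [set: Rn R n] f ->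
  measurable (D : set (Rn R n)) -> measurable_fun [set: Rn R n] (fun x => f x * \1_D x).
Proof. by move=> mf mD; apply: measurable_funM => //; exact: measurable_indic_Rn. Qed.

Lemma ae_coord_neq (j : 'I_n) (a : R) : {ae mu, forall x : 'rV[R]_n, x 0 j <> a}.
Proof.
exists [set x : 'rV[R]_n | x 0 j = a]; split.
- apply: closed_measurable_Rn.
  have -> : [set x : 'rV[R]_n | x 0 j = a] = (fun x : 'rV[R]_n => x 0 j) @^-1` [set a] by [].
  by apply: closed_comp => [x _|]; [exact: coord_continuous|exact: closed_eq].
- exact: lebesgue_outer_hyperplane.
- by move=> x /= /contrapT.
Qed.

Definition periodic (T : Type) (f : 'rV[R]_n -> T) := forall (z : 'rV[int]_n) x, f (x + map_mx intr z) = f x.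

Lemma integer_shift (L : nat) (x : 'rV[R]_n) : cube 0 L%:R x ->
  (forall j (a : 'I_L.*2.+1), x 0 j <> a%:R - L%:R) ->
  exists g : {ffun 'I_n -> 'I_L.*2.+1}, unit_cell (x - map_mx intr (\row_j ((g j)%:Z - L%:Z))).
Proof.
move=> xL xa.
have H j : exists a : 'I_L.*2.+1, a%:R - L%:R < x 0 j < a%:R - L%:R + 1.
  have := xL j; rewrite mxE subr0 ltr_norml => /andP[x1 x2].
  pose t := x 0 j + L%:R; have t0 : 0 <= t by rewrite /t; lra.
  have /andP[tl tu] := truncn_itv t0.
  have tL : (Num.truncn t < L.*2.+1)%N.
    rewrite ltnS -(ler_nat R) (le_trans tl)// /t -addnn natrD; lra.
  exists (Ordinal tL); rewrite /= -natr1 in tu *.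
  have := xa j (Ordinal tL); rewrite /= => ne.
  have : (Num.truncn t)%:R - L%:R != x 0 j by apply/eqP => /esym.
  by move: tl tu; rewrite /t => tl tu ne'; rewrite lt_neqAle ne'/=; lra.
have [g Hg] := choice H.
exists (finfun g) => j; rewrite !mxE ffunE rmorphB/=; have := Hg j.
by rewrite -!pmulrn; lra.
Qed.

(** Up to null hyperplanes the cube lies in finitely many integer translates of the cell, each with
    the same integral. Their number [K] depends on [L] only. *)
Lemma periodic_integral_cube (L : nat) : exists K : nat, forall f : 'rV[R]_n -> R,
  measurable_fun [set: Rn R n] f -> (forall x, 0 <= f x) -> periodic f ->
  (\int[mu]_(x in cube (0 : 'rV[R]_n) L%:R) (f x)%:E <= K%:R%:E * \int[mu]_(x in @unit_cell R n) (f x)%:E)%E.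
Proof.
exists #|{ffun 'I_n -> 'I_L.*2.+1}| => f mf f0 fper.
have mQ := @measurable_unit_cell R n.
have E1 := @integral_indic_mul _ (Rn R n) R mu f (cube 0 L%:R).
have E2 := @integral_indic_mul _ (Rn R n) R mu f (@unit_cell R n).
rewrite E1 E2.
pose z (g : {ffun 'I_n -> 'I_L.*2.+1}) : 'rV[R]_n := map_mx intr (\row_j ((g j)%:Z - L%:Z)).
pose h x := f x * \1_(@unit_cell R n) x.
have mh : measurable_fun [set: Rn R n] h by exact: measurable_mul_indic.
have h0 x : 0 <= h x by rewrite mulr_ge0// indicE.
have mhz g : measurable_fun [set: Rn R n] (fun x => h (x + - z g)).
  exact: (measurableT_comp mh (@measurable_translate R n (- z g))).
apply: (@le_trans _ _ (\int[mu]_x (\sum_g h (x + - z g))%:E)%E).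
  apply: (@le_ae_integral_EFin _ (Rn R n) R mu _ _ (measurable_mul_indic mf (measurable_cube _ _)) (measurable_sum _ mhz)).
  - by move=> x; rewrite mulr_ge0// indicE.
  - by move=> x; apply: sumr_ge0.
  - have ae1 := ae_forall_fin (fun j => ae_forall_fin (fun a : 'I_L.*2.+1 => ae_coord_neq j (a%:R - L%:R))).
    apply: ae_imply ae1 => x Hx.
    have [xL|nx] := pselect (cube 0 L%:R x); last first.
      by rewrite indicE memNset// mulr0; apply: sumr_ge0.
    rewrite indicE mem_set// mulr1; have [g Hg] := integer_shift xL Hx.
    rewrite (bigD1 g)//= {1}/h indicE mem_set// mulr1.
    have <- : f x = f (x - z g).
      by rewrite -[in LHS](subrK (z g) x) /z fper.
    by rewrite lerDl; apply: sumr_ge0.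
have sumE := @integral_EFin_sum _ (Rn R n) R mu _ (index_enum {ffun 'I_n -> 'I_L.*2.+1}) setT (fun g x => h (x + - z g)) measurableT mhz (fun g x => h0 _).
rewrite sumE.
rewrite (eq_bigr (fun=> \int[mu]_x (h x)%:E)%E); last first.
  move=> g _; exact: (@ge0_integral_translateT R n (- z g) (EFin \o h) (@measurable_EFinS _ (Rn R n) R setT h mh) (fun x => h0 x)).
by rewrite sumr_const mule_natl.
Qed.

End PeriodicIntegral.

Section MollifierBounds.
Variables (R : realType) (n : nat).
Local Notation mu := (@lebesgue_Rn R n).
Hypothesis vol0 : 0 < cube_vol R n.
Implicit Types (f g : 'rV[R]_n -> R) (x y : 'rV[R]_n).

Lemma moll_norm_le f g s x : 0 < s -> locint f -> locint g -> (forall x, `|f x| <= g x) ->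
  `|moll s f x| <= moll s g x.
Proof.
move=> s0 lf lg fg; rewrite (mollE x s0 lf) (mollE x s0 lg).
have If := mker_mul_integrable vol0 x s0 lf; have Ig := mker_mul_integrable vol0 x s0 lg.
apply: le_trans (@le_normr_Rintegral _ (Rn R n) R mu setT _ measurableT If) _.
apply: (@le_Rintegral _ (Rn R n) R mu setT _ _ measurableT _ Ig).
  exact: (@integrable_norm _ (Rn R n) R mu _ _ If).
by move=> z _; rewrite normrM (ger0_norm (mker_ge0 vol0 x z s0)) ler_wpM2r// mker_ge0.
Qed.

Lemma moll_addl a f s x : 0 < s -> locint f -> moll s (fun x => a + f x) x = a + moll s f x.
Proof.
move=> s0 lf; have la := @locint_cst R n a.
rewrite (mollE x s0 (locintD la lf)) (mollE x s0 lf).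
have I1 := mker_mul_integrable vol0 x s0 la; have I2 := mker_mul_integrable vol0 x s0 lf.
have E := @RintegralD _ (Rn R n) R mu _ _ _ measurableT I1 I2.
under eq_Rintegral do rewrite mulrDl.
rewrite E; congr (_ + _).
have E2 := @RintegralZl _ (Rn R n) R mu _ _ a measurableT (mker_integrable vol0 x s0).
by rewrite E2 mker_mass// mulr1.
Qed.

(** The normalised kernel is at most a constant over [s^n]. This is the origin of the power of [s]
    in the gradient bound. *)
Lemma moll_le_integral : exists2 B, 0 <= B & forall f s x E, 0 < s -> locint f -> (forall x, 0 <= f x) ->
  (\int[mu]_(y in cube x s) (f y)%:E <= E%:E)%E -> moll s f x <= B * (E / s ^+ n).
Proof.
have [B B0 HB] := mker_le vol0; exists (B / cube_vol R n); first by rewrite divr_ge0// ltW.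
move=> f s x E s0 lf f0 fE; rewrite mollE//; apply: le_trans (ler_norm _) _.
apply: le_trans (locint_mul_le lf (measurable_mker s x) (C := B / (s ^+ n * cube_vol R n)) (c := x) (r := s) _ _) _.
- by move=> z; rewrite ger0_norm ?mker_ge0//; exact: HB.
- by move=> z; exact: mker_out.
have -> : B / cube_vol R n * (E / s ^+ n) = B / (s ^+ n * cube_vol R n) * E by rewrite invfM; ring.
apply: ler_wpM2l; first by rewrite divr_ge0 ?mulr_ge0 ?exprn_ge0// ltW.
rewrite -lee_fin /Rintegral fineK.
  by apply: le_trans fE; rewrite le_eqVlt; apply/orP; left; apply/eqP; apply: eq_integral => z _; rewrite ger0_norm.
exact: (@integrable_fin_num _ (Rn R n) R mu _ (measurable_cube x s) _ ((locint_norm lf).2 x s)).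
Qed.

End MollifierBounds.

Section Excess.
Variables (R : realType) (m n N : nat) (p : R).
Local Notation mu := (@lebesgue_Rn R n).
Hypothesis p1 : 1 < p.
Variables (a1 a2 a3 : R).
Variables (P : 'I_N -> set 'rV[R]_n).
Hypothesis hP : measurable_partition P (@unit_cell R n).
Variable (W : 'I_N -> 'M[R]_(m, n) -> R).
Hypothesis hW : forall i, pgrowth_class a1 a2 a3 p (W i).
Variables (T c : R).
Hypothesis T0 : 0 <= T.
Hypothesis c0 : 0 <= c.
Hypothesis W_low : forall i A, pnorm p A <= T + c * W i A.
Variable xi : 'M[R]_(m, n).

(** In contrast to [pnorm] it is bounded by a multiple of the energy, so its integral over bounded
    sets is small for approximants. *)
Definition excess (A : 'M[R]_(m, n)) : R := Num.max 0 (pnorm p A - T).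

Lemma excess_ge0 A : 0 <= excess A. Proof. by rewrite le_max lexx. Qed.

Lemma pnorm_le_excess A : pnorm p A <= T + excess A.
Proof. by rewrite -lerBlDl le_max lexx orbT. Qed.

Lemma excess_le_mixture y A : unit_cell y -> excess A <= c * mixture P W y A.
Proof.
move=> yQ; rewrite ge_max mulr_ge0 ?(mixture_ge0 _ hW)//=.
by have [i ->] := mixture_cell hP W yQ; rewrite lerBlDl.
Qed.

Lemma measurable_excess (G : 'rV[R]_n -> 'M[R]_(m, n)) :
  (forall i j, measurable_fun [set: Rn R n] (fun x => G x i j)) ->
  measurable_fun [set: Rn R n] (fun y => excess (G y)).
Proof.
move=> mG; apply: measurable_maxr; first exact: measurable_cst.
by apply: measurable_funB; [exact: measurable_pnorm|exact: measurable_cst].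
Qed.

Definition approximant (d : R) (H : 'rV[R]_n -> 'M[R]_(m, n)) :=
  [/\ forall i j, continuous (fun x => H x i j), periodic H &
      (\int[mu]_(y in @unit_cell R n) (mixture P W y (xi + H y))%:E <= d%:E)%E].

Lemma approximant_measurable d H : approximant d H ->
  forall i j, measurable_fun [set: Rn R n] (fun x => (xi + H x) i j).
Proof. by move=> [cH _ _]; apply: measurable_addmx => i j; exact: continuous_measurable_Rn. Qed.

Lemma excess_integral (L : nat) : exists2 K : R, 0 <= K & forall d H, approximant d H ->
  (\int[mu]_(x in cube (0 : 'rV[R]_n) L%:R) (excess (xi + H x))%:E <= (K * d)%:E)%E.
Proof.
have [K HK] := @periodic_integral_cube R n L.
exists (K%:R * c); first by rewrite mulr_ge0.
move=> d H aH; have [cH perH Hd] := aH.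
have mF := approximant_measurable aH; have mE := measurable_excess mF.
have mix := measurable_mixture hP hW mF.
have mQ := @measurable_unit_cell R n.
apply: (le_trans (HK _ mE (fun x => excess_ge0 _) _)).
  by move=> z x; rewrite /= perH.
rewrite -mulrA EFinM lee_wpmul2l ?lee_fin//.
apply: (@le_trans _ _ (\int[mu]_(y in @unit_cell R n) (c * mixture P W y (xi + H y))%:E)%E).
  apply: (@le_integral_EFin _ (Rn R n) R mu _ _ _ mQ mE (measurable_funM (measurable_cst c) mix)).
  by move=> x xQ; rewrite excess_ge0/=; exact: excess_le_mixture.
have E := @integral_EFinZ _ (Rn R n) R mu _ c _ mQ mix (fun x => mixture_ge0 P hW x _) c0.
by rewrite E EFinM lee_wpmul2l// lee_fin.
Qed.

Lemma pnorm_integral (L : nat) : exists2 K : R, 0 <= K & forall d H D, approximant d H ->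
  measurable (D : set (Rn R n)) -> D `<=` cube 0 L%:R ->
  (\int[mu]_(x in D) (pnorm p (xi + H x))%:E <= T%:E * mu D + (K * d)%:E)%E.
Proof.
have [K K0 HK] := excess_integral L; exists K => // d H D aH mD DL.
have mF := approximant_measurable aH; have mE := measurable_excess mF.
have mp := measurable_pnorm p mF.
apply: (@le_trans _ _ (\int[mu]_(x in D) (T%:E) + \int[mu]_(x in D) (excess (xi + H x))%:E)%E).
  apply: (@le_integral_EFinD _ (Rn R n) R mu _ _ (fun=> T) _ mD mp (measurable_cst T) mE) => //.
    by move=> x _; rewrite pnorm_ge0/=; exact: pnorm_le_excess.
  by move=> x; exact: excess_ge0.
apply: leeD; first by rewrite (@integral_cst _ (Rn R n) R mu _ mD).
apply: le_trans (HK d H aH).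
exact: (@subset_integral_EFin _ (Rn R n) R mu _ _ _ mD (measurable_cube _ _) mE (fun x => excess_ge0 _) DL).
Qed.

Lemma integer_translate (x : 'rV[R]_n) : exists z : 'rV[int]_n, forall j, 0 <= (x - map_mx intr z) 0 j < 1.
Proof.
exists (\row_j Num.floor (x 0 j)) => j; rewrite !mxE.
by have /andP[] := floor_itv (x 0 j); rewrite intrD1; lra.
Qed.

Hypothesis vol0 : 0 < cube_vol R n.

Lemma moll_gradient_bound : exists M K : R, [/\ 0 <= M, 0 <= K & forall s d H, 0 < s <= 1 -> approximant d H ->
  forall x i j, `|moll s (fun x => H x i j) x| <= M + K * (d / s ^+ n)].
Proof.
have [K K0 HK] := excess_integral 2; have [B B0 HB] := moll_le_integral vol0.
(* Each entry of [H] is at most the sum of those of [xi + H] and [xi]; the inequality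
   [|a| <= 1 + |a|^p], applied to both, gives the [2], and [T] is the threshold of the excess. *)
pose C := pnorm p xi + 2 + T.
have C0 : 0 <= C by rewrite !addr_ge0// pnorm_ge0.
exists C, (B * K); split=> //; first by rewrite mulr_ge0.
move=> s d H /andP[s0 s1] aH x i j; have [cH perH _] := aH.
(* By periodicity the point is moved into the half-open cell, so that for [s <= 1] the support of
   the kernel lies in [cube 0 2]. *)
have [z Hz] := integer_translate x; set y := x - map_mx intr z in Hz.
have lH : locint (fun x => H x i j) by exact: continuous_locint.
have -> : moll s (fun x => H x i j) x = moll s (fun x => H x i j) y.
  rewrite /y -[in LHS](subrK (map_mx intr z) x); apply: moll_periodic => //.
  by apply: aeW => w; rewrite perH.
pose e x := excess (xi + H x).
have mF := approximant_measurable aH; have mE := measurable_excess mF.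
have e0 x' : 0 <= e x' by exact: excess_ge0.
have abs1 (a : R) : `|a| <= 1 + `|a| `^ p.
  have [a1'|a1'] := leP `|a| 1; first by rewrite (le_trans a1')// lerDl powR_ge0.
  rewrite (@le_trans _ _ (`|a| `^ p))// ?lerDr//.
  by rewrite -[X in X <= _]powRr1// ler_powR// ltW.
have He x' : `|H x' i j| <= C + e x'.
  have -> : H x' i j = (xi + H x') i j - xi i j by rewrite mxE addrC addKr.
  apply: le_trans (ler_normB _ _) _.
  have h1 := abs1 ((xi + H x') i j); have h2 := abs1 (xi i j).
  have h3 := coord_le_pnorm p (xi + H x') i j; have h4 := coord_le_pnorm p xi i j.
  have h5 := pnorm_le_excess (xi + H x'); rewrite /C /e; lra.
have le : locint e.
  apply: (locint_ge0 mE e0) => w r; have [r' r'0 Hr] := cube_subset0 w r.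
  have [K' _ HK'] := excess_integral (Num.truncn r').+1.
  apply: (le_lt_trans _ (ltry (K' * d))); apply: le_trans (HK' d H aH).
  apply: (@subset_integral_EFin _ (Rn R n) R mu _ _ _ (measurable_cube w r) (measurable_cube _ _) mE e0).
  by move=> v /Hr; apply: cube_le; exact/ltW/truncnS_gt.
have lC := @locint_cst R n C.
apply: (@le_trans _ _ (moll s (fun x => C + e x) y)).
  exact: (moll_norm_le vol0 y s0 lH (locintD lC le) He).
rewrite (moll_addl vol0 C y s0 le) lerD2l -mulrA mulrA; apply: le_trans (HB e s y (K * d) s0 le e0 _) _; last by rewrite !mulrA.
apply: le_trans (HK d H aH).
apply: (@subset_integral_EFin _ (Rn R n) R mu _ _ _ (measurable_cube y s) (measurable_cube _ _) mE e0).
move=> v vy k; rewrite mxE subr0; have := vy k; have := Hz k.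
by rewrite ltr_distl ltr_norml; lra.
Qed.

End Excess.

(** * A Poincare inequality for mollification *)

Section AbstractTools.
Context d (T : measurableType d) (R : realType).

Lemma powR_mean (p : R) N (a : 'I_N.+1 -> R) : 1 < p -> (forall i, 0 <= a i) ->
  (N.+1%:R^-1 * \sum_i a i) `^ p <= N.+1%:R^-1 * \sum_i a i `^ p.
Proof.
move=> p1 a0; set M := N.+1%:R^-1 * _.
have M0 : 0 <= M by rewrite mulr_ge0// sumr_ge0.
rewrite mulrC ler_pdivlMr// mulr_natr.
have -> : M `^ p *+ N.+1 = \sum_(i < N.+1) (M `^ p + p * (M `^ (p - 1)) * (a i - M)).
  rewrite big_split/= sumr_const card_ord -mulr_sumr sumrB sumr_const card_ord.
  by rewrite (_ : \sum_i a i = M *+ N.+1) ?subrr ?mulr0 ?addr0// -mulr_natl /M mulrA divff// mul1r.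
by apply: ler_sum => i _; exact: powR_tangent.
Qed.

Lemma powR_sum_le (p : R) n (a : 'I_n -> R) : 1 < p -> (forall i, 0 <= a i) ->
  (\sum_i a i) `^ p <= n%:R `^ p * \sum_i a i `^ p.
Proof.
move=> p1 a0; have p0 : 0 < p by lra.
set S := \sum_i a i `^ p; have S0 : 0 <= S by apply: sumr_ge0 => i _; exact: powR_ge0.
have H i : a i <= S `^ p^-1.
  have -> : a i = (a i `^ p) `^ p^-1 by rewrite -powRrM divff ?gt_eqF// powRr1.
  apply: ge0_ler_powR; rewrite ?nnegrE ?powR_ge0 ?invr_ge0 ?(ltW p0)//.
  by rewrite /S (bigD1 i)//= lerDl sumr_ge0// => j _; exact: powR_ge0.
apply: (@le_trans _ _ ((n%:R * S `^ p^-1) `^ p)).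
  apply: ge0_ler_powR; rewrite ?nnegrE ?sumr_ge0 ?mulr_ge0 ?powR_ge0 ?(ltW p0)//.
  by apply: le_trans (ler_sum _ (fun i _ => H i)) _; rewrite sumr_const card_ord mulr_natl.
by rewrite powRM ?powR_ge0// -powRrM mulVf ?gt_eqF// powRr1.
Qed.

Lemma norm_powR_lipschitz (p c x y : R) : 1 < p -> `|x| <= c -> `|y| <= c ->
  `| `|x| `^ p - `|y| `^ p| <= p * c `^ (p - 1) * `|x - y|.
Proof.
move=> p1 xc yc; have p0 : 0 <= p by lra.
have H (a b : R) : `|a| <= c -> `|a| `^ p - `|b| `^ p <= p * c `^ (p - 1) * `|a - b|.
  move=> ac; have := powR_tangent p1 (normr_ge0 a) (normr_ge0 b).
  have h1 : `|a| `^ (p - 1) <= c `^ (p - 1).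
    by apply: ge0_ler_powR; rewrite ?nnegrE//; [lra|exact: le_trans ac].
  have h2 : `|a| - `|b| <= `|a - b| by exact: lerB_dist.
  have h3 : 0 <= `|a| `^ (p - 1) by exact: powR_ge0.
  have h4 : p * (`|a| `^ (p - 1)) * (`|a| - `|b|) <= p * c `^ (p - 1) * `|a - b|.
    apply: le_trans (_ : p * (`|a| `^ (p - 1)) * `|a - b| <= _).
      by apply: ler_wpM2l => //; rewrite mulr_ge0.
    by apply: ler_wpM2r => //; apply: ler_wpM2l.
  lra.
by rewrite ler_norml; have := H x y xc; have := H y x yc; rewrite (distrC y); lra.
Qed.

Lemma continuous_norm_powR (p : R) : 1 < p -> continuous (fun y : R => `|y| `^ p).
Proof.
move=> p1 y; have p0 : 0 <= p by lra.
pose c := `|y| + 1; pose K := p * c `^ (p - 1).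
have K0 : 0 <= K by rewrite mulr_ge0// powR_ge0.
apply/cvgrPdist_le => e e0; near=> x.
have x1 : `|y - x| <= 1 by near: x; exact: cvgr_dist_le.
apply: le_trans (norm_powR_lipschitz (c := c) p1 _ _) _.
- by rewrite /c; lra.
- rewrite /c -{1}(subKr y x); apply: le_trans (ler_normB _ _) _; lra.
have xe : `|y - x| <= e / (K + 1).
  by near: x; apply: cvgr_dist_le => //; rewrite divr_gt0// ltr_wpDl.
rewrite -/K; rewrite ler_pdivlMr ?ltr_wpDl// in xe; apply: le_trans xe.
by rewrite mulrC ler_wpM2l// lerDl.
Unshelve. all: by end_near. Qed.

Lemma le_integral_of_dominated_cvg (mu : {measure set T -> \bar R}) (D : set T) (h : nat -> T -> R) (h_ g : T -> R) (A : \bar R) :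
  measurable D -> (forall k, measurable_fun setT (h k)) -> measurable_fun setT h_ ->
  (forall x, D x -> h k x @[k --> \oo] --> h_ x) -> mu.-integrable D (EFin \o g) ->
  (forall k x, D x -> `|h k x| <= g x) -> (forall k, A <= \int[mu]_(x in D) (h k x)%:E)%E ->
  (A <= \int[mu]_(x in D) (h_ x)%:E)%E.
Proof.
move=> mD mh mh_ hh gi hg Ah.
have [||||hi _ H] := @dominated_convergence _ T R mu D mD (fun k => EFin \o h k) (EFin \o h_) (EFin \o g) _ _ _ gi.
- by move=> k; exact: measurable_EFinS.
- exact: measurable_EFinS.
- apply: aeW => x Dx; apply: cvg_EFin; last exact: hh.
  by near=> k.
- by apply: aeW => x k Dx; rewrite lee_fin hg.
rewrite -(cvg_lim _ H)//; apply: lime_ge; first by apply/cvg_ex; eexists; exact: H.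
by near=> k; exact: Ah.
Unshelve. all: by end_near. Qed.

(** Tonelli puts the integral in [x] inside, and a weighted mean of quantities at most [C] is at
    most [C]. The bound is asked for only where the kernel is nonzero, that is, for small shifts. *)
Lemma tonelli_kernel_le (mu : {sigma_finite_measure set T -> \bar R}) (D : set T) (F : T * T -> R) (k : T -> R) (C : R) :
  measurable D -> measurable_fun setT F -> (forall z, 0 <= F z) ->
  measurable_fun setT k -> (forall h, 0 <= k h) -> mu.-integrable setT (EFin \o k) -> \int[mu]_h k h = 1 ->
  0 <= C -> (forall h, (k h != 0)%R -> \int[mu]_(x in D) (F (x, h))%:E <= C%:E)%E ->
  (\int[mu]_(x in D) \int[mu]_h (F (x, h) * k h)%:E <= C%:E)%E.
Proof.
move=> mD mF F0 mk k0 ki k1 C0 HC.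
have mFs h : measurable_fun setT (fun x => F (x, h)) by exact: (measurableT_comp mF (measurable_pair2 h)).
pose G z := (F z * k z.2 * \1_D z.1)%:E : \bar R.
have mG : measurable_fun setT G.
  apply/measurable_EFinP; apply: measurable_funM.
    by apply: measurable_funM => //; exact: (measurable_pair_snd mk).
  have mI : measurable_fun setT (\1_D : T -> R) by exact: measurable_indic.
  exact: (measurableT_comp mI measurable_fst).
have G0 z : (0 <= G z)%E by rewrite lee_fin !mulr_ge0// indicE.
have -> : (\int[mu]_(x in D) \int[mu]_h (F (x, h) * k h)%:E = \int[mu]_x \int[mu]_h G (x, h))%E.
  rewrite integral_mkcond; apply: eq_integral => x _; rewrite patchE /G/= indicE.
  case: ifPn => _; first by under [RHS]eq_integral do rewrite mulr1.
  by under eq_integral do rewrite mulr0; rewrite integral0.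
rewrite fubini_tonelli//.
apply: (@le_trans _ _ (\int[mu]_h (C * k h)%:E)%E).
  apply: ge0_le_integral => //.
  - by move=> h _; exact: integral_ge0.
  - exact: (@measurable_fun_fubini_tonelli_G _ _ _ _ _ mu _ mG G0).
  - by apply/measurable_EFinP; apply: measurable_funM.
  - move=> h _; rewrite /G/=.
    have [kh0|kh0] := eqVneq (k h) 0.
      by rewrite kh0 mulr0; under eq_integral do rewrite mulr0 mul0r; rewrite integral0.
    have E : (\int[mu]_x (F (x, h) * k h * \1_D x)%:E = (k h)%:E * \int[mu]_(x in D) (F (x, h))%:E)%E.
      rewrite -integral_EFinZ// [RHS]integral_indic_mul; apply: eq_integral => x _.
      by rewrite (mulrC (k h)).
    by rewrite E EFinM muleC lee_wpmul2r ?lee_fin//; exact: HC.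
rewrite integral_EFinZ//.
have -> : (\int[mu]_h (k h)%:E = 1)%E by rewrite -k1 fineK//; exact: integrable_fin_num.
by rewrite mule1.
Qed.

End AbstractTools.

Section Poincare.
Variables (R : realType) (n : nat) (p : R).
Local Notation mu := (@lebesgue_Rn R n).
Let lebS : {sigma_finite_measure set (Rn R n) -> \bar R} := @lebesgue_Rn R n.
Hypothesis p1 : 1 < p.
Implicit Types (f : 'rV[R]_n -> R) (x y h : 'rV[R]_n).

Let p0 : 0 < p. Proof. by have := p1; lra. Qed.

Lemma integral_shift_le (w : 'rV[R]_n -> R) h (L : R) : measurable_fun [set: Rn R n] w ->
  (forall x, 0 <= w x) -> `|h| <= 1 ->
  (\int[mu]_(x in cube (0 : 'rV[R]_n) L) (w (x + h))%:E <= \int[mu]_(x in cube (0 : 'rV[R]_n) (L + 1)) (w x)%:E)%E.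
Proof.
move=> mw w0 h1.
have mwh : measurable_fun [set: Rn R n] (fun x => w (x + h)) by exact: (measurableT_comp mw (@measurable_translate R n h)).
pose v x := w x * \1_(cube (0 : 'rV[R]_n) (L + 1)) x.
have mv : measurable_fun [set: Rn R n] v by exact: (measurable_mul_indic mw (measurable_cube _ _)).
have v0 x : 0 <= v x by rewrite mulr_ge0// indicE.
have E1 := @integral_indic_mul _ (Rn R n) R mu (fun x => w (x + h)) (cube 0 L).
have E2 := @integral_indic_mul _ (Rn R n) R mu w (cube 0 (L + 1)).
have E3 := @ge0_integral_translateT R n h (EFin \o v) (@measurable_EFinS _ (Rn R n) R setT v mv) (fun x => v0 x).
rewrite E1 E2; apply: le_trans (_ : (\int[mu]_x (v (x + h))%:E <= _)%E); last by rewrite le_eqVlt; apply/orP; left; apply/eqP; exact: E3.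
have mvh : measurable_fun [set: Rn R n] (fun x => v (x + h)) by exact: (measurableT_comp mv (@measurable_translate R n h)).
apply: (@le_integral_EFin _ (Rn R n) R mu _ _ _ measurableT (measurable_mul_indic mwh (measurable_cube _ _)) mvh).
move=> x _; rewrite mulr_ge0 ?indicE//=.
have [xL|nx] := pselect (cube 0 L x); last by rewrite memNset// mulr0 v0.
rewrite mem_set// mulr1 /v indicE mem_set ?mulr1// => j.
have := xL j; have := coord_le_norm h 0 j; rewrite !mxE !subr0 => hj xj.
by apply: le_lt_trans (ler_normD _ _) _; lra.
Qed.

Lemma C1_difference_quotient f g h k : C1 f g -> forall x,
  `|f (x + h) - f x| `^ p <= k.+1%:R^-1 * \sum_(a < k.+1) `|k.+1%:R * (f ((x + a%:R *: (k.+1%:R^-1 *: h)) + k.+1%:R^-1 *: h) - f (x + a%:R *: (k.+1%:R^-1 *: h)))| `^ p.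
Proof.
move=> Cf x; set h' := k.+1%:R^-1 *: h.
have -> : f (x + h) - f x = k.+1%:R^-1 * \sum_(a < k.+1) k.+1%:R * (f ((x + a%:R *: h') + h') - f (x + a%:R *: h')).
  rewrite -mulr_sumr mulrA mulVf// mul1r.
  have -> : h = k.+1%:R *: h' by rewrite /h' scalerA divff// scale1r.
  rewrite -(big_mkord predT (fun a => f ((x + a%:R *: h') + h') - f (x + a%:R *: h'))).
  rewrite (eq_bigr (fun a => f (x + a.+1%:R *: h') - f (x + a%:R *: h'))).
    by rewrite telescope_sumr// scale0r addr0.
  by move=> a _; rewrite -[a.+1%:R]natr1 scalerDl scale1r addrA.
apply: le_trans (powR_mean p1 _); last by [].
apply: ge0_ler_powR; rewrite ?nnegrE ?(ltW p0)//; first by rewrite mulr_ge0// sumr_ge0.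
rewrite normrM ger0_norm ?invr_ge0//; apply: ler_wpM2l => //.
exact: ler_norm_sum.
Qed.

(* Cut the shift into k + 1 equal steps, use convexity and translation invariance, and let k grow: no
   integration along segments is needed. *)
Lemma shift_Lp f (g : 'I_n -> 'rV[R]_n -> R) h (L I : R) : C1 f g -> `|h| <= 1 ->
  (\int[mu]_(x in cube (0 : 'rV[R]_n) (L + 1)) (\sum_j `|g j x| `^ p)%:E <= I%:E)%E ->
  (\int[mu]_(x in cube (0 : 'rV[R]_n) L) (`|f (x + h) - f x| `^ p)%:E <= (`|h| `^ p * n%:R `^ p * I)%:E)%E.
Proof.
move=> Cf h1 gI.
have cf := C1_continuous Cf; have mf := continuous_measurable_Rn cf.
have mp (w : 'rV[R]_n -> R) : measurable_fun [set: Rn R n] w -> measurable_fun [set: Rn R n] (fun x => `|w x| `^ p).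
  by move=> mw; exact: (measurableT_comp (measurable_powR p) (measurable_norm_Rn mw)).
have msh y : measurable_fun [set: Rn R n] (fun x => f (x + y)) by exact: (measurableT_comp mf (@measurable_translate R n y)).
pose e k : 'rV[R]_n := k.+1%:R^-1 *: h.
pose Phi k x := `|k.+1%:R * (f (x + e k) - f x)| `^ p.
have mPhi k : measurable_fun [set: Rn R n] (Phi k).
  exact: (mp _ (measurable_funM (measurable_cst _) (measurable_funB (msh (e k)) mf))).
have Phi0 k x : 0 <= Phi k x by exact: powR_ge0.
have mg j := continuous_measurable_Rn (Cf.2 j).
have mlim : measurable_fun [set: Rn R n] (fun x => `|\sum_j h 0 j * g j x| `^ p).
  by apply: mp; apply: measurable_sum => j; exact: (measurable_funM (measurable_cst _) (mg j)).
have step k : (\int[mu]_(x in cube (0 : 'rV[R]_n) L) (`|f (x + h) - f x| `^ p)%:E <=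
    \int[mu]_(x in cube (0 : 'rV[R]_n) (L + 1)) (Phi k x)%:E)%E.
  have mPa (a : 'I_k.+1) : measurable_fun [set: Rn R n] (fun x => Phi k (x + a%:R *: e k)).
    exact: (measurableT_comp (mPhi k) (@measurable_translate R n (a%:R *: e k))).
  have H1 := @le_integral_EFin _ (Rn R n) R mu (cube 0 L) (fun x => `|f (x + h) - f x| `^ p)
    (fun x => k.+1%:R^-1 * \sum_(a < k.+1) Phi k (x + a%:R *: e k)) (measurable_cube _ _)
    (mp _ (measurable_funB (msh h) mf)) (measurable_funM (measurable_cst _) (measurable_sum _ mPa)).
  apply: le_trans (H1 _) _.
    by move=> x _; rewrite powR_ge0/=; exact: (C1_difference_quotient h k Cf x).
  have k0 : 0 <= k.+1%:R^-1 :> R by rewrite invr_ge0.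
  have E1 := @integral_EFinZ _ (Rn R n) R mu (cube 0 L) k.+1%:R^-1 (fun x => \sum_(a < k.+1) Phi k (x + a%:R *: e k))
    (measurable_cube _ _) (measurable_sum _ mPa) (fun x => sumr_ge0 _ (fun a _ => Phi0 k _)) k0.
  have E2 := @integral_EFin_sum _ (Rn R n) R mu _ (index_enum 'I_k.+1) (cube 0 L) (fun a x => Phi k (x + a%:R *: e k))
    (measurable_cube _ _) mPa (fun a x => Phi0 k _).
  rewrite E1 E2.
  apply: (@le_trans _ _ (k.+1%:R^-1%:E * \sum_(a < k.+1) \int[mu]_(x in cube (0 : 'rV[R]_n) (L + 1)) (Phi k x)%:E)%E).
    rewrite lee_wpmul2l ?lee_fin//; apply: lee_sum => a _; apply: integral_shift_le => //.
    rewrite /e scalerA normrZ ger0_norm ?mulr_ge0//.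
    rewrite mulr_ile1// ?mulr_ge0//; rewrite ler_pdivrMr// mul1r ler_nat; exact: ltnW.
  have -> : (\sum_(a < k.+1) \int[mu]_(x in cube (0 : 'rV[R]_n) (L + 1)) (Phi k x)%:E =
      k.+1%:R%:E * \int[mu]_(x in cube (0 : 'rV[R]_n) (L + 1)) (Phi k x)%:E)%E.
    by rewrite sumr_const card_ord mule_natl.
  by rewrite muleA -EFinM mulVf// mul1e.
have [M M0 HM] : exists2 M : R, 0 <= M & forall j x, cube 0 (L + 2) x -> `|g j x| <= M.
  have /choice[M HM] : forall j, exists M : R, 0 <= M /\ forall x, cube 0 (L + 2) x -> `|g j x| <= M.
    by move=> j; have [M M0 H] := continuous_bounded_cube 0 (L + 2) (Cf.2 j); exists M.
  exists (\sum_j M j); first by apply: sumr_ge0 => j _; have [] := HM j.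
  move=> j x xL; have [_ H] := HM j; apply: le_trans (H x xL) _.
  by rewrite (bigD1 j)//= lerDl sumr_ge0// => i _; have [] := HM i.
apply: (@le_trans _ _ (\int[mu]_(x in cube (0 : 'rV[R]_n) (L + 1)) (`|\sum_j h 0 j * g j x| `^ p)%:E)%E).
  apply: (@le_integral_of_dominated_cvg _ (Rn R n) R mu (cube 0 (L + 1)) Phi _ (fun=> (n%:R * M * `|h|) `^ p) _
    (measurable_cube _ _) mPhi mlim) => //.
  - move=> x _; have := @C1_direction _ _ f g x h Cf; move=> H.
    rewrite /Phi; apply: (@continuous_cvg _ _ _ _ _ (fun k => k.+1%:R * (f (x + e k) - f x)) (fun y : R => `|y| `^ p) (\sum_j h 0 j * g j x)); last exact: H.
    exact: continuous_norm_powR.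
  - exact: integrable_cst_cube.
  - move=> k x xL; rewrite ger0_norm// /Phi; apply: ge0_ler_powR; rewrite ?nnegrE ?mulr_ge0 ?(ltW p0)//.
    rewrite normrM ger0_norm//.
    have ek : `|e k| = k.+1%:R^-1 * `|h| by rewrite normrZ ger0_norm// invr_ge0.
    have ek1 : `|e k| <= 1 by rewrite ek mulr_ile1// invf_le1// ler1n.
    have H := @C1_lipschitz_on _ _ f g x (e k) M Cf.
    apply: le_trans (ler_wpM2l _ (H _ M0)) _ => //.
      move=> j y ye; apply: HM => i; rewrite mxE subr0.
      have := coord_le_norm (y - x) 0 i; have := xL i; rewrite !mxE subr0.
      by move=> h2 h3; rewrite -(subrK (x 0 i) (y 0 i)); apply: le_lt_trans (ler_normD _ _) _; lra.
    by rewrite ek le_eqVlt; apply/orP; left; apply/eqP; field.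
have q0 : 0 <= `|h| `^ p * n%:R `^ p by rewrite mulr_ge0 ?powR_ge0.
have mS : measurable_fun [set: Rn R n] (fun x => \sum_j `|g j x| `^ p) by apply: measurable_sum => j; exact: (mp _ (mg j)).
have S0 x : 0 <= \sum_j `|g j x| `^ p by apply: sumr_ge0 => j _; exact: powR_ge0.
apply: (@le_trans _ _ (\int[mu]_(x in cube (0 : 'rV[R]_n) (L + 1)) (`|h| `^ p * n%:R `^ p * \sum_j `|g j x| `^ p)%:E)%E).
  apply: (@le_integral_EFin _ (Rn R n) R mu _ _ _ (measurable_cube _ _) mlim (measurable_funM (measurable_cst _) mS)).
  move=> x _; rewrite powR_ge0/= -mulrA.
  apply: (@le_trans _ _ ((`|h| * \sum_j `|g j x|) `^ p)).
    apply: ge0_ler_powR; rewrite ?nnegrE ?mulr_ge0 ?sumr_ge0 ?(ltW p0)//.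
    apply: le_trans (ler_norm_sum _ _ _) _; rewrite mulr_sumr; apply: ler_sum => j _.
    by rewrite normrM ler_wpM2r// coord_le_norm.
  rewrite powRM ?sumr_ge0//; apply: ler_wpM2l; first exact: powR_ge0.
  exact: powR_sum_le.
have E := @integral_EFinZ _ (Rn R n) R mu (cube 0 (L + 1)) _ _ (measurable_cube _ _) mS S0 q0.
rewrite E [leRHS]EFinM; apply: lee_wpmul2l; [by rewrite lee_fin|exact: gI].
Qed.

(** Jensen's inequality for the mean of [f - f x]. The kernel is recentred at [0], so that it
    depends on the shift [h] alone, as [tonelli_kernel_le] requires. *)
Lemma moll_powR_le (vol0 : 0 < cube_vol R n) f s x : 0 < s -> continuous f ->
  ((`|f x - moll s f x| `^ p)%:E <= \int[mu]_h (`|f (x + h) - f x| `^ p * mker s 0 h)%:E)%E.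
Proof.
move=> s0 cf; pose w z := - f x + f z.
have cw : continuous w by move=> z; apply: (@continuousD _ _ _ (fun=> - f x) f); [exact: cst_continuous|exact: cf].
have cwp : continuous (fun z => `|w z| `^ p).
  move=> z; apply: (@continuous_comp _ _ _ w (fun y : R => `|y| `^ p)); [exact: cw|exact: continuous_norm_powR].
have lw := continuous_locint cw; have lwp := continuous_locint cwp.
have -> : f x - moll s f x = - moll s w x.
  by rewrite /w (moll_addl vol0 _ _ s0 (continuous_locint cf)); ring.
rewrite normrN; apply: le_trans (_ : (moll s (fun z => `|w z| `^ p) x)%:E <= _)%E.
  by rewrite lee_fin; exact: moll_norm_powR.
have I1 := mker_mul_integrable vol0 x s0 lwp.
rewrite (mollE x s0 lwp) /Rintegral fineK; last exact: (@integrable_fin_num _ (Rn R n) R mu _ measurableT _ I1).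
have mI : measurable_fun setT (EFin \o (fun z : Rn R n => `|w z| `^ p * mker s x z)).
  exact: (@measurable_EFinS _ (Rn R n) R _ _ (measurable_funM lwp.1 (measurable_mker s x))).
have E := @ge0_integral_translateT R n x _ mI.
rewrite le_eqVlt; apply/orP; left; apply/eqP; apply: etrans (esym (E _)) _.
  by move=> z; rewrite lee_fin mulr_ge0 ?powR_ge0// mker_ge0.
apply: eq_integral => z _ /=; congr (_%:E); rewrite /w addrC (addrC x); congr (_ * _).
by rewrite /mker kern_shift addrK.
Qed.

(** The shift estimate [shift_Lp] averaged over the shifts in [cube 0 s], whence the factor
    [s^p]. *)
Lemma moll_Lp (vol0 : 0 < cube_vol R n) f (g : 'I_n -> 'rV[R]_n -> R) s (L I : R) : C1 f g -> 0 < s <= 1 -> 0 <= I ->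
  (\int[mu]_(x in cube (0 : 'rV[R]_n) (L + 1)) (\sum_j `|g j x| `^ p)%:E <= I%:E)%E ->
  (\int[mu]_(x in cube (0 : 'rV[R]_n) L) (`|f x - moll s f x| `^ p)%:E <= (s `^ p * n%:R `^ p * I)%:E)%E.
Proof.
move=> Cf /andP[s0 s1] I0 gI.
have cf := C1_continuous Cf; have mf := continuous_measurable_Rn cf.
pose F (z : Rn R n * Rn R n) : R := `|f ((z.1 : 'rV[R]_n) + z.2) - f z.1| `^ p.
have mF : measurable_fun setT F.
  apply: (measurableT_comp (measurable_powR p)); apply: (measurableT_comp (@normr_measurable R setT)).
  apply: measurable_funB; last exact: (measurableT_comp mf measurable_fst).
  apply: (@measurable_comp_mx R _ _ _ _ (fun z : Rn R n * Rn R n => (z.1 : 'rV[R]_n) + z.2) f _ cf) => i j.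
  rewrite (_ : (fun _ => _) = (fun z : Rn R n * Rn R n => (z.1 : 'rV[R]_n) i j + (z.2 : 'rV[R]_n) i j)); last first.
    by apply/funext => z; rewrite !mxE.
  apply: measurable_funD.
    exact: (measurableT_comp (measurable_coord i j) measurable_fst).
  exact: (measurableT_comp (measurable_coord i j) measurable_snd).
pose C := s `^ p * n%:R `^ p * I.
have C0 : 0 <= C by rewrite !mulr_ge0 ?powR_ge0.
have HC h : mker s 0 h != 0 -> (\int[mu]_(x in cube (0 : 'rV[R]_n) L) (F (x, h))%:E <= C%:E)%E.
  move=> kh; have hs : cube 0 s h by apply: contrapT => /(mker_out s0) k0; rewrite k0 eqxx in kh.
  move/(cubeP _ _ s0) : hs; rewrite subr0 => hs.
  apply: le_trans (shift_Lp Cf (ltW (lt_le_trans hs s1)) gI) _.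
  rewrite lee_fin; apply: ler_wpM2r => //; apply: ler_wpM2r; first exact: powR_ge0.
  by apply: ge0_ler_powR; rewrite ?nnegrE ?(ltW p0) ?(ltW s0)// ltW.
have H := @tonelli_kernel_le _ (Rn R n) R lebS (cube 0 L) F (mker s 0) C (measurable_cube _ _) mF (fun z => powR_ge0 _ _)
  (measurable_mker s 0) (fun h => mker_ge0 vol0 0 h s0) (mker_integrable vol0 0 s0) (mker_mass vol0 0 s0) C0 HC.
apply: le_trans H.
have mm := measurable_moll s0 (continuous_locint cf).
apply: (@ge0_le_integral _ (Rn R n) R mu (cube 0 L) (measurable_cube _ _)).
- by move=> x _; rewrite lee_fin powR_ge0.
- apply: (@measurable_EFinS _ (Rn R n) R _ _ (measurableT_comp (measurable_powR p) (measurable_norm_Rn (measurable_funB mf mm)))).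
- pose G (z : Rn R n * Rn R n) : \bar R := (F z * mker s 0 z.2)%:E.
  have mG : measurable_fun setT G.
    by apply/measurable_EFinP; apply: measurable_funM => //; exact: (measurableT_comp (measurable_mker s 0) measurable_snd).
  have G0 z : (0 <= G z)%E by rewrite lee_fin mulr_ge0 ?powR_ge0// mker_ge0.
  have := @measurable_fun_fubini_tonelli_F _ _ (Rn R n) (Rn R n) R lebS _ mG G0.
  exact: (measurable_funS measurableT (@subsetT _ _)).
- by move=> x _; exact: moll_powR_le.
Qed.

End Poincare.

(** * Compactness *)

Section UltraLimits.
Variables (R : realType) (n : nat).
Local Notation mu := (@lebesgue_Rn R n).
Let lebS : {sigma_finite_measure set (Rn R n) -> \bar R} := @lebesgue_Rn R n.
Variables (U : set_system nat).
Hypothesis UU : UltraFilter U.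
Let PU : ProperFilter U. Proof. exact: ultra_proper. Qed.
#[local] Existing Instance PU.
Implicit Types (f : 'rV[R]_n -> R) (x y : 'rV[R]_n).

(* Ultrafilter form of Arzela-Ascoli: test the limit against an ultralimit of the points of worst approximation. *)
Lemma equi_lipschitz_ultra_limit (v : nat -> 'rV[R]_n -> R) (La : R) : 0 <= La ->
  (forall k x y, `|v k x - v k y| <= La * `|x - y|) -> (forall k, v k 0 = 0) ->
  exists f : 'rV[R]_n -> R, [/\ forall x y, `|f x - f y| <= La * `|x - y|, forall x, v k x @[k --> U] --> f x &
    forall (L e : R), 0 < e -> \forall k \near U, forall x, cube 0 L x -> `|v k x - f x| <= e].
Proof.
move=> La0 vL v0.
have /choice[f fE] : forall x, exists l : R, v k x @[k --> U] --> l.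
  move=> x; have [|l _ H] := @ultra_limit R U UU (fun k => v k x) (- (La * `|x|)) (La * `|x|); last by exists l.
  by apply: nearW => k; rewrite -ler_norml; have := vL k x 0; rewrite v0 !subr0.
have fL x y : `|f x - f y| <= La * `|x - y|.
  have H := cvgB (fE x) (fE y).
  by apply: (cvg_norm_le_near PU (H _)); apply: nearW => k; exact: vL.
exists f; split=> // L e e0.
have /choice[z zP] : forall k, exists z, cube 0 (`|L| + 1) z /\
    (`|v k z - f z| <= e -> forall x, cube 0 L x -> `|v k x - f x| <= e).
  move=> k; have [H|/existsNP[z /not_implyP[zL zN]]] := pselect (forall x, cube 0 L x -> `|v k x - f x| <= e).
    by exists 0; split=> // j; rewrite mxE subrr normr0 ltr_wpDl.
  by exists z; split=> //; apply: cube_le zL; have := ler_norm L; lra.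
have /choice[w wE] : forall j, exists l : R, z k 0 j @[k --> U] --> l.
  move=> j; have [|l _ H] := @ultra_limit R U UU (fun k => z k 0 j) (- (`|L| + 1)) (`|L| + 1); last by exists l.
  by apply: nearW => k; rewrite -ler_norml; have [/(_ j) H _] := zP k; rewrite mxE subr0 in H; exact: ltW.
pose x0 : 'rV[R]_n := \row_j w j.
pose d := e / (4 * (La + 1)).
have d0 : 0 < d by rewrite divr_gt0// mulr_gt0// ltr_wpDl.
have H1 : \forall k \near U, forall j, `|w j - z k 0 j| <= d.
  by apply: filter_forall => j; move/cvgrPdist_le : (wE j) => /(_ d d0).
have H2 : \forall k \near U, `|f x0 - v k x0| <= e / 2.
  by move/cvgrPdist_le : (fE x0) => /(_ (e / 2)); apply; lra.
near=> k.
have zk : `|z k - x0| <= d.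
  apply: norm_le_coord; first exact: ltW.
  by move=> i j; rewrite !mxE ord1 distrC; move: j; near: k.
have [_] := zP k; apply.
have h2 : `|f x0 - v k x0| <= e / 2 by near: k.
have h3 : La * `|z k - x0| <= e / 4.
  apply: (@le_trans _ _ ((La + 1) * d)); first by apply: ler_pM => //; rewrite lerDl.
  by rewrite /d le_eqVlt; apply/orP; left; apply/eqP; field; rewrite gt_eqF// ltr_wpDl.
have -> : v k (z k) - f (z k) = (v k (z k) - v k x0) + ((f x0 - f (z k)) - (f x0 - v k x0)) by ring.
have := ler_normD (v k (z k) - v k x0) ((f x0 - f (z k)) - (f x0 - v k x0)).
have := ler_normB (f x0 - f (z k)) (f x0 - v k x0).
have := vL k (z k) x0; have := fL x0 (z k); rewrite (distrC x0); lra.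
Unshelve. all: by end_near. Qed.

Lemma weak_limit_Rn (h : nat -> 'rV[R]_n -> R) (M : R) : 0 <= M ->
  (forall k, measurable_fun [set: Rn R n] (h k)) -> (forall k x, `|h k x| <= M) ->
  exists g : 'rV[R]_n -> R, [/\ measurable_fun [set: Rn R n] g, forall x, `|g x| <= M &
    forall (psi : 'rV[R]_n -> R) (r : R), mu.-integrable setT (EFin \o psi) -> (forall x, ~ cube 0 r x -> psi x = 0) ->
      Rintegral mu setT (fun x => h k x * psi x) @[k --> U] --> Rintegral mu setT (fun x => g x * psi x)].
Proof.
move=> M0 mh hM.
pose S0 (L : nat) : set (Rn R n) := cube (0 : 'rV[R]_n) L.+1%:R.
pose S := seqDU S0.
have mS0 L : measurable (S0 L) by exact: measurable_cube.
have mS L : measurable (S L) by apply: measurableD => //; apply: bigsetU_measurable => k _; exact: mS0.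
have SS0 L : S L `<=` S0 L by exact: subset_seqDU.
have Soo L : (mu (S L) < +oo)%E.
  exact: le_lt_trans (le_lebesgue_outer (SS0 L)) (lebesgue_cube_lty 0 L.+1%:R).
have Sc : \bigcup_L S L = [set: Rn R n] by rewrite -seqDU_bigcup_eq; exact: bigcup_cube.
have [g [mg gM Hg]] := @weak_limit _ (Rn R n) R lebS U UU M h M0 mh hM S mS Soo (@trivIset_seqDU _ S0) Sc.
exists g; split=> // psi r ipsi psi0.
(* A shell of index beyond [truncn r] excludes [S0 (truncn r)], a cube of radius [truncn r + 1],
   which contains [cube 0 r]. *)
apply: (Hg psi (Num.truncn r).+1 ipsi) => x L SLx NL; apply: psi0 => xr.
have := SLx; rewrite /S /seqDU => -[_]; apply.
rewrite -bigcup_mkord; exists (Num.truncn r); first by rewrite /=; exact: NL.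
by apply: cube_le xr; exact/ltW/truncnS_gt.
Qed.

End UltraLimits.

Lemma powR_le_id (R : realType) (p a : R) : 1 < p -> 0 <= a <= 1 -> a `^ p <= a.
Proof.
move=> p1 /andP[]; rewrite le_eqVlt => /predU1P[<- _|a0 a1].
  by rewrite powR0// gt_eqF//; lra.
by rewrite -[leRHS]powRr1 ?(ltW a0)//; apply: ger_powR; [rewrite a0|exact: ltW].
Qed.

Lemma near_infty_natSinv_le (R : realType) (e : R) : 0 < e -> \forall k \near \oo, k.+1%:R^-1 <= e.
Proof. by move=> e0; apply: filterS (near_infty_natSinv_lt (PosNum e0)) => k /ltW. Qed.

Lemma lipschitz_continuous_Rn (R : realType) n (f : 'rV[R]_n -> R) La :
  (forall x y, `|f x - f y| <= La * `|x - y|) -> continuous f.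
Proof.
move=> fL x; apply: continuous_eps => e e0; exists (e / (`|La| + 1)); first by rewrite divr_gt0// ltr_wpDl.
move=> y; rewrite ltr_pdivlMr ?ltr_wpDl// => /ltW H; apply: le_trans (fL y x) _; apply: le_trans H.
by rewrite mulrC ler_wpM2l// ler_wpDr// ler_norm.
Qed.

Lemma C1_subc (R : realType) n f (g : 'I_n -> 'rV[R]_n -> R) a : C1 f g -> C1 (fun x => f x - a) g.
Proof.
move=> [df cg]; split=> // j x.
have := @is_deriveB R _ _ f (fun=> a) x (delta_mx 0 j) (g j x) 0 (df j x) (is_derive_cst _ _ _).
by rewrite subr0.
Qed.

Lemma integrable_continuous_supp (R : realType) n (f : 'rV[R]_n -> R) r : continuous f ->
  (forall x, ~ cube 0 r x -> f x = 0) -> (@lebesgue_Rn R n).-integrable setT (EFin \o f).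
Proof.
move=> cf f0; have [B B0 HB] := continuous_bounded_cube 0 r cf.
have fB x : `|f x| <= B by have [/HB//|/f0 ->] := pselect (cube 0 r x); rewrite normr0.
have := locint_mul_integrable (@locint_cst R n 1) (continuous_measurable_Rn cf) fB f0.
by rewrite (_ : (fun x => 1 * f x) = f)//; apply/funext => x; rewrite mul1r.
Qed.

Lemma integral_uniform_limit (R : realType) n (U : set_system nat) (v : nat -> 'rV[R]_n -> R) f q r :
  (forall k, continuous (v k)) -> continuous f -> continuous q -> (forall x, ~ cube 0 r x -> q x = 0) ->
  (forall e, 0 < e -> \forall k \near U, forall x, cube 0 r x -> `|v k x - f x| <= e) -> ProperFilter U ->
  Rintegral (@lebesgue_Rn R n) setT (fun x => v k x * q x) @[k --> U] --> Rintegral (@lebesgue_Rn R n) setT (fun x => f x * q x).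
Proof.
move=> cv cf cq q0 vf PU; have lq := continuous_locint cq.
have [B B0 HB] := continuous_bounded_cube 0 r cq.
have qB x : `|q x| <= B by have [/HB//|/q0 ->] := pselect (cube 0 r x); rewrite normr0.
have int (w : 'rV[R]_n -> R) : continuous w -> (@lebesgue_Rn R n).-integrable setT (EFin \o (fun x => w x * q x)).
  move=> cw; exact: (locint_mul_integrable (continuous_locint cw) (continuous_measurable_Rn cq) qB q0).
pose A := Rintegral (@lebesgue_Rn R n) (cube 0 r) (fun x : 'rV[R]_n => `|q x|).
have A0 : 0 <= A by exact: Rintegral_ge0.
apply/cvgrPdist_le => e e0.
have e'0 : 0 < e / (A + 1) by rewrite divr_gt0// ltr_wpDl.
apply: filterS (vf _ e'0) => k Hk.
have E := @RintegralB _ (Rn R n) R (@lebesgue_Rn R n) setT _ _ measurableT (int _ cf) (int _ (cv k)).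
rewrite -E.
pose w x := (f x - v k x) * \1_(cube 0 r) x.
have -> : Rintegral (@lebesgue_Rn R n) setT (fun x => f x * q x - v k x * q x) = Rintegral (@lebesgue_Rn R n) setT (fun x => q x * w x).
  apply: eq_Rintegral => x _; rewrite /w indicE.
  by have [xr|nx] := pselect (cube 0 r x); [rewrite mem_set// mulr1; ring|rewrite q0// !mulr0 mul0r subrr].
have mw : measurable_fun [set: Rn R n] w.
  exact: (measurable_mul_indic (measurable_funB (continuous_measurable_Rn cf) (continuous_measurable_Rn (cv k))) (measurable_cube _ _)).
apply: le_trans (locint_mul_le lq mw (C := e / (A + 1)) (c := 0) (r := r) _ _) _.
- move=> x; rewrite /w indicE; have [xr|nx] := pselect (cube 0 r x).
    by rewrite mem_set// mulr1 distrC; exact: Hk.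
  by rewrite memNset// mulr0 normr0 ltW.
- by move=> x nx; rewrite /w indicE memNset// mulr0.
rewrite -/A mulrAC ler_pdivrMr ?ltr_wpDl//; apply: ler_wpM2l; [exact: ltW|by rewrite lerDl].
Qed.

Section Compactness.
Variables (R : realType) (m n N : nat) (p : R).
Local Notation mu := (@lebesgue_Rn R n).
Hypothesis p1 : 1 < p.
Variables (a1 a2 a3 : R).
Hypothesis a3_gt0 : 0 < a3.
Variables (P : 'I_N -> set 'rV[R]_n).
Hypothesis hP : measurable_partition P (@unit_cell R n).
Variable (W : 'I_N -> 'M[R]_(m, n) -> R).
Hypothesis hW : forall i, pgrowth_class a1 a2 a3 p (W i).
Variables (T c : R).
Hypothesis T0 : 0 <= T.
Hypothesis c0 : 0 <= c.
Hypothesis W_low : forall i A, pnorm p A <= T + c * W i A.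
Variable xi : 'M[R]_(m, n).
Hypothesis vol0 : 0 < cube_vol R n.
Hypothesis cell0 : cell_integrand p (mixture P W) xi = 0%E.

Let p0 : 0 < p. Proof. by have := p1; lra. Qed.

Lemma fin_cube (x : 'rV[R]_n) r : mu (cube x r) = (fine (mu (cube x r)))%:E.
Proof. by rewrite fineK// ge0_fin_numE// lebesgue_cube_lty. Qed.

(** Uniform over all approximants with [d <= 1]; it supplies the constant [I] of [moll_Lp]. *)
Lemma gradient_integral_bound (L : nat) : exists2 I : R, 0 <= I & forall d H i, d <= 1 -> approximant P W xi d H ->
  (\int[mu]_(x in cube (0 : 'rV[R]_n) (L%:R + 1)) (\sum_j `|H x i j| `^ p)%:E <= I%:E)%E.
Proof.
have [K K0 HK] := pnorm_integral hP hW T0 c0 W_low xi L.+1.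
pose V := fine (mu (cube (0 : 'rV[R]_n) (L%:R + 1))).
have V0 : 0 <= V by exact: fine_ge0.
have x0 := pnorm_ge0 p (- xi).
have q0 : 0 <= 2 `^ p :> R by exact: powR_ge0.
exists (2 `^ p * (T * V + K + pnorm p (- xi) * V)); first by rewrite mulr_ge0// !addr_ge0// mulr_ge0.
move=> d H i d1 aH; have [cH _ _] := aH.
have mF := approximant_measurable aH.
have mH j : measurable_fun [set: Rn R n] (fun x => `|H x i j| `^ p).
  exact: (measurableT_comp (measurable_powR p) (measurable_norm_Rn (continuous_measurable_Rn (cH i j)))).
have mC := measurable_cube (0 : 'rV[R]_n) (L%:R + 1).
have mp := measurable_pnorm p mF.
have mpc : measurable_fun [set: Rn R n] (fun x => pnorm p (xi + H x) + pnorm p (- xi)).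
  exact: (measurable_funD mp (measurable_cst _)).
apply: (@le_trans _ _ (\int[mu]_(x in cube (0 : 'rV[R]_n) (L%:R + 1)) (2 `^ p * (pnorm p (xi + H x) + pnorm p (- xi)))%:E)%E).
  apply: (@le_integral_EFin _ (Rn R n) R mu _ _ _ mC (measurable_sum _ mH) (measurable_funM (measurable_cst _) mpc)).
  move=> x _; apply/andP; split; first by apply: sumr_ge0 => j _; exact: powR_ge0.
  apply: (@le_trans _ _ (pnorm p (H x))).
    rewrite /pnorm (bigD1 i)//= lerDl; apply: sumr_ge0 => k _; apply: sumr_ge0 => l _; exact: powR_ge0.
  by have := pnormD p1 (xi + H x) (- xi); rewrite addrAC subrr add0r.
have E := @integral_EFinZ _ (Rn R n) R mu _ (2 `^ p) _ mC mpc (fun x => addr_ge0 (pnorm_ge0 p _) x0) q0.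
have E2 := @integral_EFinD _ (Rn R n) R mu _ _ (fun=> pnorm p (- xi)) mC mp (measurable_cst _) (fun x => pnorm_ge0 p _) (fun=> x0).
have E3 := @integral_cst _ (Rn R n) R mu _ mC (pnorm p (- xi))%:E.
rewrite E E2 E3 [leRHS]EFinM; apply: lee_wpmul2l; first by rewrite lee_fin.
have HKD : (\int[mu]_(x in cube (0 : 'rV[R]_n) (L%:R + 1)) (pnorm p (xi + H x))%:E <= (T * V + K)%:E)%E.
  apply: le_trans (HK d H (cube 0 (L%:R + 1)) aH mC _) _; first by rewrite natr1.
  rewrite fin_cube -/V -EFinM -EFinD lee_fin lerD2l; exact: ler_piMr.
apply: le_trans (leeD HKD (lexx _)) _.
rewrite [leRHS]EFinD; apply: leeD => //; rewrite EFinM le_eqVlt; apply/orP; left; apply/eqP.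
by congr (_ * _)%E; exact: fin_cube.
Qed.

Lemma approximant_le d d' H : d <= d' -> approximant P W xi d H -> approximant P W xi d' H.
Proof. by move=> dd' [cH pH HI]; split=> //; apply: le_trans HI _; rewrite lee_fin. Qed.

(* delta_k must be small compared with s_k ^ n for the mollified gradients to be bounded. *)
Lemma bounded_approximants : exists (s : nat -> R) (u : nat -> 'rV[R]_n -> 'cV[R]_m) (H : nat -> 'rV[R]_n -> 'M[R]_(m, n)) (M : R),
  [/\ forall k, s k = k.+1%:R^-1, forall k i, C1 (fun x => u k x i 0) (fun j x => H k x i j),
    forall k, periodic (u k) /\ approximant P W xi (s k) (H k), 0 <= M &
    forall k i j x, `|moll (s k) (fun x => H k x i j) x| <= M].
Proof.
pose s k : R := k.+1%:R^-1.
have s01 k : 0 < s k <= 1 by rewrite invr_gt0 ltr0n/= invf_le1// ler1n.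
have d0 k : 0 < s k ^+ n * s k by have /andP[s0 _] := s01 k; rewrite mulr_gt0// exprn_gt0.
have /choice[u /choice[H HuH]] k := periodic_approx p1 a3_gt0 hP hW vol0 cell0 (d0 k).
have aH k : approximant P W xi (s k ^+ n * s k) (H k).
  by have [C1u _ perH HI] := HuH k; split=> // i j; exact: (C1u i).2 j.
have [M [K [M0 K0 HM]]] := moll_gradient_bound p1 hP hW T0 c0 W_low xi vol0.
exists s, u, H, (M + K); split=> [//|k i|k| |k i j x].
- by have [C1u _ _ _] := HuH k.
- split; first by have [] := HuH k.
  apply: approximant_le (aH k); have /andP[s0 s1] := s01 k.
  by rewrite ler_piMl ?exprn_ile1// ltW.
- exact: addr_ge0.
- have /andP[s0 s1] := s01 k; apply: le_trans (HM (s k) _ (H k) (s01 k) (aH k) x i j) _.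
  rewrite lerD2l mulrAC divff ?mul1r ?ler_piMr// expf_neq0// gt_eqF//.
Qed.

Definition locally_Lp_close (U : set_system nat) (u : nat -> 'rV[R]_n -> 'cV[R]_m) (phi : 'rV[R]_n -> 'cV[R]_m) :=
  forall i (L : nat) e, 0 < e -> \forall k \near U,
    (\int[mu]_(x in cube (0 : 'rV[R]_n) L%:R) (`|u k x i 0 - phi x i 0| `^ p)%:E <= e%:E)%E.

Lemma compactness : exists (U : set_system nat) (u : nat -> 'rV[R]_n -> 'cV[R]_m) (H : nat -> 'rV[R]_n -> 'M[R]_(m, n))
    (phi : 'rV[R]_n -> 'cV[R]_m) (G : 'rV[R]_n -> 'M[R]_(m, n)) (M La : R),
  [/\ ProperFilter U,
    (forall k i, C1 (fun x => u k x i 0) (fun j x => H k x i j)) /\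
    (forall e, 0 < e -> \forall k \near U, approximant P W xi e (H k)),
    locally_Lp_close U u phi,
    [/\ 0 <= La, forall i x y, `|phi x i 0 - phi y i 0| <= La * `|x - y| & periodic phi] &
    is_weak_gradient phi G /\ forall x i j, `|G x i j| <= M].
Proof.
have [s [u [H [M [sE Cu aH M0 HM]]]]] := bounded_approximants.
have s01 k : 0 < s k <= 1 by rewrite sE invr_gt0 ltr0n/= invf_le1// ler1n.
have s0 k : 0 < s k by have /andP[] := s01 k.
have [U [UU Uoo]] := @ultraFilterLemma nat \oo _.
have PU : ProperFilter U by exact: ultra_proper.
have lu k i : locint (fun x => u k x i 0) by exact: continuous_locint (C1_continuous (Cu k i)).
have lH k i j : locint (fun x => H k x i j) by exact: continuous_locint ((Cu k i).2 j).
have wu k : is_weak_gradient (u k) (H k) by exact: C1_weak_gradient.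
(* Subtracting the mollified value at [0] makes the equi-Lipschitz mollifications bounded at every
   point. The same constants are subtracted from [u k], whose gradient and energy do not see
   them. *)
pose b k i := moll (s k) (fun x => u k x i 0) 0.
pose v i k x := moll (s k) (fun x => u k x i 0) x - b k i.
have Cv k i : C1 (v i k) (fun j => moll (s k) (fun x => H k x i j)).
  exact: C1_subc (C1_moll vol0 i (s0 k) (wu k)).
pose La := n%:R * M.
have La0 : 0 <= La by rewrite mulr_ge0.
have vL i k x y : `|v i k x - v i k y| <= La * `|x - y|.
  have := @C1_lipschitz_on _ _ _ _ y (x - y) M (Cv k i) (fun j z _ => HM k i j z) M0.
  by rewrite (_ : y + (x - y) = x)// addrC subrK.
have v0 i k : v i k 0 = 0 by rewrite /v subrr.
have /choice[phi Hphi] i := equi_lipschitz_ultra_limit UU La0 (vL i) (v0 i).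
have mmH i j k : measurable_fun [set: Rn R n] (moll (s k) (fun x => H k x i j)) by exact: measurable_moll.
have /choice[G HG] : forall ij : 'I_m * 'I_n, exists g : 'rV[R]_n -> R, [/\ measurable_fun [set: Rn R n] g, forall x, `|g x| <= M &
    forall (psi : 'rV[R]_n -> R) (r : R), mu.-integrable setT (EFin \o psi) -> (forall x, ~ cube 0 r x -> psi x = 0) ->
      Rintegral mu setT (fun x => moll (s k) (fun x => H k x ij.1 ij.2) x * psi x) @[k --> U] --> Rintegral mu setT (fun x => g x * psi x)].
  by move=> [i j]; exact: (weak_limit_Rn UU M0 (mmH i j) (fun k x => HM k i j x)).
exists U, (fun k x => u k x - \col_i b k i), H, (fun x => \col_i phi i x), (fun x => \matrix_(i, j) G (i, j) x), M, La.
split; [exact: PU| | | |].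
- split=> [k i|e e0].
    rewrite (_ : (fun x => _) = (fun x => u k x i 0 - b k i)); last by apply/funext => x; rewrite !mxE.
    exact: C1_subc.
  apply: Uoo; near=> k; apply: approximant_le (aH k).2; rewrite sE.
  by near: k; exact: near_infty_natSinv_le.
- move=> i L e e0.
  have [I I0 HI] := gradient_integral_bound L.
  pose V := fine (mu (cube (0 : 'rV[R]_n) L%:R)).
  have V0 : 0 <= V by exact: fine_ge0.
  have q0 : 0 <= 2 `^ p :> R by exact: powR_ge0.
  have C0 : 0 <= 2 `^ p * (n%:R `^ p * I) by rewrite !mulr_ge0 ?powR_ge0.
  (* The error splits into [u_k] minus its mollification and the mollification minus [phi], each
     allowed [e / 2] with the factor [2^p] of the quasi-triangle inequality. Here [eta <= 1] gives
     [eta^p <= eta], so that a linear condition suffices; the same device is used for [s k]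
     below. *)
  pose eta := Num.min 1 (e / 2 / (2 `^ p * V + 1)).
  have B0 : 0 <= 2 `^ p * V by rewrite mulr_ge0.
  have eta0 : 0 < eta by rewrite lt_min ltr01 divr_gt0// ?divr_gt0// ltr_wpDl.
  have etaV : 2 `^ p * (eta `^ p * V) <= e / 2.
    apply: (@le_trans _ _ ((2 `^ p * V + 1) * eta)).
      rewrite mulrCA mulrC; apply: ler_pM; rewrite ?powR_ge0//; first by rewrite lerDl.
      by apply: powR_le_id => //; rewrite (ltW eta0) ge_min lexx.
    by rewrite mulrC -ler_pdivlMr ?ltr_wpDl// ge_min lexx orbT.
  have sI : \forall k \near U, 2 `^ p * (s k `^ p * n%:R `^ p * I) <= e / 2.
    have d0 : 0 < e / 2 / (2 `^ p * (n%:R `^ p * I) + 1) by rewrite divr_gt0// ?divr_gt0// ltr_wpDl.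
    apply: Uoo; apply: filterS (near_infty_natSinv_le d0) => k.
    rewrite -sE ler_pdivlMr ?ltr_wpDl// => H1; apply: le_trans H1.
    rewrite -mulrA mulrCA; apply: ler_pM; rewrite ?powR_ge0//; last by rewrite lerDl.
    by apply: powR_le_id => //; have /andP[/ltW -> ->] := s01 k.
  have [_ _ /(_ L%:R eta eta0) vphi] := Hphi i.
  near=> k.
  have h1 : 2 `^ p * (s k `^ p * n%:R `^ p * I) <= e / 2 by near: k.
  have h2 : forall x, cube 0 L%:R x -> `|v i k x - phi i x| <= eta by near: k.
  pose f1 x := `|u k x i 0 - moll (s k) (fun x => u k x i 0) x| `^ p.
  have mu' := (lu k i).1; have mm : measurable_fun [set: Rn R n] (moll (s k) (fun x => u k x i 0)) by exact: measurable_moll.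
  have mphi : measurable_fun [set: Rn R n] (phi i).
    by apply: continuous_measurable_Rn; have [H1 _ _] := Hphi i; exact: lipschitz_continuous_Rn H1.
  have mf1 : measurable_fun [set: Rn R n] f1.
    exact: (measurableT_comp (measurable_powR p) (measurable_norm_Rn (measurable_funB mu' mm))).
  have mC := measurable_cube (0 : 'rV[R]_n) L%:R.
  have f10 x : 0 <= f1 x by exact: powR_ge0.
  have mf2 : measurable_fun [set: Rn R n] (fun x => `|(u k x - \col_i b k i) i 0 - (\col_i phi i x : 'cV[R]_m) i 0| `^ p).
    apply: (measurableT_comp (measurable_powR p)); apply: measurable_norm_Rn.
    rewrite (_ : (fun x => _) = (fun x => u k x i 0 - b k i - phi i x)); last by apply/funext => x; rewrite !mxE.
    exact: (measurable_funB (measurable_funB mu' (measurable_cst _)) mphi).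
  have E := @integral_EFinZ _ (Rn R n) R mu _ (2 `^ p) _ mC mf1 f10 q0.
  have E2 := @integral_cst _ (Rn R n) R mu _ mC (2 `^ p * eta `^ p)%:E.
  apply: le_trans (@le_integral_EFinD _ (Rn R n) R mu _ _ (fun x => 2 `^ p * f1 x) (fun=> 2 `^ p * eta `^ p) mC mf2
    (measurable_funM (measurable_cst _) mf1) (measurable_cst _) _ _ _) _.
  + move=> x xL; rewrite powR_ge0/= !mxE -mulrDr.
    have -> : u k x i 0 - b k i - phi i x = (u k x i 0 - moll (s k) (fun x => u k x i 0) x) + (v i k x - phi i x).
      by rewrite /v; ring.
    apply: le_trans (powR_normD p1 _ _) _; apply: ler_wpM2l => //; rewrite lerD2l.
    by apply: ge0_ler_powR; rewrite ?nnegrE ?(ltW p0) ?(ltW eta0)//; exact: h2.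
  + by move=> x; rewrite mulr_ge0.
  + by move=> x; rewrite mulr_ge0 ?powR_ge0.
  rewrite E E2 [e in leRHS]splitr [leRHS]EFinD; apply: leeD.
    apply: le_trans (_ : (2 `^ p * (s k `^ p * n%:R `^ p * I))%:E <= _)%E; last by rewrite lee_fin.
    rewrite [leRHS]EFinM; apply: lee_wpmul2l; first by rewrite lee_fin.
    apply: (moll_Lp p1 vol0 (Cu k i) (s01 k) I0); apply: (HI (s k) _ i _ (aH k).2).
    by have /andP[] := s01 k.
  apply: le_trans (_ : (2 `^ p * (eta `^ p * V))%:E <= _)%E; last by rewrite lee_fin.
  rewrite mulrA [leRHS]EFinM le_eqVlt; apply/orP; left; apply/eqP.
  by congr (_ * _)%E; exact: fin_cube.
- split=> [//|i x y|z x].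
    by rewrite !mxE; have [H1 _ _] := Hphi i; exact: H1.
  apply/colP => i; rewrite !mxE; have [_ H2 _] := Hphi i.
  have uae k : {ae mu, forall y : 'rV[R]_n, u k (y + map_mx intr z) i 0 = u k y i 0}.
    by apply: aeW => y; rewrite (aH k).1.
  have Eper k := moll_periodic x (s0 k) (lu k i) (uae k).
  apply: (@cvg_unique _ (@Rhausdorff R) (v i k (x + map_mx intr z) @[k --> U]) _ _ _ (H2 _)).
  rewrite (_ : (fun k => _) = (fun k => v i k x)); first exact: H2.
  by apply/funext => k; rewrite /v Eper.
- split; last by move=> x i j; rewrite mxE; have [_ H1 _] := HG (i, j).
  split=> [i|i j|psi tpsi i j].
  + rewrite (_ : (fun x => _) = phi i); last by apply/funext => x; rewrite mxE.
    by apply: Lq_loc_continuous => //; have [H1 _ _] := Hphi i; exact: lipschitz_continuous_Rn H1.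
  + rewrite (_ : (fun x => _) = G (i, j)); last by apply/funext => x; rewrite mxE.
    by have [mG GM _] := HG (i, j); apply: Lq_loc_bounded => // cc r; exists M.
  have Cp := test_function_C1 tpsi; have [r r0 psi0] := test_function_supp tpsi.
  have dpsi0 := @C1_supp _ _ _ _ r r0 Cp psi0 j.
  have [phiL _ phiU] := Hphi i; have [_ _ /(_ psi r) HGij] := HG (i, j).
  under eq_Rintegral do rewrite mxE; under [in RHS]eq_Rintegral do rewrite mxE.
  have cphi := lipschitz_continuous_Rn phiL.
  have wv k : is_weak_gradient (fun x => \col_i v i k x) (fun x => \matrix_(i, j) moll (s k) (fun x => H k x i j) x).
    apply: C1_weak_gradient => i'.
    rewrite (_ : (fun x => _) = v i' k); last by apply/funext => x; rewrite mxE.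
    rewrite (_ : (fun j x => _) = fun j => moll (s k) (fun x => H k x i' j)) => //.
    by apply/funext => j'; apply/funext => x; rewrite mxE.
  (* Integration by parts holds for the mollifications; the left side converges by uniform
     convergence on the support, the right side by weak convergence, along the same ultrafilter. *)
  have lim1 := integral_uniform_limit (fun k => C1_continuous (Cv k i)) cphi (Cp.2 j) dpsi0 (phiU (r + 1)) PU.
  apply: (@cvg_unique _ (@Rhausdorff R) _ _ _ _ lim1).
  have ipsi : mu.-integrable setT (EFin \o psi).
    exact: integrable_continuous_supp (C1_continuous Cp) psi0.
  have lim2 := HGij ipsi psi0.
  rewrite (_ : (fun k => _) = (fun k => - Rintegral mu setT (fun x => moll (s k) (fun x => H k x i j) x * psi x))); first exact: cvgN.
  apply/funext => k; have [_ _ /(_ psi tpsi i j)] := wv k.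
  under eq_Rintegral do rewrite mxE; move=> ->; congr (- _).
  by apply: eq_Rintegral => x _; rewrite mxE.
Unshelve. all: by end_near. Qed.

End Compactness.

(** * Lebesgue points *)

Lemma measurable_fine_comp d (T : measurableType d) (R : realType) (f : T -> \bar R) :
  measurable_fun setT f -> measurable_fun setT (fun x => fine (f x)).
Proof. by move=> mf; exact: (measurableT_comp (fine_measurable measurableT) mf). Qed.

Section LebesguePoints.
Variables (R : realType) (n : nat).
Local Notation mu := (@lebesgue_Rn R n).
Let lebS : {sigma_finite_measure set (Rn R n) -> \bar R} := @lebesgue_Rn R n.
Hypothesis vol0 : 0 < cube_vol R n.
Implicit Types (f : 'rV[R]_n -> R) (y w : 'rV[R]_n).

Definition inner_osc f (r : R) y : \bar R := (\int[lebS]_w (`|f w - f y| * \1_(cube y r : set (Rn R n)) w)%:E)%E.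

Lemma inner_oscE f r y : inner_osc f r y = (\int[mu]_(w in cube y r) (`|f w - f y|)%:E)%E.
Proof. exact: esym (@integral_indic_mul _ (Rn R n) R mu (fun w => `|f w - f y|) (cube y r)). Qed.

Lemma inner_osc_fin f r y : locint f -> inner_osc f r y \is a fin_num.
Proof.
move=> lf; rewrite inner_oscE.
have l := locint_norm (locintB lf (@locint_cst R n (f y))).
exact: (@integrable_fin_num _ (Rn R n) R mu _ (measurable_cube y r) _ (l.2 y r)).
Qed.

Lemma measurable_inner_osc_Rn f r : measurable_fun [set: Rn R n] f -> measurable_fun [set: Rn R n] (inner_osc f r).
Proof.
move=> mf; exact: (@measurable_inner_osc _ (Rn R n) R lebS (fun x r => cube x r : set (Rn R n)) (@measurable_cube_pair R n) f f r mf mf).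
Qed.

(** The radii form one sequence, common to all points and all functions of the family, along which
    the averaged oscillations divided by [r^n] are summable. Almost everywhere convergence then
    follows from [ae_cvg0_summable_integral], and a sequence is enough for a blow-up. *)
Lemma lebesgue_points (I : finType) (f : I -> 'rV[R]_n -> R) :
  (forall i, mu.-integrable setT (EFin \o f i)) ->
  exists r : nat -> R, [/\ forall q, 0 < r q, r q @[q --> \oo] --> 0 &
    {ae mu, forall y, forall i e, 0 < e -> \forall q \near \oo,
      (\int[mu]_(w in cube y (r q)) (`|f i w - f i y|)%:E <= (e * r q ^+ n)%:E)%E}].
Proof.
move=> fi.
have lf i : locint (f i).
  have /integrableP[/measurable_EFinP mf _] := fi i.
  split=> // c r; exact: (integrableS measurableT (measurable_cube c r) (@subsetT _ _) (fi i)).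
have /choice[r rP] : forall q : nat, exists r : R, [/\ 0 < r, r <= q.+1%:R^-1 &
    forall i, (leb_osc (f i) r <= (r ^+ n / (2 ^ q.+1)%:R)%:E)%E].
  (* The factor [cube_vol] in the bound of [leb_osc_vanish] is divided out in advance. *)
  move=> q; have e0 : 0 < ((2 ^ q.+1)%:R * cube_vol R n)^-1 by rewrite invr_gt0 mulr_gt0// ltr0n expn_gt0.
  have near1 : \forall r \near (0 : R)^'+, forall i, (leb_osc (f i) r <= (r ^+ n / (2 ^ q.+1)%:R)%:E)%E.
    apply: filter_forall => i; apply: near_at_right_le.
    have [d d0 Hd] := leb_osc_vanish (fi i) e0; exists d => // r rd; apply: le_trans (Hd r rd) _.
    rewrite -EFinM lee_fin le_eqVlt; apply/orP; left; apply/eqP; field.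
    by rewrite pnatr_eq0 expn_eq0/= gt_eqF.
  near (0 : R)^'+ => r; exists r; split; [by near: r; exact: nbhs_right_gt| |by near: r].
  by near: r; apply: nbhs_right_le; rewrite invr_gt0.
have r0 q : 0 < r q by have [] := rP q.
exists r; split=> //.
  apply/cvgrPdist_le => e e0; near=> q; rewrite sub0r normrN gtr0_norm//.
  have [_ rq _] := rP q; apply: le_trans rq _; near: q; exact: near_infty_natSinv_le.
pose a i q y := fine (inner_osc (f i) (r q) y) / r q ^+ n.
have ma i q : measurable_fun [set: Rn R n] (a i q).
  apply: measurable_funM; last exact: measurable_cst.
  exact: (@measurable_fine_comp _ (Rn R n) R _ (measurable_inner_osc_Rn (r q) (lf i).1)).
have inner0 i q y : (0 <= inner_osc (f i) (r q) y)%E by apply: integral_ge0 => w _; rewrite lee_fin mulr_ge0// indicE.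
have a0 i q y : 0 <= a i q y by rewrite divr_ge0 ?exprn_ge0 ?(ltW (r0 q))// fine_ge0.
have inta i q : (\int[mu]_y (a i q y)%:E <= ((2 ^ q.+1)%:R^-1)%:E)%E.
  have [_ _ /(_ i) H] := rP q.
  have rn0 : 0 < r q ^+ n by exact: exprn_gt0.
  have E : (\int[mu]_y (a i q y)%:E = (r q ^+ n)^-1%:E * leb_osc (f i) (r q))%E.
    have mfine : measurable_fun [set: Rn R n] (fun y => fine (inner_osc (f i) (r q) y)).
      exact: (@measurable_fine_comp _ (Rn R n) R _ (measurable_inner_osc_Rn (r q) (lf i).1)).
    have rn1 : 0 <= (r q ^+ n)^-1 by rewrite invr_ge0 ltW.
    have E1 := @integral_EFinZ _ (Rn R n) R mu setT _ _ measurableT mfine (fun y => fine_ge0 (inner0 i q y)) rn1.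
    apply: etrans (_ : \int[mu]_y ((r q ^+ n)^-1 * fine (inner_osc (f i) (r q) y))%:E = _)%E.
      by apply: eq_integral => y _; rewrite /a mulrC.
    rewrite E1; congr (_ * _)%E; apply: eq_integral => y _.
    by rewrite fineK//; exact: inner_osc_fin.
  rewrite E; apply: (@le_trans _ _ ((r q ^+ n)^-1%:E * (r q ^+ n / (2 ^ q.+1)%:R)%:E)%E).
    by apply: lee_wpmul2l => //; rewrite lee_fin invr_ge0 ltW.
  by rewrite -EFinM lee_fin mulrA mulVf ?gt_eqF// mul1r.
have ae1 i : {ae mu, forall y : Rn R n, [set: Rn R n] y -> a i q y @[q --> \oo] --> 0}.
  exact: (@ae_cvg0_summable_integral _ (Rn R n) R mu setT measurableT (a i) (ma i) (a0 i) (inta i)).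
apply: ae_imply (ae_forall_fin ae1) => y Hy i e e0.
have /cvgrPdist_le /(_ e e0) := Hy i Logic.I.
apply: filterS => q; rewrite sub0r normrN ger0_norm// /a ler_pdivrMr ?exprn_gt0// => H.
by rewrite -inner_oscE -(fineK (inner_osc_fin _ _ (lf i))) lee_fin.
Unshelve. all: by end_near. Qed.

End LebesguePoints.

(** * Cutoff functions *)

Section Cutoff.
Variable R : realType.
Implicit Types t a d : R.

Definition pos_sqr t : R := Num.max 0 t ^+ 2.
Definition dpos_sqr t : R := 2 * Num.max 0 t.

Lemma max0P t : (0 <= t /\ Num.max 0 t = t) \/ (t <= 0 /\ Num.max 0 t = 0).
Proof.
have [t0|/ltW t0] := leP 0 t; [left|right]; split=> //; exact: max_r || exact: max_l.
Qed.

Lemma is_derive_affine a b t : is_derive t (1 : R) (fun u : R => a + b * u) b.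
Proof.
apply: is_derive_quotient => e e0; exists 1 => // h h0 _.
have -> : (a + b * (h *: (1 : R) + t) - (a + b * t)) / h - b = 0.
  by rewrite [h *: _]mulr1; field.
by rewrite normr0 ltW.
Qed.

Lemma is_derive_pos_sqr t : is_derive t (1 : R) pos_sqr (dpos_sqr t).
Proof.
apply: is_derive_quotient => e e0; exists e => // h h0 he.
have H : `|pos_sqr (h + t) - pos_sqr t - h * dpos_sqr t| <= `|h| * `|h|.
  rewrite -normrM [X in _ <= X]ger0_norm -?expr2 ?sqr_ge0// ler_norml /pos_sqr /dpos_sqr.
  by have [[t0 ->]|[t0 ->]] := max0P t; have [[th0 ->]|[th0 ->]] := max0P (h + t); apply/andP; split; nra.
have -> : (pos_sqr (h *: 1 + t) - pos_sqr t) / h - dpos_sqr t = (pos_sqr (h + t) - pos_sqr t - h * dpos_sqr t) / h.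
  by rewrite [h *: _]mulr1; field.
rewrite normrM normfV ler_pdivrMr ?normr_gt0//; apply: le_trans H _.
by rewrite ler_wpM2r// ltW.
Qed.

Lemma continuous_pos_sqr : continuous pos_sqr.
Proof. by move=> t; exact: is_derive_continuous (is_derive_pos_sqr t). Qed.

Lemma continuous_dpos_sqr : continuous dpos_sqr.
Proof.
move=> t; apply: (@continuousM _ _ (fun=> 2) (fun t => Num.max 0 t)); first exact: cst_continuous.
by apply: continuous_max; [exact: cst_continuous|exact: cvg_id].
Qed.

Lemma pos_sqr_ge0 t : 0 <= pos_sqr t. Proof. exact: sqr_ge0. Qed.

(** A [C1] step made of two squared positive parts: it equals 0 for [t <= 0], 1 for [t >= 1], and
    [(1 - (1 - t)^2)^2] in between. One continuous derivative suffices, since test fields need only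
    be Lipschitz. *)
Definition smooth_step t : R := pos_sqr (1 - pos_sqr (1 - t)).
Definition dsmooth_step t : R := dpos_sqr (1 - pos_sqr (1 - t)) * dpos_sqr (1 - t).

Lemma is_derive_smooth_step t : is_derive t (1 : R) smooth_step (dsmooth_step t).
Proof.
have d1 x : is_derive x (1 : R) (fun u : R => 1 - u) (-1).
  by have := is_derive_affine 1 (-1) x; under [X in is_derive _ _ X _ -> _]eq_fun do rewrite mulN1r.
have d2 := @is_derive1_comp R pos_sqr (fun u => 1 - u) t _ _ (is_derive_pos_sqr (1 - t)) (d1 t).
have d3 : is_derive t (1 : R) (fun u : R => 1 - pos_sqr (1 - u)) (dpos_sqr (1 - t)).
  have := @is_derive1_comp R (fun u => 1 - u) _ t _ _ (d1 _) d2.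
  by rewrite mulrN1 mulN1r opprK.
exact: (@is_derive1_comp R pos_sqr (fun u => 1 - pos_sqr (1 - u)) t _ _ (is_derive_pos_sqr (1 - pos_sqr (1 - t))) d3).
Qed.

Lemma continuous_one_sub : continuous (fun t : R => 1 - t).
Proof.
by move=> t; have := is_derive_continuous (is_derive_affine 1 (-1) t); under [X in {for _, continuous X} -> _]eq_fun do rewrite mulN1r.
Qed.

Lemma continuous_dsmooth_step : continuous dsmooth_step.
Proof.
have c1 : continuous (fun t => pos_sqr (1 - t)).
  by move=> t; apply: (@continuous_comp _ _ _ (fun t => 1 - t) pos_sqr); [exact: continuous_one_sub|exact: continuous_pos_sqr].
move=> t; apply: (@continuousM _ _ (fun t => dpos_sqr (1 - pos_sqr (1 - t))) (fun t => dpos_sqr (1 - t))).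
  apply: (@continuous_comp _ _ _ (fun t => 1 - pos_sqr (1 - t)) dpos_sqr); last exact: continuous_dpos_sqr.
  by apply: (@continuous_comp _ _ _ (fun t => pos_sqr (1 - t)) (fun t => 1 - t)); [exact: c1|exact: continuous_one_sub].
by apply: (@continuous_comp _ _ _ (fun t => 1 - t) dpos_sqr); [exact: continuous_one_sub|exact: continuous_dpos_sqr].
Qed.

Lemma smooth_step_itv t : 0 <= smooth_step t <= 1.
Proof.
rewrite pos_sqr_ge0/= /smooth_step; have := pos_sqr_ge0 (1 - t).
set x := pos_sqr (1 - t) => x0; rewrite /pos_sqr.
by have [[y0 ->]|[_ ->]] := max0P (1 - x); nra.
Qed.

Lemma smooth_step1 t : 1 <= t -> smooth_step t = 1 /\ dsmooth_step t = 0.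
Proof.
move=> t1; have E : Num.max 0 (1 - t) = 0 by apply/max_idPl; lra.
by rewrite /smooth_step /dsmooth_step /pos_sqr /dpos_sqr E expr0n/= subr0 mulr0 mulr0 max_r// expr1n.
Qed.

Lemma smooth_step0 t : t <= 0 -> smooth_step t = 0 /\ dsmooth_step t = 0.
Proof.
move=> t0; have E : Num.max 0 (1 - t) = 1 - t by apply/max_idPr; lra.
have E2 : Num.max 0 (1 - (1 - t) ^+ 2) = 0 by apply/max_idPl; nra.
by rewrite /smooth_step /dsmooth_step /pos_sqr /dpos_sqr E E2 expr0n/= mulr0 mul0r.
Qed.

Lemma dsmooth_step_le t : `|dsmooth_step t| <= 4.
Proof.
have [t0|t0] := leP t 0; first by have [_ ->] := smooth_step0 t0; rewrite normr0.
have [t1|t1] := leP 1 t; first by have [_ ->] := smooth_step1 t1; rewrite normr0.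
rewrite /dsmooth_step /pos_sqr /dpos_sqr (max_idPr (_ : 0 <= 1 - t)); last by lra.
rewrite (max_idPr (_ : 0 <= 1 - (1 - t) ^+ 2)); last by nra.
by rewrite ler_norml; apply/andP; split; nra.
Qed.

(** Equal to 1 for [|t| < 1 - d] and to 0 for [|t| >= 1]; the slopes have width [d], whence
    derivatives of order [1 / d]. *)
Definition plateau d t : R := smooth_step ((1 - t) / d) * smooth_step ((1 + t) / d).
Definition dplateau d t : R :=
  smooth_step ((1 - t) / d) * (dsmooth_step ((1 + t) / d) / d) - smooth_step ((1 + t) / d) * (dsmooth_step ((1 - t) / d) / d).

Lemma is_derive_plateau d t : is_derive t (1 : R) (plateau d) (dplateau d t).
Proof.
have d1 : is_derive t (1 : R) (fun u : R => (1 - u) / d) (- d^-1).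
  have := is_derive_affine d^-1 (- d^-1) t.
  rewrite (_ : (fun u : R => d^-1 + - d^-1 * u) = (fun u : R => (1 - u) / d))//; apply/funext => u.
  by rewrite mulrDl mul1r mulNr mulNr (mulrC u).
have d2 : is_derive t (1 : R) (fun u : R => (1 + u) / d) d^-1.
  have := is_derive_affine d^-1 d^-1 t.
  rewrite (_ : (fun u : R => d^-1 + d^-1 * u) = (fun u : R => (1 + u) / d))//; apply/funext => u.
  by rewrite mulrDl mul1r (mulrC u).
have d3 := @is_derive1_comp R smooth_step (fun u => (1 - u) / d) t _ _ (is_derive_smooth_step ((1 - t) / d)) d1.
have d4 := @is_derive1_comp R smooth_step (fun u => (1 + u) / d) t _ _ (is_derive_smooth_step ((1 + t) / d)) d2.
have := @is_deriveM R _ _ _ t 1 _ _ d3 d4.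
by rewrite /dplateau /GRing.scale/= mulrN mulrN.
Qed.

Lemma continuous_dplateau d : continuous (dplateau d).
Proof.
have c1 : continuous (fun t : R => (1 - t) / d).
  have -> : (fun u : R => (1 - u) / d) = (fun u : R => d^-1 + - d^-1 * u).
    by apply/funext => u; rewrite mulrDl mul1r mulNr mulNr (mulrC u).
  by move=> t; exact: is_derive_continuous (is_derive_affine d^-1 (- d^-1) t).
have c2 : continuous (fun t : R => (1 + t) / d).
  have -> : (fun u : R => (1 + u) / d) = (fun u : R => d^-1 + d^-1 * u).
    by apply/funext => u; rewrite mulrDl mul1r (mulrC u).
  by move=> t; exact: is_derive_continuous (is_derive_affine d^-1 d^-1 t).
have cs : continuous smooth_step by move=> t; exact: is_derive_continuous (is_derive_smooth_step t).
have s1 := fun t => @continuous_comp _ _ _ _ _ t (c1 t) (cs _).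
have s2 := fun t => @continuous_comp _ _ _ _ _ t (c2 t) (cs _).
have cd : continuous dsmooth_step by exact: continuous_dsmooth_step.
have s3 := fun t => @continuous_comp _ _ _ _ _ t (c1 t) (cd _).
have s4 := fun t => @continuous_comp _ _ _ _ _ t (c2 t) (cd _).
move=> t; apply: (@continuousB _ _ _ (fun t => smooth_step ((1 - t) / d) * (dsmooth_step ((1 + t) / d) / d))
  (fun t => smooth_step ((1 + t) / d) * (dsmooth_step ((1 - t) / d) / d))).
  by apply: continuousM; [exact: s1|apply: continuousM; [exact: s4|exact: cst_continuous]].
by apply: continuousM; [exact: s2|apply: continuousM; [exact: s3|exact: cst_continuous]].
Qed.

Lemma plateau_itv d t : 0 <= plateau d t <= 1.
Proof.
have /andP[a0 a1] := smooth_step_itv ((1 - t) / d); have /andP[b0 b1] := smooth_step_itv ((1 + t) / d).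
by rewrite mulr_ge0//= mulr_ile1.
Qed.

Lemma plateau_out d t : 0 < d -> 1 <= `|t| -> plateau d t = 0.
Proof.
move=> d0; rewrite ler_normr /plateau => /orP[t1|t1].
  have h : (1 - t) / d <= 0 by rewrite pmulr_lle0 ?invr_gt0//; lra.
  have [-> _] := smooth_step0 h.
  by rewrite mul0r.
have h : (1 + t) / d <= 0 by rewrite pmulr_lle0 ?invr_gt0//; lra.
have [-> _] := smooth_step0 h.
by rewrite mulr0.
Qed.

Lemma plateau_in d t : 0 < d -> `|t| < 1 - d -> plateau d t = 1 /\ dplateau d t = 0.
Proof.
move=> d0; rewrite ltr_norml /plateau /dplateau => /andP[t1 t2].
have h1 : 1 <= (1 - t) / d by rewrite ler_pdivlMr//; lra.
have h2 : 1 <= (1 + t) / d by rewrite ler_pdivlMr//; lra.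
have [-> ->] := smooth_step1 h1.
have [-> ->] := smooth_step1 h2.
by rewrite !mul0r !mul1r subrr.
Qed.

Lemma dplateau_le d t : 0 < d -> `|dplateau d t| <= 8 / d.
Proof.
move=> d0; have /andP[a0 a1] := smooth_step_itv ((1 - t) / d); have /andP[b0 b1] := smooth_step_itv ((1 + t) / d).
have da := dsmooth_step_le ((1 - t) / d); have db := dsmooth_step_le ((1 + t) / d).
rewrite /dplateau; move: (smooth_step _) (dsmooth_step _) (smooth_step _) (dsmooth_step _) a0 a1 b0 b1 da db.
move=> a a' b b' a0 a1 b0 b1 da db.
apply: le_trans (ler_normB _ _) _; rewrite !normrM !normfV (gtr0_norm d0) !mulrA -mulrDl.
rewrite ler_pM2r ?invr_gt0// (ger0_norm a0) (ger0_norm b0).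
have : a * `|b'| <= 1 * 4 by apply: ler_pM.
have : b * `|a'| <= 1 * 4 by apply: ler_pM.
lra.
Qed.

Variable n : nat.
Implicit Types x y : 'rV[R]_n.

Definition cube_cutoff y (r : R) d x : R := \prod_j plateau d ((x 0 j - y 0 j) / r).
Definition dcube_cutoff y (r : R) d (i : 'I_n) x : R :=
  (dplateau d ((x 0 i - y 0 i) / r) / r) * \prod_(j | j != i) plateau d ((x 0 j - y 0 j) / r).

Lemma C1_cube_cutoff y r d : C1 (cube_cutoff y r d) (dcube_cutoff y r d).
Proof.
have da a t : is_derive (t : R) (1 : R) (fun u : R => (u - a) / r) r^-1.
  by apply: is_derive_eq; rewrite /GRing.scale/= !mulr0 subr0 mulr1 add0r.
apply: (@C1_prod_coord R n (fun j t => plateau d ((t - y 0 j) / r)) (fun j t => dplateau d ((t - y 0 j) / r) / r)).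
  move=> j t; exact: (@is_derive1_comp R (plateau d) (fun u => (u - y 0 j) / r) t _ _ (is_derive_plateau d _) (da _ _)).
move=> j t; apply: (@continuousM _ _ (fun t => dplateau d ((t - y 0 j) / r)) (fun=> r^-1)); last exact: cst_continuous.
apply: (@continuous_comp _ _ _ (fun t => (t - y 0 j) / r) (dplateau d)); last exact: continuous_dplateau.
exact: is_derive_continuous (da _ t).
Qed.

Lemma cube_cutoff_itv y r d x : 0 <= cube_cutoff y r d x <= 1.
Proof.
apply/andP; split; first by apply: prodr_ge0 => j _; have /andP[] := plateau_itv d ((x 0 j - y 0 j) / r).
have -> : (1 : R) = \prod_(j < n) 1 by rewrite big1.
by apply: ler_prod => j _; exact: plateau_itv.
Qed.

Lemma cube_cutoff_out y r d x : 0 < r -> 0 < d -> ~ cube y r x -> cube_cutoff y r d x = 0.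
Proof.
move=> r0 d0 nx; have [j xj] : exists j, r <= `|x 0 j - y 0 j|.
  by apply: contrapT => /forallNP h; apply: nx => j; rewrite ltNge; apply/negP.
rewrite /cube_cutoff (bigD1 j)//= plateau_out ?mul0r//.
by rewrite normrM normfV (gtr0_norm r0) ler_pdivlMr// mul1r.
Qed.

Lemma cube_cutoff_in y r d x : 0 < r -> 0 < d -> cube y ((1 - d) * r) x ->
  cube_cutoff y r d x = 1 /\ forall j, dcube_cutoff y r d j x = 0.
Proof.
move=> r0 d0 xy.
have H j : plateau d ((x 0 j - y 0 j) / r) = 1 /\ dplateau d ((x 0 j - y 0 j) / r) = 0.
  apply: plateau_in => //; rewrite normrM normfV (gtr0_norm r0) ltr_pdivrMr//; exact: xy.
split=> [|j]; first by apply: big1 => j _; have [] := H j.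
by rewrite /dcube_cutoff; have [_ ->] := H j; rewrite !mul0r.
Qed.

Lemma dcube_cutoff_le y r d j x : 0 < r -> 0 < d -> `|dcube_cutoff y r d j x| <= 8 / (d * r).
Proof.
move=> r0 d0; rewrite /dcube_cutoff normrM normrM normfV (gtr0_norm r0).
have h1 := dplateau_le ((x 0 j - y 0 j) / r) d0.
have h2 : `|\prod_(i | i != j) plateau d ((x 0 i - y 0 i) / r)| <= 1.
  rewrite ger0_norm; last by apply: prodr_ge0 => i _; have /andP[] := plateau_itv d ((x 0 i - y 0 i) / r).
  apply: (@le_trans _ _ (\prod_(i < n | i != j) 1)); last by rewrite big1.
  by apply: ler_prod => i _; exact: plateau_itv.
rewrite invfM mulrA -[leRHS]mulr1; apply: ler_pM => //; first by rewrite divr_ge0// ltW.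
by rewrite ler_pM2r ?invr_gt0.
Qed.

End Cutoff.

(** * Blow-up *)

Section AffineApproximation.
Variables (R : realType) (n : nat).
Local Notation mu := (@lebesgue_Rn R n).
Implicit Types (f : 'rV[R]_n -> R) (x y z : 'rV[R]_n).

Lemma C1_linear (a : 'I_n -> R) : C1 (fun x : 'rV[R]_n => \sum_j a j * x 0 j) (fun j _ => a j).
Proof.
split=> [i x|j]; last by move=> x; exact: cst_continuous.
apply: is_derive_quotient => e e0; exists 1 => // h h0 _.
have -> : \sum_j a j * (h *: delta_mx 0 i + x) 0 j = a i * h + \sum_j a j * x 0 j.
  rewrite (eq_bigr (fun j => a j * (h * (i == j)%:R) + a j * x 0 j)); last first.
    by move=> j _; rewrite !mxE eqxx/= mulrDr (eq_sym j).
  rewrite big_split/= (bigD1 i)//= eqxx mulr1 big1 ?addr0// => j /negbTE ji.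
  by rewrite eq_sym ji !mulr0.
by rewrite addrK mulfK// subrr normr0 ltW.
Qed.

Lemma C1_affine (a : 'I_n -> R) (b : R) y : C1 (fun x => b + \sum_j a j * (x - y) 0 j) (fun j _ => a j).
Proof.
have := C1_subc (\sum_j a j * y 0 j - b) (C1_linear a).
rewrite (_ : (fun x => _ - _) = (fun x => b + \sum_j a j * (x - y) 0 j))//; apply/funext => x.
rewrite opprB addrCA -sumrB; congr (_ + _); apply: eq_bigr => j _.
by rewrite !mxE mulrBr.
Qed.

Lemma lipschitz_of_le (V V' : normedModType R) (f : V -> V') (K : R) :
  (forall u v : V, `|f u - f v| <= K * `|u - v|) -> lipschitz f.
Proof.
move=> H; exists K; split; first exact: num_real.
move=> M KM [u v] _ /=; apply: le_trans (H u v) _; rewrite ler_wpM2r// ltW//.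
Qed.

Hypothesis vol0 : 0 < cube_vol R n.

Lemma moll_norm_le_cube f s x a : 0 < s -> locint f -> (forall z, cube x s z -> `|f z| <= a) -> `|moll s f x| <= a.
Proof.
move=> s0 lf fa; rewrite (mollE x s0 lf).
have If := mker_mul_integrable vol0 x s0 lf; have Ia := mker_integrable vol0 x s0.
have iZ := mker_mul_integrable vol0 x s0 (@locint_cst R n a).
apply: le_trans (@le_normr_Rintegral _ (Rn R n) R mu setT _ measurableT If) _.
have E := @RintegralZl _ (Rn R n) R mu setT _ a measurableT Ia.
rewrite (mker_mass vol0 x s0) mulr1 in E; rewrite -E.
apply: (@le_Rintegral _ (Rn R n) R mu setT _ _ measurableT _ iZ).
  exact: (@integrable_norm _ (Rn R n) R mu _ _ If).
move=> z _; have [zs|nz] := pselect (cube x s z); last by rewrite mker_out// !mulr0 normr0.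
by rewrite normrM (ger0_norm (mker_ge0 vol0 x z s0)) ler_wpM2r ?mker_ge0//; exact: fa.
Qed.

Lemma moll_sub_lipschitz f s x La : 0 < s -> 0 <= La -> (forall x y, `|f x - f y| <= La * `|x - y|) ->
  `|moll s f x - f x| <= La * s.
Proof.
move=> s0 La0 fL; have cf := lipschitz_continuous_Rn fL; have lf := continuous_locint cf.
rewrite addrC -(moll_addl vol0 (- f x) x s0 lf).
apply: (moll_norm_le_cube s0 (locintD (@locint_cst R n (- f x)) lf)).
move=> z /(cubeP _ _ s0) zx; rewrite addrC; apply: le_trans (fL z x) _.
by apply: ler_wpM2l => //; exact: ltW.
Qed.

(** Quantitative differentiability at a Lebesgue point. Mollification at scale [t r] moves a
    Lipschitz [phi] by at most [La t r], at [x] and at [y], and the mollified gradient differs from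
    [A] by at most [B tau / t^n]. The parameter [t] balances the errors: it is fixed first and [tau]
    is taken small afterwards. *)
Lemma affine_approx : exists2 B : R, 0 <= B & forall m (phi : 'rV[R]_n -> 'cV[R]_m) (G : 'rV[R]_n -> 'M[R]_(m, n))
    (A : 'M[R]_(m, n)) La y r tau t, is_weak_gradient phi G -> 0 <= La -> 0 <= tau ->
    (forall i x y, `|phi x i 0 - phi y i 0| <= La * `|x - y|) -> 0 < r -> 0 < t <= 1 ->
    (forall i j, (\int[mu]_(x in cube y (2 * r)) (`|G x i j - A i j|)%:E <= (tau * r ^+ n)%:E)%E) ->
    forall i x, cube y r x ->
    `|phi x i 0 - (phi y i 0 + \sum_j A i j * (x - y) 0 j)| <= (2 * (La * t) + n%:R * (B * (tau / t ^+ n))) * r.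
Proof.
have [B B0 HB] := moll_le_integral vol0; exists B => // m phi G A La y r tau t wG La0 tau0 phiL r0 /andP[t0 t1] HG i x xy.
have s0 : 0 < t * r by rewrite mulr_gt0.
have [_ LG _] := wG; have lG j := locint_Lq_loc1 (LG i j).
have CP := C1_moll vol0 i s0 wG.
have CA := C1_affine (A i) (phi y i 0) y.
have Cf := C1B CP CA.
set f := (fun x => _) in Cf.
have HK j z : `|z - y| <= `|x - y| -> `|moll (t * r) (fun z => G z i j) z - A i j| <= B * (tau / t ^+ n).
  move=> zx; have zr : `|z - y| < r by apply: le_lt_trans zx _; exact/(cubeP _ _ r0).
  have lGA : locint (fun z => - A i j + G z i j) by exact: (locintD (@locint_cst R n (- A i j)) (lG j)).
  rewrite addrC -(moll_addl vol0 (- A i j) z s0 (lG j)).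
  apply: le_trans (moll_norm_le vol0 z s0 lGA (locint_norm lGA) (fun w => lexx _)) _.
  have := HB (fun w => `|- A i j + G w i j|) (t * r) z (tau * r ^+ n) s0 (locint_norm lGA) (fun w => normr_ge0 _).
  rewrite exprMn invfM.
  have -> : tau * r ^+ n * ((t ^+ n)^-1 * (r ^+ n)^-1) = tau / t ^+ n.
    by field; rewrite !expf_neq0 ?gt_eqF.
  apply; apply: le_trans (HG i j).
  have sub : cube z (t * r) `<=` cube y (2 * r).
    apply: cube_subset => k; have := coord_le_norm (z - y) 0 k; rewrite !mxE.
    have : t * r <= r by rewrite ler_piMl// ltW.
    by move: zr; lra.
  have mGA := measurable_norm_Rn lGA.1.
  apply: le_trans (@subset_integral_EFin _ (Rn R n) R mu _ _ _ (measurable_cube _ _) (measurable_cube _ _) mGA (fun w => normr_ge0 _) sub) _.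
  by rewrite le_eqVlt; apply/orP; left; apply/eqP; apply: eq_integral => w _; rewrite addrC.
have h1 : `|f x - f y| <= n%:R * (B * (tau / t ^+ n)) * r.
  have := @C1_lipschitz_on _ _ _ _ y (x - y) (B * (tau / t ^+ n)) Cf HK.
  rewrite (_ : y + (x - y) = x); last by rewrite addrC subrK.
  move=> H; apply: le_trans (H _) _; first by rewrite mulr_ge0// divr_ge0// exprn_ge0// ltW.
  apply: ler_wpM2l; first by rewrite !mulr_ge0// invr_ge0 exprn_ge0// ltW.
  by apply: ltW; exact/(cubeP _ _ r0).
have h2 := moll_sub_lipschitz x s0 La0 (phiL i).
have h3 := moll_sub_lipschitz y s0 La0 (phiL i).
have fy : f y = moll (t * r) (fun z => phi z i 0) y - phi y i 0.
  by rewrite /f subrr (big1 _ _ _ (fun j _ => _)) ?addr0// => j _; rewrite mxE mulr0.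
have fx : f x = moll (t * r) (fun z => phi z i 0) x - (phi y i 0 + \sum_j A i j * (x - y) 0 j) by [].
have -> : phi x i 0 - (phi y i 0 + \sum_j A i j * (x - y) 0 j) =
   (f x - f y) + ((moll (t * r) (fun z => phi z i 0) y - phi y i 0) - (moll (t * r) (fun z => phi z i 0) x - phi x i 0)).
  by rewrite fx fy; ring.
apply: le_trans (ler_normD _ _) _; have := ler_normB (moll (t * r) (fun z => phi z i 0) y - phi y i 0) (moll (t * r) (fun z => phi z i 0) x - phi x i 0).
by rewrite mulrDl -[2 * (La * t) * r]mulrA -(mulrA La); lra.
Qed.

End AffineApproximation.

(** * The cutoff test field and its energy *)

Section TestFunction.
Variables (R : realType) (m n : nat).
Local Notation mu := (@lebesgue_Rn R n).
Variables (f : 'M[R]_(m, n) -> R) (xi A : 'M[R]_(m, n)).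
Hypothesis fqc : quasiconvex f.
Variables (u : 'rV[R]_n -> 'cV[R]_m) (H : 'rV[R]_n -> 'M[R]_(m, n)).
Hypothesis Cu : forall i, C1 (fun x => u x i 0) (fun j x => H x i j).
Variables (y : 'rV[R]_n) (r d : R) (b : 'cV[R]_m).
Hypothesis r0 : 0 < r.
Hypothesis d0 : 0 < d.

Definition deviation i (x : 'rV[R]_n) : R := u x i 0 - (b i 0 + \sum_j A i j * (x - y) 0 j).

Definition test_field (x : 'rV[R]_n) : 'cV[R]_m := \col_i (cube_cutoff y r d x * deviation i x).

Definition test_gradient (x : 'rV[R]_n) : 'M[R]_(m, n) :=
  \matrix_(i, j) (cube_cutoff y r d x * (H x i j - A i j) + deviation i x * dcube_cutoff y r d j x).

Lemma C1_test_field i : C1 (fun x => test_field x i 0) (fun j x => test_gradient x i j).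
Proof.
rewrite (_ : (fun x => _) = (fun x => cube_cutoff y r d x * deviation i x)); last by apply/funext => x; rewrite mxE.
rewrite (_ : (fun j x => _) = (fun j x => cube_cutoff y r d x * (H x i j - A i j) + deviation i x * dcube_cutoff y r d j x)); last first.
  by apply/funext => j; apply/funext => x; rewrite mxE.
exact: (C1M (C1_cube_cutoff y r d) (C1B (Cu i) (C1_affine (A i) (b i 0) y))).
Qed.

Lemma test_field_out x : ~ cube y r x -> test_field x = 0.
Proof. by move=> nx; apply/colP => i; rewrite !mxE cube_cutoff_out// mul0r. Qed.

Lemma test_field_lipschitz : lipschitz test_field.
Proof.
have [r' r'0 Hr'] := cube_subset0 y r.
have out0 i x : ~ cube 0 r' x -> test_field x i 0 = 0.
  by move=> nx; rewrite test_field_out ?mxE// => /Hr'.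
have dout i := C1_supp r'0 (C1_test_field i) (out0 i).
have /choice[M HM] : forall ij : 'I_m * 'I_n, exists M : R, 0 <= M /\ forall x, `|test_gradient x ij.1 ij.2| <= M.
  move=> [i j]; have [M M0 H1] := continuous_bounded_cube 0 (r' + 1) ((C1_test_field i).2 j).
  exists M; split=> // x; have [/H1//|nx] := pselect (cube 0 (r' + 1) x).
  by rewrite /= dout// normr0.
pose K := \sum_ij M ij.
have K0 : 0 <= K by apply: sumr_ge0 => ij _; have [] := HM ij.
have HK i j x : `|test_gradient x i j| <= K.
  have [_ H1] := HM (i, j); apply: le_trans (H1 x) _.
  by rewrite /K (bigD1 (i, j))//= lerDl sumr_ge0// => ij _; have [] := HM ij.
apply: (@lipschitz_of_le _ 'rV[R]_n 'cV[R]_m _ (n%:R * K)) => x z.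
apply: norm_le_coord; first by rewrite !mulr_ge0.
move=> i k; rewrite ord1 mxE [X in _ + X]mxE.
have := @C1_lipschitz_on _ _ _ _ z (x - z) K (C1_test_field i) (fun j w _ => HK i j w) K0.
by rewrite (_ : z + (x - z) = x)// addrC subrK.
Qed.

Lemma quasiconvex_test : ((f (xi + A))%:E * mu (cube y r) <=
  \int[mu]_(x in cube y r) (f (xi + A + test_gradient x))%:E)%E.
Proof.
have bD : bounded_set (cube y r).
  have [r' r'0 Hr'] := cube_subset0 y r.
  exists r'; split; first exact: num_real.
  move=> M r'M x /Hr' /(cubeP _ _ r'0); rewrite subr0 => xr; exact: ltW (lt_trans xr r'M).
have := @fqc (cube y r) test_field test_gradient (xi + A) (@cube_open R n y r) bD test_field_lipschitz.
by apply; [exact: test_field_out|exact: C1_weak_gradient C1_test_field].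
Qed.

End TestFunction.

Lemma integral_sum4_le d (T : measurableType d) (R : realType) (mu : {measure set T -> \bar R}) (D : set T)
    (f g1 g2 g3 g4 : T -> R) (c1 c2 c3 c4 : R) : measurable D ->
  measurable_fun setT f -> measurable_fun setT g1 -> measurable_fun setT g2 -> measurable_fun setT g3 -> measurable_fun setT g4 ->
  (forall x, 0 <= g1 x) -> (forall x, 0 <= g2 x) -> (forall x, 0 <= g3 x) -> (forall x, 0 <= g4 x) ->
  (forall x, D x -> 0 <= f x <= g1 x + g2 x + g3 x + g4 x) ->
  (\int[mu]_(x in D) (g1 x)%:E <= c1%:E)%E -> (\int[mu]_(x in D) (g2 x)%:E <= c2%:E)%E ->
  (\int[mu]_(x in D) (g3 x)%:E <= c3%:E)%E -> (\int[mu]_(x in D) (g4 x)%:E <= c4%:E)%E ->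
  (\int[mu]_(x in D) (f x)%:E <= (c1 + c2 + c3 + c4)%:E)%E.
Proof.
move=> mD mf m1 m2 m3 m4 p1 p2 p3 p4 fg h1 h2 h3 h4.
have m12 : measurable_fun setT (fun x => g1 x + g2 x) by exact: measurable_funD.
have m123 : measurable_fun setT (fun x => g1 x + g2 x + g3 x) by exact: measurable_funD.
apply: le_trans (le_integral_EFinD mu mD mf m123 m4 fg _ p4) _; first by move=> x; rewrite !addr_ge0.
rewrite [leRHS]EFinD; apply: leeD => //.
rewrite integral_EFinD// ?[leRHS]EFinD; last by move=> x; rewrite addr_ge0.
by apply: leeD => //; rewrite integral_EFinD// EFinD; exact: leeD.
Qed.

Lemma two_powR_ge1 (R : realType) (p : R) : 1 < p -> 1 <= 2 `^ p.
Proof.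
move=> p1; have h2 : 1 <= 2 :> R by lra.
by have := @ler_powR R 2 h2 0 p; rewrite powRr0; apply; lra.
Qed.

Section PowerNormBounds.
Variables (R : realType) (m n : nat) (p : R).
Hypothesis p1 : 1 < p.
Implicit Types A : 'M[R]_(m, n).

Let p0 : 0 <= p. Proof. by have := p1; lra. Qed.
Let q : R := 2 `^ p * 2 `^ p.

Lemma pnormD3 A B C : pnorm p (A + B + C) <= q * (pnorm p A + pnorm p B + pnorm p C).
Proof.
apply: le_trans (pnormD p1 _ _) _; rewrite /q -mulrA; apply: ler_wpM2l; first exact: powR_ge0.
rewrite mulrDr; apply: lerD; first exact: pnormD.
by rewrite ler_peMl ?pnorm_ge0// two_powR_ge1.
Qed.

Lemma pnormZ_le (k : R) A : 0 <= k <= 1 -> pnorm p (k *: A) <= pnorm p A.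
Proof.
move=> /andP[k0 k1]; apply: ler_sum => i _; apply: ler_sum => j _; rewrite mxE normrM (ger0_norm k0).
by apply: ge0_ler_powR; rewrite ?nnegrE ?mulr_ge0// ler_piMl.
Qed.

Lemma pnorm_outer_le (g : 'I_m -> R) (e : 'I_n -> R) (K : R) : 0 <= K -> (forall j, `|e j| <= K) ->
  pnorm p (\matrix_(i, j) (g i * e j)) <= n%:R * K `^ p * \sum_i `|g i| `^ p.
Proof.
move=> K0 eK; rewrite mulr_sumr; apply: ler_sum => i _.
apply: (@le_trans _ _ (\sum_(j < n) K `^ p * `|g i| `^ p)); last by rewrite sumr_const card_ord -mulrA mulr_natl.
apply: ler_sum => j _; rewrite mxE normrM mulrC powRM//; apply: ler_wpM2r; first exact: powR_ge0.
by apply: ge0_ler_powR; rewrite ?nnegrE.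
Qed.

End PowerNormBounds.

Lemma bernoulli_le (R : realType) (d : R) n : 0 <= d <= 1 -> 1 - n%:R * d <= (1 - d) ^+ n.
Proof.
move=> /andP[d0 d1]; elim: n => [|n IH]; first by rewrite mul0r subr0 expr0.
rewrite exprS -natr1; have n0 : 0 <= n%:R :> R by [].
apply: (@le_trans _ _ ((1 - d) * (1 - n%:R * d))); last by rewrite ler_wpM2l// subr_ge0.
have : 0 <= n%:R * (d * d) by rewrite !mulr_ge0.
by lra.
Qed.

Section Estimate.
Variables (R : realType) (m n N : nat) (p : R).
Local Notation mu := (@lebesgue_Rn R n).
Hypothesis p1 : 1 < p.
Variables (a1 a2 a3 : R).
Variables (P : 'I_N -> set 'rV[R]_n).
Hypothesis hP : measurable_partition P (@unit_cell R n).
Variable (W : 'I_N -> 'M[R]_(m, n) -> R).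
Hypothesis hW : forall i, pgrowth_class a1 a2 a3 p (W i).
Variables (T c1 : R).
Hypothesis T0 : 0 <= T.
Hypothesis c10 : 0 <= c1.
Hypothesis W_up : forall i A, W i A <= c1 * (1 + pnorm p A).
Variables (xi A : 'M[R]_(m, n)) (i0 : 'I_N).
Hypothesis Wqc : quasiconvex (W i0).

Let p0 : 0 < p. Proof. by have := p1; lra. Qed.
Let q : R := 2 `^ p * 2 `^ p.
Let q1 : 1 <= q.
Proof.
have h2 := two_powR_ge1 p1; apply: (le_trans h2); by rewrite /q; apply: ler_peMl.
Qed.
Let C := c1 * q.
Let C0 : 0 <= C. Proof. by rewrite mulr_ge0// (le_trans _ q1). Qed.
Let c1C : c1 <= C. Proof. by rewrite /C ler_peMr. Qed.

Section Fixed.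
Variables (u : 'rV[R]_n -> 'cV[R]_m) (H : 'rV[R]_n -> 'M[R]_(m, n)).
Hypothesis Cu : forall i, C1 (fun x => u x i 0) (fun j x => H x i j).
Variables (y : 'rV[R]_n) (r d : R) (b : 'cV[R]_m).
Hypothesis r0 : 0 < r.
Hypothesis d0 : 0 < d.

Local Notation dev := (deviation A u y b).
Local Notation grad := (test_gradient A u H y r d b).

(** A convex combination of [xi + A] and [xi + H] plus a rank-one term carrying the derivative of
    the cutoff. Each part can be bounded in [pnorm] separately. *)
Lemma test_gradientE x : xi + A + grad x =
  (1 - cube_cutoff y r d x) *: (xi + A) + cube_cutoff y r d x *: (xi + H x) + \matrix_(i, j) (dev i x * dcube_cutoff y r d j x).
Proof. by apply/matrixP => i j; rewrite !mxE; ring. Qed.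

(** In the inner cube the test gradient turns [xi + A] into [xi + H], so on [P i0] the integrand is
    the energy itself. In the inner cube off [P i0], and in the cutoff layer, only the growth
    condition is available; there the part of [pnorm p (xi + H x)] above [T] is paid for by the
    excess. *)
Lemma W_test_le x : cube y r x -> unit_cell x ->
  W i0 (xi + A + grad x) <= mixture P W x (xi + H x) +
    C * (1 + pnorm p (xi + A) + T) * (\1_(cube y r `\` cube y ((1 - d) * r)) x + \1_(cube y r `\` P i0) x) +
    2 * C * excess p T (xi + H x) + C * (n%:R * (8 / (d * r)) `^ p) * \sum_i `|dev i x| `^ p.
Proof.
move=> xr xQ.
have X0 := pnorm_ge0 p (xi + A); set X := pnorm p (xi + A) in X0 *.
have e0 := excess_ge0 p T (xi + H x); have Fe := pnorm_le_excess p T (xi + H x).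
set e := excess p T (xi + H x) in e0 Fe *.
have S0 : 0 <= n%:R * (8 / (d * r)) `^ p * \sum_i `|dev i x| `^ p.
  by rewrite !mulr_ge0 ?powR_ge0// sumr_ge0// => i _; exact: powR_ge0.
rewrite -[C * (n%:R * _) * _]mulrA; set S := n%:R * (8 / (d * r)) `^ p * _ in S0 *.
have mix0 := mixture_ge0 P hW x (xi + H x).
have [xin|xout] := pselect (cube y ((1 - d) * r) x).
  have [eta1 deta0] := cube_cutoff_in r0 d0 xin.
  have -> : xi + A + grad x = xi + H x.
    by apply/matrixP => i j; rewrite !mxE eta1 deta0; ring.
  rewrite [\1_(_ `\` cube _ _) x]indicE memNset ?add0r; last by move=> [].
  have [xP|nP] := pselect (P i0 x).
    rewrite (mixtureE hP W _ xP) indicE memNset ?mulr0 ?addr0; last by move=> [].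
    by have := mulr_ge0 C0 e0; have := mulr_ge0 C0 S0; lra.
  rewrite indicE mem_set// mulr1; apply: le_trans (W_up _ _) _.
  apply: (@le_trans _ _ (C * (1 + (T + e)))).
    by apply: ler_pM => //; [rewrite addr_ge0// pnorm_ge0|rewrite lerD2l].
  have := mulr_ge0 C0 X0; have := mulr_ge0 C0 e0; have := mulr_ge0 C0 S0; lra.
rewrite [\1_(_ `\` cube _ _) x]indicE mem_set//.
have I0 : 0 <= \1_(cube y r `\` P i0) x :> R by rewrite indicE.
have etaI := cube_cutoff_itv y r d x.
have h1 : pnorm p (xi + A + grad x) <= q * (X + (T + e) + S).
  rewrite test_gradientE; apply: le_trans (pnormD3 p1 _ _ _) _.
  apply: ler_wpM2l; first by rewrite (le_trans _ q1).
  apply: lerD; first apply: lerD.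
  - by apply: pnormZ_le => //; move: etaI => /andP[? ?]; apply/andP; split; lra.
  - by apply: le_trans (pnormZ_le p1 _ etaI) Fe.
  - apply: pnorm_outer_le => //; first by rewrite divr_ge0// mulr_ge0// ltW.
    by move=> j; exact: dcube_cutoff_le.
apply: le_trans (W_up _ _) _.
apply: (@le_trans _ _ (C * (1 + (X + (T + e) + S)))).
  rewrite /C -mulrA; apply: ler_wpM2l => //; apply: le_trans (_ : 1 + q * (X + (T + e) + S) <= _).
    by rewrite lerD2l.
  by rewrite [leRHS]mulrDr mulr1 lerD2r.
have h2 := mulr_ge0 C0 e0.
have h3 : 0 <= C * (1 + X + T) * \1_(cube y r `\` P i0) x by rewrite !mulr_ge0// !addr_ge0.
rewrite (_ : true%:R = 1 :> R)// [C * (1 + X + T) * _]mulrDr mulr1; lra.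
Qed.

Hypothesis d12 : d <= 2^-1.
Hypothesis yrQ : cube y r `<=` @unit_cell R n.
Let V := r ^+ n * cube_vol R n.
Let V0 : 0 <= V. Proof. by rewrite mulr_ge0 ?cube_vol_ge0// exprn_ge0// ltW. Qed.

Lemma annulus_measure : (mu (cube y r `\` cube y ((1 - d) * r)) <= (V * (n%:R * d))%:E)%E.
Proof.
have d1 : 0 < 1 - d by have := d12; lra.
have dr0 : 0 < (1 - d) * r by rewrite mulr_gt0.
have sub : cube y ((1 - d) * r) `<=` cube y r by apply: cube_le; rewrite ler_piMl ?(ltW r0)//; have := d0; lra.
have mD := measurable_cube y r; have mI := measurable_cube y ((1 - d) * r).
have muI : mu (cube y ((1 - d) * r)) = (((1 - d) * r) ^+ n * cube_vol R n)%:E by exact: lebesgue_cubeE.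
have muD : mu (cube y r) = V%:E by exact: lebesgue_cubeE.
have E : mu (cube y r `\` cube y ((1 - d) * r)) = (V - ((1 - d) * r) ^+ n * cube_vol R n)%:E.
  apply: etrans (@measureD _ (Rn R n) R mu _ _ mD mI (lebesgue_cube_lty y r)) _.
  rewrite EFinB -muD; congr (_ - _)%E; rewrite -muI; congr (mu _); exact: (setIidr sub).
rewrite E lee_fin /V exprMn.
have := @bernoulli_le R d n; have := d12; have := d0 => h1 h2 /(_ _) h3.
have {}h3 : 1 - n%:R * d <= (1 - d) ^+ n by apply: h3; apply/andP; split; lra.
have : 0 <= V * ((1 - d) ^+ n - (1 - n%:R * d)) by rewrite mulr_ge0// subr_ge0.
rewrite /V; set x := r ^+ n; set v := cube_vol R n; set e := (1 - d) ^+ n; lra.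
Qed.

Variables (phi : 'rV[R]_n -> 'cV[R]_m) (dd E tau sigma K : R).
Hypothesis mphi : forall i, measurable_fun [set: Rn R n] (fun x => phi x i 0).
Hypothesis aH : approximant P W xi dd H.
Hypothesis uphi : forall i, (\int[mu]_(x in cube (0 : 'rV[R]_n) 2) (`|u x i 0 - phi x i 0| `^ p)%:E <= E%:E)%E.
Hypothesis phi_affine : forall i x, cube y r x -> `|phi x i 0 - (b i 0 + \sum_j A i j * (x - y) 0 j)| <= sigma * r.
Hypothesis P_dense : (mu (cube y r `\` P i0) <= (tau * r ^+ n)%:E)%E.
Hypothesis excess_int : (\int[mu]_(x in cube (0 : 'rV[R]_n) 2) (excess p T (xi + H x))%:E <= (K * dd)%:E)%E.

Lemma cube_sub2 : cube y r `<=` cube 0 2.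
Proof. by move=> x /yrQ xQ j; rewrite mxE subr0; have := xQ j => /andP[? ?]; rewrite ltr_norml; lra. Qed.

Lemma measurable_deviation i : measurable_fun [set: Rn R n] (fun x => dev i x).
Proof.
apply: continuous_measurable_Rn; exact: (C1_continuous (C1B (Cu i) (C1_affine (A i) (b i 0) y))).
Qed.

Lemma deviation_integral i : (\int[mu]_(x in cube y r) (`|dev i x| `^ p)%:E <= (2 `^ p * (E + (sigma * r) `^ p * V))%:E)%E.
Proof.
have mD := measurable_cube y r; have t0 : 0 <= 2 `^ p :> R by exact: powR_ge0.
have mp (w : 'rV[R]_n -> R) : measurable_fun [set: Rn R n] w -> measurable_fun [set: Rn R n] (fun x => `|w x| `^ p).
  by move=> mw; exact: (measurableT_comp (measurable_powR p) (measurable_norm_Rn mw)).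
have mu1 := mp _ (measurable_funB (continuous_measurable_Rn (C1_continuous (Cu i))) (mphi i)).
have mdev := mp _ (measurable_deviation i).
have E1 := @integral_EFinZ _ (Rn R n) R mu _ (2 `^ p) _ mD mu1 (fun x => powR_ge0 _ _) t0.
have E2 := @integral_cst _ (Rn R n) R mu _ mD (2 `^ p * (sigma * r) `^ p)%:E.
have H1 := @le_integral_EFinD _ (Rn R n) R mu _ _ (fun x => 2 `^ p * `|u x i 0 - phi x i 0| `^ p)
  (fun=> 2 `^ p * (sigma * r) `^ p) mD mdev (measurable_funM (measurable_cst _) mu1) (measurable_cst _).
apply: le_trans (H1 _ _ _) _.
- move=> x xr; rewrite powR_ge0/= -mulrDr.
  have -> : dev i x = (u x i 0 - phi x i 0) + (phi x i 0 - (b i 0 + \sum_j A i j * (x - y) 0 j)).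
    by rewrite /deviation addrA subrK.
  apply: le_trans (powR_normD p1 _ _) _; apply: ler_wpM2l => //; rewrite lerD2l.
  by apply: ge0_ler_powR; rewrite ?nnegrE ?(ltW p0)//; [exact: le_trans (phi_affine i xr)|exact: phi_affine].
- by move=> x; rewrite mulr_ge0// powR_ge0.
- by move=> x; rewrite mulr_ge0// powR_ge0.
rewrite E1 E2 mulrDr [leRHS]EFinD; apply: leeD.
  rewrite [leRHS]EFinM; apply: lee_wpmul2l; first by rewrite lee_fin.
  apply: le_trans (uphi i).
  exact: (@subset_integral_EFin _ (Rn R n) R mu _ _ _ mD (measurable_cube _ _) mu1 (fun x => powR_ge0 _ _) cube_sub2).
rewrite mulrA [leRHS]EFinM le_eqVlt; apply/orP; left; apply/eqP; congr (_ * _)%E; exact: lebesgue_cubeE.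
Qed.

(* The four terms come from the energy on [P i0], the annulus together with the complement of [P i0],
   the excess, and the derivative of the cutoff. *)
Lemma blowup_estimate : W i0 (xi + A) * V <= dd +
  C * (1 + pnorm p (xi + A) + T) * (V * (n%:R * d) + tau * r ^+ n) + 2 * C * (K * dd) +
  C * (n%:R * (8 / (d * r)) `^ p) * (m%:R * (2 `^ p * (E + (sigma * r) `^ p * V))).
Proof.
have mD := measurable_cube y r.
have qt := @quasiconvex_test R m n (W i0) xi A Wqc u H Cu y r d b r0 d0.
have muD : mu (cube y r) = V%:E by exact: lebesgue_cubeE.
have [cH _ Hdd] := aH.
have mF := approximant_measurable aH.
have mgrad i j : measurable_fun [set: Rn R n] (fun x => grad x i j).
  exact: continuous_measurable_Rn ((C1_test_field A Cu y r d b i).2 j).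
have Wc : continuous (W i0) by have [] := hW i0.
have mf : measurable_fun [set: Rn R n] (fun x => W i0 (xi + A + grad x)).
  apply: (@measurable_comp_mx R _ (Rn R n) _ _ (fun x => xi + A + grad x) _ _ Wc).
  exact: measurable_addmx.
have mmix := measurable_mixture hP hW mF.
have mP : measurable (P i0 : set (Rn R n)) by have [] := hP.
have mA : measurable (cube y r `\` cube y ((1 - d) * r) : set (Rn R n)) by apply: measurableD => //; exact: measurable_cube.
have mDP : measurable (cube y r `\` P i0 : set (Rn R n)) by exact: measurableD.
have mI := measurable_funD (measurable_indic_Rn mA) (measurable_indic_Rn mDP).
have me := measurable_excess p T mF.
have mS : measurable_fun [set: Rn R n] (fun x => \sum_i `|dev i x| `^ p).
  apply: measurable_sum => i; exact: (measurableT_comp (measurable_powR p) (measurable_norm_Rn (measurable_deviation i))).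
set al := C * (1 + pnorm p (xi + A) + T); set be := C * (n%:R * (8 / (d * r)) `^ p).
have al0 : 0 <= al by rewrite mulr_ge0// !addr_ge0// pnorm_ge0.
have be0 : 0 <= be by rewrite !mulr_ge0// powR_ge0.
have C20 : 0 <= 2 * C by rewrite mulr_ge0.
have I0 x : 0 <= \1_(cube y r `\` cube y ((1 - d) * r)) x + \1_(cube y r `\` P i0) x :> R by rewrite !indicE addr_ge0.
have S0 x : 0 <= \sum_i `|dev i x| `^ p by apply: sumr_ge0 => i _; exact: powR_ge0.
have H4 := @integral_sum4_le _ (Rn R n) R mu (cube y r) (fun x => W i0 (xi + A + grad x))
  (fun x => mixture P W x (xi + H x))
  (fun x => al * (\1_(cube y r `\` cube y ((1 - d) * r)) x + \1_(cube y r `\` P i0) x))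
  (fun x => 2 * C * excess p T (xi + H x)) (fun x => be * \sum_i `|dev i x| `^ p)
  dd (al * (V * (n%:R * d) + tau * r ^+ n)) (2 * C * (K * dd)) (be * (m%:R * (2 `^ p * (E + (sigma * r) `^ p * V))))
  mD mf mmix (measurable_funM (measurable_cst _) mI) (measurable_funM (measurable_cst _) me) (measurable_funM (measurable_cst _) mS)
  (fun x => mixture_ge0 P hW x _) (fun x => mulr_ge0 al0 (I0 x)) (fun x => mulr_ge0 C20 (excess_ge0 p T _)) (fun x => mulr_ge0 be0 (S0 x)).
rewrite -lee_fin EFinM -muD; apply: le_trans qt (H4 _ _ _ _ _).
- move=> x xr; have [_ W0 _] := hW i0; rewrite W0/=; apply: W_test_le => //; exact: yrQ.
- apply: le_trans Hdd.
  exact: (@subset_integral_EFin _ (Rn R n) R mu _ _ _ mD (@measurable_unit_cell R n) mmix (fun x => mixture_ge0 P hW x _) yrQ).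
- have E1 := @integral_EFinZ _ (Rn R n) R mu _ al _ mD mI I0 al0.
  have E2 := @integral_EFinD _ (Rn R n) R mu _ _ _ mD (measurable_indic_Rn mA) (measurable_indic_Rn mDP) (fun x => ler0n _ _) (fun x => ler0n _ _).
  have E3 := @integral_indic _ (Rn R n) R mu _ mD _ mA; have E4 := @integral_indic _ (Rn R n) R mu _ mD _ mDP.
  rewrite E1 E2 E3 E4 [leRHS]EFinM; apply: lee_wpmul2l; first by rewrite lee_fin.
  rewrite EFinD; apply: leeD.
    by apply: le_trans annulus_measure; apply: le_lebesgue_outer => x [].
  by apply: le_trans P_dense; apply: le_lebesgue_outer => x [].
- have E1 := @integral_EFinZ _ (Rn R n) R mu _ (2 * C) _ mD me (fun x => excess_ge0 p T _) C20.
  rewrite E1 [leRHS]EFinM; apply: lee_wpmul2l; first by rewrite lee_fin.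
  apply: le_trans excess_int.
  exact: (@subset_integral_EFin _ (Rn R n) R mu _ _ _ mD (measurable_cube _ _) me (fun x => excess_ge0 p T _) cube_sub2).
have E1 := @integral_EFinZ _ (Rn R n) R mu _ be _ mD mS S0 be0.
have mdp i : measurable_fun [set: Rn R n] (fun x => `|dev i x| `^ p).
  exact: (measurableT_comp (measurable_powR p) (measurable_norm_Rn (measurable_deviation i))).
have E2 := @integral_EFin_sum _ (Rn R n) R mu _ (index_enum 'I_m) (cube y r) (fun i x => `|dev i x| `^ p) mD mdp (fun i x => powR_ge0 _ _).
rewrite E1 E2 [leRHS]EFinM; apply: lee_wpmul2l; first by rewrite lee_fin.
apply: le_trans (lee_sum _ (fun i _ => deviation_integral i)) _.
by rewrite sumEFin lee_fin sumr_const card_ord mulr_natl.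
Qed.

End Fixed.

End Estimate.

Lemma lebesgue_null (R : realType) n : cube_vol R n = 0 -> forall A : set 'rV[R]_n, lebesgue_Rn (A : set (Rn R n)) = 0%E.
Proof.
move=> vol0 A; apply/eqP; rewrite eq_le measure_ge0 andbT.
have H : lebesgue_Rn ([set: 'rV[R]_n] : set (Rn R n)) = 0%E.
  have hk (k : nat) : lebesgue_Rn (cube (0 : 'rV[R]_n) k.+1%:R : set (Rn R n)) = 0%E.
    by rewrite lebesgue_cubeE// vol0 mulr0.
  apply/eqP; rewrite eq_le measure_ge0 andbT -bigcup_cube.
  apply: (le_trans (@lebesgue_outer_sigma_subadditive R n (fun k => cube (0 : 'rV[R]_n) k.+1%:R))).
  by rewrite eseries0// => k _ _; exact: hk.
by rewrite -H; exact: le_lebesgue_outer.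
Qed.

(** * Vanishing of the energy density at Lebesgue points *)

Section BlowUp.
Variables (R : realType) (m n N : nat) (p : R).
Local Notation mu := (@lebesgue_Rn R n).
Hypothesis p1 : 1 < p.
Variables (a1 a2 a3 : R).
Hypothesis a1_gt0 : 0 < a1.
Hypothesis a2_gt0 : 0 < a2.
Hypothesis a3_gt0 : 0 < a3.
Variables (P : 'I_N -> set 'rV[R]_n).
Hypothesis hP : measurable_partition P (@unit_cell R n).
Variable (W : 'I_N -> 'M[R]_(m, n) -> R).
Hypothesis hW : forall i, pgrowth_class a1 a2 a3 p (W i).
Hypothesis Wqc : forall i, quasiconvex (W i).
Variable xi : 'M[R]_(m, n).
Hypothesis vol0 : 0 < cube_vol R n.
Variables (U : set_system nat) (u : nat -> 'rV[R]_n -> 'cV[R]_m) (H : nat -> 'rV[R]_n -> 'M[R]_(m, n))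
    (phi : 'rV[R]_n -> 'cV[R]_m) (G : 'rV[R]_n -> 'M[R]_(m, n)) (La : R).
Hypothesis PU : ProperFilter U.
Hypothesis Cu : forall k i, C1 (fun x => u k x i 0) (fun j x => H k x i j).
Hypothesis aH : forall e, 0 < e -> \forall k \near U, approximant P W xi e (H k).
Hypothesis uphi : locally_Lp_close p U u phi.
Hypothesis La0 : 0 <= La.
Hypothesis phiL : forall i x y, `|phi x i 0 - phi y i 0| <= La * `|x - y|.
Hypothesis wG : is_weak_gradient phi G.

Let p0 : 0 < p. Proof. by have := p1; lra. Qed.

Lemma unit_cell_ball (y : 'rV[R]_n) : unit_cell y -> exists2 d : R, 0 < d & forall r, 0 < r <= d -> cube y r `<=` @unit_cell R n.
Proof.
move=> yQ; have oQ : open (@unit_cell R n) by rewrite unit_cellE; exact: cube_open.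
have /nbhs_ballP[d /= d0 H'] := open_nbhs_nbhs (conj oQ yQ).
exists d => // r /andP[r0 rd] z /(cubeP _ _ r0) zy; apply: H'.
by rewrite -ball_normE/= distrC (lt_le_trans zy).
Qed.

(** The order of choice is essential: from [e] come the layer width [d] and [rho], from these
    [sigma], then [t], then [tau], then the radius [r], and only at the end the index [k]. The
    cutoff term has the factor [(8 / (d r))^p], which for a fixed cube is compensated by the [L^p]
    closeness of [u k] to [phi]. *)
Lemma zero_at_point y i0 : P i0 y ->
  (forall tau rmax, 0 < tau -> 0 < rmax -> exists r, [/\ 0 < r <= rmax,
    forall i j, (\int[mu]_(x in cube y (2 * r)) (`|G x i j - G y i j|)%:E <= (tau * r ^+ n)%:E)%E &
    (mu (cube y r `\` P i0) <= (tau * r ^+ n)%:E)%E]) ->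
  W i0 (xi + G y) = 0.
Proof.
move=> Piy Hr; have [_ W0 _] := hW i0.
have yQ : unit_cell y by have [_ _ <-] := hP; exists i0.
apply/eqP; rewrite eq_le W0 andbT; apply/ler_addgt0Pr => e e0; rewrite add0r.
have [c1 c10 W_up] := growth_upper m n p1 a1 a2 a3_gt0.
have [T [c [T0 c0 W_low]]] := growth_lower m n p1 a3 a1_gt0 a2_gt0.
have {}W_up i := W_up _ (hW i); have {}W_low i := W_low _ (hW i).
have [K K0 HK] := excess_integral hP hW c0 W_low xi 2.
have [B B0 HB] := affine_approx vol0.
have h2 := two_powR_ge1 p1.
pose C := c1 * (2 `^ p * 2 `^ p).
have C0 : 0 <= C by rewrite !mulr_ge0// (le_trans _ h2).
pose C4 := C * (1 + pnorm p (xi + G y) + T).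
have C40 : 0 <= C4 by rewrite mulr_ge0// !addr_ge0// pnorm_ge0.
pose C5 := C * n%:R * m%:R.
have C50 : 0 <= C5 by rewrite !mulr_ge0.
(* The layer occupies at most the fraction [n d] of the cube, and [C4] is the coefficient of its
   measure in [blowup_estimate]. Layer, affine error and density defect each get [e / 3]. *)
pose d := Num.min 2^-1 (e / 3 / (C4 * n%:R + 1)).
have d0 : 0 < d by rewrite lt_min invr_gt0 ltr0n/= !divr_gt0// ltr_wpDl// mulr_ge0.
have d12 : d <= 2^-1 by rewrite ge_min lexx.
have dC : C4 * (n%:R * d) <= e / 3.
  have q0 : 0 < C4 * n%:R + 1 by rewrite ltr_wpDl// mulr_ge0.
  have : d * (C4 * n%:R + 1) <= e / 3 by rewrite -ler_pdivlMr// ge_min lexx orbT.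
  by have := ltW d0; rewrite mulrDr mulr1 (mulrC d) -mulrA; lra.
pose rho := Num.min 1 (e / 3 / (C5 + 1)).
have rho0 : 0 < rho by rewrite lt_min ltr01 !divr_gt0// ltr_wpDl.
have rhoC : C5 * rho `^ p <= e / 3.
  apply: (@le_trans _ _ ((C5 + 1) * rho)).
    apply: ler_pM => //; rewrite ?powR_ge0//; first by rewrite lerDl.
    by apply: powR_le_id => //; rewrite (ltW rho0) ge_min lexx.
  by rewrite mulrC -ler_pdivlMr ?ltr_wpDl// ge_min lexx orbT.
(* The [16] makes the product of the cutoff slope [8 / (d r)], the [2] of the quasi-triangle
   inequality and the affine error [sigma r] equal to [rho], so that the radius cancels. *)
pose sigma := d * rho / 16.
have sigma0 : 0 < sigma by rewrite !mulr_gt0.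
pose t := Num.min 1 (sigma / (4 * (La + 1))).
have La1 : 0 < 4 * (La + 1) by rewrite mulr_gt0// ltr_wpDl.
have t0 : 0 < t by rewrite lt_min ltr01 divr_gt0.
have t1 : t <= 1 by rewrite ge_min lexx.
have tLa : 2 * (La * t) <= sigma / 2.
  have : t * (4 * (La + 1)) <= sigma by rewrite -ler_pdivlMr// ge_min lexx orbT.
  by have := ltW t0; rewrite mulrCA mulrDr mulr1 (mulrC t); lra.
have tn0 : 0 < t ^+ n by exact: exprn_gt0.
have nB0 : 0 <= n%:R * B by rewrite mulr_ge0.
(* The first entry bounds the gradient error in [affine_approx] by [sigma / 2]; the second one
   bounds the contribution of the complement of [P i0]. *)
pose tau := Num.min (sigma / 2 * t ^+ n / (n%:R * B + 1)) (e / 3 * cube_vol R n / (C4 + 1)).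
have tau0 : 0 < tau by rewrite lt_min; apply/andP; split; rewrite divr_gt0 ?mulr_gt0 ?divr_gt0// ltr_wpDl.
have tauB : n%:R * (B * (tau / t ^+ n)) <= sigma / 2.
  have : tau * (n%:R * B + 1) <= sigma / 2 * t ^+ n by rewrite -ler_pdivlMr ?ltr_wpDl// ge_min lexx.
  rewrite !mulrA ler_pdivrMr//; have := ltW tau0; rewrite mulrDr mulr1 (mulrC tau); lra.
have tauC : C4 * tau <= e / 3 * cube_vol R n.
  have : tau * (C4 + 1) <= e / 3 * cube_vol R n by rewrite -ler_pdivlMr ?ltr_wpDl// ge_min lexx orbT.
  by have := ltW tau0; rewrite mulrDr mulr1 (mulrC tau); lra.
have [rmax rmax0 Hrmax] := unit_cell_ball yQ.
have [r [/andP[r0 rle] HG HP]] := Hr tau rmax tau0 rmax0.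
have yrQ : cube y r `<=` @unit_cell R n by apply: Hrmax; rewrite r0.
have rn0 : 0 < r ^+ n by exact: exprn_gt0.
pose V := r ^+ n * cube_vol R n.
have V0 : 0 < V by rewrite mulr_gt0.
have aff i x : cube y r x -> `|phi x i 0 - (phi y i 0 + \sum_j G y i j * (x - y) 0 j)| <= sigma * r.
  move=> xy; have t01 : 0 < t <= 1 by rewrite t0.
  apply: le_trans (HB m phi G (G y) La y r tau t wG La0 (ltW tau0) phiL r0 t01 HG i x xy) _.
  by apply: ler_wpM2r; [exact: ltW|lra].
pose D8 := n%:R * (8 / (d * r)) `^ p.
have D80 : 0 <= D8 by rewrite mulr_ge0// powR_ge0.
(* The total coefficient of the errors that vanish along [U], namely energy, excess and [L^p]
   distance. All are taken to be [e' / Z], so that together they contribute exactly [e']; what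
   remains is [rest]. *)
pose Z := 1 + 2 * C * K + C * D8 * (m%:R * 2 `^ p).
have Z0 : 0 < Z.
  by rewrite /Z -addrA ltr_pwDl// addr_ge0// !mulr_ge0// powR_ge0.
pose rest := C4 * (V * (n%:R * d) + tau * r ^+ n) + C * D8 * (m%:R * (2 `^ p * ((sigma * r) `^ p * V))).
have WV : W i0 (xi + G y) * V <= rest.
  apply/ler_addgt0Pr => e' e'0.
  have e2 : 0 < e' / Z by rewrite divr_gt0.
  have close : \forall k \near U, forall i, (\int[mu]_(x in cube (0 : 'rV[R]_n) 2) (`|u k x i 0 - phi x i 0| `^ p)%:E <= (e' / Z)%:E)%E.
    by apply: filter_forall => i; exact: (uphi i 2 e2).
  have [k [ak uk]] := filter_ex (filterI (aH e2) close).
  have mphi i : measurable_fun [set: Rn R n] (fun x => phi x i 0).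
    exact: continuous_measurable_Rn (lipschitz_continuous_Rn (phiL i)).
  have := blowup_estimate p1 hP hW T0 c10 W_up (Wqc i0) (Cu k) r0 d0 d12 yrQ mphi ak uk aff HP (HK _ _ ak).
  rewrite -/V -/C -/C4 -/D8; move=> h; apply: le_trans h _.
  rewrite le_eqVlt; apply/orP; left; apply/eqP; rewrite /rest.
  have : e' = e' / Z * Z by rewrite divfK// gt_eqF.
  set w := e' / Z => ->; rewrite /Z; ring.
have restE : C * D8 * (m%:R * (2 `^ p * ((sigma * r) `^ p * V))) = C5 * rho `^ p * V.
  have {1}-> : rho = 8 / (d * r) * 2 * (sigma * r) by rewrite /sigma; field; rewrite !gt_eqF.
  rewrite !powRM ?mulr_ge0 ?invr_ge0 ?mulr_ge0 ?(ltW d0) ?(ltW r0) ?(ltW rho0)//.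
  by rewrite /C5 /D8 powRM ?invr_ge0 ?mulr_ge0 ?(ltW d0) ?(ltW r0)//; ring.
rewrite -(ler_pM2r V0); apply: le_trans WV _; rewrite /rest restE.
have h3 : C4 * (tau * r ^+ n) <= e / 3 * V.
  by rewrite /V mulrA (mulrC (r ^+ n)) mulrA; apply: ler_wpM2r => //; exact: ltW.
have h4 : C4 * (V * (n%:R * d)) <= e / 3 * V.
  by rewrite (mulrC V) mulrA; apply: ler_wpM2r => //; exact: ltW.
have h5 : C5 * rho `^ p * V <= e / 3 * V by apply: ler_wpM2r => //; exact: ltW.
by rewrite mulrDr; lra.
Qed.

Lemma zero_ae i0 : {ae mu, forall y, P i0 y -> W i0 (xi + G y) = 0}.
Proof.
have mP : measurable (P i0 : set (Rn R n)) by have [] := hP.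
have [_ LG _] := wG; have lG i j := locint_Lq_loc1 (LG i j).
have mC3 := measurable_cube (0 : 'rV[R]_n) 3.
(* All entries of [G] and the indicator of [P i0] form one finite family, so that a single sequence
   of radii serves them all. The entries are made integrable by a cutoff to a cube containing every
   [cube y r] with [y] in the cell and [r <= 1]. *)
pose F (s : 'I_m * 'I_n + unit) : 'rV[R]_n -> R := match s with
  | inl ij => fun x => G x ij.1 ij.2 * \1_(cube 0 3) x | inr _ => \1_(P i0) end.
have PQ : P i0 `<=` cube 0 3.
  move=> x Px j; have : unit_cell x by have [_ _ <-] := hP; exists i0.
  by move=> /(_ j) /andP[? ?]; rewrite mxE subr0 ltr_norml; lra.
have ind_bd (A : set 'rV[R]_n) x : `|\1_A x : R| <= 1.
  by rewrite indicE; case: (_ \in _); rewrite ?normr1// normr0.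
have Fi s : mu.-integrable setT (EFin \o F s).
  case: s => [[i j]|_] /=.
    apply: (locint_mul_integrable (lG i j) (measurable_indic_Rn mC3) (ind_bd _) (c := 0) (r := 3)).
    by move=> x nx; rewrite indicE memNset.
  have := locint_mul_integrable (@locint_cst R n 1) (measurable_indic_Rn mP) (ind_bd _) (c := 0) (r := 3).
  rewrite (_ : (fun x => 1 * \1_(P i0) x) = \1_(P i0) :> ('rV[R]_n -> R)); last by apply/funext => x; rewrite mul1r.
  by apply=> x nx; rewrite indicE memNset// => /PQ.
have [r [r0 rcvg Hae]] := lebesgue_points vol0 Fi.
apply: ae_imply Hae => y Hy Piy; apply: (zero_at_point Piy) => tau rmax tau0 rmax0.
(* The blow-up radius will be half of [r q], because the gradient is controlled on the doubled cube;
   [2^n] compensates the change of volume. *)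
have e0 : 0 < tau / 2 ^+ n by rewrite divr_gt0// exprn_gt0.
have near1 : \forall q \near \oo, forall s, (\int[mu]_(w in cube y (r q)) (`|F s w - F s y|)%:E <= (tau / 2 ^+ n * r q ^+ n)%:E)%E.
  by apply: filter_forall => s; exact: Hy.
have near2 : \forall q \near \oo, `|0 - r q| <= Num.min 1 rmax.
  by move/cvgrPdist_le : rcvg; apply; rewrite lt_min ltr01.
have [q [Hq rq]] := filter_ex (filterI near1 near2).
rewrite sub0r normrN gtr0_norm// le_min in rq; move: rq => /andP[rq1 rqm].
have E : tau / 2 ^+ n * r q ^+ n = tau * (r q / 2) ^+ n by rewrite expr_div_n; field; rewrite expf_neq0.
have dbl : 2 * (r q / 2) = r q by rewrite mulrC divfK.
have yq3 w : cube y (r q) w -> cube 0 3 w.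
  move=> wy j; have := wy j; have := PQ y Piy j; rewrite !mxE !subr0 => h1 h2.
  have yQ : unit_cell y by have [_ _ <-] := hP; exists i0.
  have /andP[? ?] := yQ j.
  by move: h2; rewrite ltr_distl ltr_norml => /andP[? ?]; lra.
exists (r q / 2); split.
- by rewrite divr_gt0//= (le_trans _ rqm)// ler_pdivrMr// ler_peMr// ?ler1n// ltW.
- move=> i j; rewrite dbl -E; apply: le_trans (Hq (inl (i, j))).
  rewrite le_eqVlt; apply/orP; left; apply/eqP; apply: eq_integral => w; rewrite inE => wy.
  by rewrite /F/= !indicE !mem_set ?mulr1//; [exact: PQ|exact: yq3].
(* As [y] lies in [P i0], the oscillation of its indicator around [y] equals 1 off [P i0], so its
   integral bounds the measure of the missing part. *)
- rewrite -E; apply: le_trans (Hq (inr tt)).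
  have mD := measurable_cube y (r q / 2); have mDP : measurable (cube y (r q / 2) `\` P i0 : set (Rn R n)) by exact: measurableD.
  have sub : cube y (r q / 2) `\` P i0 `<=` cube y (r q).
    by move=> w [wy _]; apply: cube_le wy; rewrite ler_pdivrMr// ler_peMr// ?ler1n// ltW.
  have mI := measurable_norm_Rn (measurable_funB (measurable_indic_Rn mP) (measurable_cst (\1_(P i0) y : R))).
  have h := @subset_integral_EFin _ (Rn R n) R mu _ _ _ mDP (measurable_cube y (r q)) mI (fun x => normr_ge0 _) sub.
  apply: le_trans h; have E3 := @integral_cst _ (Rn R n) R mu _ mDP 1%E.
  rewrite mul1e in E3; rewrite -[leLHS]E3 le_eqVlt; apply/orP; left; apply/eqP.
  apply: eq_integral => w; rewrite inE => -[_ nP].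
  by rewrite /= !indicE memNset// mem_set// sub0r normrN normr1.
Qed.

End BlowUp.

(** * The cell set *)

Section CellSet.
Variables (R : realType) (m n N : nat) (p : R).
Local Notation mu := (@lebesgue_Rn R n).
Hypothesis p1 : 1 < p.
Variables (a1 a2 a3 : R).
Variables (P : 'I_N -> set 'rV[R]_n).
Hypothesis hP : measurable_partition P (@unit_cell R n).
Variable (W : 'I_N -> 'M[R]_(m, n) -> R).
Hypothesis hW : forall i, pgrowth_class a1 a2 a3 p (W i).
Implicit Types xi : 'M[R]_(m, n).
Local Notation A := (fun i => [set xi : 'M[R]_(m, n) | W i xi = 0]).

Lemma cell_integrand_ge0 xi : (0 <= cell_integrand p (mixture P W) xi)%E.
Proof.
apply: le_ereal_inf_tmp => _ [phi [G [_ _ ->]]]; apply: integral_ge0 => y _.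
by rewrite lee_fin (mixture_ge0 _ hW).
Qed.

Lemma weak_gradient_measurable (phi : 'rV[R]_n -> 'cV[R]_m) (G : 'rV[R]_n -> 'M[R]_(m, n)) :
  is_weak_gradient phi G -> forall i j, measurable_fun [set: Rn R n] (fun x => G x i j).
Proof. by move=> [_ LG _] i j; have [] := LG i j. Qed.

Lemma cell_integrand_le0 xi phi G : W1q_per p%:E phi -> is_weak_gradient phi G ->
  (forall i, {ae mu, forall y, P i y -> W i (xi + G y) = 0}) -> (cell_integrand p (mixture P W) xi <= 0)%E.
Proof.
move=> Wphi wG WG; apply: ereal_inf_lbound; exists phi, G; split=> //; apply/esym.
have mQ := @measurable_unit_cell R n.
have mmix := measurable_mixture hP hW (measurable_addmx xi (weak_gradient_measurable wG)).
have := @ae_eq_integral _ (Rn R n) R mu _ (cst 0%E) _ mQ (@measurable_EFinS _ (Rn R n) R _ _ mmix) (measurable_cst _).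
rewrite integral0; apply; apply: ae_imply (ae_forall_fin WG) => y Hy yQ /=.
have [_ _ QP] := hP; have [i _ Piy] : (\bigcup_i P i) y by rewrite QP.
by rewrite (mixtureE hP W _ Piy) Hy.
Qed.

Lemma zero_weak_gradient : is_weak_gradient (fun _ : 'rV[R]_n => 0 : 'cV[R]_m) (fun=> 0 : 'M[R]_(m, n)).
Proof.
have C0 i : C1 (fun x : 'rV[R]_n => (0 : 'cV[R]_m) i 0) (fun j x => (0 : 'M[R]_(m, n)) i j).
  rewrite (_ : (fun x => _) = (fun x : 'rV[R]_n => \sum_j 0 * x 0 j)); last first.
    by apply/funext => x; rewrite mxE big1// => j _; rewrite mul0r.
  rewrite (_ : (fun j x => _) = (fun (_ : 'I_n) (_ : 'rV[R]_n) => 0)); last by apply/funext => j; apply/funext => x; rewrite mxE.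
  exact: (C1_linear (fun=> 0)).
exact: C1_weak_gradient.
Qed.

Lemma zero_W1q_per (q : \bar R) : (0 < q)%E -> q != -oo%E -> W1q_per q (fun _ : 'rV[R]_n => 0 : 'cV[R]_m).
Proof.
move=> q0 qNoo; have L0 (g : 'rV[R]_n -> R) : (forall x, g x = 0) -> Lq_loc q g.
  move=> g0; rewrite (_ : g = fun=> 0); last exact/funext.
  by apply: Lq_loc_continuous => //; move=> x; exact: cst_continuous.
split; last by move=> z; apply: aeW.
split=> [i|]; first by apply: L0 => x; rewrite mxE.
exists (fun=> 0); first exact: zero_weak_gradient.
by move=> i j; apply: L0 => x; rewrite mxE.
Qed.

Lemma Lq_loc_pinfty (f : 'rV[R]_n -> R) : 0 < cube_vol R n -> Lq_loc +oo%E f -> Lq_loc p%:E f.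
Proof.
move=> vol0 [mf fK]; split=> // K cK.
have mK : measurable (K : set (Rn R n)) by apply: closed_measurable_Rn; exact: compact_closed.
have [r r0 Kr] := compact_subset_cube cK.
have Koo : (mu K < +oo)%E by exact: le_lt_trans (le_lebesgue_outer Kr) (lebesgue_cube_lty 0 r).
have mu0 : (0 < mu [set: Rn R n])%E.
  apply: lt_le_trans (le_lebesgue_outer (@subsetT _ (cube 0 1))).
  by have := lebesgue_cubeE (0 : 'rV[R]_n) (@ltr01 R); rewrite expr1n mul1r => h; rewrite [X in (_ < X)%E]h lte_fin.
have [M HM] := @Lnorm_pinfty_restrict_bounded _ (Rn R n) R mu f K mu0 mK (fK K cK).
apply: (@Lnorm_restrict_bounded _ (Rn R n) R mu f K p%:E M _ _ mK Koo mf HM) => //.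
by rewrite lte_fin; have := p1; lra.
Qed.

Lemma W1q_per_pinfty (phi : 'rV[R]_n -> 'cV[R]_m) : 0 < cube_vol R n -> W1q_per +oo%E phi -> W1q_per p%:E phi.
Proof.
move=> vol0 [[Lphi [G wG LG]] per]; split; last exact: per.
split=> [i|]; first exact: (Lq_loc_pinfty vol0 (Lphi i)).
by exists G; [exact: wG|move=> i j; exact: (Lq_loc_pinfty vol0 (LG i j))].
Qed.

(* [cube_vol R n] is in fact positive, but it is cheaper to note that both sets are full if it vanishes. *)
Lemma cell_set_null xi : cube_vol R n = 0 -> cell_set A P xi /\ cell_integrand p (mixture P W) xi = 0%E.
Proof.
move=> vol0.
have ae0 (Q : 'rV[R]_n -> Prop) : {ae mu, forall y, Q y}.
  by exists setT; split; [exact: measurableT|exact: lebesgue_null|].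
have p0 : (0 < p%:E)%E by rewrite lte_fin; have := p1; lra.
split.
  exists (fun=> 0), (fun=> 0); split; [exact: zero_W1q_per|exact: zero_weak_gradient|].
  by move=> i; exact: ae0.
apply/eqP; rewrite eq_le cell_integrand_ge0 andbT.
apply: (cell_integrand_le0 (zero_W1q_per p0 _) zero_weak_gradient) => // i; exact: ae0.
Qed.

End CellSet.

Theorem lemma4p4 (R : realType) (m n N : nat)
    (hm : (0 < m)%N) (hn : (0 < n)%N) (hN : (0 < N)%N)
    (p : R) (hp : 1 < p)
    (a1 a2 a3 : R) (ha1 : 0 < a1) (ha2 : 0 < a2) (ha3 : 0 < a3)
    (P : 'I_N -> set 'rV[R]_n)
    (hP : measurable_partition P (@unit_cell R n))
    (W : 'I_N -> 'M[R]_(m, n) -> R)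
    (hW : forall i, pgrowth_class a1 a2 a3 p (W i))
    (hWqc : forall i, quasiconvex (W i))
    (hA : forall i, [set xi | W i xi = 0] !=set0) :
  cell_set (fun i => [set xi | W i xi = 0]) P =
  [set xi | cell_integrand p (mixture P W) xi = 0%E].
Proof.
apply/seteqP; split=> xi /=.
  have [vol0|vol_gt0] := eqVneq (cube_vol R n) 0; first by have [] := cell_set_null hp hP hW xi vol0.
  have vol0 : 0 < cube_vol R n by rewrite lt_def vol_gt0 cube_vol_ge0.
  move=> [phi [G [Wphi wG WG]]]; apply/eqP; rewrite eq_le (cell_integrand_ge0 P hW) andbT.
  exact: (cell_integrand_le0 hP hW (W1q_per_pinfty hp vol0 Wphi) wG WG).
have [vol0|vol_gt0] := eqVneq (cube_vol R n) 0; first by have [] := cell_set_null hp hP hW xi vol0.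
have vol0 : 0 < cube_vol R n by rewrite lt_def vol_gt0 cube_vol_ge0.
have [T [c [T0 c0 W_low]]] := growth_lower m n hp a3 ha1 ha2.
move=> cell0; have [U [u [H [phi [G [M [La [PU [Cu aH] uphi [La0 phiL phiper] [wG GM]]]]]]]]] :=
  compactness hp ha3 hP hW T0 c0 (fun i => W_low _ (hW i)) vol0 cell0.
exists phi, G; split; last 2 first.
- exact: wG.
- move=> i; exact: (zero_ae hp ha1 ha2 ha3 hP hW hWqc vol0 PU Cu aH uphi La0 phiL wG i).
have phi_cont i := lipschitz_continuous_Rn (phiL i).
split; last by move=> z; apply: aeW => x; exact: phiper.
have y0 : (0 < +oo :> \bar R)%E by exact: ltry.
have yNoo : +oo%E != -oo%E :> \bar R by [].
split=> [i|]; first exact: (Lq_loc_continuous y0 yNoo (phi_cont i)).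
exists G; first exact: wG.
move=> i j; apply: (Lq_loc_bounded y0 yNoo (weak_gradient_measurable wG i j)).
by move=> y r; exists M => x _; exact: GM.
Qed.
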